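(* Let $U\subset V_0$ be a bounded open subset, let $f\colon U\to\mathbb{R}$, and suppose $\Gamma=\Gamma_f$ is an intrinsic Lipschitz graph with a smooth herringbone singularity $C$. Let $\gamma\colon I\to V_0$, $\gamma(t)=(t,0,\gamma_z(t))$, parametrize $\Pi(C)$, and let $\sigma^0,\sigma^+,\sigma^-\colon I\to\mathbb{R}$ be the slope functions defined in the context. Let $w_2\in C_c^\infty(U)$, let $\psi=w_2\circ\Pi$, let $V_\psi=-(X\psi)Y+\psi Z$, and let $\phi_t\colon\mathbb{H}\to\mathbb{H}$, $t\in(-\epsilon,\epsilon)$, be the flow of $V_\psi$. Let $f_t$ be the function such that $\Gamma_{f_t}=\phi_t(\Gamma)$. Then there are $\epsilon_0>0$ and $D>0$, depending only on $U$, $w_2$ and $\|f\|_{L_\infty(U)}$, such that $$\left|E_U(f_t)-E_U(f)-A_2t\right|\le D\,(E_U(f)+\mu(U))\,t^2\qquad\text{for all }t\in[-\epsilon_0,\epsilon_0],$$ where $$A_2=\int_U-\nabla_f^2w_2\cdot\nabla_ff+\tfrac12(\nabla_ff)^2\cdot\partial_zw_2\,d\mu=\frac12\int_Iw_2(\gamma(s))\,\delta(s)\,ds+\int_U\bigl(w_2\cdot\partial_zf+\nabla_fw_2\bigr)\cdot\nabla_f^2f\,d\mu$$ and $\delta(s)=(\sigma^+(s)-\sigma^0(s))^2-(\sigma^0(s)-\sigma^-(s))^2$. In particular, if $\Gamma$ is contact harmonic on $U$, then $\delta(s)=0$ and $\sigma^0(s)=\frac{\sigma^+(s)+\sigma^-(s)}2$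 for all $s\in I$.
   Context: Heisenberg group: $\mathbb{H}=\mathbb{R}^3$ with $(x,y,z)\cdot(x',y',z')=(x+x',y+y',z+z'+\frac{xy'-yx'}{2})$; left-invariant fields $X=(1,0,-\frac y2)$, $Y=(0,1,\frac x2)$, $Z=(0,0,1)$; $Y^t=(0,t,0)$; horizontal curves are those tangent to $\mathrm{span}(X,Y)$; $d$ is the Carnot–Carathéodory metric ($X,Y$ orthonormal). $V_0=\{y=0\}$ with Lebesgue measure $\mu$; $\Pi(x,y,z)=(x,0,z-\frac{xy}2)$; $\pi(x,y,z)=(x,y)$. For $f\colon U\subset V_0\to\mathbb{R}$: $\Psi_f(v)=v\cdot Y^{f(v)}$, $\Gamma_f=\Psi_f(U)$; $\Gamma_f$ is an intrinsic Lipschitz graph if for some $\lambda\in(0,1)$, $|y(q)-y(p)|\le\lambda d(p,q)$ for $p,q\in\Gamma_f$. $\nabla_f=\partial_x-f\partial_z$, with $\nabla_ff$ in general defined distributionally by $\int\nabla_ff\,\psi\,d\mu=\int-f\partial_x\psi+\frac{f^2}2\partial_z\psi\,d\mu$; in the integrals over $U$, second derivatives are evaluated on $U^+\cup U^-$ (below), where $f$ is smooth. $E_U(f)=\frac12\int_U(\nabla_ff)^2d\mu$. Smooth herringbone singularity: let $\Gamma=\Gamma_f$ be an intrinsic Lipschitz graph over the open set $U$. Suppose that the characteristic nexus of $\Gamma$ (the set of points of $\Gamma$ at which distinct horizontal curves in $\Gamma$ meet) is a smooth horizontal curve $C\subset\Gamma$, let $\gamma\colon I\to V_0$, $\gamma(t)=(t,0,\gamma_z(t))$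 ($I$ an interval) parametrize $\Pi(C)$, and suppose $\gamma$ cuts $U$ into two connected components $U^+=\{(x,0,z)\in U:z>\gamma_z(x)\}$ and $U^-=\{(x,0,z)\in U:z<\gamma_z(x)\}$. Let $\Gamma^\pm=\Psi_f(U^\pm)$. Suppose $f$ is smooth on $U^+$ and $U^-$, so that $\Gamma^\pm$ is foliated by horizontal curves; call this foliation $H^\pm$. Suppose further: (i) there is a neighborhood $N$ of $C$ such that $\pi$ restricts to an embedding of $N\cap\Gamma$; (ii) with $M^\pm=\pi(N\cap\Gamma^\pm)$, the projected foliation $\pi_*(H^\pm)$ extends to a smooth foliation $F^\pm$ defined on a neighborhood of $\overline{M^\pm}$, and $F^+,F^-$ are transverse to $\pi(C)$ and their tangent lines have bounded slopes. Then $C$ is a smooth herringbone singularity of $\Gamma$. Slopes: let $c(t)=(t,c_y(t),c_z(t))$, $t\in I$, parametrize $C$. Then $\sigma^0(t)=c_y'(t)$, and $\sigma^\pm(t)$ is the slope of (the leaf of) $F^\pm$ at $\pi(c(t))$. Contact harmonic: for $\psi\in C^\infty(\mathbb{H})$ with $YY\psi=0$ let $\phi_t$ be the flow of $V_\psi=(Y\psi)X-(X\psi)Y+\psi Z$ (near $\Gamma$, for small $|t|$); it carries $\Gamma$ to intrinsic graphs $\Gamma_{f_t}$. $\Gamma$ is contact harmonic on the bounded open set $U$ if $\frac d{dt}E_U(f_t)|_{t=0}=0$ for all such $\psi$ with support in $\Pi^{-1}(U)$. *)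

(* Defs.v *)
From HB Require Import structures.
From mathcomp Require Import all_boot all_order all_algebra.
From mathcomp Require Import all_classical all_reals all_analysis.

Set Implicit Arguments.
Unset Strict Implicit.
Unset Printing Implicit Defensive.

Import Order.TTheory GRing.Theory Num.Theory.
Import numFieldNormedType.Exports.

Local Open Scope classical_set_scope.
Local Open Scope ring_scope.

(* [heis R] carries the coordinates (x, y, z) of the Heisenberg group,
   [vplane R] the coordinates (x, z) of the point (x, 0, z) of V_0. *)
Notation heis R := (R * R * R)%type.
Notation vplane R := (R * R)%type.
(* The same type as [vplane R], with the Borel sigma-algebra on which
   [lebesgue_measure] is defined. *)
Notation mvplane R := (measurableTypeR R * measurableTypeR R)%type.

(* On an open subset A of a finite-dimensional V this is the usual C^n: all
   iterated directional derivatives up to order n exist and are continuous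
   on A. *)
Fixpoint Cn_on {R : realType} {V W : normedModType R}
    (n : nat) (A : set V) (f : V -> W) : Prop :=
  (forall x, A x -> {for x, continuous f}) /\
  match n with
  | 0 => True
  | m.+1 => forall v, (forall x, A x -> derivable f x v) /\ Cn_on m A ('D_v f)
  end.

Definition smooth_on {R : realType} {V W : normedModType R}
    (A : set V) (f : V -> W) : Prop := forall n, Cn_on n A f.

Definition support_in {R : realType} {V : normedModType R}
    (U : set V) (f : V -> R) : Prop := closure [set x | f x != 0] `<=` U.

Definition test_function {R : realType} {V : normedModType R}
    (U : set V) (f : V -> R) : Prop :=
  [/\ smooth_on setT f, compact (closure [set x | f x != 0]) & support_in U f].

Section Heisenberg.
Context {R : realType}.
Implicit Types (p q : heis R) (v : vplane R) (c : R -> heis R).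
Implicit Types (U : set (vplane R)) (f g : vplane R -> R).

Definition hx p : R := p.1.1.
Definition hy p : R := p.1.2.
Definition hz p : R := p.2.

Definition hmul p q : heis R :=
  (hx p + hx q, hy p + hy q,
   hz p + hz q + (hx p * hy q - hy p * hx q) / 2).

Definition fieldX p : heis R := (1, 0, - (hy p / 2)).
Definition fieldY p : heis R := (0, 1, hx p / 2).
Definition fieldZ p : heis R := (0, 0, 1).

Definition lie (V : heis R -> heis R) (psi : heis R -> R) p : R :=
  'D_(V p) psi p.

Definition of_vplane v : heis R := (v.1, 0, v.2).
Definition Pi p : vplane R := (hx p, hz p - hx p * hy p / 2).
Definition pi_xy p : R * R := (hx p, hy p).

(* C^1 on the interior of the interval J and continuous up to the end points
   that belong to J. *)
Definition horizontal_curve (J : set R) c : Prop :=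
  {within J, continuous c} /\
  forall t, interior J t ->
    [/\ derivable c t 1, {for t, continuous ('D_1 c)} &
        exists a b : R, 'D_1 c t = a *: fieldX (c t) + b *: fieldY (c t)].

(* If c' = a X + b Y then a = x' and b = y', so this is the length for which
   X and Y are orthonormal. *)
Definition hlength c : \bar R :=
  (\int[lebesgue_measure]_(t in `]0%R, 1%R[%classic)
     (Num.sqrt (hx ('D_1 c t) ^+ 2 + hy ('D_1 c t) ^+ 2))%:E)%E.

Definition cc_dist p q : \bar R :=
  ereal_inf [set hlength c | c in
    [set c | [/\ horizontal_curve `[0, 1] c, c 0 = p & c 1 = q]]].

Definition Psi f v : heis R := hmul (of_vplane v) (0, f v, 0).

Definition igraph U f : set (heis R) := Psi f @` U.

Definition intrinsic_lipschitz U f : Prop :=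
  exists2 lambda : R, 0 < lambda < 1 &
    forall p q, igraph U f p -> igraph U f q ->
      (`|hy q - hy p|%:E <= lambda%:E * cc_dist p q)%E.

(* The points of G at which two horizontal curves in G meet that do not
   coincide near that point.  Curves are parametrized by their
   x-coordinate: along a horizontal curve in an intrinsic Lipschitz graph
   |dy| <= lambda * |(dx, dy)| with lambda < 1, so dx never vanishes. *)
Definition characteristic_nexus (G : set (heis R)) : set (heis R) :=
  [set p | G p /\ exists (J : set R) (c1 c2 : R -> heis R),
    [/\ is_interval J, J (hx p), c1 (hx p) = p, c2 (hx p) = p &
        [/\ horizontal_curve J c1, horizontal_curve J c2,
            forall t, J t -> hx (c1 t) = t /\ G (c1 t),
            forall t, J t -> hx (c2 t) = t /\ G (c2 t) &
            forall e : R, 0 < e ->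
              exists t, [/\ J t, `|t - hx p| < e & c1 t <> c2 t]]]].

Definition area : {measure set (mvplane R) -> \bar R} :=
  (@lebesgue_measure R \x @lebesgue_measure R)%E.

Definition Linfty_norm U f : \bar R := ('N[area]_+oo%E[EFin \o (f \_ U)])%E.

Definition d_x g v : R := 'D_((1, 0) : vplane R) g v.
Definition d_z g v : R := 'D_((0, 1) : vplane R) g v.

Definition nabla f g v : R := d_x g v - f v * d_z g v.

Definition locally_integrable_on U g : Prop :=
  measurable_fun (U : set (mvplane R)) g /\
  forall K, compact K -> K `<=` U -> area.-integrable K (EFin \o g).

(* g is the distribution nabla_f f on U. *)
Definition is_distributional_nabla U f g : Prop :=
  [/\ measurable_fun (U : set (mvplane R)) f, locally_integrable_on U (fun v => f v ^+ 2),
      locally_integrable_on U g &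
      forall psi, test_function U psi ->
        \int[area]_(v in U) (g v * psi v) =
        \int[area]_(v in U) (- f v * d_x psi v + f v ^+ 2 / 2 * d_z psi v)].

(* All functions g representing nabla_f f agree almost everywhere, so the
   infimum is over a single value; it is +oo if nabla_f f is not a function. *)
Definition energy U f : \bar R :=
  ereal_inf [set ((2^-1)%:E * \int[area]_(v in U) (g v ^+ 2)%:E)%E
            | g in is_distributional_nabla U f].

(* The tangent lines of a one-dimensional foliation are linear subspaces of
   R^2; the leaves are the integral curves of this line field. *)
Definition line (w : R * R) : set (R * R) := [set a *: w | a in [set: R]].

Definition smooth_foliation (O : set (R * R)) (F : R * R -> set (R * R)) : Prop :=
  open O /\
  forall q : R * R, O q -> exists (W : set (R * R)) (w : R * R -> R * R),
    [/\ open W, W q, smooth_on W w &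
        forall r, W r -> w r != 0 /\ F r = line (w r)].

Definition slope (L : set (R * R)) : R := get [set m | L = line (1, m)].

Definition bounded_slopes (O : set (R * R)) (F : R * R -> set (R * R)) : Prop :=
  exists B : R, forall q : R * R, O q -> exists2 m : R, `|m| <= B & F q = line (1, m).

(* Along the projection of any horizontal curve in G, the line field F is the
   tangent line of that projection. *)
Definition extends_projected_foliation (G : set (heis R))
    (F : R * R -> set (R * R)) : Prop :=
  forall (J : set R) c, is_interval J -> horizontal_curve J c ->
    (forall t, J t -> hx (c t) = t /\ G (c t)) ->
    forall t, interior J t -> F (pi_xy (c t)) = line ('D_1 (pi_xy \o c) t).

Definition pi_embedding (A : set (heis R)) : Prop :=
  exists g : R * R -> heis R,
    {within pi_xy @` A, continuous g} /\ forall p, A p -> g (pi_xy p) = p.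

(* For c t = (t, c_y t, c_z t), Pi (c t) is (t, 0, gamma_z t). *)
Definition gamma_z c (t : R) : R := (Pi (c t)).2.

(* U is the union of these two sets and of the graph of gamma_z over I, which
   is a null set: integrals over U of expressions in classical derivatives
   of f are taken over U_plus and U_minus. *)
Definition U_plus U (I : set R) c : set (vplane R) :=
  [set v | [/\ U v, I v.1 & gamma_z c v.1 < v.2]].
Definition U_minus U (I : set R) c : set (vplane R) :=
  [set v | [/\ U v, I v.1 & v.2 < gamma_z c v.1]].

(* The hypotheses on the side U' (U_plus or U_minus) of the curve, with F the
   extended foliation. *)
Definition herringbone_side f (U' : set (vplane R)) (N : set (heis R))
    (I : set R) c (F : R * R -> set (R * R)) : Prop :=
  exists O : set (R * R),
    [/\ smooth_foliation O F,
        closure (pi_xy @` (N `&` igraph U' f)) `<=` O,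
        extends_projected_foliation (N `&` igraph U' f) F,
        forall t, I t -> O (pi_xy (c t)) /\
          F (pi_xy (c t)) <> line ('D_1 (pi_xy \o c) t) &
        bounded_slopes O F].

(* [herringbone_nexus] and [herringbone_cut] force I to be the projection of U
   to the x-axis; for open U it is therefore open, and [herringbone_smooth]
   only sees the values of c on I. *)
Record smooth_herringbone U f (I : set R) c
    (Fplus Fminus : R * R -> set (R * R)) : Prop := SmoothHerringbone {
  herringbone_interval : is_interval I;
  herringbone_param : forall t, I t -> hx (c t) = t;
  herringbone_smooth : smooth_on I c;
  herringbone_horizontal : horizontal_curve I c;
  herringbone_nexus : characteristic_nexus (igraph U f) = c @` I;
  herringbone_cut : U `\` ((Pi \o c) @` I) = U_plus U I c `|` U_minus U I c;
  herringbone_plus : U_plus U I c !=set0 /\ connected (U_plus U I c);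
  herringbone_minus : U_minus U I c !=set0 /\ connected (U_minus U I c);
  herringbone_smooth_plus : smooth_on (U_plus U I c) f;
  herringbone_smooth_minus : smooth_on (U_minus U I c) f;
  herringbone_foliations : exists N : set (heis R),
    [/\ open N, c @` I `<=` N, pi_embedding (N `&` igraph U f),
        herringbone_side f (U_plus U I c) N I c Fplus &
        herringbone_side f (U_minus U I c) N I c Fminus]
}.

Definition is_flow (V : heis R -> heis R) (eps : R) (W : set (heis R))
    (phi : R -> heis R -> heis R) : Prop :=
  forall p, W p -> phi 0 p = p /\
    forall t, `|t| < eps -> is_derive t (1 : R) (phi ^~ p) (V (phi t p)).

Definition contact_field (psi : heis R -> R) p : heis R :=
  lie fieldY psi p *: fieldX p - lie fieldX psi p *: fieldY p
  + psi p *: fieldZ p.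

(* The flow near the graph and the functions f_t exist for small |t|, and they
   are unique (f_t on U); they are part of the condition. *)
Definition contact_harmonic U f : Prop :=
  forall psi : heis R -> R, smooth_on setT psi ->
    (forall p, lie fieldY (lie fieldY psi) p = 0) ->
    support_in (Pi @^-1` U) psi ->
    exists (eps : R) (W : set (heis R)) (phi : R -> heis R -> heis R)
           (f_ : R -> vplane R -> R),
      [/\ 0 < eps, open W /\ igraph U f `<=` W,
          is_flow (contact_field psi) eps W phi,
          forall t, `|t| < eps -> igraph U (f_ t) = phi t @` igraph U f &
          is_derive (0 : R) (1 : R) (fun t => fine (energy U (f_ t))) 0].

End Heisenberg.

(* Main.v *)
Require Import Defs.
From mathcomp Require Import all_boot all_order all_algebra.
From mathcomp Require Import all_classical all_reals all_analysis.
From mathcomp Require Import measurable_realfun ring lra.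

Set Implicit Arguments.
Unset Strict Implicit.
Unset Printing Implicit Defensive.

Import Order.TTheory GRing.Theory Num.Theory.
Import numFieldNormedType.Exports.

Local Open Scope classical_set_scope.
Local Open Scope ring_scope.

(* Along the contact flow the height of the graph solves a linear equation with
   coefficients derivatives of w2; Taylor expansion, uniform over U, bounds the
   energy quadratically, with slope A_2.  On each side of the curve,
   nabla_f f = m (x, f) for a smooth function m.  The integrand of A_2 is the
   interior integrand plus a divergence built from a primitive of m in its second
   variable, and collars shrinking to the curve leave w2 * delta / 2.  If Gamma is
   harmonic, variations supported off the curve yield
   nabla_f^3 f = 2 d_z f * nabla_f^2 f, so the interior term vanishes and
   delta = 0.  The other root, sigma^+ = sigma^-, is excluded because
   s * (sigma^s - sigma^0) <= 0 on the side of sign s. *)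

(** The obstacle is that [f] is merely continuous across the curve: nothing bounds [d_z f] near it,
    while the interior integrand contains [w2 * d_z f], and so does the natural field for the
    integration by parts, [- kappa f w2 * nabla f f] in the x-direction. Two facts help. As [pi_xy]
    is injective on the graph near the curve, [f] is strictly monotone on short vertical segments;
    [d_z f] then has a constant sign, its integrals outside collars stay bounded, and it is
    integrable. As [nabla f f = m (x, f)], the product [nabla f f * d_z f] is the z-derivative of
    the primitive of [m] at [(x, f)]; a divergence-free correction built from it removes [d_z f]
    from the field, which becomes continuous up to the curve and so has a flux there. The constant
    of the expansion may only see [U], [w2] and a bound of [f]. Hence no derivative of [f] but
    [nabla f f] enters the estimates, derivatives of the flow are bounded through their own linear
    equations with constants chosen before the graph, and the remainder is quadratic in [nabla f f]:
    this is the factor [E_U(f) + mu(U)]. *)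

Notation is_derive1 x := (is_derive x (1 : Real.sort _)) (only parsing).
Notation is_dx v := (is_derive v ((1, 0) : (Real.sort _ * Real.sort _)%type)) (only parsing).
Notation is_dz v := (is_derive v ((0, 1) : (Real.sort _ * Real.sort _)%type)) (only parsing).
Notation off_graph U ga := [set v | U v /\ v.2 != ga v.1] (only parsing).
Notation mset A := (A : set (mvplane _)) (only parsing).
Notation integrable2 D X := (integrable (@area _) D (EFin \o X)) (only parsing).
Notation cont_on A f := (forall v, A v -> {for v, continuous f}) (only parsing).
Notation mu := (@lebesgue_measure _) (only parsing).
Notation mu2 := (@area _) (only parsing).

(** * Calculus in one and two real variables *)

Section continuity_combinators.
Context {R : realType} {V : normedModType R}.
Implicit Types (f g : V -> R) (v : V).

Lemma contD f g v : {for v, continuous f} -> {for v, continuous g} -> {for v, continuous (fun u => f u + g u)}.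
Proof. exact: (@continuousD _ _ _ f g). Qed.

Lemma contB f g v : {for v, continuous f} -> {for v, continuous g} -> {for v, continuous (fun u => f u - g u)}.
Proof. exact: (@continuousB _ _ _ f g). Qed.

Lemma contM f g v : {for v, continuous f} -> {for v, continuous g} -> {for v, continuous (fun u => f u * g u)}.
Proof. exact: (@continuousM _ _ f g). Qed.

Lemma contN f v : {for v, continuous f} -> {for v, continuous (fun u => - f u)}.
Proof. exact: (@continuousN _ _ _ f). Qed.

End continuity_combinators.

Ltac cont := repeat first
  [exact: cst_continuous | exact: cvg_fst | exact: cvg_snd | exact: cvg_id | solve [eauto 3]
  |apply: contD | apply: contB | apply: contM | apply: contN].

Lemma is_derive_continuous {R : realType} (u : R -> R) (s a : R) : is_derive1 s u a -> {for s, continuous u}.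
Proof. by move=> D; apply: differentiable_continuous; apply/derivable1_diffP; have [] := D. Qed.

Lemma is_derive_zero_out {R : realType} (V W : normedModType R) (O : set V) (u : V -> W) v (oO : open O) (d : V) :
  (forall w, O w -> u w = 0) -> O v -> is_derive v d u 0.
Proof. by move=> u0 Ov; apply: (@near_eq_is_derive _ _ _ (fun=> 0)); apply: filterS (open_nbhs_nbhs (conj oO Ov)) => w /u0. Qed.

Lemma eq_ler {R : realType} (x y : R) : x = y -> x <= y.
Proof. by move=> ->. Qed.

Notation cont_comp f g := (@continuous_comp _ _ _ f g) (only parsing).
Notation near_is_derive g := (@near_eq_is_derive _ _ _ g) (only parsing).
Section calculus.
Context {R : realType}.
Implicit Types (v : R * R).

Lemma nbhsR_leP (x : R) (P : set R) :
  nbhs x P <-> exists2 d : R, 0 < d & forall h, `|h| <= d -> P (x + h).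
Proof.
split=> [/nbhs_ballP[d /= d0 H]|[d d0 H]].
  exists (d / 2); first by rewrite divr_gt0.
  move=> h hd; apply: H; rewrite /ball /= opprD addNKr normrN.
  by rewrite (le_lt_trans hd)// ltr_pdivrMr// ltr_pMr// ltr1n.
apply/nbhs_ballP; exists d => //= y; rewrite /ball /= => yd.
by rewrite -(subrK x y) addrC; apply: H; rewrite distrC ltW.
Qed.

Lemma nbhs2_leP v (P : set (R * R)) :
  nbhs v P <-> exists2 d : R, 0 < d &
    forall h k, `|h| <= d -> `|k| <= d -> P (v.1 + h, v.2 + k).
Proof.
split=> [/nbhs_ballP[d /= d0 H]|[d d0 H]].
  exists (d / 2); first by rewrite divr_gt0.
  move=> h k hd kd; apply: H; split; rewrite /ball /= opprD addNKr normrN.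
    by rewrite (le_lt_trans hd)// ltr_pdivrMr// ltr_pMr// ltr1n.
  by rewrite (le_lt_trans kd)// ltr_pdivrMr// ltr_pMr// ltr1n.
apply/nbhs_ballP; exists d => //= -[y z]; rewrite /ball /= => -[/= yd zd].
have := H (y - v.1) (z - v.2); rewrite [v.1 + _]addrC [v.2 + _]addrC !subrK.
by apply; rewrite distrC; exact: ltW.
Qed.

Lemma continuousR_leP (f : R -> R) (x : R) :
  {for x, continuous f} <-> forall e : R, 0 < e -> exists2 d : R, 0 < d &
    forall h, `|h| <= d -> `|f (x + h) - f x| <= e.
Proof.
split=> [/cvgrPdist_le H e e0|H].
  have /nbhsR_leP[d d0 Hd] := H e e0.
  by exists d => // h /Hd; rewrite distrC.
apply/cvgrPdist_le => e e0; have [d d0 Hd] := H _ e0.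
by apply/nbhsR_leP; exists d => // h /Hd; rewrite distrC.
Qed.

Lemma continuous2_leP (f : R * R -> R) v :
  {for v, continuous f} <-> forall e : R, 0 < e -> exists2 d : R, 0 < d &
    forall h k, `|h| <= d -> `|k| <= d -> `|f (v.1 + h, v.2 + k) - f v| <= e.
Proof.
split=> [/cvgrPdist_le H e e0|H].
  have /nbhs2_leP[d d0 Hd] := H e e0.
  by exists d => // h k hd kd; rewrite distrC; exact: Hd.
apply/cvgrPdist_le => e e0; have [d d0 Hd] := H _ e0.
by apply/nbhs2_leP; exists d => // h k hd kd; rewrite distrC; exact: Hd.
Qed.

Lemma is_derive_line (V W : normedModType R) (f : V -> W) (x v : V) (a : W) :
  is_derive x v f a <-> is_derive1 (0:R) (fun h : R => f (h *: v + x)) a.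
Proof.
have E : 'D_1 (fun h : R => f (h *: v + x)) 0 = 'D_v f x.
  rewrite /derive; have -> // : (fun h : R => h^-1 *:
      (((fun h : R => f (h *: v + x)) \o shift 0) (h *: 1) - f (0 *: v + x))) =
    (fun h : R => h^-1 *: ((f \o shift x) (h *: v) - f x)).
  by apply/funext => h /=; rewrite scale0r add0r addr0 [h%:A]mulr1.
split=> -[d e]; split.
- exact: proj1 (derivable1P f x v) d.
- by rewrite E.
- exact: proj2 (derivable1P f x v) d.
- by rewrite -E.
Qed.

Lemma is_derive_leP (f : R -> R) (x a : R) :
  is_derive1 x f a <-> forall e : R, 0 < e -> exists2 d : R, 0 < d &
    forall h, `|h| <= d -> `|f (x + h) - f x - a * h| <= e * `|h|.
Proof.
split=> [[df <-] e e0|H].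
  have : h^-1 *: (f (h *: (1:R) + x) - f x) @[h --> 0^'] --> 'D_1 f x by [].
  move/cvgrPdist_le => /(_ e e0) /nbhs_ballP[d /= d0 Hd].
  exists (d / 2); first by rewrite divr_gt0.
  move=> h hd; have [->|h0] := eqVneq h 0.
    by rewrite addr0 subrr mulr0 subrr normr0 mulr0.
  have := Hd h; rewrite /ball /= sub0r normrN => /(_ _ h0).
  rewrite (le_lt_trans hd) ?ltr_pdivrMr ?ltr_pMr ?ltr1n// => /(_ isT).
  rewrite [h%:A]mulr1 [h + x]addrC => Hh.
  have -> : f (x + h) - f x - 'D_1 f x * h =
      - (('D_1 f x - h^-1 *: (f (x + h) - f x)) * h).
    by rewrite mulrBl /GRing.scale/= mulrAC mulVf// mul1r opprB.
  by rewrite normrN normrM ler_wpM2r.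
have cv : h^-1 *: (f (h *: (1:R) + x) - f x) @[h --> 0^'] --> a.
  apply/cvgrPdist_le => e e0; have [d d0 Hd] := H _ e0.
  apply/nbhs_ballP; exists d => //= h; rewrite /ball /= sub0r normrN => hd h0.
  rewrite [h%:A]mulr1 [h + x]addrC.
  have -> : a - h^-1 *: (f (x + h) - f x) = - (f (x + h) - f x - a * h) / h.
    by rewrite mulNr mulrBl mulfK// opprB; congr (_ - _); rewrite mulrC.
  rewrite normrM normrN normfV ler_pdivrMr ?normr_gt0//.
  by apply: Hd; exact: ltW.
split; first by apply/cvg_ex; exists a.
exact/cvg_lim.
Qed.

Lemma is_derive_lineR (f : R -> R) (x a : R) (y : R) : is_derive1 x f a ->
  is_derive x y f (y * a).
Proof.
move=> /is_derive_leP H; apply/is_derive_line/is_derive_leP => e e0.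
have y0 : 0 < `|y| + 1 by rewrite ltr_wpDl.
have [d d0 Hd] := H _ (divr_gt0 e0 y0).
exists (d / (`|y| + 1)); first exact: divr_gt0.
move=> h; rewrite ler_pdivlMr// => hd.
rewrite add0r scale0r add0r addrC.
have /Hd : `|h *: y| <= d.
  by apply: le_trans hd; rewrite normrZ ler_wpM2l// lerDl.
rewrite (_ : a * _ = y * a * h); last by rewrite /GRing.scale/=; ring.
rewrite [h *: y + x]addrC => Hh; rewrite addrC; apply: (le_trans Hh).
rewrite normrZ mulrC mulrA.
rewrite ler_pdivrMr// -[e * _]mulrC -!mulrA ler_wpM2l// mulrC ler_wpM2l ?(ltW e0)//.
by rewrite lerDl.
Qed.

Lemma is_derive_dx (g : R * R -> R) v (a : R) :
  is_dx v g a <-> is_derive1 v.1 (fun s => g (s, v.2)) a.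
Proof.
rewrite is_derive_line [X in _ <-> X]is_derive_line.
suff -> : (fun h => g (h *: (1,0) + v)) = (fun h => g (h *: 1 + v.1, v.2)) by [].
by apply/funext => h; congr g; case: v => x z; congr pair; rewrite /= ?scaler0 ?add0r.
Qed.

Lemma is_derive_dz (g : R * R -> R) v (a : R) :
  is_dz v g a <-> is_derive1 v.2 (fun s => g (v.1, s)) a.
Proof.
rewrite is_derive_line [X in _ <-> X]is_derive_line.
suff -> : (fun h => g (h *: (0,1) + v)) = (fun h => g (v.1, h *: 1 + v.2)) by [].
by apply/funext => h; congr g; case: v => x z; congr pair; rewrite /= ?scaler0 ?add0r.
Qed.

(** Fréchet differentiability at [v] with gradient [(a, b)], in epsilon-delta form. Partial
    derivatives alone give no chain rule for maps into the plane; this notion does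
    ([dif_is_derive]), and it carries the partial derivatives as explicit numbers. *)
Definition dif (g : R * R -> R) v (a b : R) := forall e : R, 0 < e ->
  exists2 d : R, 0 < d & forall h k, `|h| <= d -> `|k| <= d ->
    `|g (v.1 + h, v.2 + k) - g v - a * h - b * k| <= e * (`|h| + `|k|).

Lemma dif_dx g v a b : dif g v a b -> is_dx v g a.
Proof.
case: v => x z H; apply/is_derive_dx/is_derive_leP => e /H[d d0 Hd]; exists d => // h hd /=.
by have := Hd h 0 hd; rewrite normr0 !addr0 mulr0 subr0 => /(_ (ltW d0)).
Qed.

Lemma dif_dz g v a b : dif g v a b -> is_dz v g b.
Proof.
case: v => x z H; apply/is_derive_dz/is_derive_leP => e /H[d d0 Hd]; exists d => // h hd /=.
by have := Hd 0 h _ hd; rewrite normr0 !add0r !addr0 mulr0 subr0 => /(_ (ltW d0)).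
Qed.

Lemma dif_continuous g v a b : dif g v a b -> {for v, continuous g}.
Proof.
move=> H; apply/continuous2_leP => e e0; have [d d0 Hd] := H 1 ltr01.
pose c := 1 + 1 + `|a| + `|b|; have c0 : 0 < c by rewrite /c; do 2 apply: ltr_pwDl => //.
exists (Num.min d (e / c)); first by rewrite lt_min d0 divr_gt0.
move=> h k; rewrite !le_min => /andP[hd hc] /andP[kd kc].
have := Hd _ _ hd kd; rewrite mul1r => Hk.
rewrite (_ : _ - _ = (g (v.1 + h, v.2 + k) - g v - a * h - b * k) + (a * h + b * k)); last by ring.
apply: (le_trans (ler_normD _ _)).
have ah : `|a * h + b * k| <= `|a| * (e / c) + `|b| * (e / c).
  by apply: (le_trans (ler_normD _ _)); rewrite !normrM lerD// ler_wpM2l.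
apply: (le_trans (lerD Hk ah)).
have E : e = e / c * (1 + 1 + `|a| + `|b|) by rewrite divfK// gt_eqF.
by move: hc kc E; set q := e / c => hc kc ->; lra.
Qed.

Lemma dif_is_derive (V : normedModType R) (g : R * R -> R) (u1 u2 : V -> R)
    (x v : V) (a b p q : R) :
  dif g (u1 x, u2 x) a b -> is_derive x v u1 p -> is_derive x v u2 q ->
  is_derive x v (fun y => g (u1 y, u2 y)) (a * p + b * q).
Proof.
move=> H /is_derive_line/is_derive_leP H1 /is_derive_line/is_derive_leP H2.
apply/is_derive_line/is_derive_leP => e e0.
rewrite !scale0r !add0r in H1 H2 *.
(* With [e1 <= 1] both increments together are at most [c * |h|], so the remainder of [g] takes one
   half of [e]; [c'] dominates [|a| + |b|], so the remainders of [u1] and [u2], weighted by the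
   gradient, take the other half. *)
pose c := `|p| + `|q| + 2; have c0 : 0 < c by rewrite /c ltr_wpDl// addr_ge0.
pose c' := `|a| + `|b| + 1; have c'0 : 0 < c' by rewrite /c' ltr_wpDl// addr_ge0.
have [d d0 Hd] := H _ (divr_gt0 (divr_gt0 e0 (ltr0n R 2)) c0).
pose e1 := Num.min 1 (e / 2 / c').
have e10 : 0 < e1 by rewrite /e1 lt_min ltr01 !divr_gt0.
have [d1 d10 Hd1] := H1 _ e10; have [d2 d20 Hd2] := H2 _ e10.
exists (Num.min (d / c) (Num.min d1 d2)).
  by rewrite !lt_min d10 d20 divr_gt0.
move=> h; rewrite !le_min => /and3P[hd /Hd1 K1 /Hd2 K2].
rewrite !add0r in K1 K2 *.
set h1 := u1 _ - u1 x in K1; set h2 := u2 _ - u2 x in K2.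
have B1 : `|h1| <= (`|p| + 1) * `|h|.
  rewrite -[h1](subrK (p * h)) (le_trans (ler_normD _ _))// mulrDl normrM addrC lerD2l.
  by apply: (le_trans K1); rewrite ler_wpM2r// /e1 ge_min lexx.
have B2 : `|h2| <= (`|q| + 1) * `|h|.
  rewrite -[h2](subrK (q * h)) (le_trans (ler_normD _ _))// mulrDl normrM addrC lerD2l.
  by apply: (le_trans K2); rewrite ler_wpM2r// /e1 ge_min lexx.
have B : `|h1| + `|h2| <= c * `|h|.
  by apply: (le_trans (lerD B1 B2)); rewrite -mulrDl ler_wpM2r// /c; lra.
have hd' : c * `|h| <= d by rewrite mulrC -ler_pdivlMr.
have N1 := normr_ge0 h1; have N2 := normr_ge0 h2.
have L1 : `|h1| <= d by lra.
have L2 : `|h2| <= d by lra.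
have := Hd h1 h2 L1 L2 => /=.
have -> /= : u1 x + h1 = u1 (h *: v + x) by rewrite /h1 addrC subrK.
have -> : u2 x + h2 = u2 (h *: v + x) by rewrite /h2 addrC subrK.
move=> K.
set G := g _ - g _ in K *.
rewrite (_ : _ - _ = (G - a * h1 - b * h2) + (a * (h1 - p * h) + b * (h2 - q * h))); last by ring.
apply: (le_trans (ler_normD _ _)).
rewrite [e]splitr mulrDl lerD//.
  apply: (le_trans K); apply: (@le_trans _ _ (e / 2 / c * (c * `|h|))).
    by rewrite ler_wpM2l// !divr_ge0// ltW.
  by rewrite mulrA divfK// gt_eqF.
apply: (le_trans (ler_normD _ _)); rewrite !normrM.
have E1 : e1 <= e / 2 / c' by rewrite /e1 ge_min lexx orbT.
apply: (@le_trans _ _ ((`|a| + `|b|) * (e1 * `|h|))).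
  by rewrite mulrDl lerD// ler_wpM2l.
rewrite mulrA ler_wpM2r//.
apply: (@le_trans _ _ (c' * (e / 2 / c'))).
  by apply: ler_pM => //; rewrite ?addr_ge0// ?(ltW e10)// /c' lerDl.
by rewrite mulrC divfK// gt_eqF.
Qed.

(** The end points may come in either order, so that increments of both signs are treated at
    once. *)
Lemma MVT_eq (f df : R -> R) (a b : R) :
  (forall x, Num.min a b <= x <= Num.max a b -> is_derive1 x f (df x)) ->
  exists2 c, Num.min a b <= c <= Num.max a b & f b - f a = df c * (b - a).
Proof.
wlog ab : a b / a <= b.
  move=> W H; have [/W|/W] := orP (le_total a b); first by apply.
  rewrite minC maxC => /(_ H)[c cab e]; exists c => //.
  by rewrite -opprB e -mulrN opprB.
move=> H; rewrite (min_l ab) (max_r ab) in H *.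
have [<-|neq] := eqVneq a b.
  by exists a; rewrite ?lexx// !subrr mulr0.
have altb : a < b by rewrite lt_neqAle neq.
have [||c cab ->] := @MVT R f df a b altb.
- by move=> x /[!in_itv]/= /andP[x1 x2]; apply: H; rewrite !ltW.
- apply: derivable_within_continuous => x /[!in_itv]/= xab.
  by have [] := H x xab.
- by exists c => //; move: cab; rewrite in_itv/= => /andP[? ?]; rewrite !ltW.
Qed.

Lemma MVT_norm (f df : R -> R) (a b C : R) :
  (forall x, Num.min a b <= x <= Num.max a b -> is_derive1 x f (df x)) ->
  (forall x, Num.min a b <= x <= Num.max a b -> `|df x| <= C) ->
  `|f b - f a| <= C * `|b - a|.
Proof.
move=> H HC; have [c cab ->] := MVT_eq H.
by rewrite normrM ler_wpM2r// HC.
Qed.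

Lemma minmax_norm (x h y : R) : Num.min x (x + h) <= y <= Num.max x (x + h) ->
  `|y - x| <= `|h|.
Proof.
have [h0|/ltW h0] := lerP 0 h.
  rewrite min_l ?lerDl// max_r ?lerDl// => /andP[y1 y2].
  by rewrite (ger0_norm h0) ger0_norm; lra.
rewrite min_r ?gerDl// max_l ?gerDl// => /andP[y1 y2].
by rewrite (ler0_norm h0) ler0_norm; lra.
Qed.

(** The displacement is split into a horizontal segment at height [z + k] and a vertical one at
    abscissa [x]. The mean value theorem on each turns the increment into partial derivatives at
    nearby points, which continuity compares with those at [v]. *)
Lemma C1_dif (g gx gz : R * R -> R) v :
  (\forall y \near v, is_dx y g (gx y)) ->
  (\forall y \near v, is_dz y g (gz y)) ->
  {for v, continuous gx} -> {for v, continuous gz} ->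
  dif g v (gx v) (gz v).
Proof.
move=> /nbhs2_leP[d1 d10 H1] /nbhs2_leP[d2 d20 H2].
move=> /continuous2_leP C1 /continuous2_leP C2 e e0.
have [d3 d30 H3] := C1 _ e0; have [d4 d40 H4] := C2 _ e0.
exists (Num.min (Num.min d1 d2) (Num.min d3 d4)).
  by rewrite !lt_min d10 d20 d30 d40.
case: v H1 H2 H3 H4 {C1 C2} => x z /= H1 H2 H3 H4 h k; rewrite !le_min.
move=> /andP[/andP[h1 h2] /andP[h3 h4]] /andP[/andP[k1 k2] /andP[k3 k4]].
have [|c1 /minmax_norm c1h E1] :=
  @MVT_eq (fun s => g (s, z + k)) (fun s => gx (s, z + k)) x (x + h).
  move=> s /minmax_norm sh; rewrite -[s](subrK x) [_ + x]addrC.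
  have := H1 (s - x) k (le_trans sh h1) k1.
  by move=> /is_derive_dx.
have [|c2 /minmax_norm c2k E2] :=
  @MVT_eq (fun s => g (x, s)) (fun s => gz (x, s)) z (z + k).
  move=> s /minmax_norm sh; rewrite -[s](subrK z) [_ + z]addrC.
  have := H2 0 (s - z); rewrite normr0 addr0 => /(_ (ltW d20) (le_trans sh k2)).
  by move=> /is_derive_dz.
have -> : g (x + h, z + k) - g (x, z) = gx (c1, z + k) * h + gz (x, c2) * k.
  move: E1 E2; rewrite ![_ + _ - x]addrAC ![_ + _ - z]addrAC !subrr !add0r.
  by move=> <- <-; ring.
rewrite (_ : _ - _ = (gx (c1, z + k) - gx (x, z)) * h + (gz (x, c2) - gz (x, z)) * k); last by ring.
apply: (le_trans (ler_normD _ _)); rewrite !normrM mulrDr.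
have G1 : `|gx (c1, z + k) - gx (x, z)| <= e.
  have := H3 (c1 - x) k (le_trans c1h h3) k3.
  by rewrite [x + _]addrC subrK.
have G2 : `|gz (x, c2) - gz (x, z)| <= e.
  have := H4 0 (c2 - z) _ (le_trans c2k k4); rewrite normr0 addr0.
  by rewrite [z + _]addrC subrK; apply; exact: ltW.
by rewrite lerD// ler_wpM2r.
Qed.

End calculus.

Section calculus2.
Context {R : realType}.
Implicit Types (v : R * R).

Lemma open_near {T : topologicalType} (A : set T) x (P : set T) :
  open A -> A x -> (forall y, A y -> P y) -> \forall y \near x, P y.
Proof. by move=> oA Ax H; apply: filterS (open_nbhs_nbhs (conj oA Ax)). Qed.

(** The second difference [D] of [g] over a square of side [d], treated by the mean value theorem in
    either order of the variables, is [d * d] times a value of each mixed derivative near [v]; by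
    continuity both values are close to those at [v]. *)
Lemma schwarz (g gx gz : R * R -> R) (gxz gzx : R * R -> R) v :
  (\forall y \near v, is_dx y g (gx y)) ->
  (\forall y \near v, is_dz y g (gz y)) ->
  (\forall y \near v, is_dz y gx (gxz y)) ->
  (\forall y \near v, is_dx y gz (gzx y)) ->
  {for v, continuous gxz} -> {for v, continuous gzx} ->
  gxz v = gzx v.
Proof.
move=> /nbhs2_leP[d1 d10 H1] /nbhs2_leP[d2 d20 H2] /nbhs2_leP[d3 d30 H3]
  /nbhs2_leP[d4 d40 H4] /continuous2_leP C1 /continuous2_leP C2.
apply/eqP; rewrite -subr_eq0 -normr_le0; apply/ler_addgt0Pr => e e0; rewrite add0r.
have e20 : 0 < e / 2 by rewrite divr_gt0.
have [d5 d50 H5] := C1 _ e20; have [d6 d60 H6] := C2 _ e20.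
pose d := Num.min (Num.min d1 d2) (Num.min (Num.min d3 d4) (Num.min d5 d6)).
have d0 : 0 < d by rewrite /d !lt_min d10 d20 d30 d40 d50 d60.
have : d <= d by [].
rewrite {2}/d !le_min => /andP[/andP[l1 l2] /andP[/andP[l3 l4] /andP[l5 l6]]].
case: v H1 H2 H3 H4 H5 H6 {C1 C2} => x z /= H1 H2 H3 H4 H5 H6.
have dd : `|d| = d by rewrite gtr0_norm.
have ball y u : Num.min u (u + d) <= y <= Num.max u (u + d) -> `|y - u| <= d.
  by move=> /minmax_norm; rewrite dd.
have n0 : `|0:R| <= d by rewrite normr0 ltW.
pose D := g (x + d, z + d) - g (x, z + d) - (g (x + d, z) - g (x, z)).
have A1 : exists2 p, `|p.1 - x| <= d /\ `|p.2 - z| <= d & D = gxz p * d * d.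
  have [|c1 /ball c1d] := @MVT_eq _ (fun s => g (s, z + d) - g (s, z)) (fun s => gx (s, z + d) - gx (s, z)) x (x + d).
    move=> s /ball sd.
    have K1 := H1 (s - x) d (le_trans sd l1) _; rewrite dd addrCA subrr addr0 in K1.
    have K2 := H1 (s - x) 0 (le_trans sd l1) (le_trans n0 l1); rewrite addrCA subrr !addr0 in K2.
    have /is_derive_dx/= L1 := K1 l1; move/is_derive_dx : K2 => /= L2.
    exact: is_deriveB.
  rewrite [x + d - x]addrAC subrr add0r => E1.
  have [|c2 /ball c2d] := @MVT_eq _ (fun s => gx (c1, s)) (fun s => gxz (c1, s)) z (z + d).
    move=> s /ball sd.
    have := H3 (c1 - x) (s - z) (le_trans c1d l3) (le_trans sd l3).
    by rewrite addrCA subrr addr0 addrCA subrr addr0 => /is_derive_dz.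
  rewrite [z + d - z]addrAC subrr add0r => E2.
  exists (c1, c2) => //; rewrite /D -E2 -E1; ring.
have A2 : exists2 p, `|p.1 - x| <= d /\ `|p.2 - z| <= d & D = gzx p * d * d.
  have [|c1 /ball c1d] := @MVT_eq _ (fun s => g (x + d, s) - g (x, s)) (fun s => gz (x + d, s) - gz (x, s)) z (z + d).
    move=> s /ball sd.
    have K1 := H2 d (s - z) _ (le_trans sd l2); rewrite dd [z + _]addrCA subrr addr0 in K1.
    have K2 := H2 0 (s - z) (le_trans n0 l2) (le_trans sd l2); rewrite [z + _]addrCA subrr !addr0 in K2.
    have /is_derive_dz/= L1 := K1 l2; move/is_derive_dz : K2 => /= L2.
    exact: is_deriveB.
  rewrite [z + d - z]addrAC subrr add0r => E1.
  have [|c2 /ball c2d] := @MVT_eq _ (fun s => gz (s, c1)) (fun s => gzx (s, c1)) x (x + d).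
    move=> s /ball sd.
    have := H4 (s - x) (c1 - z) (le_trans sd l4) (le_trans c1d l4).
    by rewrite addrCA subrr addr0 addrCA subrr addr0 => /is_derive_dx.
  rewrite [x + d - x]addrAC subrr add0r => E2.
  exists (c2, c1) => //; rewrite /D -E2 -E1; ring.
have [[p1 p2] /= [pd1 pd2] E1] := A1; have [[q1 q2] /= [qd1 qd2] E2] := A2.
have E : gxz (p1, p2) = gzx (q1, q2).
  by apply: (mulIf (lt0r_neq0 d0)); apply: (mulIf (lt0r_neq0 d0)); rewrite -E1.
have := H5 (p1 - x) (p2 - z) (le_trans pd1 l5) (le_trans pd2 l5).
have := H6 (q1 - x) (q2 - z) (le_trans qd1 l6) (le_trans qd2 l6).
have tr (a b : R) : a + (b - a) = b by rewrite addrC subrK.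
rewrite !tr E => K1 K2.
rewrite (_ : _ - _ = (gzx (q1, q2) - gzx (x, z)) - (gzx (q1, q2) - gxz (x, z))); last by ring.
by rewrite (le_trans (ler_normB _ _))// [e]splitr lerD.
Qed.

End calculus2.

Section Cn.
Context {R : realType}.
Implicit Types (V W : normedModType R).

Lemma Cn_cont {V W} n (A : set V) (f : V -> W) x : Cn_on n A f -> A x -> {for x, continuous f}.
Proof. by case: n => [|n] [H _] Ax; exact: H. Qed.

Lemma Cn_S {V W} n (A : set V) (f : V -> W) : Cn_on n.+1 A f -> Cn_on n A f.
Proof.
elim: n f => [|n IH] f [H1 H2]; first by split.
by split=> // v; have [H3 H4] := H2 v; split=> //; exact: IH.
Qed.

Lemma Cn_sub {V W} n (A B : set V) (f : V -> W) : A `<=` B -> Cn_on n B f -> Cn_on n A f.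
Proof.
move=> AB; elim: n f => [|n IH] f [H1 H2]; first by split=> // x /AB/H1.
split=> [x /AB/H1//|v]; have [H3 H4] := H2 v; split=> [x /AB/H3//|]; exact: IH.
Qed.

Lemma Cn_setU {V W} n (A B : set V) (f : V -> W) : Cn_on n A f -> Cn_on n B f -> Cn_on n (A `|` B) f.
Proof.
elim: n f => [|n IH] f [H1 H2] [K1 K2]; first by split=> // x [/H1|/K1].
split=> [x [/H1|/K1]//|v]; have [H3 H4] := H2 v; have [K3 K4] := K2 v.
by split=> [x [/H3|/K3]//|]; exact: IH.
Qed.

Lemma Cn_eq {V W} n (A : set V) (f g : V -> W) : open A -> (forall x, A x -> f x = g x) ->
  Cn_on n A f -> Cn_on n A g.
Proof.
move=> oA; elim: n f g => [|n IH] f g fg [H1 H2]; have C x : A x -> {for x, continuous g}.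
- move=> Ax; have nfg : \forall y \near x, f y = g y by exact: open_near oA Ax fg.
  by rewrite /prop_for /continuous_at -(fg _ Ax); apply: cvg_trans (H1 _ Ax); exact: near_eq_cvg.
- by split.
- move=> Ax; have nfg : \forall y \near x, f y = g y by exact: open_near oA Ax fg.
  by rewrite /prop_for /continuous_at -(fg _ Ax); apply: cvg_trans (H1 _ Ax); exact: near_eq_cvg.
split=> // v; have [H3 H4] := H2 v.
have D x : A x -> is_derive x v g ('D_v f x).
  move=> Ax; apply: near_eq_is_derive (open_near oA Ax fg) _.
  by apply: derivableP; exact: H3.
split=> [x /D[]//|]; apply: IH H4 => x Ax.
by have [_ ->] := D x Ax.
Qed.

(** Introduction rule for [Cn_on]: a formula for the derivatives valid on the open set [A] is
    enough, since [Cn_eq] transfers its regularity to ['D_v f]. The closure properties below are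
    inductions on [n] through this rule. *)
Lemma Cn_derive {V W} n (A : set V) (f : V -> W) (df : V -> V -> W) : open A ->
  (cont_on A f) ->
  (forall x v, A x -> is_derive x v f (df v x)) ->
  (forall v, Cn_on n A (df v)) -> Cn_on n.+1 A f.
Proof.
move=> oA C D H; split=> // v; split=> [x /(D x v)[]//|].
by apply: Cn_eq (H v) => // x /(D x v)[_ ->].
Qed.

Lemma Cn_is_derive {V W} n (A : set V) (f : V -> W) x v : Cn_on n.+1 A f -> A x ->
  is_derive x v f ('D_v f x).
Proof. by move=> [_ /(_ v)[H _]] Ax; apply: derivableP; exact: H. Qed.

Lemma Cn_D {V W} n (A : set V) (f : V -> W) v : Cn_on n.+1 A f -> Cn_on n A ('D_v f).
Proof. by move=> [_ /(_ v)[]]. Qed.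

Lemma Cn_cst {V W} n (A : set V) (a : W) : open A -> Cn_on n A (fun=> a).
Proof.
move=> oA; elim: n a => [|n IH] a; first by split=> // x _; exact: cst_continuous.
apply: (@Cn_derive _ _ _ _ _ (fun v x => 0)) => //.
by move=> x _; exact: cst_continuous.
Qed.

Lemma Cn_add {V W} n (A : set V) (f g : V -> W) : open A -> Cn_on n A f -> Cn_on n A g ->
  Cn_on n A (fun x => f x + g x).
Proof.
move=> oA; elim: n f g => [|n IH] f g Hf Hg.
  split=> // x Ax; apply: continuousD; [exact: (Cn_cont Hf Ax)|exact: (Cn_cont Hg Ax)].
apply: (@Cn_derive _ _ _ _ _ (fun v x => 'D_v f x + 'D_v g x)) => //.
- move=> x Ax; apply: continuousD; [exact: (Cn_cont Hf Ax)|exact: (Cn_cont Hg Ax)].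
- by move=> x v Ax; apply: is_deriveD; [exact: (Cn_is_derive _ Hf)|exact: (Cn_is_derive _ Hg)].
- by move=> v; apply: IH; exact: Cn_D.
Qed.

Lemma Cn_mul {V} n (A : set V) (f g : V -> R) : open A -> Cn_on n A f -> Cn_on n A g ->
  Cn_on n A (fun x => f x * g x).
Proof.
move=> oA; elim: n f g => [|n IH] f g Hf Hg.
  split=> // x Ax; apply: continuousM; [exact: (Cn_cont Hf Ax)|exact: (Cn_cont Hg Ax)].
apply: (@Cn_derive _ _ _ _ _ (fun v x => f x * 'D_v g x + g x * 'D_v f x)) => //.
- move=> x Ax; apply: continuousM; [exact: (Cn_cont Hf Ax)|exact: (Cn_cont Hg Ax)].
- by move=> x v Ax; apply: is_deriveM; [exact: (Cn_is_derive _ Hf)|exact: (Cn_is_derive _ Hg)].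
- move=> v; apply: Cn_add => //; apply: IH; first [exact: Cn_D | exact: Cn_S].
Qed.

Lemma Cn_opp {V} n (A : set V) (f : V -> R) : open A -> Cn_on n A f -> Cn_on n A (fun x => - f x).
Proof.
move=> oA H; apply: (@Cn_eq _ _ _ _ (fun x => (-1) * f x)) => //.
  by move=> x _; rewrite mulN1r.
by apply: Cn_mul => //; exact: Cn_cst.
Qed.

Lemma Cn_sub_fun {V} n (A : set V) (f g : V -> R) : open A -> Cn_on n A f -> Cn_on n A g ->
  Cn_on n A (fun x => f x - g x).
Proof. by move=> oA Hf Hg; apply: Cn_add => //; exact: Cn_opp. Qed.

Lemma Cn_dif n (A : set (R * R)) (g : R * R -> R) v : open A -> Cn_on n.+1 A g -> A v ->
  dif g v (d_x g v) (d_z g v).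
Proof.
move=> oA Hg Av; apply: C1_dif.
- by apply: open_near oA Av _ => y Ay; exact: Cn_is_derive Hg Ay.
- by apply: open_near oA Av _ => y Ay; exact: Cn_is_derive Hg Ay.
- by apply: Cn_cont Av; exact: Cn_D Hg.
- by apply: Cn_cont Av; exact: Cn_D Hg.
Qed.

(** Induction on [n] with [F] varying: by the chain rule the derivatives are sums of products of
    [d_x F] and [d_z F], composed with the same inner maps, and derivatives of these maps. *)
Lemma Cn_comp2 {V} n (A : set V) (B : set (R * R)) (F : R * R -> R) (u1 u2 : V -> R) :
  open A -> open B -> Cn_on n B F -> Cn_on n A u1 -> Cn_on n A u2 ->
  (forall x, A x -> B (u1 x, u2 x)) -> Cn_on n A (fun x => F (u1 x, u2 x)).
Proof.
move=> oA oB; elim: n F => [|n IH] F HF H1 H2 AB.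
  split=> // x Ax; apply: (@continuous_comp _ _ _ (fun x => (u1 x, u2 x)) F).
    exact: cvg_pair (Cn_cont H1 Ax) (Cn_cont H2 Ax).
  exact: Cn_cont HF (AB _ Ax).
apply: (@Cn_derive _ _ _ _ _ (fun v x => d_x F (u1 x, u2 x) * 'D_v u1 x + d_z F (u1 x, u2 x) * 'D_v u2 x)) => //.
- move=> x Ax; apply: (@continuous_comp _ _ _ (fun x => (u1 x, u2 x)) F).
    exact: cvg_pair (Cn_cont H1 Ax) (Cn_cont H2 Ax).
  exact: Cn_cont HF (AB _ Ax).
- move=> x v Ax; apply: dif_is_derive.
  + exact: Cn_dif oB HF (AB _ Ax).
  + exact: Cn_is_derive H1 Ax.
  + exact: Cn_is_derive H2 Ax.
- move=> v; apply: (Cn_add oA); apply: (Cn_mul oA).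
  + exact: IH (Cn_D _ HF) (Cn_S H1) (Cn_S H2) AB.
  + exact: Cn_D H1.
  + exact: IH (Cn_D _ HF) (Cn_S H1) (Cn_S H2) AB.
  + exact: Cn_D H2.
Qed.

Lemma Cn_lin {V} n (A : set V) (f : V -> R) : open A -> continuous f ->
  (forall h x v, f (h *: v + x) = h * f v + f x) -> Cn_on n A f.
Proof.
move=> oA cf lf; case: n => [|n]; first by split=> // x _; exact: cf.
apply: (@Cn_derive _ _ _ _ _ (fun v x => f v)) => //.
- by move=> x _; exact: cf.
- move=> x v _; apply/is_derive_line; under eq_fun do rewrite lf.
  by apply/is_derive_leP => e e0; exists 1 => // h _; rewrite (_ : _ - _ = 0) ?normr0 ?mulr_ge0 ?(ltW e0)//; ring.
- by move=> v; exact: Cn_cst.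
Qed.

Lemma Cn_comp1 {V} n (A : set V) (B : set R) (F : R -> R) (u : V -> R) :
  open A -> open B -> Cn_on n B F -> Cn_on n A u ->
  (forall x, A x -> B (u x)) -> Cn_on n A (fun x => F (u x)).
Proof.
move=> oA oB; elim: n F => [|n IH] F HF H1 AB.
  split=> // x Ax; apply: (@continuous_comp _ _ _ u F); first exact: (Cn_cont H1).
  exact: Cn_cont HF (AB _ Ax).
apply: (@Cn_derive _ _ _ _ _ (fun v x => 'D_1 F (u x) * 'D_v u x)) => //.
- move=> x Ax; apply: (@continuous_comp _ _ _ u F); first exact: (Cn_cont H1).
  exact: Cn_cont HF (AB _ Ax).
- move=> x v Ax; have DF : is_derive1 (u x) F ('D_1 F (u x)) by exact: Cn_is_derive HF (AB _ Ax).
  have := @dif_is_derive _ V (fun p => F p.1) u (fun=> 0) x v ('D_1 F (u x)) 0 ('D_v u x) 0.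
  rewrite mul0r addr0; apply.
  + move/is_derive_leP : DF => DF e e0; have [d d0 Hd] := DF e e0; exists d => // h k /Hd hd _ /=.
    by rewrite mul0r subr0 (le_trans hd)// ler_wpM2l ?(ltW e0)// lerDl.
  + exact: Cn_is_derive H1 Ax.
- move=> v; apply: (Cn_mul oA).
  + exact: IH (Cn_D _ HF) (Cn_S H1) AB.
  + exact: Cn_D H1.
Qed.

Lemma is_derive_inv (x : R) : x != 0 -> is_derive1 x (fun y : R => y^-1) (- (x^-1 * x^-1)).
Proof.
move=> x0; have dx : derivable (fun y => y) x 1 by exact: derivable_id.
have E := deriveV x0 dx; rewrite derive_id in E.
split; first exact: derivableV x0 dx.
by rewrite E [_%:A]mulr1 -exprVn expr2.
Qed.

Lemma Cn_inv n : Cn_on n [set x : R | x != 0] (fun x => x^-1).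
Proof.
have oA : open [set x : R | x != 0] by exact: open_neq.
elim: n => [|n IH]; first by split=> // x x0; exact: inv_continuous.
apply: (@Cn_derive _ _ _ _ _ (fun v x : R => v * (- (x^-1 * x^-1)))) => //.
- by move=> x x0; exact: inv_continuous.
- by move=> x v /= x0; apply: is_derive_lineR; exact: is_derive_inv.
- move=> v; apply: Cn_mul => //; first exact: Cn_cst.
  by apply: Cn_opp => //; apply: Cn_mul.
Qed.

Lemma Cn_sum {V} n (A : set V) (I : Type) (s : seq I) (P : pred I) (F : I -> V -> R) : open A ->
  (forall i, P i -> Cn_on n A (F i)) -> Cn_on n A (fun x => \sum_(i <- s | P i) F i x).
Proof.
move=> oA H; elim: s => [|i s IH].
  by apply: (@Cn_eq _ _ _ _ (fun=> 0)) (Cn_cst _ _ oA) => // x _; rewrite big_nil.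
case Pi : (P i).
  apply: (@Cn_eq _ _ _ _ (fun x => F i x + \sum_(i <- s | P i) F i x)) => //.
    by move=> x _; rewrite big_cons Pi.
  by apply: Cn_add => //; exact: H.
by apply: Cn_eq IH => // x _; rewrite big_cons Pi.
Qed.

Lemma Cn_fst n (A : set (R * R)) : open A -> Cn_on n A (fun v => v.1).
Proof. by move=> oA; apply: Cn_lin => // x; exact: cvg_fst. Qed.

Lemma Cn_snd n (A : set (R * R)) : open A -> Cn_on n A (fun v => v.2).
Proof. by move=> oA; apply: Cn_lin => // x; exact: cvg_snd. Qed.

Lemma Cn_id n (A : set R) : open A -> Cn_on n A (fun v => v).
Proof. by move=> oA; apply: Cn_lin => // x; exact: cvg_id. Qed.

Lemma Cn_dxdz n (A : set (R * R)) (g : R * R -> R) v : open A -> Cn_on n.+2 A g -> A v ->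
  d_z (d_x g) v = d_x (d_z g) v.
Proof.
move=> oA Hg Av; apply: (@schwarz R g (d_x g) (d_z g)).
- by apply: open_near oA Av _ => y Ay; exact: Cn_is_derive Hg Ay.
- by apply: open_near oA Av _ => y Ay; exact: Cn_is_derive Hg Ay.
- by apply: open_near oA Av _ => y Ay; exact: (Cn_is_derive _ (Cn_D _ Hg)) Ay.
- by apply: open_near oA Av _ => y Ay; exact: (Cn_is_derive _ (Cn_D _ Hg)) Ay.
- by apply: Cn_cont Av; exact: Cn_D _ (Cn_D _ Hg).
- by apply: Cn_cont Av; exact: Cn_D _ (Cn_D _ Hg).
Qed.

End Cn.

(** * Lebesgue measure on the plane *)

Section plane_measure.
Context {R : realType}.

(** The sigma-algebra here is the product one, generated by rectangles; so an open set is written as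
    the countable union of the boxes with rational centre and radius that it contains. *)
Lemma meas_open2 (A : set (R * R)) : open A -> measurable (mset A).
Proof.
move=> oA.
pose box (i : rat * rat * rat) : set (mvplane R) :=
  `](ratr i.1.1 - ratr i.2), (ratr i.1.1 + ratr i.2)[%classic `*`
  `](ratr i.1.2 - ratr i.2), (ratr i.1.2 + ratr i.2)[%classic.
pose F i := if `[< box i `<=` A >] then box i else set0.
have -> : A = \bigcup_i F i.
  apply/seteqP; split=> [v Av|v [i _]]; last first.
    by rewrite /F; case: asboolP => // BA /BA.
  have /nbhs2_leP[d d0 Hd] : nbhs v A by exact: open_nbhs_nbhs.
  have d20 : 0 < d / 2 by rewrite divr_gt0.
  (* The centre of the box will be within [e] of [v], so its points are within [2 * e < d] of
     [v]. *)
  have [e] : exists e : rat, ratr e \in `]0, (d / 2)[ by have [e ? ] := rat_in_itvoo d20; exists e.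
  rewrite in_itv/= => /andP[e0 ed].
  have [a] : exists a : rat, ratr a \in `](v.1 - ratr e), (v.1 + ratr e)[.
    by have [|a ha] := @rat_in_itvoo R (v.1 - ratr e) (v.1 + ratr e); [lra|exists a].
  have [b] : exists b : rat, ratr b \in `](v.2 - ratr e), (v.2 + ratr e)[.
    by have [|b hb] := @rat_in_itvoo R (v.2 - ratr e) (v.2 + ratr e); [lra|exists b].
  rewrite !in_itv/= => /andP[b1 b2] /andP[a1 a2].
  have BA : box (a, b, e) `<=` A.
    move=> [y z] [/=]; rewrite !in_itv/= => /andP[y1 y2] /andP[z1 z2].
    have := Hd (y - v.1) (z - v.2); rewrite [v.1 + _]addrC [v.2 + _]addrC !subrK.
    by apply; rewrite ler_norml; apply/andP; split; lra.
  exists (a, b, e) => //; rewrite /F; case: asboolP => // _.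
  by split; rewrite /= in_itv/=; apply/andP; split; lra.
apply: countable_bigcupT_measurable; first exact: countableP.
move=> i; rewrite /F; case: asboolP => // _.
by apply: measurableX; exact: measurable_itv.
Qed.

Lemma cont2_measurable (A : set (R * R)) (f : R * R -> R) : open A ->
  (cont_on A f) -> measurable_fun (mset A) f.
Proof.
move=> oA cf; apply: (measurability _ (RGenOInfty.measurableE R)).
move=> /= _ [_ [a ->]] <-; apply: meas_open2.
rewrite openE => v [Av fv]; apply: filterI.
  exact: open_nbhs_nbhs.
by apply: (cf v Av); apply: open_nbhs_nbhs; split.
Qed.

Lemma is_derive_cst0 (V W : normedModType R) (a : W) (x v : V) :
  is_derive x v (fun=> a) 0.
Proof. by split; [exact: derivable_cst|exact: derive_cst]. Qed.

Definition Box (r : R) : set (R * R) := [set v | `|v.1| <= r /\ `|v.2| <= r].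

Lemma BoxE r : Box r = `[- r, r]%classic `*` `[- r, r]%classic.
Proof.
by apply/seteqP; split=> -[x z]; rewrite /Box /= !in_itv/= !ler_norml.
Qed.

Lemma Box_compact r : compact (Box r).
Proof. by rewrite BoxE; apply: compact_setX; exact: segment_compact. Qed.

Lemma Box_measurable r : measurable (mset (Box r)).
Proof. by rewrite BoxE; apply: measurableX; exact: measurable_itv. Qed.

Lemma area_Box r : (mu2 (Box r) < +oo)%E.
Proof.
have mI := measurable_itv `[- r, r]; rewrite BoxE.
have -> : mu2 (`[- r, r]%classic `*` `[- r, r]%classic) = (mu `[(- r)%R, r]%classic * mu `[(- r)%R, r]%classic)%E.
  exact: product_measure1E.
apply: lte_mul_pinfty => //.
  by rewrite lebesgue_measure_itv/=; case: ifP.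
by rewrite lebesgue_measure_itv/=; case: ifP; rewrite ?ltry.
Qed.

Lemma bounded_Box (U : set (R * R)) : bounded_set U -> exists2 r, 0 < r & U `<=` Box r.
Proof.
move=> [M [_ HM]]; exists (`|M| + 1); first by rewrite ltr_wpDl.
move=> v Uv; have : `|v| <= `|M| + 1.
  by apply: (HM _ _ v Uv); rewrite (le_lt_trans (ler_norm M))// ltrDl.
by rewrite prod_normE ge_max => /andP[].
Qed.

Lemma area_open_lty (U : set (R * R)) : open U -> bounded_set U -> (mu2 U < +oo)%E.
Proof.
move=> oU /bounded_Box[r r0 Ur]; apply: le_lt_trans (area_Box r).
apply: le_measure => //; rewrite ?inE; [exact: meas_open2|exact: Box_measurable].
Qed.

Lemma compact_bound (K : set (R * R)) (f : R * R -> R) : compact K ->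
  (cont_on K f) -> exists2 C, 0 < C & forall v, K v -> `|f v| <= C.
Proof.
move=> cK cf; have : compact (f @` K).
  by apply: continuous_compact => //; apply: continuous_in_subspaceT => v; rewrite inE; exact: cf.
move=> /compact_bounded[M [_ HM]]; exists (`|M| + 1); first by rewrite ltr_wpDl.
move=> v Kv; apply: (HM _ _ (f v)); last by exists v.
by rewrite (le_lt_trans (ler_norm M))// ltrDl.
Qed.

Implicit Types (r C x z : R) (f P Px Pz : R * R -> R).

(** An explicit box rather than a compact support: integrals over horizontal and vertical lines then
    run over [[-r, r]]. *)
Definition csupp (r : R) (f : R * R -> R) := forall v, ~ Box r v -> f v = 0.

Lemma csupp_bound r f : continuous f -> csupp r f -> exists2 C, 0 < C & forall v, `|f v| <= C.
Proof.
move=> cf sf; have [C C0 HC] := @compact_bound (Box r) f (@Box_compact r) (fun v _ => cf v).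
exists C => // v; have [/HC//|/sf ->] := pselect (Box r v).
by rewrite normr0 ltW.
Qed.

Lemma bounded_integrable (A : set (R * R)) r C f : measurable (mset A) ->
  measurable_fun (mset A) f ->
  (forall v, A v -> `|f v| <= C) -> (forall v, A v -> ~ Box r v -> f v = 0) ->
  integrable2 A f.
Proof.
move=> mA mf fC f0.
have mB := Box_measurable r.
apply: (@le_integrable _ _ _ _ _ mA _ (EFin \o (fun v => C * \1_(Box r) v))).
- exact/measurable_EFinP.
- move=> v Av /=; rewrite lee_fin normrM.
  have [Bv|/(f0 v Av) ->] := pselect (Box r v); last by rewrite normr0 mulr_ge0.
  rewrite indicE mem_set// normr1 mulr1.
  exact: le_trans (fC v Av) (ler_norm _).
- apply: (@integrableS _ _ _ _ setT) => //.
  rewrite (_ : _ \o _ = (fun v => C%:E * (\1_(Box r) v)%:E)%E)//.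
  apply: integrableZl => //.
  apply/integrableP; split; first exact/measurable_EFinP.
  under eq_integral => v _ do rewrite gee0_abs ?lee_fin//.
  by rewrite integral_indic// setIT area_Box.
Qed.

Lemma csupp_integrable r f : continuous f -> csupp r f -> integrable2 setT f.
Proof.
move=> cf sf; have [C C0 HC] := csupp_bound cf sf.
apply: (@bounded_integrable setT r C) => //.
- by apply: cont2_measurable; [exact: openT|move=> v _; exact: cf].
- by move=> v _; exact: sf.
Qed.

Lemma FTC_is_derive (F f : R -> R) (a b : R) : a < b ->
  (forall x, a <= x <= b -> is_derive1 x F (f x)) ->
  (forall x, a <= x <= b -> {for x, continuous f}) ->
  (\int[mu]_(x in `[a, b]) (f x)%:E = (F b - F a)%:E)%E.
Proof.
move=> ab dF cf; rewrite (@continuous_FTC2 R f F a b) //.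
- apply: continuous_in_subspaceT => x; rewrite inE/= in_itv/=; exact: cf.
- have cF x : a <= x <= b -> {for x, continuous F}.
    by move=> xab; exact: is_derive_continuous (dF x xab).
  split.
  + by move=> x; rewrite in_itv/= => /andP[ax xb]; have [] := dF x _; rewrite ?ltW.
  + by apply: cvg_at_right_filter; apply: cF; rewrite lexx ltW.
  + by apply: cvg_at_left_filter; apply: cF; rewrite lexx ltW.
- move=> x; rewrite in_itv/= => /andP[ax xb]; rewrite derive1E.
  by have [|_ ->] := dF x; rewrite ?ltW.
Qed.

Lemma open_norm_gt (r : R) : open [set y : R | r < `|y|].
Proof.
rewrite openE => x /= rx; apply/nbhsR_leP; exists ((`|x| - r) / 2).
  by rewrite divr_gt0// subr_gt0.
move=> h hd /=; have := lerB_normD x h; lra.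
Qed.

Lemma integral_derive0 (F f : R -> R) (r : R) :
  (forall x, is_derive1 x F (f x)) -> continuous f ->
  (forall x, r < `|x| -> F x = 0) -> (\int[mu]_x (f x)%:E = 0)%E.
Proof.
move=> dF cf F0.
(* [r] may be negative; [s] is positive and larger than [r], so [F] vanishes at both end points of
   [[-s, s]]. *)
pose s := `|r| + 1; have s0 : 0 < s by rewrite ltr_wpDl.
have rs : r < s by rewrite (le_lt_trans (ler_norm r))// ltrDl.
have f0 x : r < `|x| -> f x = 0.
  move=> rx; have [_ <-] := dF x.
  have [_ ] : is_derive1 x F 0; last by [].
  apply: (near_is_derive (fun=> 0)).
  apply: open_near (_ : open [set y : R | r < `|y|]) rx _ => [|y /= /F0//].
    exact: open_norm_gt.
rewrite (_ : (\int[mu]_x _ = \int[mu]_(x in `[(- s)%R, s]) (f x)%:E)%E); last first.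
  rewrite [RHS]integral_mkcond; apply: eq_integral => x _; rewrite patchE.
  case: ifPn => //; rewrite notin_setE/= in_itv/= -ler_norml => /negP; rewrite -ltNge => sx.
  by rewrite f0// (lt_trans rs).
rewrite (@FTC_is_derive F).
- by rewrite !F0 ?subrr// ?normrN gtr0_norm.
- by rewrite gtrN.
- by move=> x _; exact: cf.
Qed.

Lemma csupp_dx r P Px : (forall v, is_dx v P (Px v)) -> csupp r P -> csupp r Px.
Proof.
move=> dP sP [x z] nB; have /is_derive_dx/= [_ <-] := dP (x, z).
have [_] : is_derive1 x (fun s => P (s, z)) 0; last by [].
have [zr|zr] := lerP `|z| r.
  have xr : r < `|x| by rewrite ltNge; apply/negP => xr; exact: nB.
  apply: (near_is_derive (fun=> 0)).
  apply: open_near (_ : open [set y : R | r < `|y|]) xr _ => [|y /= yr].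
    exact: open_norm_gt.
  by rewrite sP// => -[/=]; rewrite leNgt yr.
rewrite (_ : (fun _ => _) = (fun=> 0)); first exact: is_derive_cst0.
by apply/funext => s; apply: sP => -[_ /=]; rewrite leNgt zr.
Qed.

Lemma csupp_dz r P Pz : (forall v, is_dz v P (Pz v)) -> csupp r P -> csupp r Pz.
Proof.
move=> dP sP [x z] nB; have /is_derive_dz/= [_ <-] := dP (x, z).
have [_] : is_derive1 z (fun s => P (x, s)) 0; last by [].
have [xr|xr] := lerP `|x| r.
  have zr : r < `|z| by rewrite ltNge; apply/negP => zr; exact: nB.
  apply: (near_is_derive (fun=> 0)).
  apply: open_near (_ : open [set y : R | r < `|y|]) zr _ => [|y /= yr].
    exact: open_norm_gt.
  by rewrite sP// => -[_ /=]; rewrite leNgt yr.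
rewrite (_ : (fun _ => _) = (fun=> 0)); first exact: is_derive_cst0.
by apply/funext => s; apply: sP => -[/=]; rewrite leNgt xr.
Qed.

Lemma continuous2_fix1 f x : continuous f -> continuous (fun z => f (x, z)).
Proof.
move=> cf z; apply/continuousR_leP => e e0; have /continuous2_leP/(_ e e0)[d d0 Hd] := cf (x, z).
by exists d => // h hd; have := Hd 0 h _ hd; rewrite normr0 addr0; apply; exact: ltW.
Qed.

Lemma continuous2_fix2 f z : continuous f -> continuous (fun x => f (x, z)).
Proof.
move=> cf x; apply/continuousR_leP => e e0; have /continuous2_leP/(_ e e0)[d d0 Hd] := cf (x, z).
by exists d => // h hd; have := Hd h 0 hd; rewrite normr0 addr0; apply; exact: ltW.
Qed.

(** By Fubini with the integration in [x] inside: on each horizontal line the integral of the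
    derivative of a compactly supported function is zero. *)
Lemma int_dx0 r P Px : (forall v, is_dx v P (Px v)) -> continuous Px ->
  csupp r P -> \int[mu2]_v Px v = 0.
Proof.
move=> dP cP sP; have sPx := csupp_dx dP sP.
have iP := csupp_integrable cP sPx.
rewrite /Rintegral -(integral21_prod_meas1 iP).
rewrite (eq_integral (cst 0%E)) ?integral0// => z _.
apply: (@integral_derive0 (fun s => P (s, z)) _ r).
- by move=> x; have /is_derive_dx := dP (x, z).
- exact: continuous2_fix2.
- by move=> x xr; apply: sP => -[/=]; rewrite leNgt xr.
Qed.

Lemma int_dz0 r P Pz : (forall v, is_dz v P (Pz v)) -> continuous Pz ->
  csupp r P -> \int[mu2]_v Pz v = 0.
Proof.
move=> dP cP sP; have sPz := csupp_dz dP sP.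
have iP := csupp_integrable cP sPz.
rewrite /Rintegral -(integral12_prod_meas1 iP).
rewrite (eq_integral (cst 0%E)) ?integral0// => x _.
apply: (@integral_derive0 (fun s => P (x, s)) _ r).
- by move=> z; have /is_derive_dz := dP (x, z).
- exact: continuous2_fix1.
- by move=> z zr; apply: sP => -[_ /=]; rewrite leNgt zr.
Qed.

(** Each vertical section of [N] is contained in a singleton. *)
Lemma graph_null (N : set (R * R)) (ga : R -> R) : measurable (mset N) ->
  (forall v, N v -> v.2 = ga v.1) -> mu2 N = 0%E.
Proof.
move=> mN Nga; transitivity (\int[mu]_x mu (xsection N x))%E; first by [].
rewrite (eq_integral (cst 0%E)) ?integral0// => x _ /=.
apply/eqP; rewrite eq_le measure_ge0 andbT.
rewrite -(lebesgue_measure_set1 (ga x)); apply: le_measure; rewrite ?inE//.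
- exact: measurable_xsection.
- by move=> z; rewrite /xsection/= inE => /Nga.
Qed.

End plane_measure.

(** * Smooth cutoff functions *)

Section smooth_step.
Context {R : realType}.
Implicit Types (x : R) (k n : nat).

Lemma continuous_near_eq (V W : normedModType R) (f g : V -> W) (v : V) :
  (\forall y \near v, f y = g y) -> {for v, continuous g} -> {for v, continuous f}.
Proof.
move=> fg cg; rewrite /prop_for /continuous_at (nbhs_singleton fg).
by apply: cvg_trans cg; apply: near_eq_cvg; apply: filterS fg => y ->.
Qed.

Lemma derive_cast (V W : normedModType R) (f g : V -> W) (x v : V) (a b : W) :
  is_derive x v f a -> f =1 g -> a = b -> is_derive x v g b.
Proof. by move=> H /funext <- <-. Qed.

(** [x^-k * exp (-1/x)] for positive [x], extended by zero. The derivative of a member of this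
    family is a combination of two others ([is_derive_expm]), so a single induction proves all of
    them smooth. *)
Definition expm k x : R := if 0 < x then x^-1 ^+ k * expR (- x^-1) else 0.

(** With [t = 1/x] and [n = k + 2], [exp t] is the [n]-th power of [exp (t / n) >= t / n], which
    leaves two spare powers of [x]. The function is therefore quadratically small at 0, where its
    derivative is 0. *)
Lemma expm_le k x : 0 <= expm k x <= (k.+2 ^ k.+2)%:R * `|x| ^+ 2.
Proof.
rewrite /expm; case: ifPn => [x0|_]; last by rewrite lexx /= mulr_ge0// exprn_ge0.
apply/andP; split; first by rewrite mulr_ge0 ?expR_ge0// exprn_ge0// invr_ge0 ltW.
rewrite gtr0_norm// expRN ler_pdivrMr ?expR_gt0//.
set n := k.+2; have n0 : (0 : R) < n%:R by rewrite ltr0n.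
have -> : expR x^-1 = expR (x^-1 / n%:R) ^+ n.
  by rewrite -expRM_natl mulrC divfK// gt_eqF.
apply: (@le_trans _ _ (n%:R ^+ n * x ^+ 2 * (x^-1 / n%:R) ^+ n)).
  have c0 : n%:R ^+ n != 0 :> R by rewrite expf_neq0 ?gt_eqF.
  have x00 : x != 0 by rewrite gt_eqF.
  have E : x^-1 ^+ n = x^-1 ^+ k * x^-1 ^+ 2 by rewrite -exprD addn2.
  rewrite exprMn [n%:R^-1 ^+ n]exprVn E.
  move: (x^-1 ^+ k) => a; move: (n%:R ^+ n) c0 => c c0.
  by apply: eq_ler; field; rewrite c0.
rewrite natrX ler_wpM2l//; first by rewrite mulr_ge0 ?exprn_ge0 ?ltW.
have u0 : 0 <= x^-1 / n%:R by rewrite divr_ge0 ?invr_ge0 ?ltW.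
rewrite lerXn2r ?nnegrE ?expR_ge0//.
by apply: le_trans (expR_ge1Dx _); rewrite lerDr.
Qed.

Lemma is_derive_expm k x : is_derive1 x (expm k) (- k%:R * expm k.+1 x + expm k.+2 x).
Proof.
have [x0|x0|->] := ltgtP x 0.
- have -> : - k%:R * expm k.+1 x + expm k.+2 x = 0.
    by rewrite /expm ltNge (ltW x0)/= mulr0 addr0.
  apply: (near_is_derive (fun=> 0)); apply: open_near (_ : open [set y : R | y < 0]) x0 _.
    exact: open_lt.
  by move=> y /= y0; rewrite /expm ltNge (ltW y0).
- apply: (near_is_derive (fun y : R => y^-1 ^+ k * expR (- y^-1))).
    apply: open_near (_ : open [set y : R | 0 < y]) x0 _; first exact: open_gt.
    by move=> y /= y0; rewrite /expm y0.
  have dV := is_derive_inv (lt0r_neq0 x0).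
  have dE : is_derive1 x (fun y => expR (- y^-1)) (expR (- x^-1) * (x^-1 * x^-1)).
    have dN : is_derive1 x (fun y => - y^-1) (x^-1 * x^-1).
      by rewrite -[_ * _]opprK; apply: is_deriveN.
    have := @is_derive1_comp R expR (fun y => - y^-1) x _ _ (is_derive_expR _) dN.
    by rewrite mulrC.
  have dX : is_derive1 x (fun y => y^-1 ^+ k) (k%:R * x^-1 ^+ k.-1 * - (x^-1 * x^-1)).
    apply: (derive_cast (@is_deriveX _ _ (fun y : R => y^-1) k x 1 _ dV)) => [y|]; last by rewrite /GRing.scale/= mulr_natl.
    by rewrite exprfctE.
  apply: (derive_cast (@is_deriveM _ _ _ _ x 1 _ _ dX dE)) => //; rewrite /expm x0 /GRing.scale/=.
  move: {dX} k => [|k]; rewrite /= ?mul0r ?mulr0n; first by rewrite !exprS expr0; ring.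
  by rewrite !exprS; ring.
- have -> : - k%:R * expm k.+1 0 + expm k.+2 0 = 0 by rewrite /expm ltxx mulr0 addr0.
  apply/is_derive_leP => e e0; pose C := (k.+2 ^ k.+2)%:R : R.
  have C0 : 0 < C + 1 by rewrite ltr_wpDl// /C.
  exists (e / (C + 1)); first exact: divr_gt0.
  move=> h; rewrite ler_pdivlMr// => hd.
  rewrite add0r {2}/expm ltxx subr0 mul0r subr0.
  have /andP[e1 e2] := expm_le k h; rewrite ger0_norm//.
  apply: (le_trans e2); rewrite expr2 mulrA ler_wpM2r//.
  by apply: le_trans hd; rewrite mulrC ler_wpM2l// lerDl.
Qed.

Lemma expm_smooth n k : Cn_on n setT (expm k).
Proof.
elim: n k => [|n IH] k.
  split=> // x _; exact: is_derive_continuous (is_derive_expm k x).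
apply: (@Cn_derive _ _ _ _ _ _ (fun v x => v * (- k%:R * expm k.+1 x + expm k.+2 x))).
- exact: openT.
- by move=> x _; apply: Cn_cont (IH k) _.
- by move=> x v _; apply: is_derive_lineR; exact: is_derive_expm.
- move=> v; apply: (Cn_mul openT); first exact: Cn_cst openT.
  by apply: (Cn_add openT) (IH _); apply: (Cn_mul openT) (IH _); exact: Cn_cst openT.
Qed.

(** Rises from 0 on [x <= 0] to 1 on [x >= 1]. The denominator is positive because [x] and [1 - x]
    are never both nonpositive. *)
Definition step x : R := expm 0 x / (expm 0 x + expm 0 (1 - x)).

Lemma expm_gt0 k x : 0 < x -> 0 < expm k x.
Proof. by move=> x0; rewrite /expm x0 mulr_gt0 ?expR_gt0// exprn_gt0// invr_gt0. Qed.

Lemma expm_ge0 k x : 0 <= expm k x.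
Proof. by have /andP[] := expm_le k x. Qed.

Lemma step_den x : 0 < expm 0 x + expm 0 (1 - x).
Proof.
have [x0|x0] := ltrP 0 x; first by rewrite ltr_wpDr ?expm_ge0// expm_gt0.
by rewrite ltr_wpDl ?expm_ge0// expm_gt0// subr_gt0 (le_lt_trans x0).
Qed.

Lemma step_smooth n : Cn_on n setT step.
Proof.
have E1 : Cn_on n setT (fun x => expm 0 x) by exact: expm_smooth.
have E2 : Cn_on n setT (fun x => expm 0 (1 - x)).
  apply: (@Cn_comp1 _ _ _ _ setT (expm 0)) => //; try exact: openT.
  by apply: (Cn_sub_fun openT); [exact: Cn_cst openT|exact: Cn_id openT].
apply: (Cn_mul openT E1).
apply: (@Cn_comp1 _ _ _ _ [set x : R | x != 0] (fun y => y^-1)) => //.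
- exact: openT.
- exact: Cn_inv.
- exact: Cn_add openT E1 E2.
- by move=> x _; rewrite /= gt_eqF// step_den.
Qed.

Lemma step0 x : x <= 0 -> step x = 0.
Proof. by move=> x0; rewrite /step {1}/expm ltNge x0 mul0r. Qed.

Lemma step1 x : 1 <= x -> step x = 1.
Proof.
move=> x1; rewrite /step {3}/expm subr_gt0 ltNge x1 addr0 mulfV//.
by rewrite gt_eqF// expm_gt0// (lt_le_trans ltr01).
Qed.

Lemma step_ge0 x : 0 <= step x.
Proof. by rewrite /step divr_ge0 ?expm_ge0// ltW// step_den. Qed.

Lemma step_le1 x : step x <= 1.
Proof. by rewrite /step ler_pdivrMr ?step_den// mul1r lerDl expm_ge0. Qed.

Definition dstep x : R := 'D_1 step x.

Lemma is_derive_step x : is_derive1 x step (dstep x).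
Proof. by apply: Cn_is_derive (step_smooth 1) _. Qed.

Lemma dstep_continuous : continuous dstep.
Proof. by move=> x; have [H _] := Cn_D (1:R) (step_smooth 1); exact: H. Qed.

Lemma dstep0 x : x < 0 \/ 1 < x -> dstep x = 0.
Proof.
move=> H; have [_ <-] := is_derive_step x.
suff [c [A [oA [Ax Ac]]]] : exists c A, open A /\ A x /\ forall y, A y -> c = step y.
  have [] : is_derive1 x step 0; last by [].
  by apply: (near_is_derive (fun=> c)); apply: open_near oA Ax _.
case: H => H.
  exists 0, [set y | y < 0]; split; first exact: open_lt.
  by split=> // y /= y0; rewrite step0// ltW.
exists 1, [set y | 1 < y]; split; first exact: open_gt.
by split=> // y /= y0; rewrite step1// ltW.
Qed.

Lemma dstep_bound : exists2 C, 0 < C & forall x, `|dstep x| <= C.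
Proof.
have : compact (dstep @` `[0, 1]%classic).
  apply: continuous_compact; last exact: segment_compact.
  by apply: continuous_subspaceT => x; exact: dstep_continuous.
move=> /compact_bounded[M [_ HM]]; exists (`|M| + 1); first by rewrite ltr_wpDl.
move=> x; have [x01|] := boolP (0 <= x <= 1).
  apply: (HM _ _ (dstep x)); last by exists x => //=; rewrite in_itv.
  by rewrite (le_lt_trans (ler_norm M))// ltrDl.
rewrite negb_and -!ltNge => /orP H; rewrite dstep0; last by case: H; [left|right].
by rewrite normr0 addr_ge0.
Qed.

End smooth_step.

(** * Divergence theorem on one side of a curve *)

Section divergence.
Context {R : realType}.
Implicit Types (f g P Q : R * R -> R).

(** Stronger than uniform continuity on [K]: only the base point lies in [K], the displaced point
    may leave it. *)
Lemma compact_unif (K : set (R * R)) f : compact K ->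
  (cont_on K f) -> forall e : R, 0 < e ->
  exists2 d : R, 0 < d & forall v h k, K v -> `|h| <= d -> `|k| <= d ->
    `|f (v.1 + h, v.2 + k) - f v| <= e.
Proof.
move=> cK cf e e0.
pose P (d : R) v := forall h k, `|h| <= d -> `|k| <= d ->
  `|f (v.1 + h, v.2 + k) - f v| <= e.
have /compact_near_coveringP/(_ _ (at_right 0) P) H := cK.
have /H : forall v, K v -> \forall x' \near v & i \near at_right 0, P i x'.
  move=> v Kv.
  have e20 : 0 < e / 2 by rewrite divr_gt0.
  have /continuous2_leP/(_ _ e20)[d d0 Hd] := cf v Kv.
  have d20 : 0 < d / 2 by rewrite divr_gt0.
  exists ([set w : R * R | `|w.1 - v.1| <= d / 2 /\ `|w.2 - v.2| <= d / 2], [set x | x <= d / 2]).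
    split=> /=.
      apply/nbhs2_leP; exists (d / 2) => // h k hd kd /=.
      by rewrite ![_ + _ - _]addrAC !subrr !add0r.
    exact: nbhs_right_le.
  move=> [[w1 w2] x] /= [[wd1 wd2] xd] h k hx kx /=.
  have A := Hd (w1 + h - v.1) (w2 + k - v.2).
  have B := Hd (w1 - v.1) (w2 - v.2).
  have tr (a b : R) : a + (b - a) = b by rewrite addrC subrK.
  rewrite !tr in A B.
  rewrite (_ : _ - _ = (f (w1 + h, w2 + k) - f v) - (f (w1, w2) - f v)); last by ring.
  rewrite (le_trans (ler_normB _ _))// [e]splitr lerD//.
    by apply: A; rewrite addrAC (le_trans (ler_normD _ _))// [d]splitr lerD//;
      exact: le_trans xd.
  by apply: B; [apply: (le_trans wd1)|apply: (le_trans wd2)]; lra.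
case=> /= d d0 Hd; exists (d / 2); first by rewrite divr_gt0.
have := Hd (d / 2); rewrite /ball /= sub0r normrN gtr0_norm ?divr_gt0// => Hd2.
move=> v h k Kv; apply: Hd2 => //.
by lra.
Qed.

Lemma Rint0 d (T : measurableType d) (m : measure T R) (D : set T) : \int[m]_(x in D) (0 : R) = 0.
Proof. by rewrite /Rintegral integral0. Qed.

Lemma Rdct d (T : measurableType d) (m : measure T R) (D : set T) (f_ : nat -> T -> R) (f g : T -> R) :
  measurable D -> (forall n, measurable_fun D (f_ n)) -> measurable_fun D f ->
  (forall x, D x -> f_ n x @[n --> \oo] --> f x) ->
  m.-integrable D (EFin \o g) -> (forall n x, D x -> `|f_ n x| <= g x) ->
  m.-integrable D (EFin \o f) /\ \int[m]_(x in D) f_ n x @[n --> \oo] --> \int[m]_(x in D) f x.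
Proof.
move=> mD mf_ mf f_f ig f_g.
have [|||||I1 _ I2] := @dominated_convergence _ _ R m D mD (fun n => EFin \o f_ n) (EFin \o f) (EFin \o g).
- by move=> n; exact/measurable_EFinP.
- exact/measurable_EFinP.
- by apply: aeW => x Dx; apply: cvg_EFin; [exact: nearW|exact: f_f].
- exact: ig.
- by apply: aeW => x n Dx; rewrite /= lee_fin f_g.
split=> //; apply: fine_cvg; rewrite fineK//.
exact: integrable_fin_num.
Qed.

Lemma mitv (a b : R) : measurable (`[a, b]%classic : set (measurableTypeR R)).
Proof. exact: measurable_itv. Qed.

Lemma cst_itv_integrable (a b C : R) : mu.-integrable `[a, b] (EFin \o (fun=> C)).
Proof.
apply: measurable_bounded_integrable => //.
- by rewrite /= lebesgue_measure_itv/=; case: ifP; rewrite ?ltry.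
- by exists `|C|; split=> // x Cx y _; exact: ltW.
Qed.

Lemma cont_itv_integrable (a b : R) (h : R -> R) : continuous h -> mu.-integrable `[a, b] (EFin \o h).
Proof.
move=> ch; apply: continuous_compact_integrable; first exact: segment_compact.
by apply: continuous_subspaceT => x; exact: ch.
Qed.

Lemma csupp1_integrable (r : R) (h : R -> R) : continuous h -> (forall x, r < `|x| -> h x = 0) ->
  mu.-integrable setT (EFin \o h).
Proof.
move=> ch h0; have mI := mitv (- r) r.
have -> : EFin \o h = (EFin \o h) \_ `[- r, r]%classic.
  apply/funext => x; rewrite patchE; case: ifPn => //.
  by rewrite notin_setE/= in_itv/= -ler_norml => /negP; rewrite -ltNge => /h0 ->.
by apply/(integrable_mkcond _ mI); exact: cont_itv_integrable.
Qed.

Lemma Rfubini r f : continuous f -> csupp r f ->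
  mu.-integrable setT (EFin \o (fun x => \int[mu]_z f (x, z))) /\
  \int[mu2]_v f v = \int[mu]_x \int[mu]_z f (x, z).
Proof.
move=> cf sf; have iF := csupp_integrable cf sf.
have E : (EFin \o (fun x => \int[mu]_z f (x, z))) = fubini_F mu (EFin \o f).
  apply/funext => x; rewrite /fubini_F /Rintegral /= fineK//.
  apply: integrable_fin_num => //.
  apply: (@csupp1_integrable r); first exact: continuous2_fix1.
  by move=> z zr; apply: sf => -[_ /=]; rewrite leNgt zr.
split; first by rewrite E; exact: integrable_fubini_F.
transitivity (fine (\int[mu]_x fubini_F mu (EFin \o f) x)%E); last by rewrite -E.
by rewrite (integral12_prod_meas1 iF).
Qed.

Lemma Rint_itv_le (a b C : R) (h : R -> R) : a <= b -> continuous h ->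
  (forall x, a <= x <= b -> `|h x| <= C) -> `|\int[mu]_(x in `[a, b]) h x| <= C * (b - a).
Proof.
move=> ab ch hC.
have mI := mitv a b.
have ih := @cont_itv_integrable a b h ch.
apply: (le_trans (le_normr_Rintegral mI ih)).
apply: (@le_trans _ _ (\int[mu]_(x in `[a, b]) C)).
  apply: le_Rintegral => //.
  - have := @cont_itv_integrable a b (fun x => `|h x|); apply.
    by move=> x; apply: (cont_comp h (fun y => `|y|)); [exact: ch|exact: norm_continuous].
  - exact: cst_itv_integrable.
rewrite Rintegral_cst//= lebesgue_measure_itv/=.
by case: ifPn => [_|]; rewrite ?lte_fin -?leNgt //= => ba; rewrite (_ : b = a) ?subrr ?mulr0//; apply/eqP; rewrite eq_le ba.
Qed.

Lemma Rint_itv_setT (a b : R) (h : R -> R) : (forall x, ~~ (a <= x <= b) -> h x = 0) ->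
  \int[mu]_x h x = \int[mu]_(x in `[a, b]) h x.
Proof.
move=> h0; rewrite [RHS]Rintegral_mkcond; apply: eq_Rintegral => x _; rewrite patchE.
by case: ifPn => //; rewrite notin_setE/= in_itv/= => /negP/h0.
Qed.

Lemma continuous_fst_comp (h : R -> R) (v : R * R) : {for v.1, continuous h} ->
  {for v, continuous (fun w : R * R => h w.1)}.
Proof.
move=> /continuousR_leP c; apply/continuous2_leP => e /c[d d0 H].
by exists d => // k l kd _; exact: H.
Qed.

Lemma continuous_fix1_at f x z : {for (x, z), continuous f} -> {for z, continuous (fun y => f (x, y))}.
Proof.
move=> /continuous2_leP c; apply/continuousR_leP => e /c[d d0 H]; exists d => // k kd.
by have := H 0 k _ kd; rewrite normr0 addr0; apply; exact: ltW.
Qed.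

Lemma near_fst (I : set R) (v : R * R) : open I -> I v.1 -> \forall w \near v, I w.1.
Proof.
move=> oI Iv; have /nbhsR_leP[d d0 H] : nbhs v.1 I by exact: open_nbhs_nbhs.
by apply/nbhs2_leP; exists d => // k l kd _; exact: H.
Qed.

Section shrinking_collar.
Variables (I : set R) (ga dga : R -> R) (s : R) (K : set (R * R)) (P Q Px Qz : R * R -> R).
Hypotheses (oI : open I) (dga_ga : forall x, I x -> is_derive1 x ga (dga x))
  (cdga : cont_on I dga) (s1 : s = 1 \/ s = -1)
  (cK : compact K) (KI : forall v, K v -> I v.1) (P0 : forall v, ~ K v -> P v = 0)
  (Q0 : forall v, ~ K v -> Q v = 0) (cP : continuous P) (cQ : continuous Q).
Let Om : set (R * R) := [set v | I v.1 /\ 0 < s * (v.2 - ga v.1)].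
Hypotheses (dP : forall v, Om v -> is_dx v P (Px v))
  (dQ : forall v, Om v -> is_dz v Q (Qz v))
  (cPx : cont_on Om Px)
  (cQz : cont_on Om Qz).

Let ss : s * s = 1. Proof. by case: s1 => ->; rewrite ?mulr1// mulrN1 opprK. Qed.
Let ns : `|s| = 1. Proof. by case: s1 => ->; rewrite ?normrN normr1. Qed.
Let cga x : I x -> {for x, continuous ga}.
Proof.
by move=> Ix; exact: is_derive_continuous (dga_ga Ix).
Qed.
Let clK : open (~` K).
Proof. by rewrite openC; apply: compact_closed => //; exact: norm_hausdorff. Qed.
Let h v := s * (v.2 - ga v.1).

Let ch (v : R * R) : I v.1 -> {for v, continuous h}.
Proof.
move=> Iv; apply: continuousM; first exact: cst_continuous.
by apply: continuousB; [exact: cvg_snd|apply: continuous_fst_comp; exact: cga].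
Qed.
Let nI (v : R * R) : I v.1 -> \forall w \near v, I w.1.
Proof. exact: near_fst. Qed.

Lemma collar_open : open Om.
Proof.
rewrite openE => v [Iv hv]; apply: filterI; first exact: nI.
by have /cvgr_gt := ch Iv; apply.
Qed.

(** [(- dga, 1)] is normal to the graph of [ga] and to its vertical translates, so this is the
    density in [x] of the flux of [(P, Q)] through them. The value 0 outside [I] keeps it continuous
    on the whole plane, as [P] and [Q] vanish off [K]. *)
Definition flux v := if `[< I v.1 >] then Q v - dga v.1 * P v else 0.

Lemma flux_continuous : continuous flux.
Proof.
move=> v; have [Kv|nK] := pselect (K v).
  have Iv := KI Kv.
  apply: (@continuous_near_eq _ _ _ _ (fun w => Q w - dga w.1 * P w)).
    by apply: filterS (nI Iv) => w Iw; rewrite /flux asboolT.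
  apply: continuousB; first exact: cQ.
  by apply: continuousM; [apply: continuous_fst_comp; exact: cdga|exact: cP].
apply: (@continuous_near_eq _ _ _ _ (fun=> 0)); last exact: cst_continuous.
apply: open_near clK nK _ => w nKw.
by rewrite /flux P0// Q0// mulr0 subr0; case: ifP.
Qed.

Lemma flux0 v : ~ K v -> flux v = 0.
Proof. by move=> nK; rewrite /flux P0// Q0// mulr0 subr0; case: ifP. Qed.

Section cutoff.
Variables (e : R) (e0 : 0 < e).
(** The cutoff [step (a v)] is 0 for [h v <= e] and 1 for [h v >= 2 * e]; its z-derivative is
    [s * rho]. *)
Let a v := h v / e - 1.
Let rho v := e^-1 * dstep (a v).

Let ca (v : R * R) : I v.1 -> {for v, continuous a}.
Proof.
move=> Iv; by cont.
Qed.
Let Z : set (R * R) := [set v | I v.1 /\ h v < e].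

Let nZ v : Z v -> \forall w \near v, Z w.
Proof.
move=> [Iv hv]; apply: filterI; first exact: nI.
by have /cvgr_lt := ch Iv; apply.
Qed.
Let aZ v : Z v -> step (a v) = 0 /\ dstep (a v) = 0.
Proof.
move=> [_ hv]; have aN : a v < 0 by rewrite /a subr_lt0 ltr_pdivrMr// mul1r.
by split; [rewrite step0// ltW|apply: dstep0; left].
Qed.
(** All three sets are open. On the complement of [K] and on [Z] the products with the cutoff vanish
    identically, so that their continuity and their derivatives only have to be checked on [Om]. *)
Let cover v : [\/ Om v, (~` K) v | Z v].
Proof.
have [Kv|] := pselect (K v); last by constructor 2.
have [hv|hv] := ltrP 0 (h v); first by constructor 1; split=> //; exact: KI.
by constructor 3; split; [exact: KI|exact: le_lt_trans e0].
Qed.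
Let F1 v := if `[< Om v >] then P v * step (a v) else 0.
Let G1 v := if `[< Om v >] then Q v * step (a v) else 0.
Let F1x v := if `[< Om v >] then Px v * step (a v) + P v * (dstep (a v) * (- s * dga v.1 / e)) else 0.
Let G1z v := if `[< Om v >] then Qz v * step (a v) + Q v * (dstep (a v) * (s / e)) else 0.

Let near0 (E : R * R -> R) : (forall v, Z v -> E v = 0) -> (forall v, ~ K v -> E v = 0) ->
  (cont_on Om E) -> continuous E.
Proof.
move=> E1 E2 E3 v; have [/E3//|nK|Zv] := cover v.
  apply: (@continuous_near_eq _ _ _ _ (fun=> 0)); last exact: cst_continuous.
  by apply: open_near clK nK _ => w /E2.
apply: (@continuous_near_eq _ _ _ _ (fun=> 0)); last exact: cst_continuous.
by apply: filterS (nZ Zv) => w /E1.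
Qed.
Let dnear0 (E Ex : R * R -> R) (d : R * R) : (forall v, Z v -> E v = 0) -> (forall v, ~ K v -> E v = 0) ->
  (forall v, Z v -> Ex v = 0) -> (forall v, ~ K v -> Ex v = 0) ->
  (forall v, Om v -> is_derive v d E (Ex v)) -> forall v, is_derive v d E (Ex v).
Proof.
move=> E1 E2 X1 X2 E3 v; have [/E3//|nK|Zv] := cover v.
  rewrite X2//; exact: is_derive_zero_out clK _ E2 nK.
rewrite X1//; apply: (near_is_derive (fun=> 0)).
by apply: filterS (nZ Zv) => w /E1.
Qed.
Let Px0 v : Om v -> ~ K v -> Px v = 0.
Proof.
move=> Ov nK; have [_ <-] := dP Ov.
by have [] := is_derive_zero_out clK (1, 0) P0 nK.
Qed.
Let Qz0 v : Om v -> ~ K v -> Qz v = 0.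
Proof.
move=> Ov nK; have [_ <-] := dQ Ov.
by have [] := is_derive_zero_out clK (0, 1) Q0 nK.
Qed.
Let OmE v (A B : R) : Om v -> (if `[< Om v >] then A else B) = A.
Proof. by move=> Ov; rewrite asboolT. Qed.
Let nOm v : Om v -> \forall w \near v, Om w.
Proof. by move=> Ov; apply: open_near collar_open Ov _. Qed.
Let ca_step (v : R * R) : I v.1 -> {for v, continuous (fun w => step (a w))}.
Proof.
move=> Iv; apply: (cont_comp a step); first exact: ca.
exact: is_derive_continuous (is_derive_step (a v)).
Qed.

Lemma cutoff_dstep_continuous (v : R * R) : I v.1 -> {for v, continuous (fun w => dstep (a w))}.
Proof. by move=> Iv; apply: (cont_comp a dstep); [exact: ca|exact: dstep_continuous]. Qed.
Let da_dx v : I v.1 -> is_dx v a (- s * dga v.1 / e).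
Proof.
move=> Iv; apply/is_derive_dx; have /is_derive_leP H := dga_ga Iv.
apply/is_derive_leP => d d0; have [q q0 Hq] := H _ (mulr_gt0 d0 e0); exists q => // k /Hq kq.
rewrite /a /h /= (_ : s * _ / e - 1 - _ - _ = - s / e * (ga (v.1 + k) - ga v.1 - dga v.1 * k)); last by ring.
by rewrite !normrM normrN ns mul1r normfV (gtr0_norm e0) mulrC ler_pdivrMr// mulrAC.
Qed.
Let da_dz v : I v.1 -> is_dz v a (s / e).
Proof.
move=> Iv; apply/is_derive_dz.
apply/is_derive_leP => d d0; exists 1 => // k _; rewrite /a /h /=.
by rewrite (_ : s * _ / e - 1 - _ - _ = 0) ?normr0 ?mulr_ge0 ?(ltW d0)//; ring.
Qed.
Let dcomp v d b : is_derive v d a b -> is_derive v d (fun w => step (a w)) (dstep (a v) * b).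
Proof.
move=> da; have := @dif_is_derive R _ (fun p => step p.1) a (fun=> 0) v d (dstep (a v)) 0 b 0.
rewrite mul0r addr0; apply => //.
have /is_derive_leP DF := is_derive_step (a v).
move=> r r0; have [q q0 Hq] := DF r r0; exists q => // k l /Hq kq _ /=.
by rewrite mul0r subr0 (le_trans kq)// ler_wpM2l ?(ltW r0)// lerDl.
Qed.
Let F1xP v : is_dx v F1 (F1x v).
Proof.
apply: dnear0 => {}v.
- by move=> /aZ[a0 _]; rewrite /F1 a0 mulr0; case: ifP.
- by move=> /P0 E; rewrite /F1 E mul0r; case: ifP.
- by move=> /aZ[a0 b0]; rewrite /F1x a0 b0 !mul0r !mulr0 addr0; case: ifP.
- by move=> nK; rewrite /F1x P0//; case: asboolP => // Ov; rewrite Px0// !mul0r addr0.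
move=> Ov; rewrite /F1x OmE//; apply: (near_is_derive (fun w => P w * step (a w))).
  by apply: filterS (nOm Ov) => w Ow; rewrite /F1 OmE.
by apply: (derive_cast (is_deriveM (dP Ov) (dcomp (da_dx (proj1 Ov))))) => //; rewrite /GRing.scale/=; ring.
Qed.
Let G1zP v : is_dz v G1 (G1z v).
Proof.
apply: dnear0 => {}v.
- by move=> /aZ[a0 _]; rewrite /G1 a0 mulr0; case: ifP.
- by move=> /Q0 E; rewrite /G1 E mul0r; case: ifP.
- by move=> /aZ[a0 b0]; rewrite /G1z a0 b0 !mul0r !mulr0 addr0; case: ifP.
- by move=> nK; rewrite /G1z Q0//; case: asboolP => // Ov; rewrite Qz0// !mul0r addr0.
move=> Ov; rewrite /G1z OmE//; apply: (near_is_derive (fun w => Q w * step (a w))).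
  by apply: filterS (nOm Ov) => w Ow; rewrite /G1 OmE.
by apply: (derive_cast (is_deriveM (dQ Ov) (dcomp (da_dz (proj1 Ov))))) => //; rewrite /GRing.scale/=; ring.
Qed.
Let cF1x : continuous F1x.
Proof.
apply: near0 => v.
- by move=> /aZ[a0 b0]; rewrite /F1x a0 b0 !mul0r !mulr0 addr0; case: ifP.
- by move=> nK; rewrite /F1x P0//; case: asboolP => // Ov; rewrite Px0// !mul0r addr0.
move=> Ov; have Iv := proj1 Ov.
apply: (@continuous_near_eq _ _ _ _ (fun w => Px w * step (a w) + P w * (dstep (a w) * (- s * dga w.1 / e)))).
  by apply: filterS (nOm Ov) => w Ow; rewrite /F1x OmE.
apply: continuousD; first by cont.
apply: continuousM; first exact: cP.
apply: continuousM; first exact: cutoff_dstep_continuous.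
apply: continuousM; last exact: cst_continuous.
by apply: continuousM; [exact: cst_continuous|apply: continuous_fst_comp; exact: cdga].
Qed.
Let cG1z : continuous G1z.
Proof.
apply: near0 => v.
- by move=> /aZ[a0 b0]; rewrite /G1z a0 b0 !mul0r !mulr0 addr0; case: ifP.
- by move=> nK; rewrite /G1z Q0//; case: asboolP => // Ov; rewrite Qz0// !mul0r addr0.
move=> Ov; have Iv := proj1 Ov.
apply: (@continuous_near_eq _ _ _ _ (fun w => Qz w * step (a w) + Q w * (dstep (a w) * (s / e)))).
  by apply: filterS (nOm Ov) => w Ow; rewrite /G1z OmE.
apply: continuousD; first by apply: continuousM; [exact: cQz|exact: ca_step].
apply: continuousM; first exact: cQ.
by apply: continuousM; [exact: cutoff_dstep_continuous|exact: cst_continuous].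
Qed.
Let T v := rho v * flux v.

Lemma cutoff_flux_continuous : continuous T.
Proof.
move=> v; have [Kv|nK] := pselect (K v).
  have Iv := KI Kv.
  apply: continuousM; last exact: flux_continuous.
  by apply: continuousM; [exact: cst_continuous|exact: cutoff_dstep_continuous].
apply: (@continuous_near_eq _ _ _ _ (fun=> 0)); last exact: cst_continuous.
by apply: open_near clK nK _ => w nKw; rewrite /T flux0// mulr0.
Qed.
(** Product rule: the derivatives of the cutoff contribute [dstep (a v) * s / e] times
    [Q - dga * P], which is [s * T]. Off [Om] all terms vanish. *)
Let cutoffE v : ((fun v => step (a v) * (Px v + Qz v)) \_ Om) v = (F1x v + G1z v) + - s * T v.
Proof.
rewrite patchE /F1x /G1z /T /flux.
have [Ov|nOv] := pselect (Om v).
  rewrite mem_set// asboolT// asboolT; last by case: Ov.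
  by rewrite /rho; ring.
rewrite memNset// asboolF// addr0 add0r.
case: asboolP => Iv; last by rewrite !mulr0.
rewrite /rho dstep0 ?mulr0 ?mul0r ?mulr0//; left.
have hv : h v <= 0 by rewrite leNgt; apply/negP => hv; exact: nOv.
rewrite /a subr_lt0 ltr_pdivrMr// mul1r; exact: le_lt_trans e0.
Qed.
Let cutoff_terms r : K `<=` Box r -> [/\ csupp r F1, csupp r G1,
  integrable2 setT F1x, integrable2 setT G1z &
  integrable2 setT T].
Proof.
move=> Kr.
have sK E : (forall v, ~ K v -> E v = 0) -> csupp r E by move=> E0 v nB; apply: E0 => /Kr.
have sF : csupp r F1 by apply: sK => v /P0 E; rewrite /F1 E mul0r; case: ifP.
have sG : csupp r G1 by apply: sK => v /Q0 E; rewrite /G1 E mul0r; case: ifP.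
have sT : csupp r T by apply: sK => v /flux0 E; rewrite /T E mulr0.
split => //.
- exact: csupp_integrable cF1x (csupp_dx F1xP sF).
- exact: csupp_integrable cG1z (csupp_dz G1zP sG).
- exact: csupp_integrable cutoff_flux_continuous sT.
Qed.
Let integrable_sT r : K `<=` Box r -> integrable2 setT (fun v => - s * T v).
Proof.
move=> /cutoff_terms[_ _ _ _ iT].
rewrite (_ : _ \o _ = (fun v => (- s)%:E * (T v)%:E)%E)//; exact: integrableZl.
Qed.

Lemma cutoff_integrable r : K `<=` Box r ->
  integrable2 Om (fun v => step (a v) * (Px v + Qz v)).
Proof.
move=> Kr; have [_ _ iF iG _] := cutoff_terms Kr.
have mOm := meas_open2 collar_open.
have -> : Om = [set: R * R] `&` Om by rewrite setTI.
apply/integrable_restrict => //.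
have iS := integrableD measurableT (integrableD measurableT iF iG) (integrable_sT Kr).
apply: (eq_integrable measurableT) iS => v _; rewrite -[RHS]/(((EFin \o (fun v => step (a v) * (Px v + Qz v))) \_ Om) v).
by rewrite restrict_EFin /= cutoffE.
Qed.

Lemma cutoff_divergence r : K `<=` Box r ->
  \int[mu2]_(v in Om) (step (a v) * (Px v + Qz v)) = - s * \int[mu2]_v T v.
Proof.
move=> Kr; have [sF sG iF iG iT] := cutoff_terms Kr.
have E1 := int_dx0 F1xP cF1x sF; have E2 := int_dz0 G1zP cG1z sG.
have := RintegralD measurableT iF iG; rewrite E1 E2 addr0 => E3.
rewrite Rintegral_mkcond (_ : \int[mu2]_v _ = \int[mu2]_v ((F1x v + G1z v) + - s * T v)); last first.
  by apply: eq_Rintegral => v _; exact: cutoffE.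
rewrite RintegralD//; last 2 first.
- by have := integrableD measurableT iF iG.
- exact: integrable_sT Kr.
by rewrite E3 add0r RintegralZl.
Qed.

End cutoff.

Let B x := flux (x, ga x).

Let cB : continuous B.
Proof.
move=> x; have [[v Kv vx]|nK] := pselect ([set v.1 | v in K] x).
  have Ix : I x by rewrite -vx; exact: KI.
  apply/continuousR_leP => e e0.
  have /continuous2_leP/(_ _ e0)[d d0 Hd] := @flux_continuous (x, ga x).
  have /continuousR_leP/(_ _ d0)[d' d'0 Hd'] := cga Ix.
  exists (Num.min d d'); first by rewrite lt_min d0.
  move=> k; rewrite le_min => /andP[kd /Hd' kd'].
  by have := Hd k (ga (x + k) - ga x) kd kd'; rewrite /= addrCA subrr addr0.
apply: (@continuous_near_eq _ _ _ _ (fun=> 0)); last exact: cst_continuous.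
have clK1 : open (~` [set v.1 | v in K]).
  rewrite openC; apply: compact_closed; first exact: norm_hausdorff.
  by apply: continuous_compact => //; apply: continuous_subspaceT => v; exact: cvg_fst.
by apply: open_near clK1 nK _ => y nKy; apply: flux0 => Ky; apply: nKy; exists (y, ga y).
Qed.
Let rho e v := e^-1 * dstep (h v / e - 1).

(** On a vertical line [rho] has integral 1 and lives within [3 * e] of the curve, so the integral
    is a weighted average of the flux near the curve. As [|rho| <= C / e] on an interval of length
    [6 * e], an oscillation [eta] of the flux costs at most [6 * (C * eta)]. *)
Let J_B (C eta e x : R) : 0 < e -> (forall x, `|dstep x| <= C) -> I x ->
  (forall k, `|k| <= 3 * e -> `|flux (x, ga x + k) - B x| <= eta) ->
  `|\int[mu]_z (rho e (x, z) * flux (x, z)) - B x| <= 6 * (C * eta).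
Proof.
move=> e0 HC Ix Heta; set a := ga x - 3 * e; set b := ga x + 3 * e.
have ab : a < b by rewrite /a /b; lra.
have e30 : 0 < 3 * e by lra.
have crho v : v.1 = x -> {for v, continuous (rho e)}.
  by move=> vx; apply: continuousM; [exact: cst_continuous|apply: cutoff_dstep_continuous; rewrite vx].
have crho1 : continuous (fun z => rho e (x, z)).
  by move=> z; apply: continuous_fix1_at; exact: crho.
have crB : continuous (fun z => rho e (x, z) * B x).
  by move=> z; apply: (@continuous_fix1_at (fun v => rho e v * B x));
    apply: continuousM; [exact: crho|exact: cst_continuous].
have crf : continuous (fun z => rho e (x, z) * flux (x, z)).
  exact: continuous2_fix1 (@cutoff_flux_continuous e).
have crfB : continuous (fun z => rho e (x, z) * (flux (x, z) - B x)).
  move=> z; apply: (@continuous_fix1_at (fun v => rho e v * (flux v - B x))).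
  apply: continuousM; first exact: crho.
  by apply: continuousB; [exact: flux_continuous|exact: cst_continuous].
have rho0 z : ~~ (a <= z <= b) -> rho e (x, z) = 0.
  move=> nz; rewrite /rho dstep0 ?mulr0//.
  rewrite subr_lt0 ltr_pdivrMr// mul1r ltrBrDl ltr_pdivlMr//.
  move: nz; rewrite negb_and -!ltNge /h /= /a /b.
  by case: s1 => ->; rewrite ?mul1r ?mulN1r => /orP[nz|nz]; [left|right|right|left]; lra.
rewrite (@Rint_itv_setT a b); last by move=> z /rho0 ->; rewrite mul0r.
have dF z : is_derive1 z (fun z => s * step (h (x, z) / e - 1)) (rho e (x, z)).
  have D : is_derive1 z (fun z => h (x, z) / e - 1) (s / e).
    apply/is_derive_leP => d d0; exists 1 => // k _; rewrite /h /=.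
    by rewrite (_ : s * _ / e - 1 - _ - _ = 0) ?normr0 ?mulr_ge0 ?(ltW d0)//; ring.
  apply: (derive_cast (is_deriveM (is_derive_cst s z 1) (@is_derive1_comp R step _ z _ _ (is_derive_step _) D))) => //.
  rewrite scaler0 addr0 /cst /rho /GRing.scale/=.
  rewrite (_ : s * (dstep _ * (s / e)) = s * s * (e^-1 * dstep (h (x, z) / e - 1))); last by ring.
  by rewrite ss mul1r.
have int1 : \int[mu]_(z in `[a, b]) rho e (x, z) = 1.
  rewrite /Rintegral (FTC_is_derive ab (fun z _ => dF z) (fun z _ => crho1 z)) /=.
  rewrite /h /a /b /=; case: s1 => ->; rewrite ?mul1r ?mulN1r.
    rewrite (_ : (ga x + _ - ga x) / e - 1 = 2); last by field; rewrite gt_eqF.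
    rewrite (_ : (ga x - _ - ga x) / e - 1 = -4); last by field; rewrite gt_eqF.
    by rewrite step1 ?step0 ?subr0 ?ler1n// oppr_le0.
  rewrite (_ : - (ga x + _ - ga x) / e - 1 = -4); last by field; rewrite gt_eqF.
  rewrite (_ : - (ga x - _ - ga x) / e - 1 = 2); last by field; rewrite gt_eqF.
  by rewrite step0 ?oppr_le0// step1 ?ler1n// oppr0 sub0r opprK.
have mI := mitv a b.
have -> : \int[mu]_(z in `[a, b]) (rho e (x, z) * flux (x, z)) - B x =
    \int[mu]_(z in `[a, b]) (rho e (x, z) * (flux (x, z) - B x)).
  rewrite -[X in _ - X]mul1r -int1 -RintegralZr//; last exact: @cont_itv_integrable a b _ crho1.
  rewrite -RintegralB//; last 2 first.
  - exact: @cont_itv_integrable a b _ crf.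
  - exact: @cont_itv_integrable a b _ crB.
  by apply: eq_Rintegral => z _; rewrite mulrBr.
apply: (@le_trans _ _ (C * eta / e * (b - a))).
  apply: Rint_itv_le => //; first exact: ltW.
  move=> z /andP[az zb]; rewrite /rho !normrM normfV (gtr0_norm e0) [e^-1 * _]mulrC mulrAC.
  rewrite ler_pM2r ?invr_gt0//; apply: ler_pM => //.
  have := Heta (z - ga x); rewrite (_ : ga x + (z - ga x) = z); last by rewrite addrC subrK.
  apply.
  by rewrite ler_norml; move: az zb; rewrite /a /b => az zb; apply/andP; split; lra.
by rewrite /a /b; apply: eq_ler; field; rewrite gt_eqF.
Qed.
Let e_ n : R := n.+1%:R^-1.

Let e_0 n : 0 < e_ n. Proof. by rewrite invr_gt0. Qed.

Lemma cutoff_limit :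
  \int[mu2]_(v in Om) (step (s * (v.2 - ga v.1) / n.+1%:R^-1 - 1) * (Px v + Qz v)) @[n --> \oo] -->
  - s * \int[mu]_(x in I) (Q (x, ga x) - dga x * P (x, ga x)).
Proof.
have [r r0 Kr] := bounded_Box (compact_bounded cK).
have [C C0 HC] := @dstep_bound R.
have B0 x : r < `|x| -> B x = 0.
  by move=> rx; apply: flux0 => /Kr[/=]; rewrite leNgt rx.
have -> : \int[mu]_(x in I) (Q (x, ga x) - dga x * P (x, ga x)) = \int[mu]_x B x.
  rewrite Rintegral_mkcond; apply: eq_Rintegral => x _; rewrite patchE /B /flux/=.
  by have [Ix|nIx] := pselect (I x); [rewrite mem_set// asboolT|rewrite memNset// asboolF].
under eq_fun => n do rewrite (cutoff_divergence (e_0 n) Kr).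
apply: cvgM; first exact: cvg_cst.
apply/cvgrPdist_le => eps eps0.
(* The slice error [6 * (C * eta)] is integrated over [[-r, r]], which gives
   [12 * C * r * eta <= eps]. *)
pose eta := eps / (12 * C * r + 1).
have D0 : 0 < 12 * C * r + 1 by rewrite ltr_wpDl// !mulr_ge0// ltW.
have eta0 : 0 < eta by exact: divr_gt0.
(* The margin 1 settles pairs of points with one of them outside this box: at distance at most 1,
   both are then outside [K] and the flux vanishes at both. *)
have [d d0 Hd] := @compact_unif (Box (r + 1)) flux (@Box_compact _ _) (fun v _ => @flux_continuous v) _ eta0.
have [d' d'0 Hd'] : exists2 d', 0 < d' & forall e, 0 < e -> e < d' -> forall x,
    `|\int[mu]_z (rho e (x, z) * flux (x, z)) - B x| <= 6 * (C * eta).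
  have [d2 d20 Hd2] : exists2 d2 : R, 0 < d2 & forall v w, v.1 = w.1 -> `|v.2 - w.2| <= d2 -> `|flux v - flux w| <= eta.
    exists (Num.min d 1); first by rewrite lt_min d0 ltr01.
    move=> [x z] [x' z'] /= -> {x}; rewrite le_min => /andP[zd z1].
    have [Bw|nBw] := pselect (Box (r + 1) (x', z')).
      have := Hd _ 0 (z - z') Bw; rewrite normr0 addr0 /= (_ : z' + (z - z') = z); last by rewrite addrC subrK.
      by apply => //; exact: ltW.
    rewrite !flux0 ?subrr ?normr0 ?(ltW eta0)// => /Kr[/= K1 K2]; apply: nBw; split=> /=; try lra.
    rewrite -(subrK z z') (le_trans (ler_normD _ _))// [r + 1]addrC lerD// distrC//.
  exists (d2 / 3); first by rewrite divr_gt0.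
  move=> e e0 ed x; have [Ix|nIx] := pselect (I x).
    apply: J_B => // k kd; apply: Hd2 => //=; rewrite addrAC subrr add0r (le_trans kd)//.
    by lra.
  have f0 z : flux (x, z) = 0 by rewrite /flux asboolF.
  have -> : \int[mu]_z (rho e (x, z) * flux (x, z)) = 0.
    by rewrite -[RHS](Rint0 mu setT); apply: eq_Rintegral => z _; rewrite f0 mulr0.
  have -> : B x = 0 by exact: f0.
  by rewrite subr0 normr0 mulr_ge0// mulr_ge0// ltW.
have := near_infty_natSinv_lt (PosNum d'0); apply: filterS => n /= nd.
have sT : csupp r (fun v => rho (e_ n) v * flux v).
  by move=> v nB; rewrite flux0 ?mulr0// => /Kr.
have [iJ ->] := Rfubini (@cutoff_flux_continuous (e_ n)) sT.
have iB : mu.-integrable setT (EFin \o B) by exact: csupp1_integrable cB B0.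
rewrite -RintegralB//.
have iD : mu.-integrable setT (EFin \o (fun x => B x - \int[mu]_z (rho (e_ n) (x, z) * flux (x, z)))).
  by have := integrableB measurableT iB iJ.
apply: (le_trans (le_normr_Rintegral measurableT iD)).
have D0' x : r < `|x| -> B x - \int[mu]_z (rho (e_ n) (x, z) * flux (x, z)) = 0.
  move=> rx; rewrite B0//; apply/eqP; rewrite sub0r oppr_eq0; apply/eqP.
  rewrite -[RHS](Rint0 mu setT); apply: eq_Rintegral => z _.
  by rewrite flux0 ?mulr0// => /Kr[/=]; rewrite leNgt rx.
rewrite (@Rint_itv_setT (- r) r); last first.
  by move=> x; rewrite -ler_norml -ltNge => /D0' ->; rewrite normr0.
apply: (@le_trans _ _ (\int[mu]_(x in `[- r, r]) (6 * (C * eta)))).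
  apply: le_Rintegral; first exact: mitv.
  - by apply: (integrableS measurableT (mitv (- r) r) (@subsetT _ _)); have := integrable_abse iD.
  - exact: cst_itv_integrable.
  - by move=> x _ ; rewrite distrC; apply: Hd'.
rewrite Rintegral_cst; last exact: mitv.
rewrite /= lebesgue_measure_itv/= lte_fin gtrN// -EFinD /= opprK.
rewrite /eta; apply: (@le_trans _ _ (12 * C * r / (12 * C * r + 1) * eps)).
  by apply: eq_ler; field; rewrite gt_eqF.
by rewrite ler_piMl ?(ltW eps0)// ler_pdivrMr// mul1r lerDl.
Qed.

(** The derivatives of [P] and [Q] exist on one side only and may be unbounded at the curve; what is
    asked is that the divergence be integrable. Since the cutoff takes values in [[0, 1]],
    [|Px + Qz|] dominates the cut-off integrands, whose integrals converge to the flux. *)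
Theorem collar_divergence : integrable2 Om (fun v => Px v + Qz v) ->
  \int[mu2]_(v in Om) (Px v + Qz v) =
  - s * \int[mu]_(x in I) (Q (x, ga x) - dga x * P (x, ga x)).
Proof.
move=> id; have mOm := meas_open2 collar_open.
have mfo (f : R * R -> R) : (cont_on Om f) ->
    measurable_fun (mset Om) f.
  by move=> cf; apply: cont2_measurable => //; exact: collar_open.
have cde v : Om v -> {for v, continuous (fun v => Px v + Qz v)}.
  by move=> Ov; apply: continuousD; [exact: cPx|exact: cQz].
have [] := @Rdct _ (mvplane R) mu2 Om (fun n v => step (h v / e_ n - 1) * (Px v + Qz v))
   (fun v => Px v + Qz v) (fun v => `|Px v + Qz v|) mOm.
- move=> n; apply: mfo => v Ov; apply: continuousM; last exact: cde.
  apply: (cont_comp (fun v => h v / e_ n - 1) step).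
    apply: continuousB; last exact: cst_continuous.
    by apply: continuousM; [exact: ch (proj1 Ov)|exact: cst_continuous].
  exact: is_derive_continuous (is_derive_step (h v / e_ n - 1)).
- exact: mfo.
- move=> v [Iv hv]; rewrite -[X in _ --> X]mul1r; apply: cvgM; last exact: cvg_cst.
  apply: cvg_near_cst.
  have h20 : 0 < h v / 2 by rewrite divr_gt0.
  have := near_infty_natSinv_lt (PosNum h20); apply: filterS => n /= nh.
  apply: step1; rewrite lerBrDr ler_pdivlMr//; move: nh; rewrite -/(e_ n); lra.
- by move: id => /integrable_abse.
- move=> n v _; rewrite normrM ler_piMl//.
  by rewrite ger0_norm ?step_ge0// step_le1.
move=> _ cvA.
exact: cvg_unique _ cvA cutoff_limit.
Qed.

End shrinking_collar.
End divergence.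

(** * Partitions of unity and approximation by test functions *)

Section partition.
Context {R : realType}.
Implicit Types (x y : R).

(** A bump supported in [[-1, 1]]. Its integer translates telescope, so [2 * M + 1] of them add up
    to 1 on [[-M, M]] and to at most 1 everywhere. *)
Definition pu x : R := step (x + 1) - step x.

Lemma pu_smooth n : Cn_on n setT pu.
Proof.
apply: (Cn_sub_fun openT); last exact: step_smooth.
apply: (@Cn_comp1 _ _ _ _ setT step) => //; try exact: openT.
  exact: step_smooth.
by apply: (Cn_add openT); [exact: Cn_id openT|exact: Cn_cst openT].
Qed.

Lemma pu_ge0 x : 0 <= pu x.
Proof.
rewrite /pu; have [x0|x0] := lerP x 0; first by rewrite (step0 x0) subr0 step_ge0.
have x1 : 1 <= x + 1 by rewrite lerDr ltW.
by rewrite (step1 x1) subr_ge0 step_le1.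
Qed.

Lemma pu0 x : 1 < `|x| -> pu x = 0.
Proof.
rewrite /pu ltr_normr => /orP[x1|x1].
  by rewrite !step1 ?subrr// ?ltW// ltr_wpDr.
by rewrite !step0 ?subrr//; lra.
Qed.

Lemma pu_sum (M : nat) y :
  \sum_(i < (M + M).+1) pu (y - (i%:R - M%:R)) = step (y + M%:R + 1) - step (y - M%:R).
Proof.
have H K : \sum_(i < K) pu (y - (i%:R - M%:R)) = step (y + M%:R + 1) - step (y + M%:R + 1 - K%:R).
  elim: K => [|K IH]; first by rewrite big_ord0 subr0 subrr.
  rewrite big_ord_recr /= IH /pu -[K.+1]addn1 natrD.
  rewrite (_ : y - (K%:R - M%:R) + 1 = y + M%:R + 1 - K%:R); last by ring.
  rewrite (_ : y - (K%:R - M%:R) = y + M%:R + 1 - (K%:R + 1)); last by ring.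
  by rewrite addrA subrK.
by rewrite H -addn1 !natrD; congr (_ - step _); ring.
Qed.

Lemma pu_sum_le1 (M : nat) y : \sum_(i < (M + M).+1) pu (y - (i%:R - M%:R)) <= 1.
Proof. by rewrite pu_sum lerBlDr (le_trans (step_le1 _))// lerDl step_ge0. Qed.

Lemma pu_sum1 (M : nat) y : `|y| <= M%:R -> \sum_(i < (M + M).+1) pu (y - (i%:R - M%:R)) = 1.
Proof.
rewrite ler_norml pu_sum => /andP[y1 y2].
by rewrite step1 ?step0 ?subr0//; lra.
Qed.

End partition.

Section approximation.
Context {R : realType}.
Implicit Types (h psi : R * R -> R) (Om : set (R * R)).

Lemma test_function_of (Om K : set (R * R)) psi : smooth_on setT psi -> compact K -> K `<=` Om ->
  (forall v, ~ K v -> psi v = 0) -> test_function Om psi.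
Proof.
move=> sp cK KO p0.
have sub : closure [set v | psi v != 0] `<=` K.
  have clK : closed K by apply: compact_closed => //; exact: norm_hausdorff.
  rewrite [X in _ `<=` X]((closure_id K).1 clK); apply: closure_subset => w /= pw.
  by apply: contrapT => /p0 E; rewrite E eqxx in pw.
split=> //; last exact: subset_trans sub KO.
by apply: subclosed_compact sub => //; exact: closed_closure.
Qed.

Lemma test_function0 Om psi v : test_function Om psi -> ~ closure [set v | psi v != 0] v -> psi v = 0.
Proof.
by move=> _ nv; apply/eqP; apply: contrapT => /negP pv; apply: nv; exact: subset_closure.
Qed.

Section grid.
Variables (Om : set (R * R)) (h : R * R -> R) (B : R).
Hypotheses (oOm : open Om) (ch : cont_on Om h)
  (hB : forall v, Om v -> `|h v| <= B) (B0 : 0 <= B).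

Let N (n : nat) : R := n.+1%:R.
Let M (n : nat) : nat := (n.+1 * n.+1)%N.
Let node n (i : nat) : R := (i%:R - (M n)%:R) / N n.
Let cell n i j : set (R * R) :=
  `[(node n i - (N n)^-1), (node n i + (N n)^-1)]%classic `*`
  `[(node n j - (N n)^-1), (node n j + (N n)^-1)]%classic.
Let w n (i : nat) (x : R) : R := pu (N n * x - (i%:R - (M n)%:R)).
Let a n i j : R := if `[< cell n i j `<=` Om >] then h (node n i, node n j) else 0.
(** A discrete mollification: values of [h] at nodes of mesh [1 / (n + 1)], weighted by a partition
    of unity. The nodes fill [[-(n + 1), n + 1]] in each coordinate, whence [M n = (n + 1) ^ 2].
    Nodes whose cell is not contained in [Om] get the value 0, which keeps the support in finitely
    many closed cells of [Om] and preserves bounds of [h]. *)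
Definition grid n (v : R * R) : R :=
  \sum_(i < (M n + M n).+1) \sum_(j < (M n + M n).+1) a n i j * (w n i v.1 * w n j v.2).

Let N0 n : 0 < N n. Proof. by rewrite /N. Qed.
Let w_cell n i x : w n i x != 0 -> `|x - node n i| <= (N n)^-1.
Proof.
move=> wx; have : `|N n * x - (i%:R - (M n)%:R)| <= 1.
  by rewrite leNgt; apply/negP => /pu0 E; rewrite /w E eqxx in wx.
rewrite (_ : N n * x - _ = N n * (x - node n i)); last first.
  by rewrite /node; field; rewrite gt_eqF.
by rewrite normrM gtr0_norm// mulrC -ler_pdivlMr// mul1r.
Qed.
Let cellP n i j x z : `|x - node n i| <= (N n)^-1 -> `|z - node n j| <= (N n)^-1 -> cell n i j (x, z).
Proof.
rewrite /cell; move: (node n i) (node n j) (N n)^-1 => p q c.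
rewrite !ler_norml => /andP[x1 x2] /andP[z1 z2].
by split; rewrite /= in_itv/=; apply/andP; split; lra.
Qed.
Let a_bound n i j : `|a n i j| <= B.
Proof.
rewrite /a; case: asboolP => [cO|_]; last by rewrite normr0.
apply: hB; apply: cO; apply: cellP; rewrite subrr normr0 invr_ge0; exact: ltW.
Qed.
Let w_ge0 n i x : 0 <= w n i x. Proof. exact: pu_ge0. Qed.
Let sumw n x : \sum_(i < (M n + M n).+1) w n i x <= 1.
Proof. exact: pu_sum_le1. Qed.

Lemma grid_bound n v : `|grid n v| <= B.
Proof.
apply: (@le_trans _ _ (\sum_(i < (M n + M n).+1) \sum_(j < (M n + M n).+1) B * (w n i v.1 * w n j v.2))).
  apply: (le_trans (ler_norm_sum _ _ _)); apply: ler_sum => i _.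
  apply: (le_trans (ler_norm_sum _ _ _)); apply: ler_sum => j _.
  by rewrite normrM [X in _ * X]ger0_norm ?mulr_ge0// ler_wpM2r// mulr_ge0.
under eq_bigr => i _ do rewrite -mulr_sumr -mulr_sumr mulrA.
rewrite -mulr_suml -mulr_sumr -mulrA ler_piMr// -[leRHS]mulr1.
by apply: ler_pM => //; apply: sumr_ge0.
Qed.

Lemma grid_test n : test_function Om (grid n).
Proof.
pose c (p : 'I_(M n + M n).+1 * 'I_(M n + M n).+1) : set (R * R) :=
  if `[< cell n p.1 p.2 `<=` Om >] then cell n p.1 p.2 else set0.
pose K := \bigcup_(p in [set` enum {: 'I_(M n + M n).+1 * 'I_(M n + M n).+1}]) c p.
apply: (@test_function_of _ K).
- move=> k; apply: (Cn_sum _ openT) => i _; apply: (Cn_sum _ openT) => j _.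
  apply: (Cn_mul openT); first exact: Cn_cst openT.
  have W (q : nat) (u : R * R -> R) : Cn_on k setT u -> Cn_on k setT (fun v => w n q (u v)).
    move=> Cu; apply: (@Cn_comp1 _ _ _ _ setT pu) => //; try exact: openT.
      exact: pu_smooth.
    apply: (Cn_sub_fun openT); last exact: Cn_cst openT.
    by apply: (Cn_mul openT) => //; exact: Cn_cst openT.
  by apply: (Cn_mul openT); apply: W; [exact: Cn_fst openT|exact: Cn_snd openT].
- rewrite /K bigcup_seq.
  elim/big_ind: _ => [|A A' cA cA'|p _]; first exact: compact0.
    exact: compactU.
  rewrite /c; case: asboolP => _; last exact: compact0.
  by apply: compact_setX; exact: segment_compact.
- by move=> v [p _]; rewrite /c; case: asboolP => // pO; exact: pO.
- move=> v nK; rewrite /grid big1// => i _; rewrite big1// => j _.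
  rewrite /a; case: asboolP => [cO|_]; last by rewrite mul0r.
  apply/eqP; rewrite !mulf_eq0; apply/orP; right; apply/norP => -[wi wj].
  apply: nK; exists (i, j); first by rewrite /= mem_enum.
  rewrite /c asboolT//; case: v wi wj => x z /= wi wj.
  by apply: cellP; exact: w_cell.
Qed.

(** Once the weights at [v] add up to 1, [h v - grid n v] is an average of the differences between
    [h v] and [h] at nodes near [v], whose cells all lie in [Om]. *)
Lemma grid_cvg v : Om v -> grid n v @[n --> \oo] --> h v.
Proof.
move=> Ov; apply/cvgrPdist_le => e e0.
have /nbhs2_leP[d1 d10 H1] : nbhs v Om by exact: open_nbhs_nbhs.
have /continuous2_leP/(_ _ e0)[d2 d20 H2] := ch Ov.
pose d := Num.min d1 d2; have d0 : 0 < d by rewrite /d lt_min d10.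
have d20' : 0 < d / 2 by rewrite divr_gt0.
have := near_infty_natSinv_lt (PosNum d20').
have [m0 _ Hm0] : \forall n \near \oo, `|v.1| + `|v.2| <= n%:R by exact: nbhs_infty_ger.
move=> A; near=> n.
have Nd : (N n)^-1 < d / 2 by near: n.
have Nm : `|v.1| + `|v.2| <= N n.
  by apply: (@le_trans _ _ n%:R); [apply: Hm0; near: n; exact: nbhs_infty_ge|rewrite ler_nat].
have NMx x : `|x| <= N n -> `|N n * x| <= (M n)%:R.
  by move=> xN; rewrite /M natrM normrM gtr0_norm// ler_wpM2l// ltW.
have S1 : \sum_(i < (M n + M n).+1) w n i v.1 = 1.
  by apply: pu_sum1; apply: NMx; apply: le_trans Nm; rewrite lerDl.
have S2 : \sum_(i < (M n + M n).+1) w n i v.2 = 1.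
  by apply: pu_sum1; apply: NMx; apply: le_trans Nm; rewrite lerDr.
have E c : c = \sum_(i < (M n + M n).+1) \sum_(j < (M n + M n).+1) c * (w n i v.1 * w n j v.2).
  under eq_bigr => i _ do rewrite -mulr_sumr -mulr_sumr S2 mulr1.
  by rewrite -mulr_sumr S1 mulr1.
rewrite [X in X - _](E (h v)) [leRHS](E e) /grid -sumrB.
apply: (le_trans (ler_norm_sum _ _ _)); apply: ler_sum => i _.
rewrite -sumrB; apply: (le_trans (ler_norm_sum _ _ _)); apply: ler_sum => j _.
rewrite -mulrBl normrM [X in _ * X]ger0_norm ?mulr_ge0//.
have [->|wi] := eqVneq (w n i v.1) 0; first by rewrite mul0r !mulr0.
have [->|wj] := eqVneq (w n j v.2) 0; first by rewrite mulr0 !mulr0.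
rewrite ler_wpM2r ?mulr_ge0//.
have ci := w_cell wi; have cj := w_cell wj.
have dd1 : d <= d1 by rewrite /d ge_min lexx.
have dd2 : d <= d2 by rewrite /d ge_min lexx orbT.
have tr (x y : R) : x + (y - x) = y by rewrite addrC subrK.
rewrite /a asboolT; last first.
  move=> [x z] [/=]; rewrite !in_itv/= => /andP[x1 x2] /andP[z1 z2].
  have := H1 (x - v.1) (z - v.2); rewrite !tr.
  move: ci cj x1 x2 z1 z2 Nd dd1; rewrite !ler_norml; clearbody d.
  move: (N n)^-1 (node n i) (node n j) => c p q /andP[? ?] /andP[? ?] *.
  have : - d1 <= x - v.1 <= d1 by apply/andP; split; lra.
  have : - d1 <= z - v.2 <= d1 by apply/andP; split; lra.
  by auto.
rewrite distrC; have := H2 (node n i - v.1) (node n j - v.2); rewrite !tr.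
have c1 : `|node n i - v.1| <= (N n)^-1 by rewrite distrC.
have c2 : `|node n j - v.2| <= (N n)^-1 by rewrite distrC.
move: c1 c2 Nd dd2; clearbody d.
move: (N n)^-1 (node n i) (node n j) => c p q c1 c2 Nd dd2.
have : `|p - v.1| <= d2 by lra.
have : `|q - v.2| <= d2 by lra.
by auto.
Unshelve. all: by end_near. Qed.

End grid.
End approximation.

(** * The distributional intrinsic gradient and the energy *)

Section distributional.
Context {R : realType}.
Implicit Types (U K : set (R * R)) (psi : R * R -> R).

Lemma Rint_eq0 d (T : measurableType d) (m : measure T R) (D : set T) (X : T -> R) :
  (forall x, D x -> X x = 0) -> \int[m]_(x in D) X x = 0.
Proof. by move=> X0; rewrite -[RHS](Rint0 m D); apply: eq_Rintegral => x; rewrite inE => /X0. Qed.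

Lemma Rint_ae_set (A B N : set (R * R)) (X : R * R -> R) :
  measurable (mset A) -> measurable (mset B) ->
  measurable (mset N) -> mu2 N = 0%E ->
  integrable2 A X -> integrable2 B X ->
  (forall v, ~ N v -> A v -> ~ B v -> X v = 0) ->
  (forall v, ~ N v -> B v -> ~ A v -> X v = 0) ->
  \int[mu2]_(v in A) X v = \int[mu2]_(v in B) X v.
Proof.
move=> mA mB mN N0 iA iB XA XB; rewrite /Rintegral; congr fine.
rewrite [LHS]integral_mkcond [RHS]integral_mkcond.
apply: ae_eq_integral => //.
- by have /integrable_mkcond/measurable_int := iA; apply.
- by have /integrable_mkcond/measurable_int := iB; apply.
exists N; split=> // v /= nE; apply: contrapT => nN; apply: nE => _.
rewrite !patchE; have [Av|nAv] := pselect (A v); have [Bv|nBv] := pselect (B v).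
- by rewrite !mem_set.
- by rewrite (mem_set Av) (memNset nBv) /= XA.
- by rewrite (memNset nAv) (mem_set Bv) /= XB.
- by rewrite (memNset nAv) (memNset nBv).
Qed.

Lemma integrable_disjU (A B : set (R * R)) (X : R * R -> R) :
  measurable (mset A) -> measurable (mset B) -> (forall v, A v -> ~ B v) ->
  integrable2 A X -> integrable2 B X ->
  integrable2 (A `|` B) X.
Proof.
move=> mA mB AB iA iB; have mAB : measurable (mset (A `|` B)) by exact: measurableU.
apply/(integrable_mkcond _ mAB).
have := integrableD measurableT ((integrable_mkcond _ mA).1 iA) ((integrable_mkcond _ mB).1 iB).
apply: eq_integrable => // v _; rewrite !patchE.
have [Av|nAv] := pselect (A v); have [Bv|nBv] := pselect (B v).
- by exfalso; apply: AB Bv.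
- by rewrite (mem_set Av) (memNset nBv) mem_set ?adde0//; left.
- by rewrite (memNset nAv) (mem_set Bv) mem_set ?add0e//; right.
- by rewrite (memNset nAv) (memNset nBv) memNset ?adde0// => -[].
Qed.

Section test_functions.
Variables (Om : set (R * R)) (psi : R * R -> R).
Hypothesis tpsi : test_function Om psi.
Let K := closure [set v | psi v != 0].

Lemma test_compact : compact K. Proof. by case: tpsi. Qed.

Lemma test_sub : K `<=` Om. Proof. by case: tpsi. Qed.

Lemma test_smooth : smooth_on setT psi. Proof. by case: tpsi. Qed.

Lemma test_openC : open (~` K).
Proof. by rewrite openC; exact: closed_closure. Qed.

Lemma test_zero v : ~ K v -> psi v = 0.
Proof. by move=> nv; apply/eqP; apply: contrapT => /negP pv; apply: nv; exact: subset_closure. Qed.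

Lemma test_dx v : is_dx v psi (d_x psi v).
Proof. by apply: Cn_is_derive (test_smooth 1) _. Qed.

Lemma test_dz v : is_dz v psi (d_z psi v).
Proof. by apply: Cn_is_derive (test_smooth 1) _. Qed.

Lemma test_cont : continuous psi.
Proof. by have [H _] := test_smooth 0; move=> v; exact: H. Qed.

Lemma test_cont_dx : continuous (d_x psi).
Proof. by have [H _] := Cn_D ((1, 0) : R * R) (test_smooth 1); move=> v; exact: H. Qed.

Lemma test_cont_dz : continuous (d_z psi).
Proof. by have [H _] := Cn_D ((0, 1) : R * R) (test_smooth 1); move=> v; exact: H. Qed.

Lemma test_dx_zero v : ~ K v -> d_x psi v = 0.
Proof.
by move=> nK; have [] := is_derive_zero_out test_openC (1, 0) test_zero nK.
Qed.

Lemma test_dz_zero v : ~ K v -> d_z psi v = 0.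
Proof.
by move=> nK; have [] := is_derive_zero_out test_openC (0, 1) test_zero nK.
Qed.

End test_functions.

Lemma test_function_sub (U V : set (R * R)) psi : U `<=` V -> test_function U psi -> test_function V psi.
Proof. by move=> UV [a b c]; split=> //; exact: subset_trans UV. Qed.

Lemma continuous_zero_near (f : R * R -> R) (O : set (R * R)) v : open O -> O v ->
  (forall w, O w -> f w = 0) -> {for v, continuous f}.
Proof.
move=> oO Ov f0; apply: (@continuous_near_eq _ _ _ _ (fun=> 0)); last exact: cst_continuous.
by apply: open_near oO Ov _.
Qed.

Section graph_split.
Variables (U : set (R * R)) (I : set R) (ga dga : R -> R) (h hx hz g : R * R -> R) (B : R).
Hypotheses (oU : open U) (oI : open I) (UI : forall v, U v -> I v.1)
  (dga_ga : forall x, I x -> is_derive1 x ga (dga x))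
  (cdga : cont_on I dga)
  (ch : cont_on U h).
Let Om : set (R * R) := off_graph U ga.
Hypotheses (dhx : forall v, Om v -> is_dx v h (hx v))
  (dhz : forall v, Om v -> is_dz v h (hz v))
  (chx : cont_on Om hx)
  (chz : cont_on Om hz).

Let side (s : R) : set (R * R) := [set v | I v.1 /\ 0 < s * (v.2 - ga v.1)].

Let sideE v : I v.1 -> v.2 != ga v.1 <-> side 1 v \/ side (-1) v.
Proof.
rewrite /side /= mul1r mulN1r oppr_gt0 subr_gt0 subr_lt0 neq_lt => Iv.
by split=> [/orP[H|H]|[[_ H]|[_ H]]]; [right|left|rewrite H orbT|rewrite H].
Qed.

Lemma side_open s : open (side s).
Proof.
rewrite openE => v [Iv hv]; apply: filterI; first exact: near_fst.
have c : {for v, continuous (fun w => s * (w.2 - ga w.1))}.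
  apply: continuousM; first exact: cst_continuous.
  apply: continuousB; first exact: cvg_snd.
  apply: continuous_fst_comp; exact: is_derive_continuous (dga_ga Iv).
by have /cvgr_gt := c; apply.
Qed.

Lemma off_graph_open : open Om.
Proof.
have -> : Om = U `&` (side 1 `|` side (-1)).
  by apply/seteqP; split=> v [Uv H]; split=> //; apply/(sideE (UI Uv)).
by apply: openI => //; apply: openU; exact: side_open.
Qed.

Lemma graph_area0 : mu2 (U `\` Om) = 0%E.
Proof.
apply: (@graph_null _ _ ga).
  by apply: measurableD; apply: meas_open2 => //; exact: off_graph_open.
by move=> v [Uv nO]; apply/eqP; apply: contrapT => /negP ne; apply: nO.
Qed.

Lemma Rint_off_graph (X : R * R -> R) : integrable2 U X ->
  \int[mu2]_(v in U) X v = \int[mu2]_(v in Om) X v.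
Proof.
move=> iX; have mU := meas_open2 oU; have mO := meas_open2 off_graph_open.
have OU : Om `<=` U by move=> v [].
apply: (@Rint_ae_set _ _ (U `\` Om)) => //.
- exact: measurableD.
- exact: graph_area0.
- exact: integrableS iX.
- by move=> v /= nN Uv nO; exfalso; apply: nN.
- by move=> v _ /OU.
Qed.

Section test.
Variable psi : R * R -> R.
Hypothesis tpsi : test_function U psi.
Let K := closure [set v | psi v != 0].
Let P (v : R * R) : R := h v * psi v.
Let Q (v : R * R) : R := - (h v ^+ 2 / 2) * psi v.
Let Px (v : R * R) : R := hx v * psi v + h v * d_x psi v.
Let Qz (v : R * R) : R := - (h v * hz v) * psi v - h v ^+ 2 / 2 * d_z psi v.

Let nK v : U v \/ (~` K) v.
Proof. by have [/(test_sub tpsi)|] := pselect (K v); [left|right]. Qed.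
Let zP v : ~ K v -> P v = 0. Proof. by move=> n; rewrite /P (test_zero n) mulr0. Qed.
Let zQ v : ~ K v -> Q v = 0. Proof. by move=> n; rewrite /Q (test_zero n) mulr0. Qed.
Let zPx v : ~ K v -> Px v = 0.
Proof. by move=> n; rewrite /Px (test_zero n) (test_dx_zero n) !mulr0 addr0. Qed.
Let zQz v : ~ K v -> Qz v = 0.
Proof. by move=> n; rewrite /Qz (test_zero n) (test_dz_zero n) !mulr0 subr0. Qed.
Let ch2 v : U v -> {for v, continuous (fun w => h w ^+ 2 / 2)}.
Proof.
move=> Uv; apply: continuousM; last exact: cst_continuous.
by rewrite (_ : (fun w => h w ^+ 2) = (fun w => h w * h w)); [apply: continuousM; exact: ch|apply/funext => w; rewrite expr2].
Qed.
Let cP : continuous P.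
Proof.
move=> v; have [Uv|n] := nK v; last by apply: (continuous_zero_near (test_openC (psi := psi)) n).
by apply: continuousM; [exact: ch|exact: @test_cont _ _ tpsi _].
Qed.
Let cQ : continuous Q.
Proof.
move=> v; have [Uv|n] := nK v; last by apply: (continuous_zero_near (test_openC (psi := psi)) n).
apply: (@contM _ _ (fun v => - (h v ^+ 2 / 2))); last exact: @test_cont _ _ tpsi _.
by cont.
Qed.
Let sideOm s v : s = 1 \/ s = -1 -> side s v -> U v -> Om v.
Proof. by move=> s1 sv Uv; split=> //; apply/sideE; [exact: UI|case: s1 sv => ->; [left|right]]. Qed.
Let dP s v : s = 1 \/ s = -1 -> side s v -> is_dx v P (Px v).
Proof.
move=> s1 sv; have [Uv|n] := nK v.
  have Ov := sideOm s1 sv Uv.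
  by apply: (derive_cast (is_deriveM (dhx Ov) (test_dx tpsi v))) => //; rewrite /Px /GRing.scale/=; ring.
by rewrite zPx//; exact: is_derive_zero_out (test_openC (psi := psi)) _ zP n.
Qed.
Let dQ s v : s = 1 \/ s = -1 -> side s v -> is_dz v Q (Qz v).
Proof.
move=> s1 sv; have [Uv|n] := nK v.
  have Ov := sideOm s1 sv Uv.
  apply: (derive_cast (is_deriveM (is_deriveM (is_deriveM (dhz Ov) (dhz Ov)) (is_derive_cst (- (2^-1 : R)) v (0, 1))) (test_dz tpsi v))) => [w|].
    by rewrite /Q /= !fctE /= expr2; ring.
  by rewrite /Qz !fctE scaler0 add0r /GRing.scale/=; field.
by rewrite zQz//; exact: is_derive_zero_out (test_openC (psi := psi)) _ zQ n.
Qed.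
Let cPx s v : s = 1 \/ s = -1 -> side s v -> {for v, continuous Px}.
Proof.
move=> s1 sv; have [Uv|n] := nK v; last by apply: (continuous_zero_near (test_openC (psi := psi)) n).
have Ov := sideOm s1 sv Uv; apply: continuousD; apply: continuousM.
- exact: chx.
- exact: @test_cont _ _ tpsi _.
- exact: ch.
- exact: @test_cont_dx _ _ tpsi _.
Qed.
Let cQz s v : s = 1 \/ s = -1 -> side s v -> {for v, continuous Qz}.
Proof.
move=> s1 sv; have [Uv|n] := nK v; last by apply: (continuous_zero_near (test_openC (psi := psi)) n).
have Ov := sideOm s1 sv Uv; apply: continuousB; apply: continuousM.
- by apply: continuousN; apply: continuousM; [exact: ch|exact: chz].
- exact: @test_cont _ _ tpsi _.
- exact: ch2.
- exact: @test_cont_dz _ _ tpsi _.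
Qed.

Hypotheses (gE : forall v, Om v -> g v = hx v - h v * hz v) (gB : forall v, U v -> `|g v| <= B)
  (mg : measurable_fun (mset U) g).
Let E v := g v * psi v - (- h v * d_x psi v + h v ^+ 2 / 2 * d_z psi v).

Let bounds : exists C : R, forall v, K v -> [/\ `|h v| <= C, `|psi v| <= C, `|d_x psi v| <= C & `|d_z psi v| <= C].
Proof.
have cK := test_compact tpsi.
have [C1 _ H1] := @compact_bound _ K h cK (fun v Kv => ch (test_sub tpsi Kv)).
have [C2 _ H2] := @compact_bound _ K psi cK (fun v _ => @test_cont _ _ tpsi v).
have [C3 _ H3] := @compact_bound _ K (d_x psi) cK (fun v _ => @test_cont_dx _ _ tpsi v).
have [C4 _ H4] := @compact_bound _ K (d_z psi) cK (fun v _ => @test_cont_dz _ _ tpsi v).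
exists (Num.max (Num.max C1 C2) (Num.max C3 C4)) => v Kv.
by split; rewrite !le_max; [rewrite H1|rewrite H2 ?orbT|rewrite H3 ?orbT|rewrite H4 ?orbT].
Qed.

(** The divergence theorem on each side is applied to the field [(h * psi, - h ^ 2 / 2 * psi)],
    whose divergence is the difference [E] of the two integrands. This field is continuous across
    the curve, so the two fluxes cancel. *)
Lemma nabla_weak_eq : \int[mu2]_(v in U) (g v * psi v) =
  \int[mu2]_(v in U) (- h v * d_x psi v + h v ^+ 2 / 2 * d_z psi v).
Proof.
have cK := test_compact tpsi.
have [r r0 Kr] := bounded_Box (compact_bounded cK).
have [C HC] := bounds.
have B0 v : U v -> 0 <= B by move=> /gB; exact: le_trans.
have mU := meas_open2 oU.
have nKB v : ~ Box r v -> ~ K v by move=> nB /Kr.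
have [v0|] := pselect (exists v, K v); last first.
  move=> nKv; have z v : ~ K v by move=> Kv; apply: nKv; exists v.
  rewrite !Rint_eq0// => v _; last by rewrite (test_zero (z v)) mulr0.
  by rewrite (test_dx_zero (z v)) (test_dz_zero (z v)) !mulr0 addr0.
case: v0 => v0 Kv0; have C0 : 0 <= C by have [H _ _ _] := HC _ Kv0; exact: le_trans H.
have iW (X : R * R -> R) (D : set (R * R)) Cb : measurable (mset D) ->
    measurable_fun (mset D) X -> (forall v, D v -> K v -> `|X v| <= Cb) ->
    (forall v, D v -> ~ K v -> X v = 0) -> integrable2 D X.
  move=> mD mX XC X0; apply: (@bounded_integrable _ D r `|Cb|) => // v Dv.
    have [Kv|n] := pselect (K v); last by rewrite X0// normr0.
    exact: le_trans (XC v Dv Kv) (ler_norm _).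
  by move=> /nKB; exact: X0.
have mc (f : R * R -> R) D : open D -> (cont_on D f) ->
    measurable_fun (mset D) f.
  by move=> oD cf; exact: cont2_measurable.
have i1 : integrable2 U (fun v => g v * psi v).
  apply: (iW _ _ (B * C)) => //.
  - by apply: measurable_funM => //; apply: mc => // v _; exact: @test_cont _ _ tpsi _.
  - by move=> v Uv /HC[_ H _ _]; rewrite normrM; apply: ler_pM => //; exact: gB.
  - by move=> v _ n; rewrite (test_zero n) mulr0.
have hC v : K v -> `|- h v * d_x psi v + h v ^+ 2 / 2 * d_z psi v| <= C * C + C ^+ 2 * C.
  move=> /HC[H1 H2 H3 H4]; apply: (le_trans (ler_normD _ _)); apply: lerD; rewrite normrM.
    by rewrite normrN; apply: ler_pM.
  apply: ler_pM => //; rewrite normrM normrX.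
  apply: (@le_trans _ _ (C ^+ 2 * 1)); last by rewrite mulr1.
  apply: ler_pM => //; first by rewrite lerXn2r ?nnegrE.
  by rewrite ger0_norm ?invr_ge0// invf_le1 ?ler1n.
have z2 v : ~ K v -> - h v * d_x psi v + h v ^+ 2 / 2 * d_z psi v = 0.
  by move=> n; rewrite (test_dx_zero n) (test_dz_zero n) !mulr0 addr0.
have i2 : integrable2 U (fun v => - h v * d_x psi v + h v ^+ 2 / 2 * d_z psi v).
  apply: (iW _ _ (C * C + C ^+ 2 * C)) => //.
  - apply: mc => // v Uv; apply: continuousD; apply: continuousM.
    + by cont.
    + exact: @test_cont_dx _ _ tpsi _.
    + exact: ch2.
    + exact: @test_cont_dz _ _ tpsi _.
  - by move=> v _; exact: hC.
  - by move=> v _; exact: z2.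
apply/eqP; rewrite -subr_eq0 -RintegralB//; apply/eqP.
have iE : integrable2 U E by have := integrableB mU i1 i2.
have EE s v : s = 1 \/ s = -1 -> side s v -> Px v + Qz v = E v.
  move=> s1 sv; have [Uv|n] := nK v.
    by rewrite /E /Px /Qz gE; [ring|exact: sideOm s1 sv Uv].
  by rewrite zPx// zQz// /E (test_zero n) (z2 _ n) mulr0 subr0 addr0.
have iS s : s = 1 \/ s = -1 -> integrable2 (side s) (fun v => Px v + Qz v).
  move=> s1; apply: (iW _ _ (B * C + (C * C + C ^+ 2 * C))).
  - by apply: meas_open2; exact: side_open.
  - apply: mc => [|v sv]; first exact: side_open.
    by apply: continuousD; [exact: cPx s1 sv|exact: cQz s1 sv].
  - move=> v sv Kv; rewrite (EE s)// /E; apply: (le_trans (ler_normB _ _)); apply: lerD; last exact: hC.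
    have [_ H _ _] := HC _ Kv; have Uv := test_sub tpsi Kv.
    by rewrite normrM; apply: ler_pM => //; exact: gB.
  - by move=> v sv n; rewrite zPx// zQz// addr0.
have iSE s : s = 1 \/ s = -1 -> integrable2 (side s) E.
  move=> s1; have := iS s s1; apply: eq_integrable; first by apply: meas_open2; exact: side_open.
  by move=> v; rewrite inE => sv /=; rewrite (EE s).
have DT s : s = 1 \/ s = -1 -> \int[mu2]_(v in side s) E v =
    - s * \int[mu]_(x in I) (Q (x, ga x) - dga x * P (x, ga x)).
  move=> s1; have KI v : K v -> I v.1 by move=> /(test_sub tpsi)/UI.
  have D := @collar_divergence _ I ga dga s K P Q Px Qz oI dga_ga cdga s1 cK KI zP zQ cP cQ
    (fun v => @dP s v s1) (fun v => @dQ s v s1) (fun v => @cPx s v s1) (fun v => @cQz s v s1) (iS s s1).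
  by rewrite -D; apply: eq_Rintegral => v; rewrite inE => sv; rewrite (EE s).
have l1 : (1 : R) = 1 \/ (1 : R) = -1 by left.
have l2 : (-1 : R) = 1 \/ (-1 : R) = -1 by right.
have mS s : measurable (mset (side s)) by apply: meas_open2; exact: side_open.
have dS v : side 1 v -> ~ side (-1) v.
  move=> [_ a] [_ b]; move: a b; rewrite mul1r mulN1r oppr_gt0 => a b.
  by move: (lt_trans a b); rewrite ltxx.
have iSS : mu2.-integrable (side 1 `|` side (-1)) (EFin \o E).
  by apply: integrable_disjU => //; exact: iSE.
have -> : \int[mu2]_(v in U) E v = \int[mu2]_(v in side 1 `|` side (-1)) E v.
  apply: (@Rint_ae_set _ _ (U `\` Om)) => //.
  - exact: measurableU.
  - by apply: measurableD => //; apply: meas_open2; exact: off_graph_open.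
  - exact: graph_area0.
  - move=> v nN Uv nS; exfalso; apply: nN; split=> //; case=> _ H; exact/nS/(sideE (UI Uv)).
  - move=> v _ _ nU; have n : ~ K v by move=> /(test_sub tpsi).
    by rewrite /E (test_zero n) (z2 _ n) mulr0 subr0.
rewrite Rintegral_setU//.
  by rewrite !DT// mulN1r opprK mul1r addNr.
by apply/disj_setPS => v [/dS nS /nS].
Qed.

End test.

Lemma distributional_nabla_classical :
  (forall v, Om v -> g v = hx v - h v * hz v) -> (forall v, U v -> `|g v| <= B) ->
  measurable_fun (mset U) g -> is_distributional_nabla U h g.
Proof.
move=> gE gB mg; have mU := meas_open2 oU.
have mh : measurable_fun (mset U) h by exact: cont2_measurable.
have loc (X : R * R -> R) : measurable_fun (mset U) X ->
   (forall K, compact K -> K `<=` U -> exists C, forall v, K v -> `|X v| <= C) -> locally_integrable_on U X.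
  move=> mX HX; split=> // K cK KU; have [C HC] := HX K cK KU.
  have [r r0 Kr] := bounded_Box (compact_bounded cK).
  have mK : measurable (mset K).
    rewrite -[K]setCK; apply: measurableC; apply: meas_open2; rewrite openC.
    by apply: compact_closed => //; exact: norm_hausdorff.
  apply: (@bounded_integrable _ K r C) => //.
    exact: measurable_funS mX.
  by move=> v /Kr.
split=> //.
- apply: loc => [|K cK KU].
    by apply: measurable_funX.
  have [C C0 HC] := @compact_bound _ K h cK (fun v Kv => ch (KU _ Kv)).
  by exists (C ^+ 2) => v Kv; rewrite normrX lerXn2r ?nnegrE ?(ltW C0) ?HC.
- by apply: loc => // K cK KU; exists B => v /KU/gB.
- by move=> psi tpsi; exact: nabla_weak_eq.
Qed.

End graph_split.

Lemma cvg_le_cst (u : nat -> R) (l c : R) : u @ \oo --> l -> (forall n, u n <= c) -> l <= c.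
Proof.
move=> ul uc; apply/ler_addgt0Pr => e e0; have /cvgrPdist_le/(_ _ e0)[n _ Hn] := ul.
have := Hn n (leqnn n); have := uc n; rewrite ler_norml => ? /andP[? ?]; lra.
Qed.

Lemma distributional_nabla_eq U (f f' g : R * R -> R) : measurable (mset U) ->
  (forall v, U v -> f v = f' v) -> is_distributional_nabla U f g -> is_distributional_nabla U f' g.
Proof.
move=> mU ff' [mf [mf2 lf2] lg E]; split=> //.
- by apply: eq_measurable_fun mf => v; rewrite inE; exact: ff'.
- split; first by apply: eq_measurable_fun mf2 => v; rewrite inE => /ff' ->.
  move=> K cK KU; have mK : measurable (mset K).
    rewrite -[K]setCK; apply: measurableC; apply: meas_open2; rewrite openC.
    by apply: compact_closed => //; exact: norm_hausdorff.
  by have := lf2 K cK KU; apply: eq_integrable => // v; rewrite inE => /KU/ff'/= ->.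
- move=> psi tpsi; rewrite E//; apply: eq_Rintegral => v; rewrite inE => /ff' -> //.
Qed.

Lemma energy_eq U (f f' : R * R -> R) : measurable (mset U) ->
  (forall v, U v -> f v = f' v) -> energy U f = energy U f'.
Proof.
move=> mU ff'; rewrite /energy; congr ereal_inf; congr image; apply/seteqP; split=> g.
  exact: distributional_nabla_eq.
by apply: distributional_nabla_eq => // v /ff'.
Qed.

Section energy_value.
Variables (U Om : set (R * R)) (f g : R * R -> R) (B : R).
Hypotheses (oU : open U) (bU : bounded_set U) (oOm : open Om) (OU : Om `<=` U)
  (O0 : mu2 (U `\` Om) = 0%E) (dg : is_distributional_nabla U f g)
  (cg : cont_on Om g) (gB : forall v, U v -> `|g v| <= B) (B0 : 0 <= B).

Let mU : measurable (mset U). Proof. exact: meas_open2. Qed.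
Let mO : measurable (mset Om). Proof. exact: meas_open2. Qed.
Let mg : measurable_fun (mset U) g. Proof. by case: dg => _ _ []. Qed.

Lemma bounded_on_integrable (D : set (R * R)) (X : R * R -> R) C : D `<=` U ->
  measurable (mset D) -> measurable_fun (mset D) X ->
  (forall v, D v -> `|X v| <= C) -> integrable2 D X.
Proof.
move=> DU mD mX XC; have [r r0 Ur] := bounded_Box bU.
by apply: (@bounded_integrable _ D r C) => // v /DU/Ur.
Qed.
Let toOm (X : R * R -> R) : integrable2 U X ->
  \int[mu2]_(v in U) X v = \int[mu2]_(v in Om) X v.
Proof.
move=> iX; apply: (@Rint_ae_set _ _ (U `\` Om)) => //.
- exact: measurableD.
- exact: integrableS iX.
- by move=> v /= nN Uv nO; exfalso; apply: nN.
- by move=> v _ /OU.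
Qed.

(** [energy] is an infimum over all representatives [g']. For a test function [p], [2 * int (g * p)
    - int (p ^ 2) = 2 * int (g' * p) - int (p ^ 2) <= int (g' ^ 2)]. When [p] runs through the grid
    approximations of [g], the left side tends to [int (g ^ 2)]; this avoids comparing [g] and [g']
    almost everywhere. *)
Lemma energy_value : energy U f = (2^-1 * \int[mu2]_(v in U) (g v ^+ 2))%:E.
Proof.
have ig2 : integrable2 U (fun v => g v ^+ 2).
  apply: (@bounded_on_integrable U _ (B ^+ 2)) => //; first exact: measurable_funX.
  by move=> v Uv; rewrite normrX lerXn2r ?nnegrE// gB.
have gE : (\int[mu2]_(v in U) (g v ^+ 2)%:E)%E = (\int[mu2]_(v in U) (g v ^+ 2))%:E.
  by rewrite /Rintegral fineK//; exact: integrable_fin_num ig2.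
apply/eqP; rewrite eq_le; apply/andP; split.
  by apply: ereal_inf_lbound; exists g => //; rewrite gE -EFinM.
apply: le_ereal_inf_tmp => _ [g' dg' <-]; rewrite EFinM lee_pmul2l//.
have [[mf _ [mg' _] E'] [_ _ _ E]] := (dg', dg).
have mg'2 : measurable_fun (mset U) (fun v => g' v ^+ 2) by exact: measurable_funX.
have [Joo|Joo] := leP +oo%E (\int[mu2]_(v in U) (g' v ^+ 2)%:E)%E; first by apply: le_trans Joo; rewrite leey.
have ig'2 : integrable2 U (fun v => g' v ^+ 2).
  apply/integrableP; split; first exact/measurable_EFinP.
  apply: le_lt_trans Joo; rewrite le_eqVlt; apply/orP; left; apply/eqP; apply: eq_integral => v _.
  by rewrite /= ger0_norm// sqr_ge0.
rewrite -[leRHS]fineK; last exact: integrable_fin_num ig'2.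
rewrite lee_fin -/(Rintegral mu2 U (fun v => g' v ^+ 2)).
pose p n := grid Om g n.
have pt n : test_function Om (p n) by exact: grid_test.
have pB n v : `|p n v| <= B by apply: grid_bound => // w /OU; exact: gB.
have mp n D : measurable (mset D) -> measurable_fun (mset D) (p n).
  move=> mD; apply: (@measurable_funS _ _ _ _ setT) => //; apply: cont2_measurable; first exact: openT.
  by move=> v _; exact: @test_cont _ _ (pt n) v.
have ip2 n : integrable2 U (fun v => p n v ^+ 2).
  apply: (@bounded_on_integrable U _ (B ^+ 2)) => //; first by apply: measurable_funX; exact: mp.
  by move=> v Uv; rewrite normrX lerXn2r ?nnegrE.
have igp n : integrable2 U (fun v => g v * p n v).
  apply: (@bounded_on_integrable U _ (B * B)) => //; first by apply: measurable_funM => //; exact: mp.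
  by move=> v Uv; rewrite normrM; apply: ler_pM => //; exact: gB.
have ig'p n : integrable2 U (fun v => g' v * p n v).
  apply: (@le_integrable _ _ _ _ _ mU _ (EFin \o (fun v => g' v ^+ 2 + p n v ^+ 2))).
  - by apply/measurable_EFinP; apply: measurable_funM => //; exact: mp.
  - move=> v _; rewrite /= lee_fin [leRHS]ger0_norm ?addr_ge0 ?sqr_ge0// ler_norml.
    have := sqr_ge0 (g' v + p n v); have := sqr_ge0 (g' v - p n v).
    have := sqr_ge0 (g' v); have := sqr_ge0 (p n v); rewrite !expr2 => *.
    by apply/andP; split; nra.
  - by have := integrableD mU ig'2 (ip2 n).
have key n : 2 * \int[mu2]_(v in Om) (g v * p n v) - \int[mu2]_(v in Om) (p n v ^+ 2) <=
    \int[mu2]_(v in U) (g' v ^+ 2).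
  rewrite -!toOm//.
  have -> : \int[mu2]_(v in U) (g v * p n v) = \int[mu2]_(v in U) (g' v * p n v).
    by have tU := test_function_sub OU (pt n); rewrite E// E'.
  have i2 : integrable2 U (fun v => 2 * (g' v * p n v)).
    exact: eq_integrable mU _ _ (fun v _ => esym (EFinM 2 (g' v * p n v))) (integrableZl mU 2 (ig'p n)).
  rewrite -RintegralZl// -RintegralB//; apply: le_Rintegral => //.
    by have := integrableB mU i2 (ip2 n).
  by move=> v _; have := sqr_ge0 (g' v - p n v); rewrite !expr2; lra.
have cO v : Om v -> p n v @[n --> \oo] --> g v by move=> Ov; apply: grid_cvg.
have mgO : measurable_fun (mset Om) g by exact: measurable_funS mg.
have iB C : integrable2 Om (fun=> C).
  by apply: (@bounded_on_integrable Om _ `|C|).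
have [|||||_ c1] := @Rdct _ _ (mvplane R) mu2 Om (fun n v => g v * p n v) (fun v => g v * g v) (fun=> B * B) mO.
- by move=> n; apply: measurable_funM => //; exact: mp.
- exact: measurable_funM.
- by move=> v Ov; apply: cvgM; [exact: cvg_cst|exact: cO].
- exact: iB.
- by move=> n v /OU Uv; rewrite normrM; apply: ler_pM => //; exact: gB.
have [|||||_ c2] := @Rdct _ _ (mvplane R) mu2 Om (fun n v => p n v ^+ 2) (fun v => g v * g v) (fun=> B * B) mO.
- by move=> n; apply: measurable_funX; exact: mp.
- exact: measurable_funM.
- by move=> v Ov; under eq_fun do rewrite expr2; apply: cvgM; exact: cO.
- exact: iB.
- by move=> n v Ov; rewrite expr2 normrM; apply: ler_pM.
have c3 : (2 * \int[mu2]_(v in Om) (g v * p n v) - \int[mu2]_(v in Om) (p n v ^+ 2)) @[n --> \oo] -->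
   2 * \int[mu2]_(v in Om) (g v * g v) - \int[mu2]_(v in Om) (g v * g v).
  by apply: cvgB => //; apply: cvgM => //; exact: cvg_cst.
have := cvg_le_cst c3 key; rewrite (toOm ig2).
under eq_Rintegral do rewrite -expr2.
by move=> H; apply: le_trans H; lra.
Qed.

End energy_value.
End distributional.

(** * Linear differential equations with uniform estimates *)

Section scalar_ode.
Context {R : realType}.
Implicit Types (s t T e L C : R).

Definition growth L : R := expR (2 * L + 1).

Lemma growth_ge1 L : 0 <= L -> 1 <= growth L.
Proof. by move=> L0; rewrite /growth -[leLHS](@expR0 R) ler_expR; lra. Qed.

(** [|r|] need not be differentiable, so the estimate goes through [r ^ 2]: by
    [2 * |r| * e <= r ^ 2 + e ^ 2] its derivative is at most [(2 * L + 1) * r ^ 2 + e ^ 2], and [F]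
    cannot increase. The factor found for [r ^ 2] is kept for [|r|], since [growth L >= 1]; [T <= 1]
    removes the time from the constant. *)
Lemma gronwall (r dr : R -> R) T L e : 0 <= L -> 0 <= e -> T <= 1 ->
  (forall s, 0 <= s <= T -> is_derive1 s r (dr s)) ->
  (forall s, 0 <= s <= T -> `|dr s| <= L * `|r s| + e) ->
  forall s, 0 <= s <= T -> `|r s| <= growth L * (`|r 0| + e).
Proof.
move=> L0 e0 T1 Dr Hr s /andP[s0 sT].
pose a := 2 * L + 1.
pose F x := r x * r x * expR (- a * x) - e * e * x.
pose dF x := (2 * r x * dr x - a * (r x * r x)) * expR (- a * x) - e * e.
have DF x : 0 <= x <= T -> is_derive1 x F (dF x).
  move=> xT; have D1 := Dr x xT.
  have D2 : is_derive1 x (fun y => - a * y) (- a).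
    by apply/is_derive_leP => d d0; exists 1 => // h _; rewrite (_ : _ - _ = 0) ?normr0 ?mulr_ge0 ?(ltW d0)//; ring.
  have D3 := @is_derive1_comp R expR (fun y => - a * y) x _ _ (is_derive_expR _) D2.
  have D4 : is_derive1 x (fun y => e * e * y) (e * e).
    by apply/is_derive_leP => d d0; exists 1 => // h _; rewrite (_ : _ - _ = 0) ?normr0 ?mulr_ge0 ?(ltW d0)//; ring.
  by apply: (derive_cast (is_deriveB (is_deriveM (is_deriveM D1 D1) D3) D4)) => //; rewrite /dF !fctE /GRing.scale/=; ring.
have FF : F s <= F 0.
  have [|c cs E] := @MVT_eq _ F dF 0 s.
    by move=> x; rewrite min_l// max_r// => /andP[x0 xs]; apply: DF; rewrite x0 (le_trans xs).
  rewrite -subr_le0 E subr0 mulr_le0_ge0//.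
  move: cs; rewrite min_l// max_r// => /andP[c0 cs].
  have cT : 0 <= c <= T by rewrite c0 (le_trans cs).
  rewrite /dF subr_le0.
  have h1 : 2 * r c * dr c - a * (r c * r c) <= e * e.
    have := Hr c cT; set x := r c; set y := dr c => Hy.
    have xy : x * y <= `|x| * (L * `|x| + e).
      by apply: le_trans (ler_norm _) _; rewrite normrM ler_wpM2l.
    have xx : x * x = `|x| * `|x| by rewrite -normrM ger0_norm// -expr2 sqr_ge0.
    have := sqr_ge0 (`|x| - e); rewrite expr2 /a xx => *; nra.
  have e1 : expR (- a * c) <= 1.
    by rewrite -[leRHS](@expR0 R) ler_expR mulNr oppr_le0 mulr_ge0// /a; lra.
  apply: (@le_trans _ _ (e * e * expR (- a * c))).
    by rewrite ler_wpM2r ?expR_ge0.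
  by rewrite ler_piMr// mulr_ge0.
have : (r s) ^+ 2 <= (growth L * (`|r 0| + e)) ^+ 2.
  move: FF; rewrite /F mulr0 expR0 mulr1 mulr0 subr0 lerBlDr => FF.
  have rs : r s * r s <= (r 0 * r 0 + e * e * s) * expR (a * s).
    rewrite -ler_pdivrMr ?expR_gt0// -expRN; move: FF; by rewrite -mulNr.
  rewrite expr2; apply: (le_trans rs).
  rewrite exprMn expr2 -/(growth L).
  have G1 := growth_ge1 L0.
  apply: (@le_trans _ _ ((`|r 0| + e) ^+ 2 * growth L)).
    apply: ler_pM; rewrite ?expR_ge0//.
    - apply: addr_ge0; [by rewrite -expr2 sqr_ge0|by rewrite !mulr_ge0].
    - have -> : r 0 * r 0 = `|r 0| * `|r 0| by rewrite -normrM ger0_norm// -expr2 sqr_ge0.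
      have : e * e * s <= e * e by rewrite ler_piMr ?mulr_ge0// (le_trans sT).
      have : 0 <= `|r 0| * e by rewrite mulr_ge0.
      by rewrite expr2; lra.
    - by rewrite /growth ler_expR -/a ler_piMr ?(le_trans sT)// /a; lra.
  rewrite mulrC ler_wpM2r ?sqr_ge0// ler_peMl ?(le_trans ler01)//.
rewrite -(real_normK (num_real (r s))) ler_pXn2r// nnegrE// mulr_ge0 ?addr_ge0//.
exact: expR_ge0.
Qed.

Lemma antiderivative (al : R -> R) (M : R) : continuous al ->
  exists F : R -> R, forall t, `|t| < M -> is_derive1 t F (al t).
Proof.
move=> cal; exists (fun x => \int[lebesgue_measure]_(t in [set` Interval (BLeft (- M)) (BRight x)]) al t).
move=> t; rewrite ltr_norml => /andP[t1 t2].
have [|||D E] := @continuous_FTC1 R al (BLeft (- M)) t M t2.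
- by apply: cont_itv_integrable.
- by first [exact: t1 | rewrite lteBSide/= ltW | rewrite /Order.lt/= ltW | rewrite /Order.lt/=].
- exact: cal.
by split; [exact: D|rewrite -derive1E].
Qed.

(** Retraction of the line onto [[-M, M]]. Composition with it extends a function continuous near
    this interval to one continuous on the line. *)
Definition clamp (M x : R) : R := Num.max (- M) (Num.min x M).

Lemma clamp_id M x : `|x| <= M -> clamp M x = x.
Proof. by rewrite ler_norml /clamp => /andP[a b]; rewrite (min_l b) (max_r a). Qed.

Lemma clamp_le M x : 0 <= M -> `|clamp M x| <= M.
Proof.
move=> M0; rewrite ler_norml /clamp le_max lexx/= ge_max ge_min lexx orbT andbT.
by rewrite (le_trans _ M0)// oppr_le0.
Qed.

Lemma clamp_lip M x y : `|clamp M x - clamp M y| <= `|x - y|.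
Proof.
wlog xy : x y / x <= y.
  move=> W; have [/W//|/W] := orP (le_total x y).
  by rewrite distrC [`|y - _|]distrC.
rewrite [leRHS]distrC [leRHS]ger0_norm ?subr_ge0// distrC ger0_norm.
  rewrite /clamp; case: (leP x M) => a; case: (leP y M) => b.
  - case: (leP (- M) x) => c; case: (leP (- M) y) => d; lra.
  - case: (leP (- M) x) => c; case: (leP (- M) M) => d; lra.
  - lra.
  - lra.
rewrite subr_ge0 /clamp; apply: le_max2 => //; exact: le_min2.
Qed.

Lemma clamp_comp_continuous (al : R -> R) (M e : R) : 0 <= M -> M < e ->
  (forall s, `|s| < e -> {for s, continuous al}) -> continuous (fun s => al (clamp M s)).
Proof.
move=> M0 Me cal s; apply/continuousR_leP => d d0.
have /continuousR_leP/(_ _ d0)[q q0 Hq] := cal (clamp M s) (le_lt_trans (clamp_le _ M0) Me).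
exists q => // h hq; have := Hq (clamp M (s + h) - clamp M s).
rewrite [clamp M s + _]addrC subrK; apply.
by apply: (le_trans (clamp_lip _ _ _)); rewrite addrAC subrr add0r.
Qed.

Lemma antiderivative_on (al : R -> R) (M e : R) : 0 <= M -> M < e ->
  (forall s, `|s| < e -> {for s, continuous al}) ->
  exists2 F : R -> R, F 0 = 0 & forall t, `|t| < M -> is_derive1 t F (al t).
Proof.
move=> M0 Me cal; have cc := clamp_comp_continuous M0 Me cal.
have [F HF] := antiderivative M cc.
exists (fun t => F t - F 0); first by rewrite subrr.
move=> t tM; have D := HF t tM; rewrite clamp_id ?ltW// in D.
by apply: (derive_cast (is_deriveB D (is_derive_cst (F 0) t 1))) => //; rewrite subr0.
Qed.

(** Variation of constants: [exp F * (c + H)] with [F' = A] and [H' = B * exp (- F)]. The radius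
    [M'] between [M] and [e] is there because each antiderivative lives on a smaller interval than
    its integrand. *)
Lemma linear_ode (A B : R -> R) (c M e : R) : 0 <= M -> M < e ->
  (forall s, `|s| < e -> {for s, continuous A}) ->
  (forall s, `|s| < e -> {for s, continuous B}) ->
  exists2 u : R -> R, u 0 = c & forall t, `|t| < M -> is_derive1 t u (A t * u t + B t).
Proof.
move=> M0 Me cA cB; pose M' := (M + e) / 2.
have MM' : M < M' by rewrite /M'; lra.
have M'e : M' < e by rewrite /M'; lra.
have M'0 : 0 <= M' by rewrite (le_trans M0)// ltW.
have [F F0 DF] := antiderivative_on M'0 M'e cA.
have DE t : `|t| < M' -> is_derive1 t (fun s => expR (F s)) (A t * expR (F t)).
  move=> tM; have := @is_derive1_comp R expR F t _ _ (is_derive_expR _) (DF t tM).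
  by rewrite mulrC.
have DN t : `|t| < M' -> is_derive1 t (fun s => expR (- F s)) (- A t * expR (- F t)).
  move=> tM; have := @is_derive1_comp R expR (fun s => - F s) t _ _ (is_derive_expR _) (is_deriveN (DF t tM)).
  by rewrite mulrC.
have [|H H0 DH] := @antiderivative_on (fun s => B s * expR (- F s)) M M' M0 MM'.
  move=> s sM; apply: continuousM; first by apply: cB; exact: lt_trans M'e.
  exact: is_derive_continuous (DN s sM).
exists (fun t => expR (F t) * (c + H t)); first by rewrite F0 H0 expR0 mul1r addr0.
move=> t tM; have tM' := lt_trans tM MM'.
apply: (derive_cast (is_deriveM (DE t tM') (is_deriveD (is_derive_cst c t 1) (DH t tM)))) => //.
rewrite add0r !fctE /GRing.scale/=.
have E : expR (F t) * expR (- F t) = 1 by rewrite -expRD subrr expR0.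
rewrite [expR (F t) * (B t * _)]mulrCA E mulr1; ring.
Qed.

Lemma ode_small (u du : R -> R) T (c D0 C : R) : 0 <= C ->
  (forall s, 0 <= s <= T -> is_derive1 s u (du s)) -> u 0 = c ->
  (forall s, 0 <= s <= T -> `|du s - D0| <= C * s) ->
  forall s, 0 <= s <= T -> `|u s - c - s * D0| <= C * s ^+ 2.
Proof.
move=> C0 Du u0 HD s /andP[s0 sT].
have := @MVT_norm _ (fun x => u x - c - x * D0) (fun x => du x - D0) 0 s (C * s).
rewrite u0 subrr mul0r !subr0 => H.
have -> : C * s ^+ 2 = C * s * `|s| by rewrite ger0_norm// expr2 mulrA.
apply: H => x; rewrite min_l// max_r// => /andP[x0 xs].
  have D := Du x; have xT : 0 <= x <= T by rewrite x0 (le_trans xs).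
  have D2 : is_derive1 x (fun y => y * D0) D0.
    by apply/is_derive_leP => d d0; exists 1 => // h _; rewrite (_ : _ - _ = 0) ?normr0 ?mulr_ge0 ?(ltW d0)//; ring.
  by apply: (derive_cast (is_deriveB (is_deriveB (D xT) (is_derive_cst c x 1)) D2)) => //; rewrite subr0.
apply: (le_trans (HD x _)); first by rewrite x0 (le_trans xs).
by rewrite ler_wpM2l.
Qed.

End scalar_ode.

Section families.
Context {R : realType}.
Implicit Types (T C : R) (U A B u : R -> R * R -> R).

(** Families depend on a time [s] in [[0, T]] and on a point of the plane. All bounds are uniform in
    both, and the lemmas on them fix the resulting constant before [T] and the family; this is what
    makes the final constant independent of the flow and of the graph. *)
Definition bdd T C U := forall s v, 0 <= s <= T -> `|U s v| <= C.
Definition lip T C U := forall s v h k, 0 <= s <= T ->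
  `|U s (v.1 + h, v.2 + k) - U s v| <= C * (`|h| + `|k|).
Definition taylor T C U Ux Uz := forall s v h k, 0 <= s <= T ->
  `|U s (v.1 + h, v.2 + k) - U s v - Ux s v * h - Uz s v * k| <= C * (`|h| + `|k|) ^+ 2.
Definition reg0 T C U := bdd T C U /\ lip T C U.
Definition reg1 T C U Ux Uz := [/\ reg0 T C U, reg0 T C Ux, reg0 T C Uz & taylor T C U Ux Uz].

Definition lode T (c : R) A B u := (forall v, u 0 v = c) /\
  forall s v, 0 <= s <= T -> is_derive1 s (u ^~ v) (A s v * u s v + B s v).

Lemma bdd_le T C C' U : C <= C' -> bdd T C U -> bdd T C' U.
Proof. by move=> CC H s v sT; apply: le_trans CC; exact: H. Qed.

Lemma lip_le T C C' U : C <= C' -> lip T C U -> lip T C' U.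
Proof. by move=> CC H s v h k sT; apply: (le_trans (H s v h k sT)); rewrite ler_wpM2r// addr_ge0. Qed.

Lemma taylor_le T C C' U Ux Uz : C <= C' -> taylor T C U Ux Uz -> taylor T C' U Ux Uz.
Proof. by move=> CC H s v h k sT; apply: (le_trans (H s v h k sT)); rewrite ler_wpM2r// sqr_ge0. Qed.

Lemma reg0_le T C C' U : C <= C' -> reg0 T C U -> reg0 T C' U.
Proof. by move=> CC [a b]; split; [exact: bdd_le a|exact: lip_le b]. Qed.

Lemma reg1_le T C C' U Ux Uz : C <= C' -> reg1 T C U Ux Uz -> reg1 T C' U Ux Uz.
Proof.
move=> CC [a b c d]; split; [exact: reg0_le a|exact: reg0_le b|exact: reg0_le c|exact: taylor_le d].
Qed.

Lemma reg0M T C C' A B : 0 <= C -> 0 <= C' -> reg0 T C A -> reg0 T C' B ->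
  reg0 T (C * C' + C * C') (fun s v => A s v * B s v).
Proof.
move=> C0 C'0 [a1 a2] [b1 b2]; split=> s v.
  move=> sT; rewrite normrM (le_trans (ler_pM _ _ (a1 s v sT) (b1 s v sT)))// lerDl mulr_ge0//.
move=> h k sT; rewrite (_ : _ - _ = (A s (v.1 + h, v.2 + k) - A s v) * B s (v.1 + h, v.2 + k) +
   A s v * (B s (v.1 + h, v.2 + k) - B s v)); last by ring.
rewrite (le_trans (ler_normD _ _))// !normrM [leRHS]mulrDl lerD//.
  by rewrite mulrAC; apply: ler_pM => //; [exact: a2|exact: b1].
by rewrite -mulrA; apply: ler_pM => //; [exact: a1|exact: b2].
Qed.

Lemma reg0D T C C' A B : reg0 T C A -> reg0 T C' B -> reg0 T (C + C') (fun s v => A s v + B s v).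
Proof.
move=> [a1 a2] [b1 b2]; split=> s v.
  by move=> sT; rewrite (le_trans (ler_normD _ _))// lerD// ?a1 ?b1.
move=> h k sT; rewrite (_ : _ - _ = (A s (v.1 + h, v.2 + k) - A s v) +
   (B s (v.1 + h, v.2 + k) - B s v)); last by ring.
by rewrite (le_trans (ler_normD _ _))// [leRHS]mulrDl lerD// ?a2 ?b2.
Qed.

(** The difference of the solutions at two points of the plane solves the same linear equation, with
    zero initial value and a source of the size of the displacement; [gronwall] bounds it. *)
Lemma lin0 C (c : R) : 0 <= C -> exists2 C', 0 <= C' & forall T A B u, T <= 1 -> reg0 T C A -> reg0 T C B ->
  lode T c A B u -> reg0 T C' u.
Proof.
move=> C0; have G0 : 0 <= growth C by exact: expR_ge0.
pose M := growth C * (`|c| + C).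
have M0 : 0 <= M by rewrite mulr_ge0// addr_ge0.
have N0 : 0 <= growth C * (C * M + C) by rewrite mulr_ge0// addr_ge0// mulr_ge0.
exists (M + growth C * (C * M + C)); first by rewrite addr_ge0.
move=> T A B u T1 [a1 a2] [b1 b2] [u0 du].
have bu : bdd T M u.
  move=> s v sT; rewrite /M -(u0 v).
  apply: (@gronwall _ (u ^~ v) _ T C C C0 C0 T1 (fun s => du s v)) => //.
  move=> x xT; rewrite (le_trans (ler_normD _ _))// normrM lerD ?b1// ler_wpM2r// a1//.
split; first by apply: bdd_le bu; rewrite lerDl.
move=> s v h k sT; pose v' := (v.1 + h, v.2 + k).
apply: (@le_trans _ _ (growth C * (C * M + C) * (`|h| + `|k|))); last first.
  by rewrite ler_wpM2r ?addr_ge0// lerDr.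
set d := `|h| + `|k|; have d0 : 0 <= d by rewrite /d addr_ge0.
have Dd x : 0 <= x <= T -> is_derive1 x (fun y => u y v' - u y v)
    ((A x v' * u x v' + B x v') - (A x v * u x v + B x v)).
  by move=> xT; have D1 := du x v' xT; have D2 := du x v xT; exact: is_deriveB.
have := @gronwall _ (fun y => u y v' - u y v) _ T C ((C * M + C) * d) C0 _ T1 Dd _ s sT.
rewrite !u0 subrr normr0 add0r mulrA; apply.
  by rewrite mulr_ge0// addr_ge0// mulr_ge0.
move=> x xT; rewrite (_ : _ - _ = A x v * (u x v' - u x v) + ((A x v' - A x v) * u x v' + (B x v' - B x v))); last by ring.
rewrite (le_trans (ler_normD _ _))// lerD//; first by rewrite normrM ler_wpM2r// a1.
rewrite (le_trans (ler_normD _ _))// [leRHS]mulrDl lerD//; last exact: b2.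
by rewrite normrM mulrAC; apply: ler_pM => //; [exact: a2|exact: bu].
Qed.

(** [ux] and [uz] are solutions of the formally differentiated equations. The Taylor remainder of
    [u] built with them solves the original linear equation with zero initial value and a source
    quadratic in the displacement, so they are indeed the derivatives of [u]. *)
Lemma lin1 C (c : R) : 0 <= C -> exists2 C', 0 <= C' & forall T A Ax Az B Bx Bz u ux uz, T <= 1 ->
  reg1 T C A Ax Az -> reg1 T C B Bx Bz -> lode T c A B u ->
  lode T 0 A (fun s v => Ax s v * u s v + Bx s v) ux ->
  lode T 0 A (fun s v => Az s v * u s v + Bz s v) uz -> reg1 T C' u ux uz.
Proof.
move=> C0; have [C1 C10 H1] := lin0 c C0.
have C20 : 0 <= C * C1 + C * C1 + C + C by rewrite !addr_ge0 ?mulr_ge0.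
have [C2 C2'0 H2] := lin0 0 C20.
have G0 : 0 <= growth C by exact: expR_ge0.
pose D := C * C1 + C * C1 + C.
have D0 : 0 <= D by rewrite /D !addr_ge0 ?mulr_ge0.
exists (C1 + C2 + growth C * D); first by rewrite !addr_ge0// mulr_ge0.
move=> T A Ax Az B Bx Bz u ux uz T1 [a ax az at'] [b bx bz bt] lu lux luz.
have ru := H1 T A B u T1 a b lu.
have rA : reg0 T (C * C1 + C * C1 + C + C) A by apply: reg0_le a; rewrite lerDr !addr_ge0 ?mulr_ge0.
have rx : reg0 T C2 ux.
  by apply: H2 lux => //; apply: (@reg0_le _ (C * C1 + C * C1 + C)); [rewrite lerDl|apply: reg0D => //; exact: reg0M].
have rz : reg0 T C2 uz.
  by apply: H2 luz => //; apply: (@reg0_le _ (C * C1 + C * C1 + C)); [rewrite lerDl|apply: reg0D => //; exact: reg0M].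
have GD : 0 <= growth C * D by rewrite mulr_ge0.
split.
- by apply: reg0_le ru; rewrite -addrA lerDl addr_ge0.
- by apply: reg0_le rx; rewrite addrAC lerDr addr_ge0.
- by apply: reg0_le rz; rewrite addrAC lerDr addr_ge0.
apply: (@taylor_le _ (growth C * D)); first by rewrite lerDr addr_ge0.
move=> s v h k sT; pose v' := (v.1 + h, v.2 + k).
set d := `|h| + `|k|; have d0 : 0 <= d by rewrite /d addr_ge0.
have [_ du] := lu; have [_ dux] := lux; have [_ duz] := luz.
have Dd x : 0 <= x <= T -> is_derive1 x (fun y => u y v' - u y v - ux y v * h - uz y v * k)
    ((A x v' * u x v' + B x v') - (A x v * u x v + B x v)
     - (A x v * ux x v + (Ax x v * u x v + Bx x v)) * h
     - (A x v * uz x v + (Az x v * u x v + Bz x v)) * k).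
  move=> xT; have D1 := du x v' xT; have D2 := du x v xT.
  have D3 := dux x v xT; have D4 := duz x v xT.
  apply: (derive_cast (is_deriveB (is_deriveB (is_deriveB D1 D2) (is_deriveM D3 (is_derive_cst h x 1))) (is_deriveM D4 (is_derive_cst k x 1)))) => //.
  by rewrite !scaler0 !add0r /GRing.scale/= /cst; ring.
have := @gronwall _ _ _ T C (D * d ^+ 2) C0 _ T1 Dd _ s sT.
rewrite (proj1 lu) (proj1 lu) (proj1 lux) (proj1 luz) !mul0r !subr0 subrr normr0 add0r mulrA; apply.
  by rewrite mulr_ge0// sqr_ge0.
move=> x xT.
set U' := u x v'; set U0 := u x v; set A' := A x v'; set A0 := A x v; set B' := B x v'; set B0 := B x v.
rewrite (_ : _ - _ = A0 * (U' - U0 - ux x v * h - uz x v * k) +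
  ((A' - A0) * (U' - U0) + (A' - A0 - Ax x v * h - Az x v * k) * U0 + (B' - B0 - Bx x v * h - Bz x v * k))); last by ring.
have [a1 a2] := a; have [u1 u2] := ru.
rewrite (le_trans (ler_normD _ _))// lerD//; first by rewrite normrM ler_wpM2r// a1.
rewrite (le_trans (ler_normD _ _))// /D [leRHS]mulrDl lerD//; last exact: bt.
rewrite (le_trans (ler_normD _ _))// [leRHS]mulrDl lerD//.
  rewrite normrM expr2 mulrACA; apply: ler_pM => //; [exact: a2|exact: u2].
by rewrite normrM mulrAC; apply: ler_pM => //; [exact: at'|exact: u1].
Qed.

End families.

(** * The flow on vertical lines and its derivatives *)

Section smooth_flow.
Context {R : realType}.
Implicit Types (T C : R) (W : R * R -> R) (g p q : R -> R * R -> R).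

Definition csmooth W := smooth_on setT W /\ exists r : R, csupp r W.

Lemma csmooth_is_dx W v : csmooth W -> is_dx v W (d_x W v).
Proof. by move=> [sW _]; exact: (@Cn_is_derive R _ _ 0 setT W v _ (sW 1%N)). Qed.

Lemma csmooth_is_dz W v : csmooth W -> is_dz v W (d_z W v).
Proof. by move=> [sW _]; exact: (@Cn_is_derive R _ _ 0 setT W v _ (sW 1%N)). Qed.

Lemma csmooth_dx W : csmooth W -> csmooth (d_x W).
Proof.
move=> sW; split; first by move=> n; exact: @Cn_D R _ _ n setT W _ (sW.1 n.+1).
have [r cr] := sW.2; exists r; apply: csupp_dx cr => v; exact: csmooth_is_dx.
Qed.

Lemma csmooth_dz W : csmooth W -> csmooth (d_z W).
Proof.
move=> sW; split; first by move=> n; exact: @Cn_D R _ _ n setT W _ (sW.1 n.+1).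
have [r cr] := sW.2; exists r; apply: csupp_dz cr => v; exact: csmooth_is_dz.
Qed.

Lemma csmooth_cont W : csmooth W -> continuous W.
Proof. by move=> [sW _] v; exact: (@Cn_cont R _ _ 0 setT W v (sW 0%N)). Qed.

Lemma csmooth_opp W : csmooth W -> csmooth (fun v => - W v).
Proof.
move=> [sW [r cr]]; split; first by move=> n; apply: Cn_opp => //; exact: openT.
by exists r => v /cr ->; rewrite oppr0.
Qed.

Lemma csmooth_bound W : csmooth W -> exists2 C, 0 <= C & forall v, `|W v| <= C.
Proof.
move=> sW; have [r cr] := sW.2; have [C C0 H] := csupp_bound (csmooth_cont sW) cr.
by exists C => //; exact: ltW.
Qed.

Lemma csmooth_lip W : csmooth W -> exists2 C, 0 <= C & forall v h k,
  `|W (v.1 + h, v.2 + k) - W v| <= C * (`|h| + `|k|).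
Proof.
move=> sW.
have [C1 C10 H1] := csmooth_bound (csmooth_dx sW).
have [C2 C20 H2] := csmooth_bound (csmooth_dz sW).
exists (C1 + C2); first by rewrite addr_ge0.
move=> [x z] h k /=.
have E1 : `|W (x + h, z + k) - W (x, z + k)| <= C1 * `|h|.
  have := @MVT_norm R (fun s => W (s, z + k)) (fun s => d_x W (s, z + k)) x (x + h) C1.
  rewrite addrAC subrr add0r; apply => // s _.
  exact: proj1 (is_derive_dx _ (s, z + k) _) (csmooth_is_dx _ sW).
have E2 : `|W (x, z + k) - W (x, z)| <= C2 * `|k|.
  have := @MVT_norm R (fun s => W (x, s)) (fun s => d_z W (x, s)) z (z + k) C2.
  rewrite addrAC subrr add0r; apply => // s _.
  exact: proj1 (is_derive_dz _ (x, s) _) (csmooth_is_dz _ sW).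
rewrite (_ : _ - _ = (W (x + h, z + k) - W (x, z + k)) + (W (x, z + k) - W (x, z))); last by ring.
rewrite (le_trans (ler_normD _ _))//.
have := mulr_ge0 C10 (normr_ge0 k); have := mulr_ge0 C20 (normr_ge0 h); lra.
Qed.

Lemma csmooth_taylor W : csmooth W -> exists2 C, 0 <= C & forall v h k,
  `|W (v.1 + h, v.2 + k) - W v - d_x W v * h - d_z W v * k| <= C * (`|h| + `|k|) ^+ 2.
Proof.
move=> sW.
have [C1 C10 H1] := csmooth_lip (csmooth_dx sW).
have [C2 C20 H2] := csmooth_lip (csmooth_dz sW).
exists (C1 + C2); first by rewrite addr_ge0.
move=> [x z] h k /=; set d := `|h| + `|k|.
have d0 : 0 <= d by rewrite addr_ge0.
have hd : `|h| <= d by rewrite lerDl.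
have kd : `|k| <= d by rewrite lerDr.
have [s sh E1] : exists2 s, Num.min x (x + h) <= s <= Num.max x (x + h) &
    W (x + h, z + k) - W (x, z + k) = d_x W (s, z + k) * h.
  have := @MVT_eq R (fun s => W (s, z + k)) (fun s => d_x W (s, z + k)) x (x + h).
  rewrite [x + h - x]addrAC subrr add0r; apply => // s _.
  exact: proj1 (is_derive_dx _ (s, z + k) _) (csmooth_is_dx _ sW).
have [u uk E2] : exists2 s, Num.min z (z + k) <= s <= Num.max z (z + k) &
    W (x, z + k) - W (x, z) = d_z W (x, s) * k.
  have := @MVT_eq R (fun s => W (x, s)) (fun s => d_z W (x, s)) z (z + k).
  rewrite [z + k - z]addrAC subrr add0r; apply => // u _.
  exact: proj1 (is_derive_dz _ (x, u) _) (csmooth_is_dz _ sW).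
rewrite (_ : _ - _ - _ - _ = (d_x W (s, z + k) - d_x W (x, z)) * h +
   (d_z W (x, u) - d_z W (x, z)) * k); last first.
  rewrite !mulrBl -E1 -E2; ring.
rewrite (le_trans (ler_normD _ _))// !normrM mulrDl expr2 !mulrA.
apply: lerD; apply: ler_pM => //.
  have := H1 (x, z) (s - x) k; rewrite /= [x + _]addrC subrK => H; apply: (le_trans H).
  by rewrite ler_wpM2l// lerD2r; exact: minmax_norm.
have := H2 (x, z) 0 (u - z); rewrite /= addr0 [z + _]addrC subrK normr0 add0r => H; apply: (le_trans H).
by rewrite ler_wpM2l// (le_trans _ kd)//; exact: minmax_norm.
Qed.

Lemma taylor_dif T C (u ux uz : R -> R * R -> R) s v : 0 <= C -> 0 <= s <= T -> taylor T C u ux uz ->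
  dif (u s) v (ux s v) (uz s v).
Proof.
move=> C0 sT H e e0; have K0 : 0 < 2 * (C + 1) by lra.
exists (e / (2 * (C + 1))); first by rewrite divr_gt0.
move=> h k hd kd; apply: (le_trans (H s v h k sT)).
rewrite expr2 mulrA ler_wpM2r ?addr_ge0//.
have dd : `|h| + `|k| <= 2 * (e / (2 * (C + 1))) by lra.
apply: (@le_trans _ _ (C * (2 * (e / (2 * (C + 1)))))); first by rewrite ler_wpM2l.
rewrite (_ : C * _ = e * (C / (C + 1))); last by field; lra.
apply: ler_piMr; [exact: ltW|rewrite ler_pdivrMr ?mul1r; lra].
Qed.

Lemma lip_continuous T C (u : R -> R * R -> R) s : 0 <= C -> 0 <= s <= T -> lip T C u -> continuous (u s).
Proof.
move=> C0 sT H v; apply/continuous2_leP => e e0; have K0 : 0 < 2 * (C + 1) by lra.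
exists (e / (2 * (C + 1))); first by rewrite divr_gt0.
move=> h k hd kd; apply: (le_trans (H s v h k sT)).
have dd : `|h| + `|k| <= 2 * (e / (2 * (C + 1))) by lra.
apply: (@le_trans _ _ (C * (2 * (e / (2 * (C + 1)))))); first by rewrite ler_wpM2l.
rewrite (_ : C * _ = e * (C / (C + 1))); last by field; lra.
apply: ler_piMr; [exact: ltW|rewrite ler_pdivrMr ?mul1r; lra].
Qed.

Variable w : R * R -> R.
Hypothesis sw : csmooth w.

(** Under [Pi] the contact field of [w \o Pi] becomes [w] times the vertical unit field: points of
    the plane move on vertical lines, with [x] as a parameter, and [g s v] is the height at time
    [s]. *)
Definition slice_flow T g := (forall v, g 0 v = v.2) /\
  forall s v, 0 <= s <= T -> is_derive1 s (g ^~ v) (w (v.1, g s v)).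

Definition along W g : R -> R * R -> R := fun s v => W (v.1, g s v).

Let wz := d_z w.
Let wx := d_x w.
Let swz : csmooth wz := csmooth_dz sw.
Let swx : csmooth wx := csmooth_dx sw.

Lemma slice_flow_lip : exists2 C, 0 <= C & forall T g, T <= 1 -> slice_flow T g -> lip T C g.
Proof.
have [L L0 HL] := csmooth_lip sw.
have G0 : 0 <= growth L by exact: expR_ge0.
exists (growth L * (1 + L)); first by rewrite mulr_ge0// addr_ge0.
move=> T g T1 [g0 dg] s v h k sT; pose v' := (v.1 + h, v.2 + k).
have Dd x : 0 <= x <= T -> is_derive1 x (fun y => g y v' - g y v)
    (w (v'.1, g x v') - w (v.1, g x v)).
  by move=> xT; have D1 := dg x v' xT; have D2 := dg x v xT; exact: is_deriveB.
have := @gronwall _ (fun y => g y v' - g y v) _ T L (L * `|h|) L0 _ T1 Dd _ s sT.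
rewrite !g0 /= [v.2 + k - _]addrAC subrr add0r => H.
apply: le_trans (H _ _) _.
- by rewrite mulr_ge0.
- move=> x xT; have := HL (v.1, g x v) h (g x v' - g x v); rewrite /= [g x v + _]addrC subrK.
  by rewrite [L * (_ + _)]mulrDr [L * _ + L * _]addrC.
- rewrite -mulrA ler_wpM2l//.
  have := mulr_ge0 L0 (normr_ge0 k); have := normr_ge0 h; lra.
Qed.

Lemma along_reg0 W : csmooth W -> exists2 C, 0 <= C & forall T g, T <= 1 -> slice_flow T g ->
  reg0 T C (along W g).
Proof.
move=> sW; have [L L0 HL] := csmooth_lip sW; have [B B0 HB] := csmooth_bound sW.
have [C1 C10 H1] := slice_flow_lip.
exists (B + L * (1 + C1)); first by rewrite addr_ge0// mulr_ge0// addr_ge0.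
move=> T g T1 fg; split.
  by move=> s v _; apply: (le_trans (HB _)); rewrite lerDl mulr_ge0// addr_ge0.
move=> s v h k sT.
have := HL (v.1, g s v) h (g s (v.1 + h, v.2 + k) - g s v).
rewrite /along /= [g s v + _]addrC subrK => H; apply: (le_trans H).
have := H1 T g T1 fg s v h k sT; set a := `|_ - _|; set d := `|h| + `|k| => ad.
have hd : `|h| <= d by rewrite lerDl.
have d0 : 0 <= d by rewrite addr_ge0.
apply: (@le_trans _ _ (L * ((1 + C1) * d))); first by rewrite ler_wpM2l//; lra.
by rewrite mulrA ler_wpM2r// lerDr.
Qed.

(** Equations of variation for the derivatives of the flow in [x] and in [z]; the initial values are
    0 and 1 because [g 0 v = v.2]. *)
Definition slice_dx T g p := lode T 0 (along wz g) (along wx g) p.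
Definition slice_dz T g q := lode T 1 (along wz g) (fun _ _ => 0) q.

Lemma reg0_cst T C (c : R) : `|c| <= C -> reg0 T C (fun _ _ => c).
Proof.
move=> cC; split=> s v // h k _; rewrite subrr normr0 mulr_ge0 ?addr_ge0//.
exact: le_trans cC.
Qed.

Lemma slice_d_reg0 : exists2 C, 0 <= C & forall T g p q, T <= 1 -> slice_flow T g ->
  slice_dx T g p -> slice_dz T g q -> reg0 T C p /\ reg0 T C q.
Proof.
have [C1 C10 H1] := along_reg0 swz; have [C2 C20 H2] := along_reg0 swx.
have C12 : 0 <= C1 + C2 by rewrite addr_ge0.
have [C3 C30 H3] := lin0 0 C12; have [C4 C40 H4] := lin0 1 C12.
exists (C3 + C4); first by rewrite addr_ge0.
move=> T g p q T1 fg dp dq; split.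
  apply: (@reg0_le _ _ C3); first by rewrite lerDl.
  apply: H3 dp => //; first by apply: (@reg0_le _ _ C1); [rewrite lerDl|exact: H1].
  by apply: (@reg0_le _ _ C2); [rewrite lerDr|exact: H2].
apply: (@reg0_le _ _ C4); first by rewrite lerDr.
apply: H4 dq => //; first by apply: (@reg0_le _ _ C1); [rewrite lerDl|exact: H1].
by apply: reg0_cst; rewrite normr0.
Qed.

(** As in [lin1], but for the nonlinear equation of the flow itself: the Taylor remainder of [w]
    supplies the quadratic source. *)
Lemma slice_flow_taylor : exists2 C, 0 <= C & forall T g p q, T <= 1 -> slice_flow T g ->
  slice_dx T g p -> slice_dz T g q -> taylor T C g p q.
Proof.
have [L L0 HL] := csmooth_bound swz; have [B B0 HB] := csmooth_taylor sw.
have [C1 C10 H1] := slice_flow_lip.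
have G0 : 0 <= growth L by exact: expR_ge0.
have K0 : 0 <= B * (1 + C1) ^+ 2 by rewrite mulr_ge0// sqr_ge0.
exists (growth L * (B * (1 + C1) ^+ 2)); first by rewrite mulr_ge0.
move=> T g p q T1 fg [p0 dp] [q0 dq] s v h k sT; have [g0 dg] := fg.
pose v' := (v.1 + h, v.2 + k); set d := `|h| + `|k|.
have hd : `|h| <= d by rewrite lerDl.
have d0 : 0 <= d by rewrite addr_ge0.
have Dd x : 0 <= x <= T -> is_derive1 x (fun y => g y v' - g y v - p y v * h - q y v * k)
    (w (v'.1, g x v') - w (v.1, g x v) - (along wz g x v * p x v + along wx g x v) * h
     - (along wz g x v * q x v + 0) * k).
  move=> xT; have D1 := dg x v' xT; have D2 := dg x v xT.
  have D3 := dp x v xT; have D4 := dq x v xT.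
  apply: (derive_cast (is_deriveB (is_deriveB (is_deriveB D1 D2) (is_deriveM D3 (is_derive_cst h x 1))) (is_deriveM D4 (is_derive_cst k x 1)))) => //.
  by rewrite !scaler0 !add0r /GRing.scale/= /cst; ring.
have := @gronwall _ _ _ T L (B * (1 + C1) ^+ 2 * d ^+ 2) L0 _ T1 Dd _ s sT.
rewrite !g0 p0 q0 mul0r subr0 mul1r /= [v.2 + k - _]addrAC subrr add0r subrr normr0 add0r => H.
rewrite -[leRHS](mulrA (growth L)); apply: H.
  by rewrite mulr_ge0// sqr_ge0.
move=> x xT.
pose D := g x v' - g x v.
have HD : `|D| <= C1 * d by exact: H1 T g T1 fg x v h k xT.
have := HB (v.1, g x v) h D; rewrite /= /D [g x v + _]addrC subrK -/D -/wx -/wz => HB'.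
rewrite (_ : _ - _ - _ - _ = wz (v.1, g x v) * (D - p x v * h - q x v * k) +
   (w (v.1 + h, g x v') - w (v.1, g x v) - wx (v.1, g x v) * h - wz (v.1, g x v) * D)); last first.
  by rewrite /along /v' /=; ring.
rewrite (le_trans (ler_normD _ _))// lerD//; first by rewrite normrM ler_wpM2r.
apply: (le_trans HB'); rewrite -mulrA ler_wpM2l// -exprMn ler_pXn2r// ?nnegrE ?addr_ge0// ?mulr_ge0 ?addr_ge0//.
lra.
Qed.

Lemma along_reg1 W : csmooth W -> exists2 C, 0 <= C & forall T g p q, T <= 1 -> slice_flow T g ->
  slice_dx T g p -> slice_dz T g q ->
  reg1 T C (along W g) (fun s v => along (d_x W) g s v + along (d_z W) g s v * p s v)
    (fun s v => along (d_z W) g s v * q s v).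
Proof.
move=> sW; have sx := csmooth_dx sW; have sz := csmooth_dz sW.
have [C1 C10 H1] := along_reg0 sW; have [C2 C20 H2] := along_reg0 sx; have [C3 C30 H3] := along_reg0 sz.
have [C4 C40 H4] := slice_d_reg0; have [C5 C50 H5] := slice_flow_taylor.
have [B B0 HB] := csmooth_taylor sW; have [C6 C60 H6] := slice_flow_lip.
pose CM := C3 * C4 + C3 * C4.
have CM0 : 0 <= CM by rewrite addr_ge0 ?mulr_ge0.
pose CT := B * (1 + C6) ^+ 2 + C3 * C5.
have CT0 : 0 <= CT by apply: addr_ge0; rewrite mulr_ge0// sqr_ge0.
have CME : CM = C3 * C4 + C3 * C4 by [].
have CTE : CT = B * (1 + C6) ^+ 2 + C3 * C5 by [].
clearbody CM CT.
exists (C1 + (C2 + CM) + CM + CT); first lra.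
move=> T g p q T1 fg dp dq; have [rp rq] := H4 T g p q T1 fg dp dq.
have rz := H3 T g T1 fg.
split.
- by apply: (@reg0_le _ _ C1); [lra|exact: H1].
- by apply: (@reg0_le _ _ (C2 + CM)); [lra|rewrite CME; apply: reg0D; [exact: H2|exact: reg0M]].
- by apply: (@reg0_le _ _ CM); [lra|rewrite CME; exact: reg0M].
apply: (@taylor_le _ _ CT); first lra.
move=> s v h k sT; pose v' := (v.1 + h, v.2 + k); set d := `|h| + `|k|.
have hd : `|h| <= d by rewrite lerDl.
have d0 : 0 <= d by rewrite addr_ge0.
pose D := g s v' - g s v.
have HD : `|D| <= C6 * d by exact: (H6 T g T1 fg s v h k sT).
have := HB (v.1, g s v) h D; rewrite /= /D [g s v + _]addrC subrK -/D => HB'.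
rewrite (_ : _ - _ - _ - _ = (W (v.1 + h, g s v') - W (v.1, g s v) - d_x W (v.1, g s v) * h - d_z W (v.1, g s v) * D)
  + d_z W (v.1, g s v) * (D - p s v * h - q s v * k)); last by rewrite /along /v' /=; ring.
rewrite (le_trans (ler_normD _ _))// CTE [leRHS]mulrDl lerD//.
  apply: (le_trans HB'); rewrite -mulrA ler_wpM2l// -exprMn ler_pXn2r// ?nnegrE ?addr_ge0// ?mulr_ge0 ?addr_ge0//.
  lra.
rewrite normrM -mulrA; apply: ler_pM => //; first exact: (proj1 rz).
exact: (H5 T g p q T1 fg dp dq).
Qed.

End smooth_flow.

Section small_time.
Context {R : realType}.
Implicit Types (T C : R) (W : R * R -> R) (g p q : R -> R * R -> R).

Lemma continuous_pair_comp W (u1 u2 : R -> R) (s : R) : continuous W -> {for s, continuous u1} ->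
  {for s, continuous u2} -> {for s, continuous (fun x => W (u1 x, u2 x))}.
Proof.
move=> cW c1 c2; apply: (cont_comp (fun x => (u1 x, u2 x)) W); last exact: cW.
exact: cvg_pair c1 c2.
Qed.

(** The solution comes with continuity beyond time [T]: it enters the coefficients of the next
    equation, whose solvability asks for coefficients continuous on a longer interval. *)
Lemma lode_exists T (e c : R) (A B : R -> R * R -> R) : 0 <= T -> T < e ->
  (forall v s, `|s| < e -> {for s, continuous (A ^~ v)}) ->
  (forall v s, `|s| < e -> {for s, continuous (B ^~ v)}) ->
  exists2 u : R -> R * R -> R, lode T c A B u &
    exists2 e', T < e' <= e & forall v s, `|s| < e' -> {for s, continuous (u ^~ v)}.
Proof.
move=> T0 Te cA cB; pose M := (T + e) / 2.
have TM : T < M by rewrite /M; lra.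
have Me : M < e by rewrite /M; lra.
have M0 : 0 <= M by lra.
have /choice[u Hu] : forall v : R * R, exists u : R -> R, u 0 = c /\
    forall t, `|t| < M -> is_derive1 t u (A t v * u t + B t v).
  move=> v; have [u u0 du] := @linear_ode R (A ^~ v) (B ^~ v) c M e M0 Me (cA v) (cB v).
  by exists u.
exists (fun s v => u v s).
  split=> [v|s v /andP[s0 sT]]; first by have [] := Hu v.
  have [_] := Hu v; apply; rewrite (ger0_norm s0); exact: le_lt_trans TM.
exists M; first by rewrite TM ltW.
by move=> v s sM; have [_ /(_ s sM)] := Hu v; exact: is_derive_continuous.
Qed.

Lemma ode_first (A B u : R -> R) T (c a : R) : 0 <= a -> u 0 = c ->
  (forall s, 0 <= s <= T -> is_derive1 s u (A s * u s + B s)) ->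
  (forall s, 0 <= s <= T -> [/\ `|A s| <= a, `|B s| <= a & `|u s| <= a]) ->
  forall s, 0 <= s <= T -> `|u s - c| <= (a * a + a) * s.
Proof.
move=> a0 u0 du H s /andP[s0 sT].
have := @MVT_norm R u (fun x => A x * u x + B x) 0 s (a * a + a).
rewrite u0 subr0 (ger0_norm s0); apply => x; rewrite min_l// max_r// => /andP[x0 xs].
  by apply: du; rewrite x0 (le_trans xs).
have [|h1 h2 h3] := H x; first by rewrite x0 (le_trans xs).
by rewrite (le_trans (ler_normD _ _))// normrM lerD// ler_pM.
Qed.

(** The derivative of [u] differs from [A0 * c + D0] by at most a constant times [s]; integration
    gains one power of [s]. *)
Lemma ode_second (A B u : R -> R) T (c a k A0 D0 : R) : 0 <= a -> 0 <= k -> u 0 = c ->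
  (forall s, 0 <= s <= T -> is_derive1 s u (A s * u s + B s)) ->
  (forall s, 0 <= s <= T -> [/\ `|A s| <= a, `|A s - A0| <= k * s, `|B s - D0| <= k * s
     & `|u s - c| <= k * s]) ->
  forall s, 0 <= s <= T -> `|u s - c - s * (A0 * c + D0)| <= (a + `|c| + 1) * k * s ^+ 2.
Proof.
move=> a0 k0 u0 du H; apply: (@ode_small R u _ T c _ _ _ du) => //.
  by rewrite mulr_ge0// !addr_ge0.
move=> s sT; have [h1 h2 h3 h4] := H s sT.
rewrite (_ : _ - _ = A s * (u s - c) + ((A s - A0) * c + (B s - D0))); last by ring.
rewrite (_ : (_ + _ + _) * _ * _ = a * (k * s) + (`|c| * (k * s) + k * s)); last by ring.
rewrite (le_trans (ler_normD _ _))// lerD//; first by rewrite normrM; apply: ler_pM.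
rewrite (le_trans (ler_normD _ _))// lerD// normrM mulrC; exact: ler_wpM2l.
Qed.

Lemma common_bound (l : seq R) : exists2 b : R, 0 <= b & forall x, x \in l -> x <= b.
Proof.
elim: l => [|x l [b b0 H]]; first by exists 0.
exists (Num.max x b); first by rewrite le_max b0 orbT.
by move=> y; rewrite inE le_max => /orP[/eqP->|/H->]; rewrite ?lexx ?orbT.
Qed.

Lemma normM_le (a b x y : R) : `|x| <= a -> `|y| <= b -> `|x * y| <= a * b.
Proof. by move=> ? ?; rewrite normrM ler_pM. Qed.

Lemma normD_le (a b x y : R) : `|x| <= a -> `|y| <= b -> `|x + y| <= a + b.
Proof. by move=> ? ?; rewrite (le_trans (ler_normD _ _))// lerD. Qed.

Section source_bounds.
Variables (b e p q : R).
Hypotheses (b0 : 0 <= b) (e0 : 0 <= e) (pb : `|p| <= b) (qb : `|q| <= b) (pe : `|p| <= e) (qe : `|q - 1| <= e).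

Let K := b + 2 * (b * b) + b * b * b.
Let bb : 0 <= b * b. Proof. exact: mulr_ge0. Qed.
Let bbb : 0 <= b * b * b. Proof. exact: mulr_ge0. Qed.
Let be : 0 <= b * e. Proof. exact: mulr_ge0. Qed.
Let bbe : 0 <= b * b * e. Proof. exact: mulr_ge0. Qed.

(** Here and in the next three lemmas the expression is the source term in the equation of a second
    derivative of the flow, where [p] and [q] are its first derivatives, close to 0 and 1 for small
    times. The first bound compares the source with its value at time 0, linearly in [e]; the second
    is a uniform bound. *)
Lemma source_px (W1 W2 W3 W4 D0 : R) : `|W1| <= b -> `|W2| <= b -> `|W3| <= b -> `|W4| <= b -> `|W3 - D0| <= e ->
  `|(W1 + W2 * p) * p + (W3 + W4 * p) - D0| <= (b + 1) ^+ 2 * e /\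
  `|(W1 + W2 * p) * p + (W3 + W4 * p)| <= K.
Proof.
move=> h1 h2 h3 h4 h5; split.
  rewrite (_ : _ - _ = W1 * p + W2 * p * p + ((W3 - D0) + W4 * p)); last by ring.
  apply: (le_trans (normD_le (normD_le (normM_le h1 pe) (normM_le (normM_le h2 pb) pe))
    (normD_le h5 (normM_le h4 pe)))); rewrite expr2; lra.
rewrite (_ : _ * p + _ = W1 * p + W2 * p * p + (W3 + W4 * p)); last by ring.
apply: (le_trans (normD_le (normD_le (normM_le h1 pb) (normM_le (normM_le h2 pb) pb))
    (normD_le h3 (normM_le h4 pb)))); rewrite /K; lra.
Qed.

Lemma source_pz (W1 W2 D0 : R) : `|W1| <= b -> `|W2| <= b -> `|W2 - D0| <= e -> `|D0| <= b ->
  `|W1 * q * p + W2 * q - D0| <= (b + 1) ^+ 2 * e /\ `|W1 * q * p + W2 * q| <= K.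
Proof.
move=> h1 h2 h3 h4; split.
  rewrite (_ : _ - _ = W1 * q * p + (W2 - D0) * q + D0 * (q - 1)); last by ring.
  apply: (le_trans (normD_le (normD_le (normM_le (normM_le h1 qb) pe) (normM_le h3 qb))
    (normM_le h4 qe))); rewrite expr2; move: be bbe e0; lra.
apply: (le_trans (normD_le (normM_le (normM_le h1 qb) pb) (normM_le h2 qb))).
rewrite /K; move: b0 bb bbb; lra.
Qed.

Lemma source_qx (W1 W2 D0 : R) : `|W1| <= b -> `|W2| <= b -> `|W1 - D0| <= e ->
  `|(W1 + W2 * p) * q + 0 - D0| <= (b + 1) ^+ 2 * e /\ `|(W1 + W2 * p) * q + 0| <= K.
Proof.
move=> h1 h2 h3; split.
  rewrite (_ : _ - _ = (W1 - D0) + W1 * (q - 1) + W2 * q * p); last by ring.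
  apply: (le_trans (normD_le (normD_le h3 (normM_le h1 qe)) (normM_le (normM_le h2 qb) pe))).
  rewrite expr2; move: be bbe e0; lra.
rewrite (_ : _ + 0 = W1 * q + W2 * p * q); last by ring.
apply: (le_trans (normD_le (normM_le h1 qb) (normM_le (normM_le h2 pb) qb))).
rewrite /K; move: b0 bb bbb; lra.
Qed.

Lemma source_qz (W1 D0 : R) : `|W1| <= b -> `|W1 - D0| <= e ->
  `|W1 * q * q + 0 - D0| <= (b + 1) ^+ 2 * e /\ `|W1 * q * q + 0| <= K.
Proof.
move=> h1 h2; split.
  rewrite (_ : _ - _ = (W1 - D0) + W1 * q * (q - 1) + W1 * (q - 1)); last by ring.
  apply: (le_trans (normD_le (normD_le h2 (normM_le (normM_le h1 qb) qe)) (normM_le h1 qe))).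
  rewrite expr2; move: be bbe e0; lra.
rewrite addr0; apply: (le_trans (normM_le (normM_le h1 qb) qb)).
rewrite /K; move: b0 bb bbb; lra.
Qed.

End source_bounds.

Variable w : R * R -> R.
Hypothesis sw : csmooth w.
Let wz := d_z w.
Let wx := d_x w.
Let swz : csmooth wz := csmooth_dz sw.
Let swx : csmooth wx := csmooth_dx sw.

(** What is used of the time-[T] map: its first derivatives [p] and [q], its second derivatives, and
    their expansions in [T]. As for the last field, the height of a point of the graph solves
    [u' = wz * u - wx]. Since [q] solves the homogeneous equation and [p] the one with source [wx],
    the solution is [u 0 * q - p]. *)
Record slice_map T (g : R -> R * R -> R) C (p q px pz qx qz : R * R -> R) : Prop := SliceMap {
  slice_map_dif : forall v, dif (g T) v (p v) (q v);
  slice_map_difp : forall v, dif p v (px v) (pz v);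
  slice_map_difq : forall v, dif q v (qx v) (qz v);
  slice_map_cont : [/\ continuous px, continuous pz, continuous qx & continuous qz];
  slice_map_q1 : forall v, `|q v - 1| <= C * T;
  slice_map_q : forall v, `|q v - 1 - T * wz v| <= C * T ^+ 2;
  slice_map_px : forall v, `|px v - T * d_x wx v| <= C * T ^+ 2;
  slice_map_pz : forall v, `|pz v - T * d_z wx v| <= C * T ^+ 2;
  slice_map_qx : forall v, `|qx v - T * d_x wz v| <= C * T ^+ 2;
  slice_map_qz : forall v, `|qz v - T * d_z wz v| <= C * T ^+ 2;
  slice_map_ode : forall (u : R -> R) v,
    (forall s, 0 <= s <= T -> is_derive1 s u (wz (v.1, g s v) * u s - wx (v.1, g s v))) ->
    u T = u 0 * q v - p v }.

Lemma csmooth_BL W : csmooth W -> exists2 C, 0 <= C & (forall v, `|W v| <= C) /\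
  (forall x y z, `|W (x, y) - W (x, z)| <= C * `|y - z|).
Proof.
move=> sW; have [C1 C10 H1] := csmooth_bound sW; have [C2 C20 H2] := csmooth_lip sW.
exists (C1 + C2); first by rewrite addr_ge0.
split=> [v|x y z]; first by rewrite (le_trans (H1 v))// lerDl.
have := H2 (x, z) 0 (y - z); rewrite /= addr0 [z + _]addrC subrK normr0 add0r => H.
by rewrite (le_trans H)// ler_wpM2r// lerDr.
Qed.

(** The derivatives of the flow are constructed as solutions of the successive equations of
    variation; the Taylor estimates identify them as derivatives, and [ode_second] expands them in
    time. *)
Lemma slice_map_exists : exists2 C, 0 <= C & forall T (e : R) g, 0 <= T -> T <= 1 -> T < e ->
  (forall v, g 0 v = v.2) ->
  (forall s v, `|s| < e -> is_derive1 s (g ^~ v) (w (v.1, g s v))) ->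
  exists (p q px pz qx qz : R * R -> R), slice_map T g C p q px pz qx qz.
Proof.
have [b0 b00 [B0 L0]] := csmooth_BL sw.
have [b1 b10 [B1 L1]] := csmooth_BL swz; have [b2 b20 [B2 L2]] := csmooth_BL swx.
have [b3 b30 [B3 L3]] := csmooth_BL (csmooth_dx swz).
have [b4 b40 [B4 L4]] := csmooth_BL (csmooth_dz swz).
have [b5 b50 [B5 L5]] := csmooth_BL (csmooth_dx swx).
have [b6 b60 [B6 L6]] := csmooth_BL (csmooth_dz swx).
have [c1 c10 H1] := along_reg1 sw swz; have [c2 c20 H2] := along_reg1 sw swx.
have c120 : 0 <= c1 + c2 by rewrite addr_ge0.
have [c3 c30 H3] := lin1 0 c120; have [c4 c40 H4] := lin1 1 c120.
have [b bb bge] := common_bound [:: b0; b1; b2; b3; b4; b5; b6; c3; c4].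
have [b_0 b_1 b_2 b_3 b_4] : [/\ b0 <= b, b1 <= b, b2 <= b, b3 <= b & b4 <= b] by split; apply: bge; rewrite !inE eqxx ?orbT.
have [b_5 b_6 b_c3 b_c4] : [/\ b5 <= b, b6 <= b, c3 <= b & c4 <= b] by split; apply: bge; rewrite !inE eqxx ?orbT.
pose a := b + 2 * (b * b) + b * b * b.
have ba : b <= a by rewrite /a -addrA lerDl addr_ge0// ?mulr_ge0.
have a0 : 0 <= a := le_trans bb ba.
pose m := a * a + a.
have m0 : 0 <= m by rewrite addr_ge0// mulr_ge0.
have bbm : b * b <= m by rewrite (le_trans (ler_pM bb bb ba ba))// lerDl.
pose k := (b + 1) ^+ 2 * m.
have mk : m <= k by apply: ler_peMl => //; rewrite exprn_ege1// lerDr.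
have k0 : 0 <= k := le_trans m0 mk.
exists ((a + 1 + 1) * k); first exact: (mulr_ge0 (addr_ge0 (addr_ge0 a0 ler01) ler01) k0).
move=> T e g T0 T1 Te g0 dg.
have fg : slice_flow w T g.
  by split=> // s v /andP[s0 sT]; apply: dg; rewrite (ger0_norm s0); exact: le_lt_trans Te.
have cg v s : `|s| < e -> {for s, continuous (g ^~ v)}.
  by move=> se; exact: is_derive_continuous (dg s v se).
have ca W : csmooth W -> forall v s, `|s| < e -> {for s, continuous ((along W g) ^~ v)}.
  move=> sW v s se; apply: continuous_pair_comp; [exact: csmooth_cont|exact: cst_continuous|exact: cg].
have [p lp [e1 /andP[Te1 e1e] cp]] := @lode_exists T e 0 _ _ T0 Te (ca _ swz) (ca _ swx).
have [q lq [e2 /andP[Te2 e2e] cq]] := @lode_exists T e 1 (along wz g) (fun _ _ => 0) T0 Te (ca _ swz) (fun v s _ => @cst_continuous _ _ 0 s).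
pose mm := Num.min e1 e2.
have Tm : T < mm by rewrite lt_min Te1.
have mE s : `|s| < mm -> [/\ `|s| < e1, `|s| < e2 & `|s| < e].
  by rewrite lt_min => /andP[x y]; split => //; exact: lt_le_trans e1e.
have cam W : csmooth W -> forall v s, `|s| < mm -> {for s, continuous ((along W g) ^~ v)}.
  by move=> sW v s /mE[_ _ se]; exact: ca.
have cpm v s : `|s| < mm -> {for s, continuous (p ^~ v)} by move=> /mE[s1 _ _]; exact: cp.
have cqm v s : `|s| < mm -> {for s, continuous (q ^~ v)} by move=> /mE[_ s1 _]; exact: cq.
have cb W1 W2 W3 W4 v s : csmooth W1 -> csmooth W2 -> csmooth W3 -> csmooth W4 -> `|s| < mm ->
    {for s, continuous (fun s => (along W1 g s v + along W2 g s v * p s v) * p s v + (along W3 g s v + along W4 g s v * p s v))}.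
  move=> s1 s2 s3 s4 sm; apply: continuousD; first apply: continuousM; last first.
  - by apply: continuousD; [exact: cam|apply: continuousM; [exact: cam|exact: cpm]].
  - exact: cpm.
  - by apply: continuousD; [exact: cam|apply: continuousM; [exact: cam|exact: cpm]].
have cb2 W1 W2 v s : csmooth W1 -> csmooth W2 -> `|s| < mm ->
    {for s, continuous (fun s => (along W1 g s v + along W2 g s v * p s v) * q s v + 0)}.
  move=> s1 s2 sm; apply: continuousD; last exact: cst_continuous.
  apply: continuousM; last exact: cqm.
  by apply: continuousD; [exact: cam|apply: continuousM; [exact: cam|exact: cpm]].
have cb3 W1 W2 v s : csmooth W1 -> csmooth W2 -> `|s| < mm ->
    {for s, continuous (fun s => along W1 g s v * q s v * p s v + along W2 g s v * q s v)}.
  move=> s1 s2 sm; apply: continuousD; last by cont.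
  by apply: continuousM; [apply: continuousM; [exact: cam|exact: cqm]|exact: cpm].
have cb4 W1 v s : csmooth W1 -> `|s| < mm ->
    {for s, continuous (fun s => along W1 g s v * q s v * q s v + 0)}.
  move=> s1 sm; apply: continuousD; last exact: cst_continuous.
  by apply: continuousM; [apply: continuousM; [exact: cam|exact: cqm]|exact: cqm].
have swzx := csmooth_dx swz; have swzz := csmooth_dz swz.
have swxx := csmooth_dx swx; have swxz := csmooth_dz swx.
have [px lpx _] := @lode_exists T mm 0 _ _ T0 Tm (cam _ swz) (fun v s => cb _ _ _ _ v s swzx swzz swxx swxz).
have [pz lpz _] := @lode_exists T mm 0 _ _ T0 Tm (cam _ swz) (fun v s => cb3 _ _ v s swzz swxz).
have [qx lqx _] := @lode_exists T mm 0 _ _ T0 Tm (cam _ swz) (fun v s => cb2 _ _ v s swzx swzz).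
have [qz lqz _] := @lode_exists T mm 0 _ _ T0 Tm (cam _ swz) (fun v s => cb4 _ v s swzz).
have r1 := H1 T g p q T1 fg lp lq; have r2 := H2 T g p q T1 fg lp lq.
have c1_ : c1 <= c1 + c2 by rewrite lerDl.
have c2_ : c2 <= c1 + c2 by rewrite lerDr.
have R1 := reg1_le c1_ r1.
have R0 : reg1 T (c1 + c2) (fun _ _ => 0) (fun _ _ => 0) (fun _ _ => 0).
  have z0 : reg0 T (c1 + c2) (fun _ _ => 0) by apply: reg0_cst; rewrite normr0.
  by split => // s v h l _; rewrite !mul0r !subr0 normr0 mulr_ge0// sqr_ge0.
have [[bp lip_p] [bpx lpx'] [bpz lpz'] tp] := H3 _ _ _ _ _ _ _ _ _ _ T1 R1 (reg1_le c2_ r2) lp lpx lpz.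
have [[bq lip_q] [bqx lqx'] [bqz lqz'] tq] := H4 _ _ _ _ _ _ _ _ _ _ T1 R1 R0 lq lqx lqz.
have [c5 c50 H5] := slice_flow_taylor sw.
have TT : 0 <= T <= T by rewrite T0 lexx.
have gs s v : 0 <= s <= T -> `|g s v - v.2| <= b * s.
  move=> /andP[s0 sT]; have := @MVT_norm R (g ^~ v) (fun s => w (v.1, g s v)) 0 s b.
  rewrite g0 subr0 (ger0_norm s0); apply => x; rewrite min_l// max_r// => /andP[x0 xs].
    by apply: (proj2 fg); rewrite x0 (le_trans xs).
  exact: le_trans (B0 _) b_0.
have aW W c : 0 <= c -> (forall x y z, `|W (x, y) - W (x, z)| <= c * `|y - z|) -> c <= b ->
    forall s v, 0 <= s <= T -> `|along W g s v - W v| <= m * s.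
  move=> cc LW cb' s v sT; have := LW v.1 (g s v) v.2; rewrite /along -surjective_pairing => h.
  have s0 : 0 <= s by case/andP: sT.
  apply: (le_trans h); apply: (@le_trans _ _ (b * (b * s))).
    by apply: ler_pM => //; exact: gs.
  by rewrite mulrA ler_wpM2r.
have first c (u Bs : R -> R * R -> R) v : lode T c (along wz g) Bs u ->
    bdd T b u -> (forall s, 0 <= s <= T -> `|Bs s v| <= a) -> forall s, 0 <= s <= T -> `|u s v - c| <= m * s.
  move=> lu bu hB; apply: (@ode_first _ _ (u ^~ v) T c a a0 (proj1 lu v) (fun s => proj2 lu s v)).
  move=> s sT; split; [exact: le_trans (B1 _) (le_trans b_1 ba)|exact: hB|exact: le_trans (bu s v sT) ba].
have pb s v : 0 <= s <= T -> `|p s v| <= b by move=> sT; exact: le_trans (bp s v sT) b_c3.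
have qb s v : 0 <= s <= T -> `|q s v| <= b by move=> sT; exact: le_trans (bq s v sT) b_c4.
have sp v s : 0 <= s <= T -> `|p s v| <= m * s.
  move=> sT; rewrite -[p s v]subr0; move: s sT; apply: (@first 0 p _ v lp (fun s v sT => pb s v sT)) => s' _.
  exact: le_trans (B2 _) (le_trans b_2 ba).
have sq v s : 0 <= s <= T -> `|q s v - 1| <= m * s.
  by move=> sT; apply: (@first 1 q _ v lq (fun s v sT => qb s v sT)) => // s' _; rewrite normr0.
have second c (u : R -> R * R -> R) (Bs : R -> R * R -> R) D0 v : `|c| <= 1 ->
    lode T c (along wz g) Bs u -> bdd T b u ->
    (forall s, 0 <= s <= T -> `|Bs s v - D0| <= (b + 1) ^+ 2 * (m * s) /\ `|Bs s v| <= a) ->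
    `|u T v - c - T * (wz v * c + D0)| <= (a + 1 + 1) * k * T ^+ 2.
  move=> cc lu bu hB; have := @ode_second _ _ (u ^~ v) T c a k (wz v) D0 a0 k0 (proj1 lu v) (fun s => proj2 lu s v).
  move=> H; apply: (@le_trans _ _ ((a + `|c| + 1) * k * T ^+ 2)).
    apply: (H _ _ TT) => s sT; have s0 : 0 <= s by case/andP: sT.
    have [hB1 hB2] := hB s sT.
    split; [exact: le_trans (B1 _) (le_trans b_1 ba)| |by rewrite /k -mulrA|].
      by apply: (le_trans (aW _ _ b10 L1 b_1 s v sT)); rewrite ler_wpM2r.
    apply: (@le_trans _ _ (m * s)); last by rewrite ler_wpM2r.
    by apply: (@first c u Bs v lu bu) => // s' sT'; have [] := hB s' sT'.
  by rewrite ler_wpM2r ?sqr_ge0// ler_wpM2r// lerD2r lerD2l.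
have nz : `|0 : R| <= 1 by rewrite normr0.
have ms s : 0 <= s <= T -> 0 <= m * s by move=> /andP[s0 _]; exact: mulr_ge0.
have bpx' : bdd T b px by exact: bdd_le bpx.
have bpz' : bdd T b pz by exact: bdd_le bpz.
have bqx' : bdd T b qx by exact: bdd_le bqx.
have bqz' : bdd T b qz by exact: bdd_le bqz.
have B3' v := le_trans (B3 v) b_3.
have B4' v := le_trans (B4 v) b_4.
have B5' v := le_trans (B5 v) b_5.
have B6' v := le_trans (B6 v) b_6.
exists (p T), (q T), (px T), (pz T), (qx T), (qz T).
split.
- by move=> v; exact: (@taylor_dif _ T c5 g p q T v c50 TT (H5 T g p q T1 fg lp lq)).
- by move=> v; exact: (@taylor_dif _ T c3 p px pz T v c30 TT tp).
- by move=> v; exact: (@taylor_dif _ T c4 q qx qz T v c40 TT tq).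
- by split; [exact: (@lip_continuous _ T c3 px T c30 TT lpx')|exact: (@lip_continuous _ T c3 pz T c30 TT lpz')|exact: (@lip_continuous _ T c4 qx T c40 TT lqx')|exact: (@lip_continuous _ T c4 qz T c40 TT lqz')].
- move=> v; apply: (le_trans (sq v T TT)); rewrite ler_wpM2r//.
  by apply: (le_trans mk); apply: (ler_peMl k0); rewrite lerDr; exact: addr_ge0 a0 ler01.
- move=> v; have := @second 1 q (fun _ _ => 0) 0 v _ lq (fun s v sT => qb s v sT); rewrite mulr1 addr0; apply.
    by rewrite normr1.
  move=> s sT; rewrite subr0 normr0; split=> //.
  by rewrite mulr_ge0 ?sqr_ge0// ms.
- move=> v; have := @second 0 px _ (d_x wx v) v nz lpx bpx'; rewrite mulr0 add0r subr0; apply.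
  move=> s sT; apply: source_px; [exact: pb|exact: sp|exact: B3'|exact: B4'|exact: B5'|exact: B6'|].
  exact: (aW _ _ b50 L5 b_5 s v sT).
- move=> v; have := @second 0 pz _ (d_z wx v) v nz lpz bpz'; rewrite mulr0 add0r subr0; apply.
  move=> s sT; apply: source_pz; [exact: bb|exact: ms|exact: pb|exact: qb|exact: sp|exact: sq|exact: B4'|exact: B6'| |exact: B6'].
  exact: (aW _ _ b60 L6 b_6 s v sT).
- move=> v; have := @second 0 qx _ (d_x wz v) v nz lqx bqx'; rewrite mulr0 add0r subr0; apply.
  move=> s sT; apply: source_qx; [exact: bb|exact: ms|exact: pb|exact: qb|exact: sp|exact: sq|exact: B3'|exact: B4'|].
  exact: (aW _ _ b30 L3 b_3 s v sT).
- move=> v; have := @second 0 qz _ (d_z wz v) v nz lqz bqz'; rewrite mulr0 add0r subr0; apply.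
  move=> s sT; apply: source_qz; [exact: bb|exact: ms|exact: qb|exact: sq|exact: B4'|].
  exact: (aW _ _ b40 L4 b_4 s v sT).
- move=> u v du.
  have [_ dp] := lp; have [_ dq] := lq.
  have Dd x : 0 <= x <= T -> is_derive1 x (fun y => u y - (u 0 * q y v - p y v))
     (wz (v.1, g x v) * (u x - (u 0 * q x v - p x v))).
    move=> xT; have D1 := du x xT; have D2 := dp x v xT; have D3 := dq x v xT.
    apply: (derive_cast (is_deriveB D1 (is_deriveB (is_deriveM (is_derive_cst (u 0) x (1:R)) D3) D2))) => //.
    by rewrite scaler0 addr0 /GRing.scale/= /cst /along; ring.
  have := @gronwall _ _ _ T b 0 bb (lexx 0) T1 Dd _ T TT.
  rewrite (proj1 lp) (proj1 lq) mulr1 !subr0 subrr normr0 addr0 mulr0 => H.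
  have /H : forall s, 0 <= s <= T -> `|wz (v.1, g s v) * (u s - (u 0 * q s v - p s v))| <=
       b * `|u s - (u 0 * q s v - p s v)| + 0.
    by move=> s sT; rewrite addr0 normrM ler_wpM2r// (le_trans (B1 _) b_1).
  by rewrite normr_le0 subr_eq0 => /eqP.
Qed.

End small_time.

Section slice_maps.
Context {R : realType}.
Implicit Types (T C e : R) (w : R * R -> R) (g : R -> R * R -> R).

Lemma slice_ode_unique w T (x : R) (u1 u2 : R -> R) : csmooth w -> T <= 1 ->
  (forall s, 0 <= s <= T -> is_derive1 s u1 (w (x, u1 s))) ->
  (forall s, 0 <= s <= T -> is_derive1 s u2 (w (x, u2 s))) ->
  u1 0 = u2 0 -> forall s, 0 <= s <= T -> u1 s = u2 s.
Proof.
move=> sw T1 D1 D2 u12 s sT.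
have [L L0 HL] := csmooth_lip sw.
have Dd y : 0 <= y <= T -> is_derive1 y (fun y => u1 y - u2 y) (w (x, u1 y) - w (x, u2 y)).
  by move=> yT; have E1 := D1 y yT; have E2 := D2 y yT; exact: is_deriveB.
have := @gronwall _ _ _ T L 0 L0 (lexx 0) T1 Dd _ s sT.
rewrite u12 subrr normr0 addr0 mulr0 normr_le0 subr_eq0 => H; apply/eqP; apply: H => y yT.
have := HL (x, u2 y) 0 (u1 y - u2 y).
by rewrite /= !addr0 [u2 y + _]addrC subrK normr0 add0r.
Qed.

Definition local_flow w e g := (forall v, g 0 v = v.2) /\
  forall s v, `|s| < e -> is_derive1 s (g ^~ v) (w (v.1, g s v)).

Lemma is_derive_neg (u : R -> R) (s a : R) : is_derive1 (- s) u a ->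
  is_derive1 s (fun s => u (- s)) (- a).
Proof.
move=> D; have E : is_derive1 s (fun y => - y) (-1) by exact: is_deriveN (is_derive_id _ _).
by have := @is_derive1_comp R u (fun y => - y) s _ _ D E; rewrite mulrN1.
Qed.

Lemma local_flow_neg w e g : local_flow w e g ->
  local_flow (fun v => - w v) e (fun s v => g (- s) v).
Proof.
move=> [g0 dg]; split=> [v|s v se]; first by rewrite oppr0.
by apply: (@is_derive_neg (g ^~ v)); apply: dg; rewrite normrN.
Qed.

(** [s |-> g (- s) (v.1, g T v)] and [s |-> g (T - s) v] solve the same reversed equation with the
    same initial value. *)
Lemma local_flow_inverse w e g T v : csmooth w -> local_flow w e g ->
  0 <= T -> T <= 1 -> T < e -> g (- T) (v.1, g T v) = v.2.
Proof.
move=> sw fg T0 T1 Te; have [g0 dg] := fg.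
have [_ dn] := local_flow_neg fg.
have TT : 0 <= T <= T by rewrite T0 lexx.
have := @slice_ode_unique _ T v.1 (fun s => g (- s) (v.1, g T v)) (fun s => g (T - s) v)
  (csmooth_opp sw) T1 _ _ _ T TT.
rewrite subrr g0; apply.
- move=> s /andP[s0 sT]; apply: (dn s (v.1, g T v)); rewrite ger0_norm//; exact: le_lt_trans Te.
- move=> s /andP[s0 sT].
  have D : is_derive1 (T - s) (g ^~ v) (w (v.1, g (T - s) v)).
    by apply: dg; rewrite ger0_norm ?subr_ge0//; apply: le_lt_trans Te; rewrite lerBlDr lerDl.
  have E : is_derive1 s (fun y => T - y) (-1).
    by apply: (derive_cast (is_deriveB (is_derive_cst T s 1) (is_derive_id s 1))) => //; rewrite sub0r.
  by have := @is_derive1_comp R (g ^~ v) (fun y => T - y) s _ _ D E; rewrite mulrN1.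
- by rewrite subr0 oppr0 g0.
Qed.

(** The hypothesis on [z] amounts to [w v = 0]; the point is then stationary by uniqueness. *)
Lemma local_flow_fix w e g s v : csmooth w -> local_flow w e g -> (forall z, w z = 0 \/ z != v) ->
  `|s| < e -> `|s| <= 1 -> g s v = v.2.
Proof.
move=> sw.
have pos w' g' t : csmooth w' -> local_flow w' e g' -> (forall z, w' z = 0 \/ z != v) ->
    0 <= t -> t < e -> t <= 1 -> g' t v = v.2.
  move=> sw' [g0 dg] wv t0 te t1; have tt : 0 <= t <= t by rewrite t0 lexx.
  apply: (@slice_ode_unique _ t v.1 (g' ^~ v) (fun=> v.2) sw' t1 _ _ (g0 v) t tt) => y /andP[y0 yt].
    by apply: dg; rewrite ger0_norm//; exact: le_lt_trans te.
  have -> : w' (v.1, v.2) = 0 by have [//|] := wv (v.1, v.2); rewrite -surjective_pairing eqxx.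
  exact: is_derive_cst.
move=> fg wv; have [s0|s0] := leP 0 s.
  by rewrite (ger0_norm s0) => se s1; exact: (pos w g s).
rewrite (ltr0_norm s0) => se s1.
have := pos _ _ (- s) (csmooth_opp sw) (local_flow_neg fg) _ _ se s1.
rewrite opprK; apply; last by rewrite oppr_ge0 ltW.
by move=> z; have [->|] := wv z; [left; rewrite oppr0|right].
Qed.

(** Change of variables on each vertical line: if [F] is an antiderivative of [psi (x, .)], then
    [F (G (x, .))] is one of the right-hand integrand, and [G] fixes both ends of [[-r, r]]. Fubini
    assembles the lines. *)
Lemma slice_substitution (psi G q : R * R -> R) (r : R) : 0 < r -> continuous psi -> csupp r psi ->
  continuous G -> continuous q -> (forall v, is_dz v G (q v)) ->
  (forall v, r <= `|v.1| \/ r <= `|v.2| -> G v = v.2) ->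
  \int[mu2]_v psi v = \int[mu2]_v (psi (v.1, G v) * q v).
Proof.
move=> r0 cpsi spsi cG cq dG GE.
have cc : continuous (fun v => psi (v.1, G v) * q v).
  move=> v; apply: contM; last exact: cq.
  apply: (cont_comp (fun v => (v.1, G v)) psi); last exact: cpsi.
  have c1 : {for v, continuous (fun u => u.1)} by exact: cvg_fst.
  exact: (cvg_pair c1 (cG v)).
have sc : csupp r (fun v => psi (v.1, G v) * q v).
  move=> v nv; rewrite GE; first by rewrite -surjective_pairing spsi ?mul0r.
  have [h1|h1] := leP r `|v.1|; [by left|right]; rewrite leNgt; apply/negP => h2.
  by apply: nv; split; exact: ltW.
rewrite (Rfubini cpsi spsi).2 (Rfubini cc sc).2.
apply: eq_Rintegral => x _ /=.
have zr (z : R) : ~~ (- r <= z <= r) -> r <= `|z|.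
  by rewrite -ler_norml -ltNge; exact: ltW.
rewrite (@Rint_itv_setT _ (- r) r); last first.
  by move=> z zr'; apply: spsi; rewrite /Box/= => -[_]; rewrite ler_norml (negbTE zr').
rewrite (@Rint_itv_setT _ (- r) r); last first.
  move=> z zr'; rewrite GE; last by right; exact: zr.
  by rewrite spsi ?mul0r// /Box/= => -[_]; rewrite ler_norml (negbTE zr').
have [C C0 HC] : exists2 C : R, 0 < C & forall z, - r <= z <= r -> `|G (x, z)| <= C.
  have [C C0 HC] := @compact_bound R (Box (Num.max r `|x|)) G (@Box_compact R _) (fun v _ => cG v).
  by exists C => // z zr'; apply: HC; split; rewrite /= le_max ?lexx ?orbT// ler_norml zr'.
(* [F] is also evaluated at [G (x, z)], which may leave [[-r, r]] but is bounded by [C]. *)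
have [F HF] := @antiderivative R (fun z => psi (x, z)) (C + r + 1) (@continuous2_fix1 R psi x cpsi).
have rr : - r < r by rewrite gt0_cp.
have e1 : (\int[lebesgue_measure]_(z in `[(- r)%R, r]) (psi (x, z))%:E = (F r - F (- r))%:E)%E.
  apply: FTC_is_derive => // z zr'; last exact: (@continuous2_fix1 R psi x cpsi).
  by apply: HF; apply: (@le_lt_trans _ _ r); [rewrite ler_norml|lra].
have e2 : (\int[lebesgue_measure]_(z in `[(- r)%R, r]) (psi (x, G (x, z)) * q (x, z))%:E = (F (G (x, r)) - F (G (x, - r)))%:E)%E.
  apply: (@FTC_is_derive R (fun z => F (G (x, z)))) => // z zr'; last exact: (@continuous2_fix1 R (fun v => psi (v.1, G v) * q v) x cc).
  have D := (is_derive_dz _ (x, z) _).1 (dG (x, z)).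
  have D2 : is_derive (G (x, z)) (1:R) F (psi (x, G (x, z))).
    by apply: HF; have := HC z zr'; lra.
  by have := @is_derive1_comp R F (fun z => G (x, z)) z _ _ D2 D; rewrite mulrC.
by rewrite /Rintegral e1 e2/= !GE//=; right; rewrite /= ?normrN ger0_norm ?(ltW r0).
Qed.

End slice_maps.

(** * Expansion of the energy along the flow *)

Section second_order.
Context {R : realType}.
Variables (b c M T : R).
Hypotheses (b0 : 0 <= b) (c0 : 0 <= c) (M0 : 0 <= M) (T0 : 0 <= T) (T1 : T <= 1).
Variables (f G q px pz qx qz wz wxx wxz wzx wzz : R).
Hypotheses (fM : `|f| <= M) (bz : `|wz| <= b) (bxx : `|wxx| <= b) (bxz : `|wxz| <= b)
  (bzx : `|wzx| <= b) (bzz : `|wzz| <= b)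
  (eq : `|q - 1 - T * wz| <= c * T ^+ 2) (epx : `|px - T * wxx| <= c * T ^+ 2)
  (epz : `|pz - T * wxz| <= c * T ^+ 2) (eqx : `|qx - T * wzx| <= c * T ^+ 2)
  (eqz : `|qz - T * wzz| <= c * T ^+ 2).

(** [G] is the intrinsic gradient of the graph at a point, [k] that of the flowed graph at the image
    point, [q] the Jacobian of the flow on the plane, and [N] the second intrinsic derivative of
    [w]. *)
Let k := - px + f * pz + q * G + f * qx - f ^+ 2 * qz.
Let N := wxx - f * (wxz + wzx) + f ^+ 2 * wzz - G * wz.
Let X := 1 + `|G|.
Let m := 1 + 2 * M + M ^+ 2.

Let r1 := k - G + T * N.
Let r2 := q - 1 - T * wz.

Definition second_order_constant : R :=
  let n := b * m in let c1 := c * m in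
  (n ^+ 2 + c1 ^+ 2 + 2 * n * c1 + 2 * c1) * (1 + b + c) + 2 * n * (b + c) + c.

Let G0 : 0 <= `|G|. Proof. exact: normr_ge0. Qed.
Let m1 : 1 <= m. Proof. by have := sqr_ge0 M; move: M0; rewrite /m; lra. Qed.
Let f2 : `|f ^+ 2| <= M ^+ 2.
Proof. by rewrite normrX; apply: lerXn2r; rewrite ?nnegrE. Qed.
Let lin (a1 a2 a3 a4 a5 d : R) : 0 <= d -> `|a1| <= d -> `|a2| <= d -> `|a3| <= d -> `|a4| <= d -> `|a5| <= d ->
  `|a1 - f * (a2 + a3) + f ^+ 2 * a4 - G * a5| <= d * m * X.
Proof.
move=> d0 h1 h2 h3 h4 h5.
have H : `|a1 - f * (a2 + a3) + f ^+ 2 * a4 - G * a5| <= d + M * (d + d) + M ^+ 2 * d + `|G| * d.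
  apply: normD_le; first apply: normD_le; first apply: normD_le => //.
  - by rewrite normrN; apply: normM_le => //; exact: normD_le.
  - exact: normM_le.
  - by rewrite normrN normrM ler_wpM2l.
apply: (le_trans H).
have dG : `|G| * d <= `|G| * d * m by rewrite ler_peMr// mulr_ge0.
rewrite (_ : d * m * X = d * m + `|G| * d * m); last by rewrite /X; ring.
by move: dG; rewrite /m; lra.
Qed.
Let Nb : `|N| <= b * m * X. Proof. exact: lin. Qed.
Let T2 : 0 <= T ^+ 2. Proof. exact: sqr_ge0. Qed.
Let r1b : `|r1| <= c * m * X * T ^+ 2.
Proof.
have -> : r1 = - ((px - T * wxx) - f * ((pz - T * wxz) + (qx - T * wzx)) + f ^+ 2 * (qz - T * wzz)
  - G * (q - 1 - T * wz)) by rewrite /r1 /k /N; ring.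
rewrite normrN; apply: (le_trans (lin _ epx epz eqx eqz eq)); first by rewrite mulr_ge0.
by apply: eq_ler; ring.
Qed.

(** [k = G - T * N + r1] and [q = 1 + T * wz + r2] with remainders of order [T ^ 2]. As [k] and [N]
    are affine in [G], all errors are at most a constant times [X ^ 2 * T ^ 2], where [X = 1 + |G|],
    and [X ^ 2 <= 2 * (1 + G ^ 2)]. Integrated, this bound becomes energy plus area. *)
Lemma second_order : `|2^-1 * (k ^+ 2 * q) - 2^-1 * G ^+ 2 - T * (- (N * G) + 2^-1 * (G ^+ 2 * wz))| <=
  second_order_constant * (1 + G ^+ 2) * T ^+ 2.
Proof.
pose n := b * m; pose c1 := c * m.
have n0 : 0 <= n by rewrite mulr_ge0// (le_trans ler01).
have c10 : 0 <= c1 by rewrite mulr_ge0// (le_trans ler01).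
have X0 : 0 <= X by rewrite addr_ge0.
have X1 : 1 <= X by rewrite lerDl.
have GX : `|G| <= X by rewrite lerDr.
have TT : T ^+ 2 <= T by rewrite expr2 ler_piMr.
have T21 : T ^+ 2 <= 1 by exact: le_trans TT T1.
have XX : 0 <= X ^+ 2 by exact: sqr_ge0.
have r2b : `|r2| <= c * T ^+ 2 by [].
have Tn : `|T| <= T by rewrite ger0_norm.
have TNb : `|T * N| <= n * X * T.
  by have := normM_le Tn Nb; rewrite -/n; have -> : T * (n * X) = n * X * T by ring.
pose E1 := (T * N) * (T * N) + r1 * r1 - 2 * (T * N) * r1 + 2 * G * r1.
pose e1 := n ^+ 2 + c1 ^+ 2 + 2 * n * c1 + 2 * c1.
have two : `|2 : R| <= 2 by rewrite normr_nat.
have c1X : 0 <= c1 * X by rewrite mulr_ge0.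
have r1T : `|r1| <= c1 * X * T.
  by apply: (le_trans r1b); rewrite -/c1 ler_wpM2l.
have E1b : `|E1| <= e1 * (X ^+ 2 * T ^+ 2).
  apply: (le_trans (normD_le (normD_le (normD_le (normM_le TNb TNb) (normM_le r1T r1T)) _) (normM_le (normM_le two GX) r1b))).
    by rewrite normrN; exact: normM_le (normM_le two TNb) r1T.
  by rewrite -/c1 /e1; apply: eq_ler; ring.
have qb : `|q| <= 1 + b + c.
  rewrite (_ : q = 1 + T * wz + r2); last by rewrite /r2; ring.
  apply: normD_le; first apply: normD_le; first by rewrite normr1.
    by apply: (le_trans (normM_le Tn bz)); rewrite ler_piMl.
  by apply: (le_trans r2b); rewrite ler_piMr.
have sb : `|T * wz + r2| <= (b + c) * T.
  apply: (le_trans (normD_le (normM_le Tn bz) r2b)).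
  by rewrite mulrDl [T * b]mulrC lerD2l ler_wpM2l.
have key : k ^+ 2 * q - G ^+ 2 - 2 * T * (- (N * G) + 2^-1 * (G ^+ 2 * wz)) =
    E1 * q - 2 * (T * N) * G * (T * wz + r2) + G * G * r2.
  have kE : k = G - T * N + r1 by rewrite /r1; ring.
  by move: kE; rewrite /E1 /r2; generalize k r1 N => k' A B ->; field.
have H : `|k ^+ 2 * q - G ^+ 2 - 2 * T * (- (N * G) + 2^-1 * (G ^+ 2 * wz))| <=
    second_order_constant * (X ^+ 2 * T ^+ 2).
  rewrite key; apply: (le_trans (normD_le (normD_le (normM_le E1b qb) _) (normM_le (normM_le GX GX) r2b))).
    by rewrite normrN; exact: normM_le (normM_le (normM_le two TNb) GX) sb.
  rewrite /second_order_constant -/n -/c1 -/e1; apply: eq_ler; ring.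
have S0 : 0 <= second_order_constant.
  rewrite /second_order_constant -/n -/c1; move: n0 c10; generalize n c1 => n' c' n0 c10.
  have h1 : 0 <= 2 * n' * c' by rewrite !mulr_ge0.
  have h2 : 0 <= 2 * c' by rewrite mulr_ge0.
  have h3 : 0 <= 2 * n' * (b + c) by rewrite !mulr_ge0// addr_ge0.
  have h4 : 0 <= 1 + b + c by rewrite !addr_ge0.
  have h5 : 0 <= n' ^+ 2 + c' ^+ 2 + 2 * n' * c' + 2 * c' by rewrite !addr_ge0// sqr_ge0.
  exact: addr_ge0 (addr_ge0 (mulr_ge0 h5 h4) h3) c0.
have X2 : X ^+ 2 <= 2 * (1 + G ^+ 2).
  rewrite -(real_normK (num_real G)) /X; have := sqr_ge0 (1 - `|G|); rewrite !expr2; lra.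
rewrite (_ : 2^-1 * _ - _ - _ = 2^-1 * (k ^+ 2 * q - G ^+ 2 - 2 * T * (- (N * G) + 2^-1 * (G ^+ 2 * wz)))); last by field.
rewrite normrM ger0_norm ?invr_ge0//.
have H2 : second_order_constant * (X ^+ 2 * T ^+ 2) <= second_order_constant * (2 * (1 + G ^+ 2) * T ^+ 2).
  by rewrite ler_wpM2l// ler_wpM2r.
have := le_trans H H2; set L := `|_|; move: second_order_constant => S.
rewrite (_ : S * (2 * (1 + G ^+ 2) * T ^+ 2) = 2 * (S * (1 + G ^+ 2) * T ^+ 2)); last by ring.
lra.
Qed.

End second_order.

Lemma is_derive_unique {R : realType} (V W : normedModType R) (f : V -> W) (x v : V) (a b : W) :
  is_derive x v f a -> is_derive x v f b -> a = b.
Proof. by move=> [_ <-] [_ <-]. Qed.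

Lemma is_derive_fst {R : realType} (x v : R * R) : is_derive x v (fun y : R * R => y.1) v.1.
Proof.
apply/is_derive_line/is_derive_leP => e e0; exists 1 => // h _ /=.
by rewrite (_ : _ - _ - _ = 0) ?normr0 ?mulr_ge0 ?(ltW e0)//= /GRing.scale/=; ring.
Qed.

Lemma is_derive_snd {R : realType} (x v : R * R) : is_derive x v (fun y : R * R => y.2) v.2.
Proof.
apply/is_derive_line/is_derive_leP => e e0; exists 1 => // h _ /=.
by rewrite (_ : _ - _ - _ = 0) ?normr0 ?mulr_ge0 ?(ltW e0)//= /GRing.scale/=; ring.
Qed.

Lemma patch_measurable {R : realType} (U Om : set (R * R)) (g : R * R -> R) : open U -> open Om -> Om `<=` U ->
  (cont_on Om g) -> measurable_fun (mset U) (g \_ Om).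
Proof.
move=> oU oOm OU cg.
apply: (proj1 (@measurable_restrict _ _ (mvplane R) (measurableTypeR R) Om U g _ _)).
- exact: meas_open2.
- exact: meas_open2.
- by rewrite setIidr//; exact: cont2_measurable.
Qed.

Section off_graph_energy.
Context {R : realType}.
Variables (U : set (R * R)) (I : set R) (ga dga : R -> R) (f fx fz G : R * R -> R) (B : R).
Hypotheses (oU : open U) (bU : bounded_set U) (oI : open I) (UI : forall v, U v -> I v.1)
  (dga_ga : forall x, I x -> is_derive1 x ga (dga x))
  (cdga : cont_on I dga)
  (cf : cont_on U f).
Let Om : set (R * R) := off_graph U ga.
Hypotheses (dfx : forall v, Om v -> is_dx v f (fx v))
  (dfz : forall v, Om v -> is_dz v f (fz v))
  (cfx : cont_on Om fx)
  (cfz : cont_on Om fz)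
  (GE : forall v, Om v -> G v = fx v - f v * fz v)
  (GB : forall v, Om v -> `|G v| <= B) (B0 : 0 <= B).

Let oOm : open Om. Proof. exact: off_graph_open oU oI UI dga_ga. Qed.
Let OU : Om `<=` U. Proof. by move=> v []. Qed.
Let mU : measurable (mset U). Proof. exact: meas_open2. Qed.
Let mOm : measurable (mset Om). Proof. exact: meas_open2. Qed.
Let cG v : Om v -> {for v, continuous G}.
Proof.
move=> Ov; apply: (@continuous_near_eq _ _ _ _ (fun v => fx v - f v * fz v)).
  by apply: (open_near oOm Ov); exact: GE.
apply: contB; first exact: cfx.
by apply: contM; [exact: cf (OU Ov)|exact: cfz].
Qed.

(** The patch of [G] by 0 on the curve is measurable and bounded on [U], and represents the
    distributional gradient; the value chosen on the curve does not matter as the curve is a null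
    set. *)
Lemma off_graph_energy : energy U f = (2^-1 * \int[mu2]_(v in Om) (G v ^+ 2))%:E.
Proof.
have BG v : U v -> `|(G \_ Om) v| <= B.
  move=> Uv; rewrite patchE; case: ifPn => [|_]; first by rewrite inE; exact: GB.
  by rewrite [point](_ : _ = 0) ?normr0.
have mG : measurable_fun (mset U) (G \_ Om) by exact: patch_measurable.
have PE v : Om v -> (G \_ Om) v = G v by move=> Ov; rewrite patchE mem_set.
have dG : is_distributional_nabla U f (G \_ Om).
  apply: (distributional_nabla_classical oU oI UI dga_ga cdga cf dfx dfz cfx cfz _ BG mG).
  by move=> v Ov; rewrite PE// GE.
have := energy_value oU bU oOm OU (graph_area0 oU oI UI dga_ga) dG _ BG B0.
move=> ->; last first.
  move=> v Ov; apply: (@continuous_near_eq _ _ _ _ G); last exact: cG.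
  by apply: (open_near oOm Ov) => w; exact: PE.
congr ((_ * _)%:E).
rewrite (Rint_off_graph oU oI UI dga_ga).
  by apply: eq_Rintegral => v; rewrite inE => Ov; rewrite PE.
apply: (bounded_on_integrable bU (C := B ^+ 2)) => //; first exact: measurable_funX.
by move=> v Uv; rewrite normrX lerXn2r ?nnegrE// BG.
Qed.

End off_graph_energy.

Section flowed_energy.
Context {R : realType}.
Variables (U : set (R * R)) (I : set R) (ga dga : R -> R) (f fx fz G : R * R -> R) (B M : R).
Hypotheses (oU : open U) (bU : bounded_set U) (oI : open I) (UI : forall v, U v -> I v.1)
  (dga_ga : forall x, I x -> is_derive1 x ga (dga x))
  (cdga : cont_on I dga)
  (cf : cont_on U f).
Let Om : set (R * R) := off_graph U ga.
Hypotheses (dfx : forall v, Om v -> is_dx v f (fx v))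
  (dfz : forall v, Om v -> is_dz v f (fz v))
  (cfx : cont_on Om fx)
  (cfz : cont_on Om fz)
  (GE : forall v, Om v -> G v = fx v - f v * fz v)
  (GB : forall v, Om v -> `|G v| <= B) (B0 : 0 <= B) (M0 : 0 <= M)
  (fM : forall v, U v -> `|f v| <= M).

Let oOm : open Om. Proof. exact: (off_graph_open oU oI UI dga_ga). Qed.
Let OU : Om `<=` U. Proof. by move=> v []. Qed.
Let mU : measurable (mset U). Proof. exact: meas_open2. Qed.
Let mOm : measurable (mset Om). Proof. exact: meas_open2. Qed.

Variables (w : R * R -> R) (e T C : R) (g : R -> R * R -> R) (p q px pz qx qz p' q' f1 : R * R -> R).
Hypotheses (tw : test_function U w) (sw : csmooth w) (fg : local_flow w e g)
  (T0 : 0 <= T) (T1 : T <= 1) (Te : T < e) (C0 : 0 <= C)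
  (sm : slice_map w T g C p q px pz qx qz)
  (dg' : forall v, dif (g (- T)) v (p' v) (q' v)) (cp' : continuous p') (cq' : continuous q').

Let K := closure [set v | w v != 0].
Let Phi (v : R * R) : R * R := (v.1, g T v).
Let Phi' (v : R * R) : R * R := (v.1, g (- T) v).
Let F (v : R * R) : R := - p v + q v * f v.
Hypothesis f1E : forall v, U v -> f1 (Phi v) = F v.

Let PhiK v : Phi' (Phi v) = v.
Proof. by rewrite /Phi' /= (local_flow_inverse v sw fg T0 T1 Te) -surjective_pairing. Qed.
Let PhiK' v : Phi (Phi' v) = v.
Proof.
have := local_flow_inverse v (csmooth_opp sw) (local_flow_neg fg) T0 T1 Te.
by rewrite /Phi /= opprK => ->; rewrite -surjective_pairing.
Qed.
Let fix_off (s : R) v : ~ K v -> `|s| < e -> `|s| <= 1 -> g s v = v.2.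
Proof.
move=> nK; apply: (local_flow_fix sw fg) => z.
have [->|] := eqVneq z v; [left|by right].
exact: test_function0 tw nK.
Qed.
Let Tn : `|T| < e /\ `|T| <= 1. Proof. by rewrite ger0_norm. Qed.
(** Off the support of [w], which lies in [U], the flow is the identity; so neither the flow nor its
    inverse leaves [U]. *)
Let PhiU v : U v -> U (Phi v).
Proof.
move=> Uv; have [KP|nK] := pselect (K (Phi v)); first by case: tw => _ _; apply.
have := PhiK v; rewrite /Phi' fix_off// ?normrN; [|exact: Tn.1|exact: Tn.2].
by rewrite -surjective_pairing => ->.
Qed.
Let PhiU' v : U v -> U (Phi' v).
Proof.
move=> Uv; have [KP|nK] := pselect (K (Phi' v)); first by case: tw => _ _; apply.
have := PhiK' v; rewrite /Phi fix_off//; [|exact: Tn.1|exact: Tn.2].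
by rewrite -surjective_pairing => ->.
Qed.
Let gaT x : R := g T (x, ga x).
Let dgaT x : R := p (x, ga x) + q (x, ga x) * dga x.
Let OmT : set (R * R) := (off_graph U gaT).

Let PhiOm v : Om v -> OmT (Phi v).
Proof.
move=> [Uv ng]; split; first exact: PhiU.
apply/eqP => /= E; move/eqP: ng; apply.
by rewrite -(local_flow_inverse v sw fg T0 T1 Te) E /gaT (local_flow_inverse (v.1, ga v.1) sw fg T0 T1 Te).
Qed.
Let PhiOm' v : OmT v -> Om (Phi' v).
Proof.
move=> [Uv ng]; split; first exact: PhiU'.
apply/eqP => /= E; move/eqP: ng; apply.
by rewrite -[in LHS](PhiK' v) /Phi /= /Phi' E.
Qed.
Let cp : continuous p. Proof. by move=> v; exact: dif_continuous (slice_map_difp sm v). Qed.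
Let cq : continuous q. Proof. by move=> v; exact: dif_continuous (slice_map_difq sm v). Qed.
Let cgT : continuous (g T). Proof. by move=> v; exact: dif_continuous (slice_map_dif sm v). Qed.
Let cpair (u : R * R -> R) : continuous u -> continuous (fun v : R * R => (v.1, u v)).
Proof.
move=> cu v; have c1 : {for v, continuous (fun u : R*R => u.1)} by exact: cvg_fst.
exact: cvg_pair c1 (cu v).
Qed.
Let cPhi : continuous Phi. Proof. exact: cpair. Qed.
Let cPhi' : continuous Phi'.
Proof. by apply: cpair => v; exact: dif_continuous (dg' v). Qed.
Let cga x : I x -> {for x, continuous ga}.
Proof. by move=> Ix; exact: is_derive_continuous (dga_ga Ix). Qed.
Let dgaT_ga x : I x -> is_derive1 x gaT (dgaT x).
Proof.
move=> Ix; have := @dif_is_derive R R^o (g T) id ga x 1 _ _ _ _ (slice_map_dif sm (x, ga x)) (is_derive_id x 1) (dga_ga Ix).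
by rewrite mulr1.
Qed.
Let cdgaT x : I x -> {for x, continuous dgaT}.
Proof.
move=> Ix; have cc (u : R * R -> R) : continuous u -> {for x, continuous (fun y => u (y, ga y))}.
  by move=> cu; apply: continuous_pair_comp => //; exact: cga.
by cont.
Qed.
(** Differentiation of [g (- T) (v.1, g T v) = v.2] in [z] and in [x]. *)
Let rel v : q v * q' (Phi v) = 1 /\ p' (Phi v) + q' (Phi v) * p v = 0.
Proof.
have E : (fun y => g (- T) (y.1, g T y)) = (fun y => y.2).
  by apply/funext => y; rewrite (local_flow_inverse y sw fg T0 T1 Te).
split.
  have D := @dif_is_derive R (R * R)%type (g (- T)) (fun y => y.1) (g T) v (0, 1) _ _ _ _ (dg' (Phi v)) (is_derive_fst _ _) (dif_dz (slice_map_dif sm v)).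
  have := is_derive_unique D; rewrite E => /(_ _ (is_derive_snd _ _)).
  by rewrite /= mulr0 add0r mulrC.
have D := @dif_is_derive R (R * R)%type (g (- T)) (fun y => y.1) (g T) v (1, 0) _ _ _ _ (dg' (Phi v)) (is_derive_fst _ _) (dif_dx (slice_map_dif sm v)).
have := is_derive_unique D; rewrite E => /(_ _ (is_derive_snd _ _)).
by rewrite /= mulr1.
Qed.
Let Fx (v : R * R) : R := - px v + (qx v * f v + q v * fx v).
Let Fz (v : R * R) : R := - pz v + (qz v * f v + q v * fz v).

Let dFx v : Om v -> is_dx v F (Fx v).
Proof.
by move=> Ov; apply: (derive_cast (is_deriveD (is_deriveN (dif_dx (slice_map_difp sm v))) (is_deriveM (dif_dx (slice_map_difq sm v)) (dfx Ov)))) => //; rewrite /Fx /GRing.scale/=; ring.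
Qed.
Let dFz v : Om v -> is_dz v F (Fz v).
Proof.
by move=> Ov; apply: (derive_cast (is_deriveD (is_deriveN (dif_dz (slice_map_difp sm v))) (is_deriveM (dif_dz (slice_map_difq sm v)) (dfz Ov)))) => //; rewrite /Fz /GRing.scale/=; ring.
Qed.
Let cpx : continuous px. Proof. by case: (slice_map_cont sm). Qed.
Let cpz : continuous pz. Proof. by case: (slice_map_cont sm). Qed.
Let cqx : continuous qx. Proof. by case: (slice_map_cont sm). Qed.
Let cqz : continuous qz. Proof. by case: (slice_map_cont sm). Qed.
Let clin (a b d : R * R -> R) (y : R * R -> R) v : {for v, continuous a} -> {for v, continuous b} ->
  {for v, continuous d} -> {for v, continuous y} ->
  {for v, continuous (fun u => - a u + (b u * f u + d u * y u))} \/ ~ U v.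
Proof.
move=> ca cb cd cy; have [Uv|] := pselect (U v); [left|by right].
by apply: contD; [exact: contN|apply: contD; apply: contM => //; exact: cf].
Qed.
Let cFx v : Om v -> {for v, continuous Fx}.
Proof. by move=> Ov; case: (clin (@cpx v) (@cqx v) (@cq v) (cfx Ov)) => // -[]; exact: OU. Qed.
Let cFz v : Om v -> {for v, continuous Fz}.
Proof. by move=> Ov; case: (clin (@cpz v) (@cqz v) (@cq v) (cfz Ov)) => // -[]; exact: OU. Qed.
Let cF v : U v -> {for v, continuous F}.
Proof.
move=> Uv; apply: contD.
  by apply: continuousN; exact: cp.
by apply: contM; [exact: cq|exact: cf].
Qed.
Let dF v : Om v -> dif F v (Fx v) (Fz v).
Proof.
move=> Ov; apply: C1_dif; [|  |exact: cFx|exact: cFz].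
  by apply: (open_near oOm Ov); exact: dFx.
by apply: (open_near oOm Ov); exact: dFz.
Qed.
Let h (v : R * R) : R := F (Phi' v).
Let hx (v : R * R) : R := Fx (Phi' v) + Fz (Phi' v) * p' v.
Let hz (v : R * R) : R := Fz (Phi' v) * q' v.

Let dhx v : OmT v -> is_dx v h (hx v).
Proof.
move=> Ov; have := @dif_is_derive R (R * R)%type F (fun y => y.1) (g (- T)) v (1, 0) _ _ _ _ (dF (PhiOm' Ov)) (is_derive_fst _ _) (dif_dx (dg' v)).
by rewrite mulr1.
Qed.
Let dhz v : OmT v -> is_dz v h (hz v).
Proof.
move=> Ov; have := @dif_is_derive R (R * R)%type F (fun y => y.1) (g (- T)) v (0, 1) _ _ _ _ (dF (PhiOm' Ov)) (is_derive_fst _ _) (dif_dz (dg' v)).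
by rewrite mulr0 add0r.
Qed.
Let comp' (u : R * R -> R) v : {for Phi' v, continuous u} -> {for v, continuous (fun y => u (Phi' y))}.
Proof. by move=> cu; apply: (cont_comp Phi' u); [exact: cPhi'|exact: cu]. Qed.
Let ch v : U v -> {for v, continuous h}.
Proof. by move=> Uv; apply: comp'; apply: cF; exact: PhiU'. Qed.
Let chx v : OmT v -> {for v, continuous hx}.
Proof.
move=> Ov; apply: contD.
  by apply: comp'; apply: cFx; exact: PhiOm'.
apply: contM; last exact: cp'.
by apply: comp'; apply: cFz; exact: PhiOm'.
Qed.
Let chz v : OmT v -> {for v, continuous hz}.
Proof.
move=> Ov; apply: contM; last exact: cq'.
by apply: comp'; apply: cFz; exact: PhiOm'.
Qed.
Let k (v : R * R) : R := - px v + f v * pz v + q v * G v + f v * qx v - f v ^+ 2 * qz v.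

Let kE v : OmT v -> hx v - h v * hz v = k (Phi' v).
Proof.
move=> Ov; have [r1 r2] := rel (Phi' v); rewrite PhiK' in r1 r2.
have O := PhiOm' Ov.
rewrite /hx /hz /h /k (GE O); set u := Phi' v in r1 r2 *.
have -> : Fx u + Fz u * p' v - F u * (Fz u * q' v) =
   Fx u + Fz u * (p' v + q' v * p u) - f u * Fz u * (q u * q' v) by rewrite /F; ring.
by rewrite r1 r2 /Fx /Fz; ring.
Qed.
Let ck v : Om v -> {for v, continuous k}.
Proof.
move=> Ov.
apply: (@continuous_near_eq _ _ _ _ (fun v => Fx v - f v * Fz v)).
  by apply: (open_near oOm Ov) => y Oy; rewrite /k (GE Oy) /Fx /Fz; ring.
apply: contB; first exact: cFx.
by apply: contM; [exact: cf (OU Ov)|exact: cFz].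
Qed.
Let kB : exists2 B1, 0 <= B1 & forall v, Om v -> `|k v| <= B1 /\ `|q v| <= B1.
Proof.
have [r r0 Ur] := bounded_Box bU.
have bd (u : R * R -> R) : continuous u -> exists2 c, 0 <= c & forall v, U v -> `|u v| <= c.
  move=> cu; have [c c0 Hc] := @compact_bound R (Box r) u (@Box_compact R r) (fun v _ => cu v).
  by exists c; [exact: ltW|move=> v /Ur; exact: Hc].
have [c1 c10 H1] := bd _ cpx; have [c2 c20 H2] := bd _ cpz; have [c3 c30 H3] := bd _ cq.
have [c4 c40 H4] := bd _ cqx; have [c5 c50 H5] := bd _ cqz.
exists (c1 + M * c2 + c3 * B + M * c4 + M ^+ 2 * c5 + c3); first by rewrite !addr_ge0// mulr_ge0// sqr_ge0.
move=> v Ov; have Uv := OU Ov.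
have n0 : 0 <= c1 + M * c2 + c3 * B + M * c4 + M ^+ 2 * c5 by rewrite !addr_ge0// mulr_ge0// sqr_ge0.
split; last by rewrite (le_trans (H3 v Uv))// lerDr.
apply: (@le_trans _ _ (c1 + M * c2 + c3 * B + M * c4 + M ^+ 2 * c5)); last by rewrite lerDl.
have fv := fM Uv.
rewrite /k; apply: normD_le; first apply: normD_le; first apply: normD_le; first apply: normD_le.
- by rewrite normrN; exact: H1.
- by apply: normM_le => //; exact: H2.
- by apply: normM_le; [exact: H3|exact: GB].
- by apply: normM_le => //; exact: H4.
- rewrite normrN; apply: normM_le; last exact: H5.
  by rewrite normrX lerXn2r ?nnegrE.
Qed.
Let oOmT : open OmT. Proof. exact: off_graph_open oU oI UI dgaT_ga. Qed.
Let OUT : OmT `<=` U. Proof. by move=> v []. Qed.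
Let mOmT : measurable (mset OmT). Proof. exact: meas_open2. Qed.
Let ckP v : OmT v -> {for v, continuous (fun y => k (Phi' y))}.
Proof. by move=> Ov; apply: comp'; apply: ck; exact: PhiOm'. Qed.

(** On [U], [f1] coincides with [h], the transport of [F] by the inverse flow, which is classical
    off the flowed curve; this gives the energy as an integral over [OmT]. The substitution back to
    [Om] wants an integrand continuous on the plane, so it is made for the squares of grid
    approximations of [k (Phi' v)], and both sides pass to the limit by dominated convergence. *)
Lemma flowed_energy : energy U f1 = (2^-1 * \int[mu2]_(v in Om) (k v ^+ 2 * q v))%:E.
Proof.
have [B1 B10 HB] := kB.
have kPB v : OmT v -> `|k (Phi' v)| <= B1 by move=> Ov; have [] := HB _ (PhiOm' Ov).
have -> : energy U f1 = energy U h.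
  by apply: energy_eq => // v Uv; rewrite -[in LHS](PhiK' v) f1E//; exact: PhiU'.
rewrite (off_graph_energy oU bU oI UI dgaT_ga cdgaT ch dhx dhz chx chz _ kPB B10); last first.
  by move=> v Ov; rewrite kE.
congr ((_ * _)%:E).
pose psi n := grid OmT (fun v => k (Phi' v)) n.
have tpsi n : test_function OmT (psi n) by exact: grid_test.
have psiB n v : `|psi n v| <= B1 by exact: grid_bound kPB B10 n v.
have cpsi n : continuous (psi n) by exact: test_cont (tpsi n).
have cc n : continuous (fun v => psi n v ^+ 2).
  by move=> v; apply: contM; exact: cpsi.
have [r r0 Ur] := bounded_Box bU.
have psi0 n v : ~ OmT v -> psi n v = 0.
  by move=> nO; apply: (test_function0 (tpsi n)) => /(test_sub (tpsi n)).
have dt v : is_dz v (g T) (q v) by exact: dif_dz (slice_map_dif sm v).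
have sub n : \int[mu2]_(v in OmT) (psi n v ^+ 2) = \int[mu2]_(v in Om) (psi n (Phi v) ^+ 2 * q v).
  have E1 : \int[mu2]_(v in OmT) (psi n v ^+ 2) = \int[mu2]_v (psi n v ^+ 2).
    rewrite Rintegral_mkcond; apply: eq_Rintegral => v _; rewrite patchE.
    by have [Ov|nO] := pselect (OmT v); [rewrite mem_set|rewrite memNset// psi0 ?expr0n].
  have E2 : \int[mu2]_(v in Om) (psi n (Phi v) ^+ 2 * q v) = \int[mu2]_v (psi n (Phi v) ^+ 2 * q v).
    rewrite Rintegral_mkcond; apply: eq_Rintegral => v _; rewrite patchE.
    have [Ov|nO] := pselect (Om v); [by rewrite mem_set|rewrite memNset// psi0 ?expr0n ?mul0r//].
    by move=> /PhiOm'; rewrite PhiK.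
  rewrite E1 E2; have r1 : 0 < r + 1 by rewrite addr_gt0.
  apply: (slice_substitution r1 (cc n) _ cgT cq dt).
    move=> v nB; rewrite psi0 ?expr0n// => -[/Ur [a b] _]; apply: nB; rewrite /Box /=.
    by split; rewrite ler_wpDr.
  move=> v rv; apply: fix_off; [|exact: Tn.1|exact: Tn.2] => Kv.
  have [Uv1 Uv2] : Box r v by apply: Ur; case: tw => _ _; apply.
  by case: rv; apply/negP; rewrite -ltNge; apply: ltr_pwDr.
have iB C' (D : set (R * R)) : D `<=` U -> measurable (mset D) -> integrable2 D (fun=> C').
  by move=> DU mD; apply: (@bounded_on_integrable R U bU D _ `|C'|).
have mpsi n (D : set (R * R)) : open D -> measurable_fun (mset D) (psi n).
  by move=> oD; apply: cont2_measurable => // v _; exact: cpsi.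
have cOm v : OmT v -> psi n v @[n --> \oo] --> k (Phi' v).
  by move=> Ov; exact: @grid_cvg R OmT _ oOmT ckP v Ov.
have [|||||_ c1] := @Rdct _ _ (mvplane R) mu2 OmT (fun n v => psi n v ^+ 2) (fun v => k (Phi' v) ^+ 2) (fun=> B1 ^+ 2) mOmT.
- by move=> n; apply: measurable_funX; exact: mpsi.
- by apply: measurable_funX; apply: cont2_measurable => //; exact: ckP.
- by move=> v Ov; rewrite expr2; under eq_fun do rewrite expr2; apply: cvgM; exact: cOm.
- exact: iB.
- by move=> n v Ov; rewrite normrX lerXn2r ?nnegrE.
have [|||||_ c2] := @Rdct _ _ (mvplane R) mu2 Om (fun n v => psi n (Phi v) ^+ 2 * q v) (fun v => k v ^+ 2 * q v) (fun=> B1 ^+ 2 * B1) mOm.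
- move=> n; apply: cont2_measurable => // v _.
  apply: contM; last exact: cq.
  by apply: (cont_comp Phi (fun v => psi n v ^+ 2)); [exact: cPhi|exact: cc].
- apply: cont2_measurable => // v Ov.
  apply: contM; last exact: cq.
  by apply: contM; exact: ck.
- move=> v Ov; apply: cvgM; last exact: cvg_cst.
  have := cOm _ (PhiOm Ov); rewrite PhiK => cv.
  by rewrite expr2; under eq_fun do rewrite expr2; exact: cvgM.
- exact: iB.
- move=> n v Ov; have [_ qv] := HB v Ov.
  by rewrite normrM normrX; apply: ler_pM => //; rewrite lerXn2r ?nnegrE.
have c3 : \int[mu2]_(v in OmT) (psi n v ^+ 2) @[n --> \oo] --> \int[mu2]_(v in Om) (k v ^+ 2 * q v).
  by under eq_fun do rewrite sub; exact: c2.
exact: cvg_unique _ c1 c3.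
Qed.

Lemma flowed_integrable : integrable2 Om (fun v => k v ^+ 2 * q v).
Proof.
have [B1 B10 HB] := kB.
apply: (@bounded_on_integrable R U bU Om _ (B1 ^+ 2 * B1)) => //.
  apply: cont2_measurable => // v Ov.
  apply: contM; last exact: cq.
  by apply: contM; exact: ck.
move=> v Ov; have [kv qv] := HB v Ov.
by rewrite normrM normrX; apply: ler_pM => //; rewrite lerXn2r ?nnegrE.
Qed.

End flowed_energy.

Lemma continuous_second_order {R : realType} (a1 a2 a3 a4 a5 f G : R * R -> R) (v : R * R) :
  {for v, continuous f} -> {for v, continuous G} -> {for v, continuous a1} -> {for v, continuous a2} ->
  {for v, continuous a3} -> {for v, continuous a4} -> {for v, continuous a5} ->
  {for v, continuous (fun v => - ((a1 v - f v * (a2 v + a3 v) + f v ^+ 2 * a4 v - G v * a5 v) * G v) +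
     2^-1 * (G v ^+ 2 * a5 v))}.
Proof.
move=> cf cG c1 c2 c3 c4 c5.
apply: contD; last by apply: contM; [exact: cst_continuous|apply: contM => //; exact: contM].
apply: contN; apply: contM => //; apply: contB; last exact: contM.
apply: contD; last by apply: contM => //; exact: contM.
by apply: contB => //; apply: contM => //; exact: contD.
Qed.

Lemma bounded_second_order {R : realType} (a1 a2 a3 a4 a5 f G b1 b2 b3 b4 b5 M B : R) : 0 <= M -> 0 <= B ->
  `|f| <= M -> `|G| <= B -> `|a1| <= b1 -> `|a2| <= b2 -> `|a3| <= b3 -> `|a4| <= b4 -> `|a5| <= b5 ->
  `|- ((a1 - f * (a2 + a3) + f ^+ 2 * a4 - G * a5) * G) + 2^-1 * (G ^+ 2 * a5)| <=
  (b1 + M * (b2 + b3) + M ^+ 2 * b4 + B * b5) * B + 2^-1 * (B ^+ 2 * b5).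
Proof.
move=> M0 B0 fM GB h1 h2 h3 h4 h5.
have f2 : `|f ^+ 2| <= M ^+ 2 by rewrite normrX lerXn2r ?nnegrE.
have G2 : `|G ^+ 2| <= B ^+ 2 by rewrite normrX lerXn2r ?nnegrE.
apply: normD_le; last first.
  by apply: normM_le; [rewrite ger0_norm// invr_ge0|exact: normM_le].
rewrite normrN; apply: normM_le => //; apply: normD_le; last by rewrite normrN; exact: normM_le.
apply: normD_le; last exact: normM_le.
by apply: normD_le => //; rewrite normrN; apply: normM_le => //; exact: normD_le.
Qed.

Lemma expansion_constant_le {R : realType} (s x J y : R) : 0 <= s -> 0 <= x -> x <= y -> 0 <= J ->
  s * (x + J) <= 2 * (s + 1) * (2^-1 * J + y).
Proof.
move=> s0 x0 xy J0; rewrite (_ : 2 * _ * _ = (s + 1) * (J + 2 * y)); last by field.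
by apply: ler_pM => //; lra.
Qed.

(** [nabla f (nabla f w)] expanded, with [G] in place of [nabla f f]. Second derivatives fall on [w]
    alone, so the expression stays bounded where [d_x f] and [d_z f] may not. *)
Definition second_nabla {R : realType} (w f G : R * R -> R) v : R :=
  d_x (d_x w) v - f v * (d_z (d_x w) v + d_x (d_z w) v) + f v ^+ 2 * d_z (d_z w) v - G v * d_z w v.

Definition var_density {R : realType} (w f G : R * R -> R) v : R :=
  - (second_nabla w f G v * G v) + 2^-1 * (G v ^+ 2 * d_z w v).

Notation energy_expansion_bound U ga w f G f1 T D := (exists2 E1, energy U f1 = E1%:E &
  `|E1 - 2^-1 * \int[mu2]_(v in off_graph U ga) (G v ^+ 2) -
    (\int[mu2]_(v in off_graph U ga) var_density w f G v) * T| <=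
  D * (2^-1 * \int[mu2]_(v in off_graph U ga) (G v ^+ 2) + fine (mu2 U)) * T ^+ 2) (only parsing).

Section energy_expansion.
Context {R : realType}.
Variables (U : set (R * R)) (M : R).
Hypotheses (oU : open U) (bU : bounded_set U) (M0 : 0 <= M).

Lemma test_csmooth (w : R * R -> R) : test_function U w -> csmooth w.
Proof.
move=> tw; split; first exact: test_smooth tw.
have [r r0 Ur] := bounded_Box bU; exists r => v nB.
by apply: (test_function0 tw) => Kv; apply: nB; apply: Ur; exact: (test_sub tw).
Qed.

(* What is used of the graph of [f]: [f] is bounded by [M], continuous on [U]
   and C^1 off the graph of [ga], where [G] is its bounded intrinsic gradient. *)
Record graph_data (I : set R) (ga dga : R -> R) (f fx fz G : R * R -> R) (B : R) : Prop := GraphData {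
  gd_oI : open I;
  gd_UI : forall v, U v -> I v.1;
  gd_dga : forall x, I x -> is_derive1 x ga (dga x);
  gd_cdga : cont_on I dga;
  gd_cf : cont_on U f;
  gd_dfx : forall v, (off_graph U ga) v -> is_dx v f (fx v);
  gd_dfz : forall v, (off_graph U ga) v -> is_dz v f (fz v);
  gd_cfx : forall v, (off_graph U ga) v -> {for v, continuous fx};
  gd_cfz : forall v, (off_graph U ga) v -> {for v, continuous fz};
  gd_GE : forall v, (off_graph U ga) v -> G v = fx v - f v * fz v;
  gd_GB : forall v, (off_graph U ga) v -> `|G v| <= B;
  gd_B0 : 0 <= B;
  gd_fM : forall v, U v -> `|f v| <= M }.

Section data.
Variables (I : set R) (ga dga : R -> R) (f fx fz G : R * R -> R) (B : R).
Hypothesis gd : graph_data I ga dga f fx fz G B.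
Let Om : set (R * R) := off_graph U ga.

Lemma graph_data_open : open Om.
Proof. by case: gd => oI UI dga_ga *; exact: off_graph_open oU oI UI dga_ga. Qed.

Lemma graph_data_cG v : Om v -> {for v, continuous G}.
Proof.
move=> Ov; apply: (@continuous_near_eq _ _ _ _ (fun v => fx v - f v * fz v)).
  by apply: (open_near graph_data_open Ov); exact: (gd_GE gd).
apply: contB; first exact: (gd_cfx gd).
by apply: contM; [exact: (gd_cf gd (proj1 Ov))|exact: (gd_cfz gd)].
Qed.

Lemma graph_data_mOm : measurable (mset Om).
Proof. by apply: meas_open2; exact: graph_data_open. Qed.

Lemma graph_data_integrable (X : R * R -> R) (c : R) : (cont_on Om X) ->
  (forall v, Om v -> `|X v| <= c) -> integrable2 Om X.
Proof.
move=> cX HX; apply: (@bounded_on_integrable R U bU Om X c) => //.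
- by move=> v [].
- exact: graph_data_mOm.
- by apply: cont2_measurable => //; exact: graph_data_open.
Qed.

Lemma graph_data_iG2 : integrable2 Om (fun v => G v ^+ 2).
Proof.
apply: (@graph_data_integrable _ (B ^+ 2)).
  by move=> v Ov; apply: contM; exact: graph_data_cG.
by move=> v Ov; rewrite normrX lerXn2r ?nnegrE ?(gd_B0 gd)//; exact: (gd_GB gd).
Qed.

Lemma graph_data_energy : energy U f = (2^-1 * \int[mu2]_(v in Om) (G v ^+ 2))%:E.
Proof. by case: gd => oI UI dga_ga cdga cf dfx dfz cfx cfz GE GB B0 fM;
  exact: off_graph_energy oU bU oI UI dga_ga cdga cf dfx dfz cfx cfz GE GB B0. Qed.

Variable w : R * R -> R.
Hypothesis tw : test_function U w.
Let sw : csmooth w := test_csmooth tw.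
Let swx := csmooth_dx sw.
Let swz := csmooth_dz sw.

Lemma var_density_continuous v : Om v -> {for v, continuous (var_density w f G)}.
Proof.
move=> Ov; have cG := graph_data_cG Ov; have cf := gd_cf gd (proj1 Ov).
have cw (u : R * R -> R) : csmooth u -> {for v, continuous u} by move=> su; exact: csmooth_cont.
have c1 := cw _ swz.
have c2 := cw _ (csmooth_dx swx); have c3 := cw _ (csmooth_dz swx).
have c4 := cw _ (csmooth_dx swz); have c5 := cw _ (csmooth_dz swz).
exact: continuous_second_order cf cG c2 c3 c4 c5 c1.
Qed.

Lemma var_density_integrable : mu2.-integrable Om (EFin \o var_density w f G).
Proof.
have [b1 b10 H1] := csmooth_bound swz.
have [b2 b20 H2] := csmooth_bound (csmooth_dx swx).
have [b3 b30 H3] := csmooth_bound (csmooth_dz swx).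
have [b4 b40 H4] := csmooth_bound (csmooth_dx swz).
have [b5 b50 H5] := csmooth_bound (csmooth_dz swz).
apply: (@graph_data_integrable _ ((b2 + M * (b3 + b4) + M ^+ 2 * b5 + B * b1) * B + 2^-1 * (B ^+ 2 * b1))).
  exact: var_density_continuous.
move=> v Ov; have fM := gd_fM gd (proj1 Ov); have GB := gd_GB gd Ov.
exact: bounded_second_order M0 (gd_B0 gd) fM GB (H2 v) (H3 v) (H4 v) (H5 v) (H1 v).
Qed.

End data.

(** Integration of [second_order] over [Om]. The derivatives of the inverse flow that
    [flowed_energy] asks for are those of the flow of [- w]. *)
Lemma energy_expansion_pos (w : R * R -> R) : test_function U w -> exists2 D, 0 < D &
  forall I ga dga f fx fz G B e g (Y : R -> R * R -> R) f1 T,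
  graph_data I ga dga f fx fz G B -> local_flow w e g -> 0 <= T -> T <= 1 -> T < e ->
  (forall v, U v -> Y 0 v = f v /\ forall s, 0 <= s <= T ->
     is_derive1 s (Y ^~ v) (d_z w (v.1, g s v) * Y s v - d_x w (v.1, g s v))) ->
  (forall v, U v -> f1 (v.1, g T v) = Y T v) ->
  energy_expansion_bound U ga w f G f1 T D.
Proof.
move=> tw; have sw := test_csmooth tw.
have swx := csmooth_dx sw; have swz := csmooth_dz sw.
have [b1 b10 H1] := csmooth_bound swz.
have [b2 b20 H2] := csmooth_bound (csmooth_dx swx).
have [b3 b30 H3] := csmooth_bound (csmooth_dz swx).
have [b4 b40 H4] := csmooth_bound (csmooth_dx swz).
have [b5 b50 H5] := csmooth_bound (csmooth_dz swz).
have [b b0 bge] := common_bound [:: b1; b2; b3; b4; b5].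
have [b_1 b_2 b_3 b_4 b_5] : [/\ b1 <= b, b2 <= b, b3 <= b, b4 <= b & b5 <= b] by split; apply: bge; rewrite !inE eqxx ?orbT.
have [C C0 HC] := slice_map_exists sw.
have [C' C'0 HC'] := slice_map_exists (csmooth_opp sw).
pose S := second_order_constant b C M.
(* [|S| + 1] ensures positivity; the factor 2 compensates the 1/2 in the energy. *)
exists (2 * (`|S| + 1)); first by rewrite mulr_gt0// ltr_wpDl.
move=> I ga dga f fx fz G B e g Y f1 T gd fg T0 T1 Te HY Hf1.
have [p [q [px [pz [qx [qz sm]]]]]] := HC T e g T0 T1 Te fg.1 fg.2.
have fgn := local_flow_neg fg.
have [p' [q' [px' [pz' [qx' [qz' sm']]]]]] := HC' T e _ T0 T1 Te fgn.1 fgn.2.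
have cp' : continuous p' by move=> v; exact: dif_continuous (slice_map_difp sm' v).
have cq' : continuous q' by move=> v; exact: dif_continuous (slice_map_difq sm' v).
set Om := [set v | _ /\ _].
have f1E v : U v -> f1 (v.1, g T v) = - p v + q v * f v.
  move=> Uv; have [Y0 dY] := HY v Uv.
  by rewrite Hf1// (slice_map_ode sm dY) Y0; ring.
case: (gd) => oI UI dga_ga cdga cf dfx dfz cfx cfz GE GB B0 fM.
have /= E1 := flowed_energy oU bU oI UI dga_ga cdga cf dfx dfz cfx cfz GE GB B0 M0 fM tw sw fg T0 T1 Te sm (slice_map_dif sm') cp' cq' f1E.
have /= I1 := flowed_integrable oU bU oI UI dga_ga cf cfx cfz GE GB B0 M0 fM sm.
rewrite -/Om in E1 I1.
pose k2 v := (- px v + f v * pz v + q v * G v + f v * qx v - f v ^+ 2 * qz v) ^+ 2 * q v.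
rewrite -/k2 in E1 I1.
exists (2^-1 * \int[mu2]_(v in Om) k2 v); first exact: E1.
have mOm := graph_data_mOm gd; rewrite -/Om in mOm.
have I2 := graph_data_iG2 gd; rewrite -/Om in I2.
have I3 := var_density_integrable gd tw; rewrite -/Om in I3.
have IZ (c : R) (X : R * R -> R) : integrable2 Om X -> integrable2 Om (fun v => c * X v).
  move=> iX; have := integrableZl mOm c iX.
  by apply: eq_integrable => // v _; rewrite /= EFinM.
have IB (X1 X2 : R * R -> R) : integrable2 Om X1 -> integrable2 Om X2 ->
    integrable2 Om (fun v => X1 v - X2 v).
  by move=> i1 i2; have := integrableB mOm i1 i2.
have i1 := IZ 2^-1 _ I1; have i2 := IZ 2^-1 _ I2; have i3 := IZ T _ I3.
have -> : 2^-1 * \int[mu2]_(v in Om) k2 v - 2^-1 * \int[mu2]_(v in Om) G v ^+ 2 -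
     (\int[mu2]_(v in Om) var_density w f G v) * T =
   \int[mu2]_(v in Om) (2^-1 * k2 v - 2^-1 * G v ^+ 2 - T * var_density w f G v).
  rewrite [_ * T]mulrC -!RintegralZl//.
  by rewrite RintegralB//; [rewrite RintegralB|exact: IB].
have iA : integrable2 Om (fun=> 1 : R).
  by apply: (@bounded_on_integrable R U bU Om _ `|1|) => // v [].
have iD : integrable2 Om (fun v => 1 + G v ^+ 2).
  by have := integrableD mOm iA I2.
have i123 := IB _ _ (IB _ _ i1 i2) i3.
apply: (le_trans (le_normr_Rintegral mOm i123)).
apply: (@le_trans _ _ (\int[mu2]_(v in Om) ((`|S| * T ^+ 2) * (1 + G v ^+ 2)))).
  apply: le_Rintegral => //; [|exact: IZ|].
    by have := integrable_norm i123.
  move=> v Ov; have Uv : U v by case: Ov.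
  have := @second_order R b C M T b0 C0 M0 T0 T1 (f v) (G v) (q v) (px v) (pz v) (qx v) (qz v) (d_z w v)
    (d_x (d_x w) v) (d_z (d_x w) v) (d_x (d_z w) v) (d_z (d_z w) v) (fM v Uv) (le_trans (H1 v) b_1)
    (le_trans (H2 v) b_2) (le_trans (H3 v) b_3) (le_trans (H4 v) b_4) (le_trans (H5 v) b_5)
    (slice_map_q sm v) (slice_map_px sm v) (slice_map_pz sm v) (slice_map_qx sm v) (slice_map_qz sm v).
  move=> H; apply: (le_trans H); rewrite -/S [leRHS]mulrAC ler_wpM2r ?sqr_ge0//.
  by rewrite ler_wpM2r ?ler_norm// addr_ge0 ?sqr_ge0.
rewrite RintegralZl// RintegralD//.
have -> : \int[mu2]_(v in Om) (1 : R) = fine (mu2 Om).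
  by rewrite Rintegral_cst// mul1r.
have aOm : fine (mu2 Om) <= fine (mu2 U).
  have aU := area_open_lty oU bU.
  have le : (mu2 Om <= mu2 U)%E by apply: le_measure; rewrite ?inE//; [exact: meas_open2|move=> v []].
  by rewrite fine_le// ge0_fin_numE//; exact: le_lt_trans le aU.
set J := \int[mu2]_(v in Om) (G v ^+ 2).
have J0 : 0 <= J by apply: Rintegral_ge0 => v _; exact: sqr_ge0.
have a0 : 0 <= fine (mu2 Om) by exact: fine_ge0.
rewrite [leLHS]mulrAC ler_wpM2r ?sqr_ge0//; exact: expansion_constant_le.
Qed.

Lemma d_xN (w : R * R -> R) : csmooth w -> d_x (fun v => - w v) = fun v => - d_x w v.
Proof.
move=> sw; apply/funext => v.
exact: is_derive_unique (csmooth_is_dx v (csmooth_opp sw)) (is_deriveN (csmooth_is_dx v sw)).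
Qed.

Lemma d_zN (w : R * R -> R) : csmooth w -> d_z (fun v => - w v) = fun v => - d_z w v.
Proof.
move=> sw; apply/funext => v.
exact: is_derive_unique (csmooth_is_dz v (csmooth_opp sw)) (is_deriveN (csmooth_is_dz v sw)).
Qed.

Lemma var_densityN (w f G : R * R -> R) v : csmooth w ->
  var_density (fun v => - w v) f G v = - var_density w f G v.
Proof.
move=> sw; have sx := csmooth_dx sw; have sz := csmooth_dz sw.
rewrite /var_density /second_nabla (d_xN sw) (d_zN sw) (d_xN sx) (d_zN sx) (d_xN sz) (d_zN sz).
by move: (d_x (d_x w) v) (d_z (d_x w) v) (d_x (d_z w) v) (d_z (d_z w) v) (d_z w v) => *; ring.
Qed.

Lemma test_functionN (w : R * R -> R) : test_function U w -> test_function U (fun v => - w v).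
Proof.
move=> tw; apply: (@test_function_of _ _ (closure [set v | w v != 0])).
- by move=> n; apply: Cn_opp; [exact: openT|exact: test_smooth tw n].
- exact: test_compact tw.
- exact: test_sub tw.
- by move=> v nK; rewrite (test_function0 tw nK) oppr0.
Qed.

Lemma variationN (w : R * R -> R) I ga dga f fx fz G B : graph_data I ga dga f fx fz G B -> test_function U w ->
  \int[mu2]_(v in off_graph U ga) var_density (fun v => - w v) f G v =
  - \int[mu2]_(v in off_graph U ga) var_density w f G v.
Proof.
move=> gd tw; have mOm := graph_data_mOm gd.
have iv := var_density_integrable gd tw.
transitivity (\int[mu2]_(v in off_graph U ga) (-1 * var_density w f G v)).
  by apply: eq_Rintegral => v _; rewrite mulN1r var_densityN//; exact: test_csmooth.
by rewrite RintegralZl// mulN1r.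
Qed.

(** Negative times are positive times for the flow of [- w], and the coefficient of [T] is odd in
    [w]. *)
Lemma energy_expansion (w : R * R -> R) : test_function U w -> exists2 D, 0 < D &
  forall I ga dga f fx fz G B e g (Y : R -> R * R -> R) f1 T,
  graph_data I ga dga f fx fz G B -> local_flow w e g -> `|T| <= 1 -> `|T| < e ->
  (forall v, U v -> Y 0 v = f v /\ forall s, `|s| < e ->
     is_derive1 s (Y ^~ v) (d_z w (v.1, g s v) * Y s v - d_x w (v.1, g s v))) ->
  (forall v, U v -> f1 (v.1, g T v) = Y T v) ->
  energy_expansion_bound U ga w f G f1 T D.
Proof.
move=> tw; have sw := test_csmooth tw.
have [D1 D10 H1] := energy_expansion_pos tw.
have [D2 D20 H2] := energy_expansion_pos (test_functionN tw).
exists (D1 + D2); first exact: addr_gt0.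
move=> I ga dga f fx fz G B e g Y f1 T gd fg T1 Te HY Hf1.
set Om := [set v | _ /\ _].
have J0 : 0 <= \int[mu2]_(v in Om) (G v ^+ 2) by apply: Rintegral_ge0 => v _; exact: sqr_ge0.
have A0 : 0 <= fine (mu2 U) by exact: fine_ge0.
have JA : 0 <= 2^-1 * \int[mu2]_(v in Om) (G v ^+ 2) + fine (mu2 U) by rewrite addr_ge0// mulr_ge0.
have [T0|T0] := leP 0 T.
  rewrite (ger0_norm T0) in T1 Te.
  have [|E1 HE HB] := H1 I ga dga f fx fz G B e g Y f1 T gd fg T0 T1 Te _ Hf1.
    move=> v Uv; have [Y0 dY] := HY v Uv; split=> // s /andP[s0 sT]; apply: dY.
    by rewrite ger0_norm// (le_lt_trans sT).
  exists E1 => //; apply: (le_trans HB); rewrite ler_wpM2r ?sqr_ge0// ler_wpM2r//.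
  by rewrite lerDl ltW.
rewrite (ltr0_norm T0) in T1 Te; have nT0 : 0 <= - T by rewrite oppr_ge0 ltW.
have [||E1 HE HB] := H2 I ga dga f fx fz G B e _ (fun s v => Y (- s) v) f1 (- T) gd (local_flow_neg fg) nT0 T1 Te.
- move=> v Uv; have [Y0 dY] := HY v Uv; split=> [|s /andP[s0 sT]]; first by rewrite oppr0.
  have se : `|- s| < e by rewrite normrN ger0_norm// (le_lt_trans sT).
  have := @is_derive_neg _ (Y ^~ v) s _ (dY _ se).
  by rewrite (d_zN sw) (d_xN sw) => H; apply: (derive_cast H) => //; ring.
- by move=> v Uv; rewrite !opprK Hf1.
exists E1 => //; move: HB; rewrite -/Om.
rewrite /Om (variationN gd tw) mulrNN.
rewrite sqrrN => HB; apply: (le_trans HB); rewrite ler_wpM2r ?sqr_ge0// ler_wpM2r//.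
by rewrite lerDr ltW.
Qed.

End energy_expansion.

(** * Horizontal curves and intrinsic Lipschitz graphs *)

Section derivatives_of_pairs.
Context {R : realType}.

Lemma is_derive_cvgP (V W : normedModType R) (f : V -> W) (x v : V) (a : W) :
  is_derive x v f a <-> h^-1 *: (f (h *: v + x) - f x) @[h --> (0 : R)^'] --> a.
Proof.
split=> [[D <-]|H]; first exact: D.
by split; [apply/cvg_ex; exists a|exact/cvg_lim].
Qed.

Lemma is_derive_pair (V W1 W2 : normedModType R) (f : V -> W1) (g : V -> W2) (x v : V) a b :
  is_derive x v f a -> is_derive x v g b -> is_derive x v (fun y => (f y, g y)) (a, b).
Proof.
move=> /is_derive_cvgP Hf /is_derive_cvgP Hg; apply/is_derive_cvgP.
exact: cvg_pair Hf Hg.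
Qed.

Lemma is_derive_fst_comp (V W1 W2 : normedModType R) (f : V -> W1 * W2) (x v : V) a :
  is_derive x v f a -> is_derive x v (fun y => (f y).1) a.1.
Proof.
move=> /is_derive_cvgP H; apply/is_derive_cvgP.
exact: cvg_comp _ _ H (@cvg_fst _ _ (nbhs a.1) (nbhs a.2) _).
Qed.

Lemma is_derive_snd_comp (V W1 W2 : normedModType R) (f : V -> W1 * W2) (x v : V) a :
  is_derive x v f a -> is_derive x v (fun y => (f y).2) a.2.
Proof.
move=> /is_derive_cvgP H; apply/is_derive_cvgP.
exact: cvg_comp _ _ H (@cvg_snd _ _ (nbhs a.1) (nbhs a.2) _).
Qed.

End derivatives_of_pairs.

Section cc_distance.
Context {R : realType}.

(** The Euclidean speed is bounded by [|dx| + |dy|], which is simpler to estimate on explicit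
    polynomial curves. *)
Lemma cc_dist_le (x y z dx dy : R -> R) (l : R) :
  (forall t, is_derive1 t x (dx t)) -> (forall t, is_derive1 t y (dy t)) ->
  (forall t, is_derive1 t z ((x t * dy t - y t * dx t) / 2)) ->
  continuous dx -> continuous dy -> (forall t, 0 <= t <= 1 -> `|dx t| + `|dy t| <= l) ->
  (cc_dist (x 0%R, y 0%R, z 0%R) (x 1%R, y 1%R, z 1%R) <= l%:E)%E.
Proof.
move=> Dx Dy Dz cdx cdy Hl.
pose c t : heis R := (x t, y t, z t).
pose dc t : heis R := (dx t, dy t, (x t * dy t - y t * dx t) / 2).
have Dc t : is_derive1 t c (dc t) by exact: is_derive_pair (is_derive_pair (Dx t) (Dy t)) (Dz t).
have DcE t : 'D_1 c t = dc t by have [] := Dc t.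
have DcF : 'D_1 c = dc by apply/funext.
have cx : continuous x by move=> t; exact: is_derive_continuous (Dx t).
have cy : continuous y by move=> t; exact: is_derive_continuous (Dy t).
have cz : continuous z by move=> t; exact: is_derive_continuous (Dz t).
have cdz : continuous (fun t => (x t * dy t - y t * dx t) / 2).
  move=> t; apply: (@contM _ _ (fun t => x t * dy t - y t * dx t)); last exact: cst_continuous.
  by apply: contB; [exact: contM (cx t) (cdy t)|exact: contM (cy t) (cdx t)].
have cdc : continuous dc by move=> t; exact: cvg_pair (cvg_pair (cdx t) (cdy t)) (cdz t).
have hc : horizontal_curve `[0, 1] c.
  split.
    by apply: continuous_subspaceT => t; exact: cvg_pair (cvg_pair (cx t) (cy t)) (cz t).
  move=> t _; split; first by have [] := Dc t.
    by rewrite DcF; exact: cdc.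
  exists (dx t), (dy t); rewrite DcE /dc /fieldX /fieldY /c /hx /hy /=.
  transitivity (dx t * 1 + dy t * 0, dx t * 0 + dy t * 1, dx t * - (y t / 2) + dy t * (x t / 2)) => //.
  by congr (_, _, _); [ring|ring|field].
apply: (@le_trans _ _ (hlength c)).
  by apply: ereal_inf_lbound; exists c => //; split.
rewrite /hlength; under eq_integral do rewrite DcE /dc /hx /hy /=.
have l0 : 0 <= l by apply: le_trans (Hl 0 _); rewrite ?addr_ge0// lexx ler01.
apply: (@le_trans _ _ (\int[lebesgue_measure]_(t in `]0%R, 1%R[%classic) l%:E)%E).
  apply: ge0_le_integral => //.
  - apply/measurable_EFinP; apply: (@measurable_funS _ _ _ _ setT) => //.
    apply: continuous_measurable_fun => t.
    apply: (cont_comp (fun t => dx t ^+ 2 + dy t ^+ 2) Num.sqrt); last exact: sqrt_continuous.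
    by apply: contD; [exact: contM (cdx t) (cdx t)|exact: contM (cdy t) (cdy t)].
  - move=> t; rewrite /= in_itv/= => /andP[t0 t1]; rewrite lee_fin.
    apply: le_trans (Hl t _); last by rewrite !ltW.
    rewrite -[leRHS]ger0_norm ?addr_ge0// -sqrtr_sqr ler_wsqrtr//.
    rewrite sqrrD !real_normK ?num_real//.
    by rewrite lerD2r lerDl mulrn_wge0// mulr_ge0.
rewrite integral_cst//= lebesgue_measure_itv/= lte_fin ltr01 oppr0 adde0.
by rewrite mule1.
Qed.

Lemma is_derive_poly3 (a b c d t : R) :
  is_derive1 t (fun t : R => a + b * t + c * t ^+ 2 + d * t ^+ 3) (b + 2 * c * t + 3 * d * t ^+ 2).
Proof.
have D1 : is_derive1 t (fun t => t) 1 by exact: is_derive_id.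
have Dc (k : R) : is_derive1 t (fun _ => k) (0 : R) by exact: is_derive_cst.
have D2 := is_deriveM D1 D1; have D3 := is_deriveM D1 D2.
by apply: (derive_cast (is_deriveD (is_deriveD (is_deriveD (Dc a) (is_deriveM (Dc b) D1)) (is_deriveM (Dc c) D2)) (is_deriveM (Dc d) D3))) => [s|]; rewrite !fctE /GRing.scale/=; ring.
Qed.

Lemma poly2_continuous (b c d : R) : continuous (fun t : R => b + 2 * c * t + 3 * d * t ^+ 2).
Proof.
move=> t; apply: (@is_derive_continuous _ _ _ (2 * c + 2 * (3 * d) * t + 3 * 0 * t ^+ 2)).
by apply: (derive_cast (is_derive_poly3 b (2 * c) (3 * d) 0 t)) => // s; ring.
Qed.

(* The cubic curves used below are horizontal lifts: in the coordinate
   zeta = z - x y / 2 a curve is horizontal when zeta' = - y x'. *)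
Lemma is_derive_lift (x y u : R -> R) (dx dy t : R) : is_derive1 t x dx ->
  is_derive1 t y dy -> is_derive1 t u (- (y t * dx)) ->
  is_derive1 t (fun t => u t + x t * y t / 2) ((x t * dy - y t * dx) / 2).
Proof.
move=> Dx Dy Du; by apply: (derive_cast (is_deriveD Du (is_deriveM (is_deriveM Dx Dy) (is_derive_cst (2^-1 : R) t 1)))) => [s|]; rewrite !fctE /GRing.scale/=; field.
Qed.

(** [y] runs linearly while [x] makes a parabolic detour proportional to [h] on its way to [x0 + a].
    The detour changes the final height by [h * b] and costs at most [6 * |h|] in length, so if [b]
    is not 0 every final height can be reached. *)
Lemma cc_dist_le_quadratic (x0 y0 u0 a b h : R) :
  (cc_dist (x0, y0, (u0 + x0 * y0 / 2)%R)
    ((x0 + a)%R, (y0 + b)%R, (u0 - y0 * a - a * b / 2 + h * b + (x0 + a) * (y0 + b) / 2)%R)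
   <= (`|a| + 6 * `|h| + `|b|)%:E)%E.
Proof.
pose x (t : R) := x0 + (a + 6 * h) * t + (- (6 * h)) * t ^+ 2 + 0 * t ^+ 3.
pose y (t : R) := y0 + b * t + 0 * t ^+ 2 + 0 * t ^+ 3.
pose u (t : R) := u0 + (- (y0 * a + 6 * h * y0)) * t + (- ((b * a + 6 * h * b - 12 * h * y0) / 2)) * t ^+ 2 +
   (4 * h * b) * t ^+ 3.
have Dx t := is_derive_poly3 x0 (a + 6 * h) (- (6 * h)) 0 t.
have Dy t := is_derive_poly3 y0 b 0 0 t.
have Du t : is_derive1 t u (- (y t * (a + 6 * h + 2 * (- (6 * h)) * t + 3 * 0 * t ^+ 2))).
  by apply: (derive_cast (is_derive_poly3 u0 (- (y0 * a + 6 * h * y0)) (- ((b * a + 6 * h * b - 12 * h * y0) / 2)) (4 * h * b) t)) => //; rewrite /y; field.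
have := @cc_dist_le x y (fun t => u t + x t * y t / 2) _ _ (`|a| + 6 * `|h| + `|b|) Dx Dy
  (fun t => is_derive_lift (Dx t) (Dy t) (Du t)) (@poly2_continuous _ _ _) (@poly2_continuous _ _ _).
have -> : x 0 = x0 by rewrite /x; ring.
have -> : y 0 = y0 by rewrite /y; ring.
have -> : u 0 = u0 by rewrite /u; ring.
have -> : x 1 = x0 + a by rewrite /x; ring.
have -> : y 1 = y0 + b by rewrite /y; ring.
have -> : u 1 = u0 - y0 * a - a * b / 2 + h * b by rewrite /u; field.
apply=> t /andP[t0 t1]; apply: lerD.
  rewrite (_ : _ + _ = a + 6 * (h * (1 - 2 * t))); last by ring.
  apply: normD_le => //; rewrite normrM ger0_norm// ler_wpM2l// normrM ler_piMr// ler_norml; apply/andP; split; lra.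
by rewrite (_ : _ + _ = b)//; ring.
Qed.

(** [x] runs linearly and [y] has slope [b] with the correction [h * (3 * t ^ 2 - 2 * t)], which
    ends at [h] but has integral 0: in the coordinate [zeta] the end point does not feel [h]. *)
Lemma cc_dist_le_straight (x0 y0 u0 s b h : R) :
  (cc_dist (x0, y0, (u0 + x0 * y0 / 2)%R)
    ((x0 + s)%R, (y0 + b * s + h)%R, (u0 - s * y0 - b * s ^+ 2 / 2 + (x0 + s) * (y0 + b * s + h) / 2)%R)
   <= (`|s| + (`|b| * `|s| + 4 * `|h|))%:E)%E.
Proof.
pose x (t : R) := x0 + s * t + 0 * t ^+ 2 + 0 * t ^+ 3.
pose y (t : R) := y0 + (b * s - 2 * h) * t + 3 * h * t ^+ 2 + 0 * t ^+ 3.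
pose u (t : R) := u0 + (- (s * y0)) * t + (- (s * (b * s - 2 * h) / 2)) * t ^+ 2 + (- (s * h)) * t ^+ 3.
have Dx t := is_derive_poly3 x0 s 0 0 t.
have Dy t := is_derive_poly3 y0 (b * s - 2 * h) (3 * h) 0 t.
have Du t : is_derive1 t u (- (y t * (s + 2 * 0 * t + 3 * 0 * t ^+ 2))).
  by apply: (derive_cast (is_derive_poly3 u0 (- (s * y0)) (- (s * (b * s - 2 * h) / 2)) (- (s * h)) t)) => //; rewrite /y; field.
have := @cc_dist_le x y (fun t => u t + x t * y t / 2) _ _ (`|s| + (`|b| * `|s| + 4 * `|h|)) Dx Dy
  (fun t => is_derive_lift (Dx t) (Dy t) (Du t)) (@poly2_continuous _ _ _) (@poly2_continuous _ _ _).
have -> : x 0 = x0 by rewrite /x; ring.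
have -> : y 0 = y0 by rewrite /y; ring.
have -> : u 0 = u0 by rewrite /u; ring.
have -> : x 1 = x0 + s by rewrite /x; ring.
have -> : y 1 = y0 + b * s + h by rewrite /y; ring.
have -> : u 1 = u0 - s * y0 - b * s ^+ 2 / 2 by rewrite /u; field.
apply=> t /andP[t0 t1]; apply: lerD.
  by rewrite (_ : _ + _ = s)//; ring.
have -> : b * s - 2 * h + 2 * (3 * h) * t + 3 * 0 * t ^+ 2 = b * s + 2 * (h * (3 * t - 1)) by ring.
apply: normD_le; first by rewrite normrM.
have h1 : `|3 * t - 1| <= 2 by rewrite ler_norml; apply/andP; split; lra.
rewrite (_ : 4 * `|h| = 2 * (`|h| * 2)); last by ring.
by apply: normM_le; [rewrite normr_nat|exact: normM_le].
Qed.

End cc_distance.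

Section intrinsic_lipschitz.
Context {R : realType}.
Variables (U : set (R * R)) (f : R * R -> R).

Lemma PsiE (v : R * R) : Psi f v = (v.1, f v, v.2 + v.1 * f v / 2).
Proof. by rewrite /Psi /hmul /of_vplane /hx /hy /hz /=; congr (_, _, _); [ring|ring|field]. Qed.

Lemma Pi_Psi (v : R * R) : Pi (Psi f v) = v.
Proof. by rewrite PsiE /Pi /hx /hy /hz /= addrK -surjective_pairing. Qed.

Lemma intrinsic_lipschitz_le : intrinsic_lipschitz U f -> exists2 la : R, 0 < la < 1 &
  forall (v v' : R * R) l, U v -> U v' -> (cc_dist (Psi f v) (Psi f v') <= l%:E)%E ->
    `|f v' - f v| <= la * l.
Proof.
move=> [la la01 H]; exists la => // v v' l Uv Uv' Hl.
have := H (Psi f v) (Psi f v') (imageP _ Uv) (imageP _ Uv').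
have HP u : hy (Psi f u) = f u by rewrite PsiE.
rewrite !HP => H'; rewrite -lee_fin EFinM; apply: (le_trans H'); apply: lee_wpmul2l => //.
by rewrite lee_fin; case/andP: la01 => /ltW.
Qed.

(** [h] is chosen so that the curve of [cc_dist_le_quadratic] ends at [Psi f v']. Multiplying the
    Lipschitz inequality by [|b|] turns [|h|] into known increments and leaves a term
    [la * |b| ^ 2], absorbed on the left because [la < 1]. The square on the left expresses that [f]
    is Hölder of exponent 1/2. *)
Lemma quadratic_estimate : intrinsic_lipschitz U f -> exists2 la : R, 0 < la < 1 &
  forall v v' : R * R, U v -> U v' ->
  (1 - la) * `|f v' - f v| ^+ 2 <= la * (4 * `|v'.1 - v.1| * `|f v' - f v| +
     6 * `|v'.2 - v.2| + 6 * `|f v| * `|v'.1 - v.1|).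
Proof.
move=> /intrinsic_lipschitz_le[la /andP[la0 la1] H]; exists la; first by rewrite la0.
move=> v v' Uv Uv'.
set a := v'.1 - v.1; set b := f v' - f v; set d := v'.2 - v.2.
have [b0|b0] := eqVneq b 0.
  by rewrite b0 normr0 expr0n mulr0/= mulr0 add0r mulr_ge0 ?(ltW la0)// addr_ge0// !mulr_ge0.
pose h := (d + f v * a + a * b / 2) / b.
have := @cc_dist_le_quadratic R v.1 (f v) v.2 a b h.
have <- : Psi f v = (v.1, f v, v.2 + v.1 * f v / 2) by rewrite PsiE.
have <- : Psi f v' = (v.1 + a, f v + b, v.2 - f v * a - a * b / 2 + h * b + (v.1 + a) * (f v + b) / 2).
  rewrite PsiE /a /b [v.1 + _]addrC [f v + _]addrC !subrK -/a -/b; congr (_, _, (_ + _)).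
  by rewrite /h divfK// /d; ring.
move=> /(H _ _ _ Uv Uv'); rewrite -/b => Hb.
have bp : 0 < `|b| by rewrite normr_gt0.
have hb : `|h| * `|b| <= `|d| + `|f v| * `|a| + `|a| * `|b| / 2.
  rewrite -normrM /h divfK//.
  by apply: normD_le; [apply: normD_le => //; rewrite normrM|rewrite !normrM normfV normr_nat].
have := ler_wpM2r (ltW bp) Hb.
move: hb; set hb := `|h| * `|b| => hb' Hb2.
have E2 : la * (`|a| + 6 * `|h| + `|b|) * `|b| = la * (`|a| * `|b| + 6 * hb) + la * `|b| ^+ 2.
  by rewrite /hb; ring.
have : la * hb <= la * (`|d| + `|f v| * `|a| + `|a| * `|b| / 2) by rewrite ler_wpM2l// ltW.
move: Hb2; rewrite E2 expr2; clearbody hb; move: (`|a|) (`|b|) (`|d|) (`|f v|) => A' B' D' F'; lra.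
Qed.

Lemma intrinsic_lipschitz_bounded : bounded_set U -> intrinsic_lipschitz U f ->
  exists2 B : R, 0 <= B & forall v, U v -> `|f v| <= B.
Proof.
move=> /bounded_Box[r r0 Ur] /quadratic_estimate[la /andP[la0 la1] H].
have [[v0 Uv0]|U0] := pselect (U !=set0); last first.
  by exists 0 => // v Uv; exfalso; apply: U0; exists v.
pose c := la * (8 * r + 12 * r + 12 * `|f v0| * r) / (1 - la).
have c0 : 0 <= c.
  apply: mulr_ge0; last by rewrite invr_ge0 subr_ge0 ltW.
  apply: (mulr_ge0 (ltW la0)); have r0' := ltW r0.
  have : 0 <= `|f v0| * r by rewrite mulr_ge0.
  lra.
exists (`|f v0| + c + 1); first by rewrite !addr_ge0.
move=> v Uv.
suff : `|f v - f v0| <= c + 1.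
  move=> h; rewrite -[f v](subrK (f v0)) addrC -addrA; exact: normD_le.
(* If the increment exceeds 1, the remaining terms of the quadratic estimate may be multiplied by it
   and one factor cancelled, which bounds it by [c]. *)
have [h|h] := leP (`|f v - f v0|) 1; first by rewrite (le_trans h)// lerDr.
have := H v0 v Uv0 Uv.
have [a1 a2] := Ur _ Uv; have [b1 b2] := Ur _ Uv0.
have e1 : `|v.1 - v0.1| <= 2 * r.
  by rewrite (_ : 2 * r = r + r); [apply: normD_le => //; rewrite normrN|ring].
have e2 : `|v.2 - v0.2| <= 2 * r.
  by rewrite (_ : 2 * r = r + r); [apply: normD_le => //; rewrite normrN|ring].
move: h; have := normr_ge0 (f v0).
rewrite /c; move: (`|f v - f v0|) (`|v.1 - v0.1|) (`|v.2 - v0.2|) (`|f v0|) e1 e2 => y A' D' F e1 e2 F0 y1 K.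
apply: (@le_trans _ _ (la * (8 * r + 12 * r + 12 * F * r) / (1 - la))); last by rewrite lerDl.
rewrite ler_pdivlMr ?subr_gt0//.
have la' := ltW la0; have y0 : 0 <= y by lra.
have h1 : A' * y <= 2 * r * y by rewrite ler_wpM2r.
have h2 : F * A' <= F * (2 * r) by rewrite ler_wpM2l.
have h3 : r <= r * y by rewrite ler_peMr// ltW.
have h4 : F * r <= F * r * y by rewrite ler_peMr ?mulr_ge0// ltW.
have h5 : la * (4 * A' * y + 6 * D' + 6 * F * A') <= la * ((8 * r + 12 * r + 12 * F * r) * y).
  by rewrite ler_wpM2l//; lra.
have : y * (1 - la) * y <= la * (8 * r + 12 * r + 12 * F * r) * y.
  by have := le_trans K h5; rewrite expr2; lra.
by rewrite ler_pM2r//; lra.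
Qed.

(** Once [|f|] is bounded, the right side of the quadratic estimate is at most linear in the
    displacement; this gives the modulus [e ^ 2 / (c + 1)]. *)
Lemma intrinsic_lipschitz_continuous : open U -> bounded_set U -> intrinsic_lipschitz U f ->
  cont_on U f.
Proof.
move=> oU bU Lf v Uv; have [B B0 HB] := intrinsic_lipschitz_bounded bU Lf.
have [la /andP[la0 la1] H] := quadratic_estimate Lf.
apply/continuous2_leP => e e0.
pose c := la * (8 * B + 6 + 6 * B) / (1 - la).
have c0 : 0 < c + 1.
  rewrite ltr_wpDl// /c divr_ge0 ?subr_ge0 ?(ltW la1)// mulr_ge0 ?(ltW la0)// !addr_ge0// mulr_ge0//.
have /nbhs2_leP[d1 d10 Hd1] : nbhs v U by exact: open_nbhs_nbhs.
exists (Num.min d1 (e ^+ 2 / (c + 1))); first by rewrite lt_min d10 divr_gt0// exprn_gt0.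
move=> h k; rewrite !le_min => /andP[h1 h2] /andP[k1 k2].
have Uv' := Hd1 h k h1 k1.
have := H v _ Uv Uv'; rewrite /= [v.1 + h - _]addrAC subrr add0r [v.2 + k - _]addrAC subrr add0r.
have fB : `|f (v.1 + h, v.2 + k) - f v| <= 2 * B.
  by rewrite (_ : 2 * B = B + B); [apply: normD_le; rewrite ?normrN HB|ring].
have fB0 := HB v Uv.
set m := e ^+ 2 / (c + 1) in h2 k2.
have cm : (c + 1) * m = e ^+ 2 by rewrite /m mulrC divfK// gt_eqF.
have m0 : 0 <= m by rewrite divr_ge0 ?sqr_ge0// ltW.
have cE : c * (1 - la) = la * (8 * B + 6 + 6 * B) by rewrite /c divfK// subr_eq0 gt_eqF.
clearbody m c.
move=> K; move: (normr_ge0 h) (normr_ge0 (f (v.1 + h, v.2 + k) - f v)) K.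
move: (`|f (v.1 + h, v.2 + k) - f v|) (`|h|) (`|k|) (`|f v|) fB fB0 h2 k2 => y A' D' F fB fB0 h2 k2 A0 y0 K.
rewrite -(@ler_pXn2r _ 2) ?nnegrE ?(ltW e0)// -cm.
have h3 : A' * y <= m * (2 * B) by rewrite ler_pM.
have h5 : F * A' <= B * m by apply: le_trans (ler_wpM2r A0 fB0) _; rewrite ler_wpM2l.
have h6 : la * (4 * A' * y + 6 * D' + 6 * F * A') <= la * ((8 * B + 6 + 6 * B) * m).
  by rewrite ler_wpM2l ?(ltW la0)//; lra.
have : (1 - la) * y ^+ 2 <= (1 - la) * ((c + 1) * m).
  apply: (le_trans K); apply: (le_trans h6); rewrite mulrA -cE.
  have : 0 <= (1 - la) * m by rewrite mulr_ge0// subr_ge0 ltW.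
  lra.
by rewrite ler_pM2l// subr_gt0.
Qed.

(** A displacement by [s] along the direction in which [f] grows by [g * s] is joined by the nearly
    straight curve of slope [g]; the Lipschitz condition reads [|g| * s <= la * (1 + |g|) * s] up to
    [o(s)], so [|g| <= la / (1 - la)]. Only this combination of [a] and [b] is controlled, not [b]
    itself. *)
Lemma intrinsic_lipschitz_gradient : intrinsic_lipschitz U f -> exists2 B : R, 0 <= B &
  forall v (a b : R), (\forall w \near v, U w) -> dif f v a b -> `|a - f v * b| <= B.
Proof.
move=> /intrinsic_lipschitz_le[la /andP[la0 la1] H].
exists (la / (1 - la)); first by rewrite divr_ge0 ?subr_ge0// ltW.
move=> v a b nU df; have Uv : U v := nbhs_singleton nU.
set g := a - f v * b.
suff K : forall e : R, 0 < e -> `|g| <= la * (1 + `|g|) + e.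
  have : `|g| <= la * (1 + `|g|) by apply/ler_addgt0Pr => e e0; exact: K.
  by rewrite ler_pdivlMr ?subr_gt0//; lra.
move=> e e0.
pose F := `|f v| + `|g| + 1.
have F0 : 0 < F by rewrite ltr_wpDl// addr_ge0.
(* The error [h] enters once in the increment of [f] and four times in the length, so
   [|h| <= e / 5 * s] is wanted; the other factor collects the coefficients in the estimate of
   [h]. *)
pose e1 := e / (5 * (F + 1 + `|b| * `|g| + 1)).
have D0 : 0 < F + 1 + `|b| * `|g| + 1 by rewrite ltr_wpDl// !addr_ge0 ?mulr_ge0// ltW.
have e10 : 0 < e1 by rewrite divr_gt0// mulr_gt0.
have [d d0 Hd] := df e1 e10.
have /nbhs2_leP[d1 d10 Hd1] := nU.
pose s := Num.min 1 (Num.min (Num.min d d1 / F) (Num.min (Num.min d d1) e1)).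
have s0 : 0 < s by rewrite !lt_min ltr01 e10 d0 d10 divr_gt0// lt_min d0 d10.
have [s1 s2 s3 s4] : [/\ s <= 1, s <= Num.min d d1 / F, s <= Num.min d d1 & s <= e1].
  by rewrite /s; generalize (Num.min d d1 / F) (Num.min d d1) => m1 m2; split; rewrite !ge_min lexx ?orbT.
clearbody s.
(* Vertical displacement of the horizontal lift over [[0, s]]: the integral of [- (f v + g * t)]. *)
pose k := - (s * f v) - g * s ^+ 2 / 2.
have kF : `|k| <= F * s.
  have ss : s ^+ 2 <= s by rewrite expr2 ler_piMr// ltW.
  rewrite /k; apply: (@le_trans _ _ (s * `|f v| + `|g| * s)).
    apply: normD_le; rewrite normrN; first by rewrite normrM (ger0_norm (ltW s0)).
    rewrite 2!normrM (ger0_norm (sqr_ge0 s)) normfV normr_nat -mulrA ler_wpM2l//.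
    have := sqr_ge0 s; lra.
  by rewrite /F; have := ltW s0; have := normr_ge0 (f v); lra.
have sd : `|s| <= d by rewrite ger0_norm ?(ltW s0)// (le_trans s3)// ge_min lexx.
have sd1 : `|s| <= d1 by rewrite ger0_norm ?(ltW s0)// (le_trans s3)// ge_min lexx orbT.
have Fs : F * s <= Num.min d d1 by rewrite mulrC -ler_pdivlMr.
have kd : `|k| <= d by rewrite (le_trans kF)// (le_trans Fs)// ge_min lexx.
have kd1 : `|k| <= d1 by rewrite (le_trans kF)// (le_trans Fs)// ge_min lexx orbT.
pose v' := (v.1 + s, v.2 + k).
have Uv' : U v' by exact: Hd1.
pose h := f v' - f v - g * s.
have hs : `|h| <= (e / 5) * s.
  have := Hd s k sd kd; rewrite -/v' => Hd'.
  have -> : h = (f v' - f v - a * s - b * k) - b * g * s ^+ 2 / 2 by rewrite /h /k /g; field.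
  apply: (@le_trans _ _ (e1 * (`|s| + `|k|) + `|b| * `|g| * s * e1)).
    apply: normD_le => //; rewrite normrN 3!normrM (ger0_norm (sqr_ge0 s)) normfV normr_nat.
    have -> : `|b| * `|g| * s ^+ 2 / 2 = `|b| * `|g| * (s * (s / 2)) by field.
    rewrite -(mulrA (`|b| * `|g|)) ler_wpM2l ?mulr_ge0// ler_wpM2l ?(ltW s0)//.
    by have := ltW s0; lra.
  rewrite (ger0_norm (ltW s0)).
  apply: (@le_trans _ _ (e1 * (F + 1 + `|b| * `|g| + 1) * s)).
    have h1 : e1 * `|k| <= e1 * (F * s) by rewrite ler_wpM2l// ltW.
    have h2 : 0 <= e1 * s by rewrite mulr_ge0// ltW.
    by lra.
  rewrite ler_wpM2r ?(ltW s0)// /e1; apply: eq_ler.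
  by move: (F + 1 + _ + 1) D0 => D D0; field; rewrite gt_eqF.
have := @cc_dist_le_straight R v.1 (f v) v.2 s g h.
have <- : Psi f v = (v.1, f v, v.2 + v.1 * f v / 2) by rewrite PsiE.
have <- : Psi f v' = (v.1 + s, f v + g * s + h, v.2 - s * f v - g * s ^+ 2 / 2 + (v.1 + s) * (f v + g * s + h) / 2).
  have -> : f v + g * s + h = f v' by rewrite /h; ring.
  by rewrite PsiE /v' /k /=; congr (_, _, (_ + _)); ring.
move=> /(H _ _ _ Uv Uv').
have -> : f v' - f v = g * s + h by rewrite /h; ring.
rewrite (ger0_norm (ltW s0)) => K.
have : `|g| * s <= `|g * s + h| + `|h|.
  rewrite -{1}(ger0_norm (ltW s0)) -normrM -[X in `|X| <= _](addrK h); apply: normD_le => //.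
  by rewrite normrN.
move=> K2; rewrite -(ler_pM2r s0).
have : la * (s + (`|g| * s + 4 * `|h|)) <= la * ((1 + `|g|) * s) + 4 * `|h|.
  have : la * (4 * `|h|) <= 4 * `|h| by rewrite ler_piMl ?mulr_ge0// ltW.
  lra.
move: K K2 hs; move: (`|h|) (`|g * s + h|) (`|g|) => H' X G'; lra.
Qed.

End intrinsic_lipschitz.

(** * The contact flow of a function of the plane *)

Section contact_flows.
Context {R : realType}.
Implicit Types (U : set (R * R)) (f w : R * R -> R).

Lemma area_box_gt0 (v : R * R) (d : R) : 0 < d ->
  (0 < mu2 (`[(v.1 - d)%R, (v.1 + d)%R]%classic `*` `[(v.2 - d)%R, (v.2 + d)%R]%classic : set (mvplane R)))%E.
Proof.
move=> d0; pose mu := @lebesgue_measure R.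
have -> : mu2 (`[(v.1 - d)%R, (v.1 + d)%R]%classic `*` `[(v.2 - d)%R, (v.2 + d)%R]%classic) =
    (mu `[(v.1 - d)%R, (v.1 + d)%R]%classic * mu `[(v.2 - d)%R, (v.2 + d)%R]%classic)%E.
  by apply: product_measure1E; exact: mitv.
rewrite /mu !lebesgue_measure_itv/= !lte_fin.
rewrite ifT; last by lra.
rewrite ifT; last by lra.
by rewrite -!EFinB -EFinM lte_fin mulr_gt0//; lra.
Qed.

(** If [|f|] exceeded the essential supremum at a point, by continuity it would do so on a box,
    which has positive area. The rough bound [B] makes the norm finite, so that [fine M] is its
    value. *)
Lemma Linfty_norm_bound U f (B : R) (M : \bar R) : open U -> (cont_on U f) ->
  (forall v, U v -> `|f v| <= B) -> 0 <= B -> Linfty_norm U f = M -> forall v, U v -> `|f v| <= `|fine M|.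
Proof.
move=> oU cf fB B0 LM v Uv.
have M0 : (0 <= M)%E by rewrite -LM; exact: Lnorm_ge0.
rewrite [leRHS]ger0_norm ?fine_ge0//.
move: LM; rewrite /Linfty_norm unlock ifT; last first.
  apply: lt_le_trans (area_box_gt0 v ltr01) _.
  by apply: le_measure; rewrite ?inE//; apply: measurableX; exact: mitv.
set g := abse \o _ => LM.
have gB u : (g u <= B%:E)%E.
  rewrite /g /= lee_fin patchE; case: ifPn => [|_]; first by rewrite inE; exact: fB.
  by rewrite [point](_ : _ = 0) ?normr0.
have MB : (M <= B%:E)%E by rewrite -LM; apply/ess_sup_inf.ess_supP; apply: nearW => u; exact: gB.
have Mf : M \is a fin_num by rewrite ge0_fin_numE// (le_lt_trans MB)// ltry.
rewrite leNgt; apply/negP => Mv.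
have : \forall u \near v, fine M < `|f u| /\ U u.
  near=> u; split; last by near: u; exact: open_nbhs_nbhs.
  near: u; apply: (@cvgr_gt _ _ _ _ (fun u => `|f u|) `|f v|) => //.
  by apply: (@cvg_norm _ _ _ _ _ f (f v)); exact: cf.
move=> /nbhs2_leP[d d0 Hd].
have [N [mN N0 HN]] := ess_sup_inf.ess_sup_ge mu2 g.
have := area_box_gt0 v d0; rewrite ltNge -[X in (_ <= X)%E]N0 => /negP; apply.
apply: le_measure; rewrite ?inE//; first by apply: measurableX; exact: mitv.
move=> u [/= h1 h2]; apply: HN => /=; rewrite LM; apply/negP.
have := Hd (u.1 - v.1) (u.2 - v.2); have -> : v.1 + (u.1 - v.1) = u.1 by ring.
have -> : v.2 + (u.2 - v.2) = u.2 by ring.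
rewrite -surjective_pairing => -[||Mu Uu].
- by move: h1; rewrite in_itv/= ler_norml => /andP[a b]; apply/andP; split; lra.
- by move: h2; rewrite in_itv/= ler_norml => /andP[a b]; apply/andP; split; lra.
rewrite -ltNge /g /= patchE mem_set// -(fineK Mf) lte_fin; exact: Mu.
Unshelve. all: by end_near. Qed.

Lemma is_derive_comp_Pi w (p V : heis R) : smooth_on setT w ->
  is_derive p V (w \o Pi) (d_x w (Pi p) * V.1.1 + d_z w (Pi p) * (V.2 - (V.1.1 * hy p + hx p * V.1.2) / 2)).
Proof.
move=> sw; have D0 : is_derive p V (fun p => p) V by exact: is_derive_id.
have D1 := is_derive_fst_comp D0; have Dz := is_derive_snd_comp D0.
have Dx := is_derive_fst_comp D1; have Dy := is_derive_snd_comp D1.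
have D2 : is_derive p V (fun p => hz p - hx p * hy p / 2) (V.2 - (V.1.1 * hy p + hx p * V.1.2) / 2).
  by apply: (derive_cast (is_deriveB Dz (is_deriveM (is_deriveM Dx Dy) (is_derive_cst (2^-1 : R) p V)))) => //; rewrite !fctE /GRing.scale/= /hx /hy; field.
exact: @dif_is_derive R _ w hx (fun p => hz p - hx p * hy p / 2) p V _ _ _ _
  (@Cn_dif R 0 setT w (Pi p) openT (sw 1%N) I) Dx D2.
Qed.

Lemma lieX_comp_Pi w (p : heis R) : smooth_on setT w ->
  lie fieldX (w \o Pi) p = d_x w (Pi p) - hy p * d_z w (Pi p).
Proof.
move=> sw; have [_] := is_derive_comp_Pi p (fieldX p) sw; rewrite /lie => ->.
by rewrite /fieldX /=; field.
Qed.

Lemma lieY_comp_Pi w (p : heis R) : smooth_on setT w -> lie fieldY (w \o Pi) p = 0.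
Proof.
move=> sw; have [_] := is_derive_comp_Pi p (fieldY p) sw; rewrite /lie => ->.
by rewrite /fieldY /=; field.
Qed.

Lemma contact_field_comp_Pi w (p : heis R) : smooth_on setT w ->
  contact_field (w \o Pi) p = - (lie fieldX (w \o Pi) p *: fieldY p) + (w \o Pi) p *: fieldZ p.
Proof. by move=> sw; rewrite /contact_field lieY_comp_Pi// scale0r add0r. Qed.

Lemma smooth_comp_Pi w : smooth_on setT w -> smooth_on setT (w \o Pi).
Proof.
move=> sw n; have oT : open (setT : set (heis R)) by exact: openT.
have cx : continuous (hx : heis R -> R).
  by move=> p; apply: (cont_comp (fun p : heis R => p.1) (fun q => q.1)); exact: cvg_fst.
have cy : continuous (hy : heis R -> R).
  by move=> p; apply: (cont_comp (fun p : heis R => p.1) (fun q => q.2)); [exact: cvg_fst|exact: cvg_snd].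
have cz : continuous (hz : heis R -> R) by move=> p; exact: cvg_snd.
have sx : Cn_on n (setT : set (heis R)) hx by apply: Cn_lin.
have sy : Cn_on n (setT : set (heis R)) hy by apply: Cn_lin.
have sz : Cn_on n (setT : set (heis R)) hz by apply: Cn_lin.
apply: (@Cn_comp2 R _ n setT setT w hx (fun p => hz p - hx p * hy p / 2)) => //; first exact: openT.
by apply: Cn_sub_fun => //; apply: Cn_mul => //; [exact: Cn_mul|exact: Cn_cst].
Qed.

Lemma support_comp_Pi U w : test_function U w -> support_in (Pi @^-1` U) (w \o Pi).
Proof.
move=> tw p Cp; have cPi : continuous (Pi : heis R -> R * R).
  have cx : continuous (hx : heis R -> R).
    by move=> q; apply: (cont_comp (fun p : heis R => p.1) (fun q => q.1)); exact: cvg_fst.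
  have cy : continuous (hy : heis R -> R).
    by move=> q; apply: (cont_comp (fun p : heis R => p.1) (fun q => q.2)); [exact: cvg_fst|exact: cvg_snd].
  have cz : continuous (hz : heis R -> R) by move=> q; exact: cvg_snd.
  move=> q; have c2 : {for q, continuous (fun p : heis R => hz p - hx p * hy p / 2)}.
    apply: contB; first exact: cz.
    apply: contM; last exact: cst_continuous.
    by apply: continuousM; [exact: cx|exact: cy].
  exact: cvg_pair (cx q) c2.
apply: (test_sub tw) => A nA; have [q [Hq Aq]] := Cp _ (cPi p A nA).
by exists (Pi q).
Qed.

Section flow_data.
Variables (U : set (R * R)) (f w : R * R -> R) (eps : R) (W : set (heis R)) (V : heis R -> heis R)
  (phi : R -> heis R -> heis R).
Hypotheses (sw : smooth_on setT w) (w0 : forall v, ~ U v -> w v = 0)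
  (VE : forall p, V p = - (lie fieldX (w \o Pi) p *: fieldY p) + (w \o Pi) p *: fieldZ p)
  (UW : igraph U f `<=` W) (fl : is_flow V eps W phi) (eps0 : 0 < eps).

(** Height of the projection by [Pi] of the flowed point of the graph. Off [U], where [w] vanishes,
    the stationary value makes it a flow of [w] on the whole plane, as [local_flow] demands. *)
Definition plane_flow (t : R) (v : R * R) : R := if `[< U v >] then (Pi (phi t (Psi f v))).2 else v.2.
Definition flow_height (t : R) (v : R * R) : R := hy (phi t (Psi f v)).

Let VE' p : V p = (0, - (d_x w (Pi p) - hy p * d_z w (Pi p)),
  - (d_x w (Pi p) - hy p * d_z w (Pi p)) * hx p / 2 + w (Pi p)).
Proof.
rewrite VE lieX_comp_Pi// /fieldY /fieldZ; set L := _ - _.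
transitivity (- (L * 0) + w (Pi p) * 0, - (L * 1) + w (Pi p) * 0, - (L * (hx p / 2)) + w (Pi p) * 1) => //.
by congr (_, _, _); [ring|ring|field].
Qed.
Let D v t : U v -> `|t| < eps -> is_derive1 t (phi ^~ (Psi f v)) (V (phi t (Psi f v))).
Proof. by move=> Uv te; have [_] := fl (UW (imageP _ Uv)); apply. Qed.
Let Dx v t : U v -> `|t| < eps -> is_derive1 t (fun t => hx (phi t (Psi f v))) 0.
Proof.
by move=> Uv te; have := is_derive_fst_comp (is_derive_fst_comp (D Uv te)); rewrite VE'.
Qed.
Let Dy v t : U v -> `|t| < eps -> is_derive1 t (flow_height ^~ v)
  (- (d_x w (Pi (phi t (Psi f v))) - flow_height t v * d_z w (Pi (phi t (Psi f v))))).
Proof.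
by move=> Uv te; have := is_derive_snd_comp (is_derive_fst_comp (D Uv te)); rewrite VE'.
Qed.

Lemma flow_x v t : U v -> `|t| < eps -> hx (phi t (Psi f v)) = v.1.
Proof.
move=> Uv te.
have [|c ct E] := @MVT_eq R (fun t => hx (phi t (Psi f v))) (fun=> 0) 0 t.
  by move=> s st; apply: Dx => //; apply: le_lt_trans te; have := @minmax_norm R 0 t s; rewrite add0r subr0; apply.
have [p0 _] := fl (UW (imageP _ Uv)).
by move/eqP: E; rewrite mul0r subr_eq0 p0 => /eqP ->; rewrite PsiE.
Qed.

Lemma plane_flow_Pi v t : U v -> `|t| < eps -> Pi (phi t (Psi f v)) = (v.1, plane_flow t v).
Proof.
by move=> Uv te; rewrite /plane_flow asboolT//; rewrite [LHS]surjective_pairing; congr (_, _); exact: flow_x.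
Qed.

Lemma plane_flow_local : local_flow w eps plane_flow.
Proof.
split=> [v|t v te].
  rewrite /plane_flow; case: asboolP => // Uv.
  by have [-> _] := fl (UW (imageP _ Uv)); rewrite Pi_Psi.
have [Uv|nUv] := pselect (U v); last first.
  have pE s : plane_flow s v = v.2 by rewrite /plane_flow asboolF.
  rewrite pE -surjective_pairing (w0 nUv) (_ : plane_flow ^~ v = fun=> v.2); last exact/funext.
  exact: is_derive_cst.
have Dz := is_derive_snd_comp (D Uv te).
have Dy' := Dy Uv te.
apply: (derive_cast (is_deriveB Dz (is_deriveM (is_deriveM (Dx Uv te) Dy') (is_derive_cst (2^-1 : R) t 1)))) => [s|]; first by rewrite /plane_flow asboolT.
rewrite -plane_flow_Pi// VE' !fctE /GRing.scale/= /flow_height.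
by move: (d_x w _) (d_z w _) => a b; field.
Qed.

Lemma flow_height0 v : U v -> flow_height 0 v = f v.
Proof. by move=> Uv; rewrite /flow_height; have [-> _] := fl (UW (imageP _ Uv)); rewrite PsiE. Qed.

Lemma flow_height_ode v t : U v -> `|t| < eps -> is_derive1 t (flow_height ^~ v)
  (d_z w (v.1, plane_flow t v) * flow_height t v - d_x w (v.1, plane_flow t v)).
Proof.
move=> Uv te; apply: (derive_cast (Dy Uv te)) => //.
by rewrite plane_flow_Pi//; move: (d_x w _) (d_z w _) => a b; ring.
Qed.

Lemma flowed_graph (f1 : R * R -> R) t v : igraph U f1 = phi t @` igraph U f -> `|t| < eps -> U v ->
  f1 (v.1, plane_flow t v) = flow_height t v.
Proof.
move=> E te Uv; have : igraph U f1 (phi t (Psi f v)) by rewrite E; exists (Psi f v) => //; exists v.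
move=> [u Uu Eu]; have := Pi_Psi f1 u; rewrite Eu plane_flow_Pi// => ->.
by rewrite /flow_height -Eu PsiE.
Qed.

End flow_data.
End contact_flows.

Lemma segment_norm_lt {R : realType} (L y y' s : R) : `|y| < L -> `|y'| < L ->
  Num.min y y' <= s <= Num.max y y' -> `|s| < L.
Proof.
rewrite !ltr_norml => /andP[a b] /andP[c d] /andP[]; rewrite ge_min le_max => s1 s2.
by apply/andP; split; [case/orP: s1|case/orP: s2] => ?; lra.
Qed.

Lemma segment_norm_le {R : realType} (L y y' s : R) : `|y| <= L -> `|y'| <= L ->
  Num.min y y' <= s <= Num.max y y' -> `|s| <= L.
Proof.
rewrite !ler_norml => /andP[a b] /andP[c d] /andP[]; rewrite ge_min le_max => s1 s2.
by apply/andP; split; [case/orP: s1|case/orP: s2] => ?; lra.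
Qed.

(** * Primitives in the second variable and Picard iteration *)

Section primitive.
Context {R : realType}.
Variables (m : R * R -> R) (L : R).
Hypotheses (sm : csmooth m) (L0 : 0 < L).

(** [E] is the primitive of [m] in the second variable that vanishes at height 0, and [Ex] is that
    of [d_x m]. The mean value inequality, applied to the primitive of the Taylor remainder of [m]
    in [x], shows that [Ex] is the x-derivative of [E]; joint differentiability follows by
    [C1_dif]. *)
Lemma primitive_exists : exists E Ex : R * R -> R,
  (forall v, `|v.2| < L -> dif E v (Ex v) (m v)) /\
  (forall v, `|v.2| < L -> {for v, continuous Ex} /\ is_dz v Ex (d_x m v)).
Proof.
have smx := csmooth_dx sm.
have cm := csmooth_cont sm; have cmx := csmooth_cont smx.
have prim (u : R * R -> R) : continuous u -> exists F : R -> R -> R, forall x,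
    F x 0 = 0 /\ forall y, `|y| < L -> is_derive1 y (F x) (u (x, y)).
  move=> cu; suff : forall x, exists F : R -> R, F 0 = 0 /\ forall y, `|y| < L -> is_derive1 y F (u (x, y)).
    by move/choice => [F HF]; exists F.
  move=> x; have [F HF] := @antiderivative R (fun y => u (x, y)) L (@continuous2_fix1 R u x cu).
  exists (fun y => F y - F 0); split; first by rewrite subrr.
  move=> y yL; by apply: (derive_cast (is_deriveB (HF y yL) (is_derive_cst (F 0) y (1:R)))) => //; rewrite subr0.
have [F HF] := prim m cm; have [Fx HFx] := prim _ cmx.
have [B B0 HB] := csmooth_bound sm; have [Bx Bx0 HBx] := csmooth_bound smx.
have [T T0 HT] := csmooth_taylor sm; have [Lx Lx0 HLx] := csmooth_lip smx.
have [Lm Lm0 HLm] := csmooth_lip sm.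
have seg (y y' : R) : `|y| < L -> `|y'| < L -> forall s, Num.min y y' <= s <= Num.max y y' -> `|s| < L.
  by move=> yL y'L s; exact: segment_norm_lt.
have z0 : `|0 : R| < L by rewrite normr0.
have ynorm (y : R) C : 0 <= C -> `|y| < L -> C * `|y - 0| <= C * L.
  by move=> C0 yL; rewrite subr0 ler_wpM2l// ltW.
have TX x h y : `|y| < L -> `|F (x + h) y - F x y - h * Fx x y| <= T * `|h| ^+ 2 * L.
  move=> yL; have := @MVT_norm R (fun y => F (x + h) y - F x y - h * Fx x y)
     (fun y => m (x + h, y) - m (x, y) - h * d_x m (x, y)) 0 y (T * `|h| ^+ 2).
  rewrite (proj1 (HF (x + h))) (proj1 (HF x)) (proj1 (HFx x)) mulr0 !subr0 => H.
  have TC : 0 <= T * `|h| ^+ 2 by rewrite mulr_ge0// sqr_ge0.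
  apply: (le_trans (H _ _)).
  - move=> s /(seg _ _ z0 yL) sL.
    by apply: (derive_cast (is_deriveB (is_deriveB (proj2 (HF (x + h)) s sL) (proj2 (HF x) s sL)) (is_deriveM (is_derive_cst h s (1:R)) (proj2 (HFx x) s sL)))) => //; rewrite scaler0 addr0.
  - move=> s _; have := HT (x, s) h 0; rewrite /= addr0 mulr0 subr0 normr0 addr0 [_ * h]mulrC; exact.
  - by rewrite ler_wpM2l// ltW.
have FXL x h y : `|y| < L -> `|Fx (x + h) y - Fx x y| <= Lx * `|h| * L.
  move=> yL; have := @MVT_norm R (fun y => Fx (x + h) y - Fx x y) (fun y => d_x m (x + h, y) - d_x m (x, y)) 0 y (Lx * `|h|).
  rewrite (proj1 (HFx (x + h))) (proj1 (HFx x)) !subr0 => H; apply: (le_trans (H _ _)).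
  - move=> s /(seg _ _ z0 yL) sL; have D1 := proj2 (HFx (x + h)) s sL; have D2 := proj2 (HFx x) s sL.
    exact: is_deriveB.
  - by move=> s _; have := HLx (x, s) h 0; rewrite /= addr0 normr0 addr0.
  - by rewrite ler_wpM2l ?mulr_ge0// ltW.
have FYL x y k : `|y| < L -> `|y + k| < L -> `|Fx x (y + k) - Fx x y| <= Bx * `|k|.
  move=> yL ykL; have := @MVT_norm R (Fx x) (fun y => d_x m (x, y)) y (y + k) Bx.
  rewrite [y + k - y]addrAC subrr add0r; apply.
    by move=> s /(seg _ _ yL ykL); exact: (proj2 (HFx x)).
  by move=> s _; exact: HBx.
pose E (v : R * R) := F v.1 v.2; pose Ex (v : R * R) := Fx v.1 v.2.
have DE v : `|v.2| < L -> is_dx v E (Ex v).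
  case: v => x y /= yL; apply/is_derive_dx/is_derive_leP => e e0 /=; rewrite /E /Ex /=.
  exists (e / (T * L + 1)) => [|h he]; first by rewrite divr_gt0// ltr_wpDl// mulr_ge0// ltW.
  rewrite [_ * h]mulrC; apply: (le_trans (TX x h y yL)).
  rewrite expr2 mulrA [_ * L]mulrAC ler_wpM2r//.
  have K0 : 0 < T * L + 1 by rewrite ltr_wpDl// mulr_ge0// ltW.
  have : `|h| * (T * L + 1) <= e by rewrite -ler_pdivlMr.
  by have := normr_ge0 h; lra.
have DEz v : `|v.2| < L -> is_dz v E (m v).
  by case: v => x y yL; apply/is_derive_dz; exact: (proj2 (HF x)).
have CEx v : `|v.2| < L -> {for v, continuous Ex}.
  case: v => x y /= yL; apply/continuous2_leP => e e0; pose C := Lx * L + Bx + 1.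
  have C0 : 0 < C by rewrite ltr_wpDl// !addr_ge0// mulr_ge0// ltW.
  have dd : 0 < (L - `|y|) / 2 by rewrite divr_gt0// subr_gt0.
  exists (Num.min ((L - `|y|) / 2) (e / C)); first by rewrite lt_min dd divr_gt0.
  move=> h k; rewrite !le_min => /andP[h1 h2] /andP[k1 k2] /=; rewrite /Ex /=.
  have ykL : `|y + k| < L by rewrite (le_lt_trans (ler_normD _ _))//; lra.
  rewrite (_ : _ - _ = (Fx (x + h) (y + k) - Fx x (y + k)) + (Fx x (y + k) - Fx x y)); last by ring.
  apply: (le_trans (normD_le (FXL x h _ ykL) (FYL x y k yL ykL))).
  have he : Lx * `|h| * L <= Lx * L * (e / C) by rewrite mulrAC ler_wpM2l ?mulr_ge0// ltW.
  have ke : Bx * `|k| <= Bx * (e / C) by rewrite ler_wpM2l.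
  apply: (@le_trans _ _ (C * (e / C))).
    by have : 0 <= e / C by [rewrite divr_ge0 ?ltW]; rewrite /C; lra.
  by rewrite mulrC divfK// gt_eqF.
have oL : open [set v : R * R | `|v.2| < L].
  apply: (@open_comp _ _ (fun v : R * R => `|v.2|) [set y : R | y < L]); last exact: open_lt.
  move=> v _; apply: (cont_comp (fun v : R * R => v.2) (fun y : R => `|y|)); [exact: cvg_snd|exact: norm_continuous].
exists E, Ex; split=> v vL.
  apply: C1_dif; [|  |exact: CEx|exact: cm].
    exact: (open_near oL vL).
  exact: (open_near oL vL).
split; first exact: CEx.
by case: v vL => x y yL; apply/is_derive_dz; exact: (proj2 (HFx x)).
Qed.

End primitive.

Section picard.
Context {R : realType}.

(** Adding and subtracting [2 * M * 2^-n] encloses [u] between a nonincreasing and a nondecreasing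
    sequence. *)
Lemma geometric_cvg (u : nat -> R) (M : R) : 0 <= M ->
  (forall n, `|u n.+1 - u n| <= M * 2^-1 ^+ n) ->
  cvgn u /\ forall n, `|limn u - u n| <= 2 * M * 2^-1 ^+ n.
Proof.
move=> M0 H.
have pn n : 0 <= 2 * M * 2^-1 ^+ n by rewrite !mulr_ge0// exprn_ge0// invr_ge0.
pose a n := u n + 2 * M * 2^-1 ^+ n; pose b n := u n - 2 * M * 2^-1 ^+ n.
have E n : 2 * M * 2^-1 ^+ n.+1 = M * 2^-1 ^+ n by rewrite exprS; field.
have an : nonincreasing_seq a.
  apply/nonincreasing_seqP => n; rewrite /a E; have := H n; rewrite ler_norml => /andP[_ h]; lra.
have bn : nondecreasing_seq b.
  apply/nondecreasing_seqP => n; rewrite /b E; have := H n; rewrite ler_norml => /andP[h _]; lra.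
have ab n : b n <= a n by have := pn n; rewrite /a /b; lra.
have ca : cvgn a.
  apply: nonincreasing_is_cvgn => //; exists (b 0%N) => _ [n _ <-].
  by apply: le_trans (ab n); exact: bn.
have e0 : (fun n : nat => 2 * M * 2^-1 ^+ n) @ \oo --> (0 : R).
  rewrite -[X in _ --> X](mulr0 (2 * M)); apply: cvgM; first exact: cvg_cst.
  by apply: cvg_expr; rewrite ger0_norm ?invr_ge0// invf_lt1// ltr1n.
have uE : u = (fun n => a n - 2 * M * 2^-1 ^+ n) by apply/funext => n; rewrite /a addrK.
have cu : u @ \oo --> limn a by rewrite {1}uE -[X in _ --> X]subr0; exact: cvgB.
have lu : limn u = limn a by exact/cvg_lim.
split; first by apply/cvg_ex; exists (limn a).
move=> n; rewrite lu ler_norml; apply/andP; split.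
  have cb : b @ \oo --> limn a by rewrite -[X in _ --> X]subr0; exact: cvgB.
  have := nondecreasing_cvgn_le bn (cvgP _ cb) n; rewrite (cvg_lim _ cb)// /b; lra.
by have := nonincreasing_cvgn_ge an ca n; rewrite /a; lra.
Qed.

(** Successive approximations contract by 1/2 on [[-r, r]]. Their limit [Z] is at first only
    Lipschitz; it is differentiable because it equals [Y], the integral of [F (t, Z t)], whose
    distance to the iterates tends to zero as well. *)
Lemma picard_global (F : R * R -> R) (M L r : R) : continuous F -> 0 <= M -> 0 <= L -> 0 < r -> r <= 1 -> L * r <= 2^-1 ->
  (forall v, `|F v| <= M) -> (forall x y y', `|F (x, y) - F (x, y')| <= L * `|y - y'|) ->
  exists2 z : R -> R, z 0 = 0 & forall t, `|t| < r ->
    `|z t| <= M * `|t| /\ is_derive1 t z (F (t, z t)).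
Proof.
move=> cF M0 L0 r0 r1 Lr FM FL.
pose good (z : R -> R) := forall t, `|t| < 2 -> {for t, continuous z}.
(* The iteration needs an operator on all functions; its value is specified only on those continuous
   for [|t| < 2]. *)
have step (z : R -> R) : exists z' : R -> R, good z -> z' 0 = 0 /\
    forall t, `|t| < 2 -> is_derive1 t z' (F (t, z (clamp 1 t))).
  have [gz|] := pselect (good z); last by exists z.
  have cc : continuous (fun t => z (clamp 1 t)).
    by apply: (@clamp_comp_continuous R z 1 2) => //; rewrite ltr1n.
  have cal : continuous (fun t => F (t, z (clamp 1 t))).
    by move=> t; apply: continuous_pair_comp => //; exact: cc.
  have [G HG] := antiderivative 2 cal.
  exists (fun t => G t - G 0) => _; rewrite subrr; split=> // t t2.
  by apply: (derive_cast (is_deriveB (HG t t2) (is_derive_cst (G 0) t 1))) => //; rewrite subr0.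
have [Phi HPhi] := choice step.
pose z n := iter n Phi (fun=> 0).
have gz n : good (z n).
  elim: n => [|n IH]; first by move=> t _; exact: cst_continuous.
  by move=> t t2; have [_ D] := HPhi _ IH; exact: is_derive_continuous (D t t2).
have z0 n : z n 0 = 0 by case: n => // n; have [E _] := HPhi _ (gz n); exact: E.
have dz n t : `|t| < 2 -> is_derive1 t (z n.+1) (F (t, z n (clamp 1 t))).
  by move=> t2; have [_ H] := HPhi _ (gz n); exact: H t t2.
have seg (t t' : R) : `|t| <= r -> `|t'| <= r -> forall s, Num.min t t' <= s <= Num.max t t' -> `|s| <= r.
  by move=> tr tr' s; exact: segment_norm_le.
have r2 (t : R) : `|t| <= r -> `|t| < 2 by move=> tr; apply: le_lt_trans tr _; lra.
have rc t : `|t| <= r -> clamp 1 t = t by move=> tr; apply: clamp_id; exact: le_trans r1.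
have n0r : `|0 : R| <= r by rewrite normr0 ltW.
have lipz n t t' : `|t| <= r -> `|t'| <= r -> `|z n t' - z n t| <= M * `|t' - t|.
  move=> tr tr'; case: n => [|n]; first by rewrite /z/= subrr normr0 mulr_ge0.
  apply: (@MVT_norm R (z n.+1) (fun s => F (s, z n (clamp 1 s)))) => s /(seg _ _ tr tr') sr; first exact: dz n s (r2 s sr).
  exact: FM.
have contr (u1 u2 v1 v2 : R -> R) (a t : R) : 0 <= a -> `|t| <= r -> u1 0 = u2 0 ->
    (forall s, `|s| <= r -> is_derive1 s u1 (F (s, v1 s))) ->
    (forall s, `|s| <= r -> is_derive1 s u2 (F (s, v2 s))) ->
    (forall s, `|s| <= r -> `|v1 s - v2 s| <= a) -> `|u1 t - u2 t| <= 2^-1 * a.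
  move=> a0 tr u0 D1 D2 Hv.
  have := @MVT_norm R (fun s => u1 s - u2 s) (fun s => F (s, v1 s) - F (s, v2 s)) 0 t (L * a).
  rewrite u0 subrr !subr0 => H; apply: (le_trans (H _ _)).
  - move=> s /(seg _ _ n0r tr) sr; have E1 := D1 s sr; have E2 := D2 s sr; exact: is_deriveB.
  - by move=> s /(seg _ _ n0r tr) sr; apply: (le_trans (FL _ _ _)); rewrite ler_wpM2l// Hv.
  - rewrite mulrAC ler_wpM2r// (le_trans _ Lr)// ler_wpM2l//.
have dz' n t : `|t| <= r -> is_derive1 t (z n.+1) (F (t, z n t)).
  by move=> tr; have := dz n t (r2 t tr); rewrite rc.
have diff n t : `|t| <= r -> `|z n.+1 t - z n t| <= M * 2^-1 ^+ n.
  elim: n t => [|n IH] t tr.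
    have := lipz 1%N 0 t n0r tr; rewrite z0 !subr0 expr0 mulr1 => h; apply: (le_trans h).
    by rewrite ler_piMr// (le_trans tr).
  have a0 : 0 <= M * 2^-1 ^+ n by rewrite mulr_ge0// exprn_ge0// invr_ge0.
  have E0 : z n.+2 0 = z n.+1 0 by rewrite !z0.
  rewrite exprS mulrCA; exact: contr _ _ _ _ _ t a0 tr E0 (dz' n.+1) (dz' n) IH.
have lim t : `|t| <= r -> cvgn (z ^~ t) /\ forall n, `|limn (z ^~ t) - z n t| <= 2 * M * 2^-1 ^+ n.
  by move=> tr; apply: geometric_cvg => // n; exact: diff.
pose Z t := limn (z ^~ t).
have Z0 : Z 0 = 0 by rewrite /Z (_ : z ^~ 0 = fun=> 0) ?lim_cst//; apply/funext => n; exact: z0.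
have small (a b : R) : 0 <= a -> (forall n, b <= a * 2^-1 ^+ n) -> b <= 0.
  move=> a0 H; have e0 : (fun n : nat => a * 2^-1 ^+ n) @ \oo --> (0 : R).
    rewrite -[X in _ --> X](mulr0 a); apply: cvgM; first exact: cvg_cst.
    by apply: cvg_expr; rewrite ger0_norm ?invr_ge0// invf_lt1// ltr1n.
  have := cvg_lim (@Rhausdorff R) e0 => <-.
  by apply: limr_ge; [apply/cvg_ex; exists 0|apply: nearW => n; exact: H].
have Zlip t t' : `|t| <= r -> `|t'| <= r -> `|Z t' - Z t| <= M * `|t' - t|.
  move=> tr tr'; rewrite -subr_le0; apply: (small (4 * M)); first by rewrite mulr_ge0.
  move=> n; have [_ /(_ n) h1] := lim t tr; have [_ /(_ n) h2] := lim t' tr'.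
  have h3 := lipz n t t' tr tr'.
  rewrite lerBlDr (_ : Z t' - Z t = (Z t' - z n t') + (z n t' - z n t) - (Z t - z n t)); last by ring.
  apply: (le_trans (normD_le (normD_le h2 h3) _)); first by rewrite normrN; exact: h1.
  by apply: eq_ler; ring.
have cZ : continuous (fun t => Z (clamp r t)).
  move=> t; apply/continuousR_leP => e e0; exists (e / (M + 1)); first by rewrite divr_gt0// ltr_wpDl.
  move=> h he; have r0' := ltW r0.
  apply: (le_trans (Zlip _ _ (clamp_le _ r0') (clamp_le _ r0'))).
  apply: (@le_trans _ _ (M * (e / (M + 1)))).
    by rewrite ler_wpM2l// (le_trans (clamp_lip _ _ _))// addrAC subrr add0r.
  rewrite mulrCA ler_piMr ?(ltW e0)// ler_pdivrMr ?mul1r; [lra|by rewrite ltr_wpDl].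
have cal : continuous (fun t => F (t, Z (clamp r t))).
  by move=> t; apply: continuous_pair_comp => //; exact: cZ.
have [G HG] := antiderivative 2 cal.
pose Y t := G t - G 0.
have dY t : `|t| <= r -> is_derive1 t Y (F (t, Z t)).
  move=> tr; by apply: (derive_cast (is_deriveB (HG t (r2 t tr)) (is_derive_cst (G 0) t 1))) => //; rewrite subr0 clamp_id.
have YZ t : `|t| <= r -> Y t = Z t.
  move=> tr; apply/eqP; rewrite -subr_eq0 -normr_le0; apply: (small (2 * M)); first by rewrite mulr_ge0.
  move=> n; have [_ /(_ n.+1) h1] := lim t tr.
  have h2 : `|Y t - z n.+1 t| <= 2^-1 * (2 * M * 2^-1 ^+ n).
    have a0 : 0 <= 2 * M * 2^-1 ^+ n by rewrite !mulr_ge0// exprn_ge0// invr_ge0.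
    have E0 : Y 0 = z n.+1 0 by rewrite z0 /Y subrr.
    exact: contr _ _ Z (z n) _ t a0 tr E0 dY (dz' n) (fun s sr => proj2 (lim s sr) n).
  rewrite (_ : Y t - Z t = (Y t - z n.+1 t) - (Z t - z n.+1 t)); last by ring.
  apply: (le_trans (normD_le h2 _)); first by rewrite normrN; exact: h1.
  by rewrite exprS; apply: eq_ler; field.
exists Y; first by rewrite /Y subrr.
move=> t tr; have tr' := ltW tr; split.
  by have := Zlip 0 t n0r tr'; rewrite YZ// Z0 !subr0.
by have := dY t tr'; rewrite YZ.
Qed.

(** Clamping both coordinates to a box around [v] makes the field bounded and globally Lipschitz in
    the second variable; for [|t - v.1| < r] the solution stays in the box, where nothing was
    changed. *)
Lemma picard (f fz : R * R -> R) (O : set (R * R)) (v : R * R) : open O -> O v ->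
  (cont_on O f) -> (cont_on O fz) ->
  (forall u, O u -> is_dz u f (fz u)) ->
  exists2 r : R, 0 < r & exists2 z : R -> R, z v.1 = v.2 &
    forall t, `|t - v.1| < r -> O (t, z t) /\ is_derive1 t z (- f (t, z t)).
Proof.
move=> oO Ov cf cfz df.
have /nbhs2_leP[d d0 Hd] : nbhs v O by exact: open_nbhs_nbhs.
pose tr (u : R * R) : R * R := (v.1 + u.1, v.2 + u.2).
have trO u : Box d u -> O (tr u) by move=> [a b]; exact: Hd.
have ctr : continuous tr.
  move=> u; have c1 : {for u, continuous (fun u => v.1 + u.1)}.
    by cont.
  have c2 : {for u, continuous (fun u => v.2 + u.2)}.
    by cont.
  exact: cvg_pair c1 c2.
have [M M0 HM] : exists2 M : R, 0 < M & forall u, Box d u -> `|f (tr u)| <= M.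
  apply: (@compact_bound R (Box d) (fun u => f (tr u))); first exact: Box_compact.
  by move=> u Bu; apply: (cont_comp tr f); [exact: ctr|exact: cf (trO u Bu)].
have [L L0 HL] : exists2 L : R, 0 < L & forall u, Box d u -> `|fz (tr u)| <= L.
  apply: (@compact_bound R (Box d) (fun u => fz (tr u))); first exact: Box_compact.
  by move=> u Bu; apply: (cont_comp tr fz); [exact: ctr|exact: cfz (trO u Bu)].
have d0' := ltW d0.
pose cl (u : R * R) : R * R := (clamp d u.1, clamp d u.2).
have clB u : Box d (cl u) by split; exact: clamp_le.
have ccl : continuous cl.
  have cc : continuous (clamp d).
    move=> s; apply/continuousR_leP => e e0; exists e => // h he.
    by rewrite (le_trans (clamp_lip _ _ _))// addrAC subrr add0r.
  move=> u.
  have c1 : {for u, continuous (fun u => clamp d u.1)}.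
    by apply: (cont_comp (fun u => u.1) (clamp d)); [exact: cvg_fst|exact: cc].
  have c2 : {for u, continuous (fun u => clamp d u.2)}.
    by apply: (cont_comp (fun u => u.2) (clamp d)); [exact: cvg_snd|exact: cc].
  exact: cvg_pair c1 c2.
pose F u := - f (tr (cl u)).
have cF : continuous F.
  move=> u; apply: continuousN; apply: (cont_comp (fun u => tr (cl u)) f).
    by apply: (cont_comp cl tr); [exact: ccl|exact: ctr].
  by apply: cf; apply: trO; exact: clB.
have FL x y y' : `|F (x, y) - F (x, y')| <= L * `|y - y'|.
  rewrite /F opprK addrC /tr /cl /=.
  have := @MVT_norm R (fun s => f (v.1 + clamp d x, s)) (fun s => fz (v.1 + clamp d x, s)) (v.2 + clamp d y) (v.2 + clamp d y') L.
  rewrite -[`|f _ - f _|]distrC => H; rewrite distrC.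
  have seg s : Num.min (v.2 + clamp d y) (v.2 + clamp d y') <= s <= Num.max (v.2 + clamp d y) (v.2 + clamp d y') -> `|s - v.2| <= d.
    have := clamp_le y d0'; have := clamp_le y' d0'; rewrite !ler_norml => /andP[a b] /andP[a' b'] /andP[].
    by rewrite ge_min le_max => s1 s2; apply/andP; split; [case/orP: s1|case/orP: s2] => ?; lra.
  have sE s : s = v.2 + (s - v.2) by ring.
  rewrite distrC; apply: (le_trans (H _ _)).
  - move=> s /seg sd; apply: (proj1 (is_derive_dz _ (v.1 + clamp d x, s) _)); apply: df.
    by rewrite {1}(sE s); apply: (trO (clamp d x, s - v.2)); split => //; exact: clamp_le.
  - move=> s /seg sd; rewrite {1}(sE s); apply: (HL (clamp d x, s - v.2)); split => //; exact: clamp_le.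
  - rewrite ler_wpM2l ?(ltW L0)// opprD addrACA subrr add0r distrC; exact: clamp_lip.
pose r := Num.min 1 (Num.min (d / (M + 1)) (Num.min d (2^-1 / L))).
have M1 : 0 < M + 1 by rewrite addr_gt0.
have r0 : 0 < r by rewrite !lt_min ltr01 d0 !divr_gt0.
have [r1 rd rd' rL] : [/\ r <= 1, r <= d / (M + 1), r <= d & r <= 2^-1 / L].
  by rewrite /r; generalize (d / (M + 1)) (2^-1 / L) => m1 m2; split; rewrite !ge_min lexx ?orbT.
have Lr : L * r <= 2^-1 by rewrite mulrC -ler_pdivlMr.
have [Y Y0 HY] := @picard_global F M L r cF (ltW M0) (ltW L0) r0 r1 Lr (fun u => ltac:(by rewrite /F normrN; exact: HM)) FL.
exists r => //; exists (fun t => v.2 + Y (t - v.1)); first by rewrite subrr Y0 addr0.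
move=> t ht; have [Yt DY] := HY _ ht.
have Yd : `|Y (t - v.1)| <= d.
  apply: (le_trans Yt); apply: (@le_trans _ _ (M * r)); first by rewrite ler_wpM2l ?(ltW M0)// ltW.
  have : r * (M + 1) <= d by rewrite -ler_pdivlMr.
  by lra.
have td : `|t - v.1| <= d by rewrite (le_trans _ rd')// ltW.
have tE : (t, v.2 + Y (t - v.1)) = tr (t - v.1, Y (t - v.1)) by rewrite /tr /=; congr (_, _); ring.
split; first by rewrite tE; exact: trO.
have E : is_derive1 t (fun y => y - v.1) 1.
  by apply: (derive_cast (is_deriveB (is_derive_id t 1) (is_derive_cst v.1 t 1))) => //; rewrite subr0.
apply: (derive_cast (is_deriveD (is_derive_cst v.2 t 1) (@is_derive1_comp R Y (fun y => y - v.1) t _ _ DY E))) => //.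
by rewrite add0r mulr1 tE /F /cl /= !clamp_id.
Qed.

End picard.

(** * The herringbone curve, its slopes and the leaves *)

Section smooth_pairs.
Context {R : realType}.

Lemma Cn_fst_comp (V W1 W2 : normedModType R) n (A : set V) (f : V -> W1 * W2) : open A ->
  Cn_on n A f -> Cn_on n A (fun x => (f x).1).
Proof.
move=> oA; elim: n f => [|n IH] f.
  move=> [cf _]; split=> // x Ax; apply: (cont_comp f (fun w => w.1)); [exact: cf|exact: cvg_fst].
move=> sf; apply: (@Cn_derive R _ _ n A _ (fun v x => ('D_v f x).1) oA).
- move=> x Ax; apply: (cont_comp f (fun w => w.1)); [exact: Cn_cont sf Ax|exact: cvg_fst].
- by move=> x v Ax; apply: is_derive_fst_comp; exact: Cn_is_derive sf Ax.
- by move=> v; apply: IH; exact: Cn_D sf.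
Qed.

Lemma Cn_snd_comp (V W1 W2 : normedModType R) n (A : set V) (f : V -> W1 * W2) : open A ->
  Cn_on n A f -> Cn_on n A (fun x => (f x).2).
Proof.
move=> oA; elim: n f => [|n IH] f.
  move=> [cf _]; split=> // x Ax; apply: (cont_comp f (fun w => w.2)); [exact: cf|exact: cvg_snd].
move=> sf; apply: (@Cn_derive R _ _ n A _ (fun v x => ('D_v f x).2) oA).
- move=> x Ax; apply: (cont_comp f (fun w => w.2)); [exact: Cn_cont sf Ax|exact: cvg_snd].
- by move=> x v Ax; apply: is_derive_snd_comp; exact: Cn_is_derive sf Ax.
- by move=> v; apply: IH; exact: Cn_D sf.
Qed.

End smooth_pairs.

Section herringbone.
Context {R : realType}.
Variables (U : set (R * R)) (f : R * R -> R) (I : set R) (c : R -> heis R) (Fp Fm : R * R -> set (R * R)).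
Hypotheses (oU : open U) (bU : bounded_set U) (Lf : intrinsic_lipschitz U f)
  (H : smooth_herringbone U f I c Fp Fm).

Let ga := gamma_z c.
Let cy (x : R) : R := hy (c x).

(** The nexus is contained in the graph by definition, and [Pi] inverts [Psi f]. *)
Lemma nexus_point x : I x -> [/\ U (x, ga x), f (x, ga x) = cy x & c x = Psi f (x, ga x)].
Proof.
move=> Ix; have : (c @` I) (c x) by exists x.
rewrite -(herringbone_nexus H) => -[[v Uv E] _].
have vE : v = Pi (c x) by rewrite -E Pi_Psi.
have v1 : v.1 = x by rewrite vE /= (herringbone_param H Ix).
have v2 : v.2 = ga x by rewrite vE.
have {}vE : v = (x, ga x) by rewrite (surjective_pairing v) v1 v2.
by rewrite -vE -E; split=> //; rewrite /cy -E PsiE.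
Qed.

Lemma projection_I v : U v -> I v.1.
Proof.
move=> Uv; have [[t It Et]|nC] := pselect (((Pi \o c) @` I) v).
  by rewrite -Et /= (herringbone_param H It).
have : (U `\` ((Pi \o c) @` I)) v by [].
by rewrite (herringbone_cut H) => -[[]|[]].
Qed.

(** [U] is an open neighbourhood of the projected curve, and it projects into [I]. *)
Lemma I_open : open I.
Proof.
rewrite openE => x Ix; have [Ux _ _] := nexus_point Ix.
have /nbhs2_leP[d d0 Hd] : nbhs (x, ga x) U by exact: open_nbhs_nbhs.
rewrite /interior; apply/nbhsR_leP; exists d => // h hd.
have := Hd h 0 hd; rewrite normr0 (ltW d0) => /(_ isT) /projection_I.
by rewrite /=.
Qed.
Let oI := I_open.

Lemma cy_smooth : smooth_on I cy.
Proof.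
move=> n; apply: (@Cn_snd_comp R _ _ _ n I (fun t => (c t).1)) => //.
exact: @Cn_fst_comp R _ _ _ n I c oI (herringbone_smooth H n).
Qed.

Lemma is_derive_cy x : I x -> is_derive1 x cy ('D_1 cy x).
Proof. by move=> Ix; exact: Cn_is_derive _ (cy_smooth 1) Ix. Qed.

Lemma cy_continuous x : I x -> {for x, continuous cy}.
Proof. by move=> Ix; exact: Cn_cont (cy_smooth 0) Ix. Qed.

Lemma dcy_continuous x : I x -> {for x, continuous ('D_1 cy)}.
Proof. by move=> Ix; exact: Cn_cont (@Cn_D R _ _ 0 I cy 1 (cy_smooth 1)) Ix. Qed.

(** Horizontality: for a horizontal curve with [x' = 1], the derivative of [z - x * y / 2] is
    [- y]. *)
Lemma is_derive_ga x : I x -> is_derive1 x ga (- cy x).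
Proof.
move=> Ix; have [_ /(_ x)] := herringbone_horizontal H.
have iI : interior I x by exact: open_nbhs_nbhs.
move=> /(_ iI)[D _ [a [b E]]].
have Dc : is_derive1 x c ('D_1 c x) by split.
have Dx := is_derive_fst_comp (is_derive_fst_comp Dc).
have Dy := is_derive_snd_comp (is_derive_fst_comp Dc).
have Dz := is_derive_snd_comp Dc.
have Dx1 : is_derive1 x (fun t => hx (c t)) 1.
  have : is_derive1 x (fun t => t) 1 by exact: is_derive_id.
  by apply: near_eq_is_derive; apply: (open_near oI Ix) => t It; rewrite (herringbone_param H It).
have a1 : a = 1.
  have := is_derive_unique Dx Dx1; rewrite E /fieldX /fieldY /=.
  by rewrite /GRing.scale/= => <-; ring.
apply: (derive_cast (is_deriveB Dz (is_deriveM (is_deriveM Dx Dy) (is_derive_cst (2^-1 : R) x 1)))) => //.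
rewrite !fctE E /fieldX /fieldY /= a1 (herringbone_param H Ix) /GRing.scale/= -/(cy x) /hy -/(hy _) -/(cy x).
by rewrite -/(hx (c x)) (herringbone_param H Ix); field.
Qed.

Lemma continuous_Ncy x : I x -> {for x, continuous (fun x => - cy x)}.
Proof. by move=> Ix; apply: continuousN; exact: cy_continuous. Qed.
Let Om : set (R * R) := off_graph U ga.

Lemma off_curveE : Om = U_plus U I c `|` U_minus U I c.
Proof.
apply/seteqP; split=> v.
  move=> [Uv]; rewrite neq_lt => /orP[h|h]; [right|left]; split => //; exact: projection_I.
by move=> [[Uv Iv h]|[Uv Iv h]]; split=> //; rewrite neq_lt; [rewrite [X in _ || X]h orbT|rewrite [X in X || _]h].
Qed.

Lemma off_curve_open : open Om.
Proof. exact: off_graph_open oU oI projection_I is_derive_ga. Qed.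

Lemma f_smooth : smooth_on Om f.
Proof.
move=> n; rewrite off_curveE; apply: Cn_setU; [exact: (herringbone_smooth_plus H)|exact: (herringbone_smooth_minus H)].
Qed.

Lemma f_dif v : Om v -> dif f v (d_x f v) (d_z f v).
Proof. by move=> Ov; exact: Cn_dif off_curve_open (f_smooth 1) Ov. Qed.

Lemma f_continuous v : U v -> {for v, continuous f}.
Proof. exact: intrinsic_lipschitz_continuous. Qed.

Lemma herringbone_graph_data (M : R) : (forall v, U v -> `|f v| <= M) -> exists B,
  graph_data U M I ga (fun x => - cy x) f (d_x f) (d_z f) (nabla f f) B.
Proof.
move=> fM; have [B B0 HB] := intrinsic_lipschitz_gradient Lf.
exists B; have oOm := off_curve_open; split => //.
- exact: projection_I.
- exact: is_derive_ga.
- exact: continuous_Ncy.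
- exact: f_continuous.
- by move=> v Ov; exact: dif_dx (f_dif Ov).
- by move=> v Ov; exact: dif_dz (f_dif Ov).
- by move=> v Ov; exact: Cn_cont (Cn_D _ (f_smooth 1)) Ov.
- by move=> v Ov; exact: Cn_cont (Cn_D _ (f_smooth 1)) Ov.
- move=> v Ov; apply: HB; last exact: f_dif.
  by apply: open_nbhs_nbhs; split=> //; case: Ov.
Qed.

Lemma second_nablaE w v : smooth_on setT w -> Om v ->
  nabla f (nabla f w) v = second_nabla w f (nabla f f) v.
Proof.
move=> sw Ov.
have sx : smooth_on setT (d_x w) by move=> n; exact: (Cn_D _ (sw n.+1)).
have sz : smooth_on setT (d_z w) by move=> n; exact: (Cn_D _ (sw n.+1)).
have Dx (u : R * R -> R) : smooth_on setT u -> is_dx v u (d_x u v).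
  by move=> su; exact: (Cn_is_derive _ (su 1%N)).
have Dz (u : R * R -> R) : smooth_on setT u -> is_dz v u (d_z u v).
  by move=> su; exact: (Cn_is_derive _ (su 1%N)).
have fx := dif_dx (f_dif Ov); have fz := dif_dz (f_dif Ov).
have E1 : d_x (nabla f w) v = d_x (d_x w) v - (f v *: d_x (d_z w) v + d_z w v *: d_x f v).
  by have [_] := is_deriveB (Dx _ sx) (is_deriveM fx (Dx _ sz)).
have E2 : d_z (nabla f w) v = d_z (d_x w) v - (f v *: d_z (d_z w) v + d_z w v *: d_z f v).
  by have [_] := is_deriveB (Dz _ sx) (is_deriveM fz (Dz _ sz)).
rewrite [LHS]/nabla E1 E2 /second_nabla /nabla /GRing.scale/=.
by move: (d_x (d_x w) v) (d_x (d_z w) v) (d_z (d_x w) v) (d_z (d_z w) v) (d_z w v) (d_x f v) (d_z f v) => *; ring.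
Qed.

End herringbone.

Section cutoff.
Context {R : realType}.

Definition plateau (u : R) : R := step (2 + u) * step (2 - u).

Lemma plateau_smooth n : Cn_on n setT plateau.
Proof.
have oT : open (setT : set R) by exact: openT.
have aff (s : R) : Cn_on n setT (fun u : R => 2 + s * u).
  apply: Cn_add => //; first exact: Cn_cst.
  by apply: Cn_mul => //; [exact: Cn_cst|exact: Cn_id].
apply: Cn_mul => //.
  apply: (@Cn_comp1 R _ n setT setT step (fun u : R => 2 + u)) => //; first exact: step_smooth.
  by apply: (Cn_eq oT) (aff 1) => u _; rewrite mul1r.
apply: (@Cn_comp1 R _ n setT setT step (fun u : R => 2 - u)) => //; first exact: step_smooth.
by apply: (Cn_eq oT) (aff (-1)) => u _; rewrite mulN1r.
Qed.

Lemma plateau1 u : `|u| <= 1 -> plateau u = 1.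
Proof. by rewrite ler_norml => /andP[a b]; rewrite /plateau !step1 ?mulr1//; lra. Qed.

Lemma plateau0 u : 2 <= `|u| -> plateau u = 0.
Proof.
have [u0|u0] := leP 0 u; first by rewrite ger0_norm// => h; rewrite /plateau [step (2 - u)]step0 ?mulr0//; lra.
by rewrite ltr0_norm// => h; rewrite /plateau [step (2 + u)]step0 ?mul0r//; lra.
Qed.

Lemma plateau_ge0 u : 0 <= plateau u.
Proof. by rewrite mulr_ge0// step_ge0. Qed.

Lemma plateau_le1 u : plateau u <= 1.
Proof. by rewrite mulr_ile1 ?step_ge0 ?step_le1. Qed.

Lemma Cn_affine_comp (F : R -> R) (a b : R) n : Cn_on n setT F -> Cn_on n setT (fun x : R => F ((x - a) / b)).
Proof.
move=> sF; have oT : open (setT : set R) by exact: openT.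
apply: (@Cn_comp1 R _ n setT setT F (fun x => (x - a) / b)) => //.
apply: Cn_mul => //; last exact: Cn_cst.
by apply: Cn_sub_fun => //; [exact: Cn_id|exact: Cn_cst].
Qed.

Lemma Cn_comp_fst (F : R -> R) n (I : set R) (A : set (R * R)) : open A -> open I -> (forall v, A v -> I v.1) ->
  Cn_on n I F -> Cn_on n A (fun v => F v.1).
Proof.
by move=> oA oI AI sF; apply: (@Cn_comp1 R _ n A I F (fun v => v.1)) => //; exact: Cn_fst.
Qed.

Lemma Cn_comp_snd (F : R -> R) n (A : set (R * R)) : open A ->
  Cn_on n setT F -> Cn_on n A (fun v => F v.2).
Proof.
by move=> oA sF; apply: (@Cn_comp1 R _ n A setT F (fun v => v.2)) => //; [exact: openT|exact: Cn_snd].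
Qed.

Definition box_plateau (v0 : R * R) (r : R) (v : R * R) : R :=
  plateau ((v.1 - v0.1) / r) * plateau ((v.2 - v0.2) / r).

Lemma box_plateau_smooth v0 r n : Cn_on n setT (box_plateau v0 r).
Proof.
have oT : open (setT : set (R * R)) by exact: openT.
apply: Cn_mul => //.
  by apply: (@Cn_comp_fst (fun x => plateau ((x - v0.1) / r)) n setT) => //; [exact: openT|apply: Cn_affine_comp; exact: plateau_smooth].
by apply: (@Cn_comp_snd (fun x => plateau ((x - v0.2) / r)) n) => //; apply: Cn_affine_comp; exact: plateau_smooth.
Qed.

Lemma box_plateau1 v0 r v : 0 < r -> `|v.1 - v0.1| <= r -> `|v.2 - v0.2| <= r -> box_plateau v0 r v = 1.
Proof.
move=> r0 h1 h2; have P u : `|u| <= r -> plateau (u / r) = 1.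
  by move=> ur; rewrite plateau1// normrM normfV (gtr0_norm r0) ler_pdivrMr// mul1r.
by rewrite /box_plateau !P ?mulr1.
Qed.

Lemma box_plateau0 v0 r v : 0 < r -> 2 * r <= `|v.1 - v0.1| \/ 2 * r <= `|v.2 - v0.2| -> box_plateau v0 r v = 0.
Proof.
move=> r0 [h|h]; rewrite /box_plateau.
  by rewrite [X in X * _]plateau0 ?mul0r// normrM normfV (gtr0_norm r0) ler_pdivlMr.
by rewrite [X in _ * X]plateau0 ?mulr0// normrM normfV (gtr0_norm r0) ler_pdivlMr.
Qed.

Lemma smooth_localization (A : set (R * R)) (m0 : R * R -> R) (v0 : R * R) (r : R) : 0 < r -> open A ->
  smooth_on A m0 -> (forall v, `|v.1 - v0.1| <= 2 * r -> `|v.2 - v0.2| <= 2 * r -> A v) ->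
  exists2 m, csmooth m & forall v, `|v.1 - v0.1| <= r -> `|v.2 - v0.2| <= r -> m v = m0 v.
Proof.
move=> r0 oA sA HA; exists (fun v => box_plateau v0 r v * m0 v); last first.
  by move=> v h1 h2; rewrite box_plateau1// mul1r.
pose B := [set v : R * R | 2 * r < `|v.1 - v0.1|] `|` [set v : R * R | 2 * r < `|v.2 - v0.2|].
have oB : open B.
  apply: openU.
    apply: (@open_comp _ _ (fun v => `|v.1 - v0.1|) [set y : R | 2 * r < y]); last exact: open_gt.
    move=> v _; apply: (cont_comp (fun v => v.1 - v0.1) (fun y => `|y|)); last exact: norm_continuous.
    by cont.
  apply: (@open_comp _ _ (fun v => `|v.2 - v0.2|) [set y : R | 2 * r < y]); last exact: open_gt.
  move=> v _; apply: (cont_comp (fun v => v.2 - v0.2) (fun y => `|y|)); last exact: norm_continuous.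
  by cont.
have B0 v : B v -> box_plateau v0 r v * m0 v = 0.
  by move=> [] /= /ltW h; rewrite box_plateau0 ?mul0r//; [left|right].
split.
  move=> n; have -> : setT = A `|` B.
    apply/seteqP; split=> // v _.
    have [h1|h1] := leP `|v.1 - v0.1| (2 * r); last by right; left.
    have [h2|h2] := leP `|v.2 - v0.2| (2 * r); last by right; right.
    by left; exact: HA.
  apply: Cn_setU.
    apply: Cn_mul => //.
    by apply: (@Cn_sub R _ _ n A setT) => //; exact: box_plateau_smooth.
  by apply: (Cn_eq oB) (Cn_cst n 0 oB) => v Bv; rewrite B0.
exists (`|v0.1| + `|v0.2| + 2 * r) => v nB; apply: B0.
have [h1|h1] := leP `|v.1 - v0.1| (2 * r); last by left.
have [h2|h2] := leP `|v.2 - v0.2| (2 * r); last by right.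
exfalso; apply: nB; split.
  rewrite -(subrK v0.1 v.1) addrC; apply: (le_trans (normD_le (lexx _) h1)).
  by rewrite addrAC lerDl.
rewrite -(subrK v0.2 v.2) addrC; apply: (le_trans (normD_le (lexx _) h2)).
by rewrite -addrA lerDr.
Qed.

End cutoff.

Section foliations.
Context {R : realType}.

Lemma line_slopeE (w : R * R) (m : R) : w != 0 -> line w = line (1, m) -> w.1 != 0 /\ m = w.2 / w.1.
Proof.
move=> w0 E; have : line w w by exists 1 => //; rewrite scale1r.
rewrite E => -[a _ Ea].
have w1 : w.1 = a by rewrite -Ea /= /GRing.scale/= mulr1.
have w2 : w.2 = a * m by rewrite -Ea.
have a0 : a != 0.
  apply/eqP => a0; move/eqP: w0; apply.
  by rewrite (surjective_pairing w) w1 w2 a0 mul0r.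
by rewrite w1 w2; split=> //; rewrite mulrC mulKf.
Qed.

Lemma line_slope_inj (m m' : R) : line (1, m) = line (1, m') :> set (R * R) -> m = m'.
Proof.
move=> E; have n0 : ((1, m) : R * R) != 0 by rewrite xpair_eqE oner_eq0.
by have [_ ->] := line_slopeE n0 E; rewrite /= divr1.
Qed.

Lemma slope_line (m : R) : slope (line (1, m)) = m.
Proof.
have ex : exists m', line (1, m) = line (1, m') :> set (R * R) by exists m.
by rewrite /slope; have := getPex ex => /= /line_slope_inj <-.
Qed.

(** Bounded slopes exclude vertical lines, so the slope is the quotient of the components of a local
    spanning field. A plateau function extends it to a compactly supported smooth function on the
    plane that is the slope near [p]. *)
Lemma foliation_slope_smooth (O : set (R * R)) (F : R * R -> set (R * R)) (p : R * R) :
  smooth_foliation O F -> bounded_slopes O F -> O p ->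
  exists2 m, csmooth m & exists2 r : R, 0 < r &
    forall q, `|q.1 - p.1| <= r -> `|q.2 - p.2| <= r -> F q = line (1, m q).
Proof.
move=> [oO sF] [B HB] Op; have [W [w [oW Wp sw Hw]]] := sF p Op.
pose A := W `&` O; have oA : open A by exact: openI.
have Fm q : A q -> (w q).1 != 0 /\ F q = line (1, (w q).2 / (w q).1).
  move=> [Wq Oq]; have [w0 Fq] := Hw q Wq; have [m _ Em] := HB q Oq.
  have [w1 mE] : (w q).1 != 0 /\ m = (w q).2 / (w q).1 by apply: line_slopeE w0 _; rewrite -Fq.
  by split=> //; rewrite -mE.
have sm : smooth_on A (fun q => (w q).2 / (w q).1).
  move=> n; have swA : Cn_on n A w by apply: (@Cn_sub R _ _ n A W); [move=> q []|exact: sw].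
  apply: Cn_mul => //; first exact: Cn_snd_comp.
  have oN0 : open [set x : R | x != 0] by exact: open_neq.
  apply: (@Cn_comp1 R _ n A [set x : R | x != 0] (fun x => x^-1) (fun q => (w q).1)) => //.
  - exact: Cn_inv.
  - exact: Cn_fst_comp.
  - by move=> q /Fm[].
have /nbhs2_leP[d d0 Hd] : nbhs p A by apply: open_nbhs_nbhs; split=> //; split.
have d2 : 0 < d / 2 by rewrite divr_gt0.
have [m sm' mE] := smooth_localization (v0 := p) d2 oA sm (fun v h1 h2 => ltac:(
  rewrite (surjective_pairing v) -(subrK p.1 v.1) -(subrK p.2 v.2) [_ + p.1]addrC [_ + p.2]addrC;
  apply: Hd; [move: h1|move: h2]; rewrite mulrC divfK ?pnatr_eq0//)).
exists m => //; exists (d / 2) => // q h1 h2; rewrite mE//.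
suff /Fm[] : A q by [].
rewrite (surjective_pairing q) -(subrK p.1 q.1) -(subrK p.2 q.2) [_ + p.1]addrC [_ + p.2]addrC.
by apply: Hd; [apply: le_trans h1 _|apply: le_trans h2 _]; lra.
Qed.

Lemma continuous_Psi (f : R * R -> R) (u : R * R) : {for u, continuous f} -> {for u, continuous (Psi f)}.
Proof.
move=> cf; have -> : Psi f = fun u => (u.1, f u, u.2 + u.1 * f u / 2) by apply/funext => w; rewrite PsiE.
have c1 : {for u, continuous (fun u : R * R => u.1)} by exact: cvg_fst.
have c2 : {for u, continuous (fun u : R * R => u.2 + u.1 * f u / 2)}.
  by cont.
exact: cvg_pair (cvg_pair c1 cf) c2.
Qed.

(** The solution of [z' = - f (t, z)] through [v] lifts to a horizontal curve in the graph. Along it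
    [f] has derivative [nabla f f], which is thus the slope of its projection, and [F] is the
    tangent of this projection. *)
Lemma leaf_slope (U' : set (R * R)) (f : R * R -> R) (N : set (heis R)) F v :
  open U' -> smooth_on U' f -> open N -> extends_projected_foliation (N `&` igraph U' f) F ->
  U' v -> N (Psi f v) -> F (v.1, f v) = line (1, nabla f f v).
Proof.
move=> oU' sf oN ext Uv Nv.
pose O := U' `&` [set u | N (Psi f u)].
have cf u : U' u -> {for u, continuous f} by move=> Uu; exact: Cn_cont (sf 0%N) Uu.
have cPsi u : U' u -> {for u, continuous (Psi f)} by move=> Uu; exact: continuous_Psi (cf u Uu).
have oO : open O.
  rewrite openE => u [Uu Nu]; rewrite /interior; near=> u'; split.
    by near: u'; exact: open_nbhs_nbhs.
  by near: u'; apply: cPsi => //; exact: open_nbhs_nbhs.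
have cfz u : O u -> {for u, continuous (d_z f)}.
  by move=> [Uu _]; exact: Cn_cont (@Cn_D R _ _ 0 U' f _ (sf 1%N)) Uu.
have cfx u : O u -> {for u, continuous (d_x f)}.
  by move=> [Uu _]; exact: Cn_cont (@Cn_D R _ _ 0 U' f _ (sf 1%N)) Uu.
have df u : O u -> dif f u (d_x f u) (d_z f u) by move=> [Uu _]; exact: Cn_dif oU' (sf 1%N) Uu.
have [r r0 [z zv Hz]] := @picard R f (d_z f) O v oO (conj Uv Nv) (fun u Ou => cf u (proj1 Ou)) cfz (fun u Ou => dif_dz (df u Ou)).
pose J := [set t : R | `|t - v.1| < r].
have oJ : open J.
  apply: (@open_comp _ _ (fun t => `|t - v.1|) [set y : R | y < r]); last exact: open_lt.
  move=> t _; apply: (cont_comp (fun t => t - v.1) (fun y => `|y|)); last exact: norm_continuous.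
  by apply: contB; [exact: id|exact: cst_continuous].
have iJ : is_interval J.
  move=> x y Jx Jy t /andP[xt ty]; move: Jx Jy; rewrite /J/= !ltr_norml => /andP[? ?] /andP[? ?].
  by apply/andP; split; lra.
pose u (t : R) : R * R := (t, z t).
have Du t : J t -> is_derive1 t (fun t => f (u t)) (nabla f f (u t)).
  move=> Jt; have [Ot Dz] := Hz t Jt.
  by apply: (derive_cast (@dif_is_derive R R f (fun t => t) z t 1 _ _ _ _ (df _ Ot) (is_derive_id t 1) Dz)) => //; rewrite /nabla; ring.
pose c (t : R) : heis R := Psi f (u t).
pose dc (t : R) : heis R := (1, nabla f f (u t), - f (u t) + (f (u t) + t * nabla f f (u t)) / 2).
have Dc t : J t -> is_derive1 t c (dc t).
  move=> Jt; have [Ot Dz] := Hz t Jt; have Dy := Du t Jt.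
  have Dt := is_derive_id t (1:R).
  have D3 := is_deriveD Dz (is_deriveM (is_deriveM Dt Dy) (is_derive_cst (2^-1 : R) t 1)).
  apply: (derive_cast (is_derive_pair (is_derive_pair Dt Dy) D3)) => [s|]; first by rewrite /c PsiE.
  by rewrite /dc !fctE /GRing.scale/=; congr (_, _, _); field.
have cu t : J t -> {for t, continuous u}.
  by move=> Jt; have [_ /is_derive_continuous cz] := Hz t Jt; exact: cvg_pair (@cvg_id _ _) cz.
have cdc t : J t -> {for t, continuous dc}.
  move=> Jt; have [Ot _] := Hz t Jt.
  have cG : {for t, continuous (fun t => nabla f f (u t))}.
    apply: (cont_comp u (nabla f f)); first exact: cu.
    apply: contB; first exact: cfx.
    by apply: contM; [exact: cf (proj1 Ot)|exact: cfz].
  have cF : {for t, continuous (fun t => f (u t))} by exact: is_derive_continuous (Du t Jt).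
  have c3 : {for t, continuous (fun t => - f (u t) + (f (u t) + t * nabla f f (u t)) / 2)}.
    apply: contD.
      exact: continuousN.
    apply: contM; last exact: cst_continuous.
    apply: contD => //.
    by apply: contM => //; exact: id.
  exact: cvg_pair (cvg_pair (@cst_continuous _ _ (1 : R) t) cG) c3.
have hc : horizontal_curve J c.
  split.
    apply: continuous_in_subspaceT => t; rewrite inE => Jt.
    have [D _] := Dc t Jt; apply: differentiable_continuous; exact/derivable1_diffP.
  move=> t; rewrite /interior => /nbhs_singleton Jt; split; first by have [] := Dc t Jt.
    apply: (@continuous_near_eq _ _ _ _ dc); last exact: cdc.
    by apply: (open_near oJ Jt) => s Js; have [] := Dc s Js.
  exists 1, (nabla f f (u t)); have [_ ->] := Dc t Jt.
  rewrite /c PsiE /fieldX /fieldY /dc /hx /hy /=.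
  transitivity (1 * 1 + nabla f f (u t) * 0, 1 * 0 + nabla f f (u t) * 1,
    1 * - (f (u t) / 2) + nabla f f (u t) * (t / 2)) => //.
  by congr (_, _, _); [ring|ring|field].
have Jv : J v.1 by rewrite /J/= subrr normr0.
have := ext J c iJ hc _ v.1.
have uv : u v.1 = v by rewrite /u zv -surjective_pairing.
have -> : pi_xy (c v.1) = (v.1, f v) by rewrite /c uv PsiE.
move=> ->; last 2 first.
- move=> t Jt; have [[Ut Nt] _] := Hz t Jt; split; first by rewrite /c PsiE.
  by split=> //; exists (u t).
- by rewrite /interior; exact: open_nbhs_nbhs.
have Dp := is_derive_fst_comp (Dc v.1 Jv).
by have [_ E] := Dp; rewrite -[in RHS]uv; congr line; exact: E.
Unshelve. all: by end_near. Qed.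

End foliations.

Section local_leaves.
Context {R : realType}.
Variables (U : set (R * R)) (f : R * R -> R) (I : set R) (c : R -> heis R) (Fp Fm : R * R -> set (R * R)).
Hypotheses (oU : open U) (bU : bounded_set U) (Lf : intrinsic_lipschitz U f)
  (H : smooth_herringbone U f I c Fp Fm).

Let ga := gamma_z c.
Let cy (x : R) : R := hy (c x).
Let oI := I_open oU H.

Definition cbox (v0 : R * R) (r : R) : set (R * R) :=
  [set v | `|v.1 - v0.1| <= r /\ `|v.2 - v0.2| <= r].

Lemma nbhs_cbox (v0 : R * R) (P : set (R * R)) : nbhs v0 P ->
  exists2 r, 0 < r & cbox v0 r `<=` P.
Proof.
move=> /nbhs2_leP[r r0 Hr]; exists r => // v [h1 h2].
by rewrite (surjective_pairing v) -(subrK v0.1 v.1) -(subrK v0.2 v.2) [_ + v0.1]addrC [_ + v0.2]addrC; exact: Hr.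
Qed.

Lemma sub_cbox (v0 : R * R) (r r' : R) : r <= r' -> cbox v0 r `<=` cbox v0 r'.
Proof. by move=> rr v [h1 h2]; split; exact: le_trans rr. Qed.

Lemma continuous_cbox (h : R * R -> R) (v0 : R * R) (e : R) : {for v0, continuous h} -> 0 < e ->
  exists2 r, 0 < r & forall v, cbox v0 r v -> `|h v - h v0| <= e.
Proof. by move=> ch e0; apply: nbhs_cbox; have /cvgr_distC_le := ch; apply. Qed.

Lemma local_leaf (U' : set (R * R)) N F t0 : open U' -> U' `<=` U -> smooth_on U' f -> open N ->
  c @` I `<=` N -> pi_embedding (N `&` igraph U f) -> herringbone_side f U' N I c F -> I t0 ->
  exists2 m, csmooth m & exists2 r, 0 < r &
    [/\ cbox (t0, ga t0) r `<=` U,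
        forall v, cbox (t0, ga t0) r v -> U' v -> nabla f f v = m (v.1, f v),
        forall x, `|x - t0| <= r -> I x -> slope (F (pi_xy (c x))) = m (x, cy x),
        forall x, `|x - t0| <= r -> I x -> slope (F (pi_xy (c x))) <> 'D_1 cy x &
        forall x z z', cbox (t0, ga t0) r (x, z) -> cbox (t0, ga t0) r (x, z') ->
          f (x, z) = f (x, z') -> z = z'].
Proof.
move=> oU' UU sf oN cN [g [_ gN]] [ O1 [fO _ ext tr bO]] It0.
have [U0 f0 c0] := nexus_point H It0.
have [Ot0 _] := tr _ It0.
have pi0 t : I t -> pi_xy (c t) = (t, cy t) by move=> It; rewrite /pi_xy (herringbone_param H It).
have [m sm [r0 r00 Fm0]] := foliation_slope_smooth fO bO Ot0; rewrite pi0// in Fm0.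
have cPsi := continuous_Psi (f_continuous oU bU Lf U0).
have cf : {for (t0, ga t0), continuous f} by exact: f_continuous oU bU Lf _ U0.
have nN : nbhs (Psi f (t0, ga t0)) N by apply: open_nbhs_nbhs; split=> //; rewrite -c0; apply: cN; exists t0.
have [r1 r10 H1] := nbhs_cbox (open_nbhs_nbhs (conj oU U0)).
have [r2 r20 H2] := nbhs_cbox (cPsi _ nN).
have [r3 r30 H3] := continuous_cbox cf r00.
have /continuousR_leP/(_ _ r00)[r4 r40 H4] : {for t0, continuous cy} by exact: cy_continuous oU H _ It0.
exists m => //; exists (Num.min (Num.min r1 r2) (Num.min (Num.min r3 r4) r0)).
  by rewrite !lt_min r10 r20 r30 r40.
have S1 := sub_cbox (v0 := (t0, ga t0)) (_ : Num.min (Num.min r1 r2) (Num.min (Num.min r3 r4) r0) <= r1).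
have S2 := sub_cbox (v0 := (t0, ga t0)) (_ : Num.min (Num.min r1 r2) (Num.min (Num.min r3 r4) r0) <= r2).
have {}S1 := S1 ltac:(by rewrite !ge_min lexx).
have {}S2 := S2 ltac:(by rewrite !ge_min lexx !orbT).
have Fline x : `|x - t0| <= Num.min (Num.min r1 r2) (Num.min (Num.min r3 r4) r0) -> I x -> F (pi_xy (c x)) = line (1, m (x, cy x)).
  rewrite !le_min => /andP[_ /andP[/andP[_ x4] x0]] Ix; rewrite pi0//; apply: Fm0 => //=.
  by have := H4 _ x4; rewrite [t0 + _]addrC subrK.
split.
- by move=> v /S1/H1.
- move=> v bv Uv; have := leaf_slope oU' sf oN ext Uv (H2 _ (S2 _ bv)).
  case: bv; rewrite !le_min => /andP[_ /andP[/andP[v3 _] v0]] /andP[_ /andP[/andP[v3' _] _]].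
  have := H3 v (conj v3 v3'); rewrite f0 => vf.
  by rewrite (Fm0 (v.1, f v))// => /line_slope_inj <-.
- by move=> x xr Ix; rewrite Fline// slope_line.
- move=> x xr Ix E; have [_] := tr _ Ix; apply; rewrite -[in RHS](_ : (1, slope (F (pi_xy (c x)))) = 'D_1 (pi_xy \o c) x).
    by rewrite Fline// slope_line.
  rewrite E.
  have Dx : is_derive1 x (fun t => hx (c t)) 1.
    have : is_derive1 x (fun t => t) 1 by exact: is_derive_id.
    by apply: near_eq_is_derive; apply: (open_near oI Ix) => t It; rewrite (herringbone_param H It).
  by have [_ <-] := is_derive_pair Dx (is_derive_cy oU H Ix).
move=> x z z' bz bz' E; have Nz y : cbox (t0, ga t0) (Num.min (Num.min r1 r2) (Num.min (Num.min r3 r4) r0)) (x, y) ->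
    g (pi_xy (Psi f (x, y))) = Psi f (x, y).
  move=> by'; apply: gN; split; first exact: H2 (S2 _ by').
  by exists (x, y) => //; exact: H1 (S1 _ by').
have : Psi f (x, z) = Psi f (x, z').
  by rewrite -(Nz _ bz) -(Nz _ bz') !PsiE /pi_xy /hx /hy /= E.
by rewrite !PsiE /= => -[_ +]; rewrite E => /addIr.
Qed.

End local_leaves.

(** * Integrability of the vertical derivative near the curve *)

Section fatou.
Context {R : realType}.

Lemma Rfatou d (T : measurableType d) (m : {measure set T -> \bar R}) (D : set T) (f_ : nat -> T -> R) (f : T -> R) (C : R) :
  measurable D -> (forall n, m.-integrable D (EFin \o f_ n)) -> measurable_fun D f ->
  (forall x, D x -> f_ n x @[n --> \oo] --> f x) -> (forall n x, D x -> 0 <= f_ n x) ->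
  (forall n, \int[m]_(x in D) f_ n x <= C) -> m.-integrable D (EFin \o f).
Proof.
move=> mD if_ mf f_f f_0 f_C; apply/integrableP; split; first exact/measurable_EFinP.
have f0 x : D x -> 0 <= f x.
  by move=> Dx; have /cvg_lim <- := f_f x Dx => //; apply: limr_ge; [apply/cvg_ex; exists (f x); exact: f_f|apply: nearW => n; exact: f_0].
have mf_ n : measurable_fun D (EFin \o f_ n) by have /integrableP[] := if_ n.
have -> : (\int[m]_(x in D) `|(EFin \o f) x| = \int[m]_(x in D) limn_einf ((fun n => EFin \o f_ n) ^~ x))%E.
  apply: eq_integral => x; rewrite inE => Dx.
  have cx : (f_ n x)%:E @[n --> \oo] --> (f x)%:E by apply: cvg_EFin; [exact: nearW|exact: f_f].
  rewrite is_cvg_limn_einfE; last by apply/cvg_ex; exists (f x)%:E.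
  by move/cvg_lim: cx => ->//; rewrite /= ger0_norm ?f0.
apply: le_lt_trans (fatou m mD mf_ _) _; first by move=> n x Dx; rewrite /= lee_fin f_0.
apply: (@le_lt_trans _ _ C%:E); last exact: ltry.
rewrite limn_einf_lim; apply: lime_le; first exact: is_cvg_einfs.
apply: nearW => n; apply: (@le_trans _ _ (\int[m]_(x in D) (EFin \o f_ n) x)%E).
  by apply: ereal_inf_lbound; exists n => /=.
by rewrite -(fineK (integrable_fin_num mD (if_ n))) lee_fin; exact: f_C.
Qed.

End fatou.

Section monotone_slices.
Context {R : realType}.

Lemma cboxE (v0 : R * R) (r : R) :
  cbox v0 r = `[v0.1 - r, v0.1 + r]%classic `*` `[v0.2 - r, v0.2 + r]%classic.
Proof.
by apply/seteqP; split=> -[x z]; rewrite /cbox /= !in_itv/= !ler_distl.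
Qed.

Lemma cbox_compact (v0 : R * R) (r : R) : compact (cbox v0 r).
Proof. by rewrite cboxE; apply: compact_setX; exact: segment_compact. Qed.

Lemma cbox_measurable (v0 : R * R) (r : R) : measurable (cbox v0 r : set (mvplane R)).
Proof. by rewrite cboxE; apply: measurableX; exact: measurable_itv. Qed.

Lemma cbox_openC (v0 : R * R) (r : R) : open (~` cbox v0 r).
Proof. by rewrite openC; apply: compact_closed; [exact: norm_hausdorff|exact: cbox_compact]. Qed.

Lemma convex_norm (t a b c r : R) : 0 <= t -> t <= 1 -> `|a - c| <= r -> `|b - c| <= r ->
  `|a + t * (b - a) - c| <= r.
Proof.
move=> t0 t1 ha hb; rewrite (_ : _ - c = (1 - t) * (a - c) + t * (b - c)); last by ring.
have t1' : 0 <= 1 - t by lra.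
apply: (le_trans (ler_normD _ _)); rewrite !normrM !(ger0_norm t0) (ger0_norm t1').
by rewrite [leRHS](_ : r = (1 - t) * r + t * r) ?lerD ?ler_wpM2l//; ring.
Qed.

Variables (f : R * R -> R) (v0 : R * R) (r : R).
Hypotheses (r0 : 0 < r) (cf : forall v, cbox v0 r v -> {for v, continuous f})
  (injf : forall x z z', cbox v0 r (x, z) -> cbox v0 r (x, z') -> f (x, z) = f (x, z') -> z = z').

(* The pairs of points z < z' on a common slice form a convex set, on which
   f (x, z') - f (x, z) does not vanish. *)
Lemma slice_sign : exists2 o : R, o = 1 \/ o = -1 & forall x z z',
  cbox v0 r (x, z) -> cbox v0 r (x, z') -> z < z' -> 0 < o * (f (x, z') - f (x, z)).
Proof.
have b0 : cbox v0 r (v0.1, v0.2) by split; rewrite /= subrr normr0 ltW.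
have b1 : cbox v0 r (v0.1, v0.2 + r).
  by split; rewrite /= ?subrr ?normr0 ?(ltW r0)// addrAC subrr add0r ger0_norm// ltW.
have n0 : f (v0.1, v0.2 + r) - f (v0.1, v0.2) != 0.
  by rewrite subr_eq0; apply/eqP => /(injf b1 b0) E; move: r0; lra.
have [ o o1 oP] : exists2 o : R, o = 1 \/ o = -1 & 0 < o * (f (v0.1, v0.2 + r) - f (v0.1, v0.2)).
  move: n0; rewrite neq_lt => /orP[h|h]; [exists (-1)|exists 1]; rewrite ?mul1r ?mulN1r ?oppr_gt0; tauto.
exists o => // x z z' bz bz' zz'.
pose X (t : R) := v0.1 + t * (x - v0.1).
pose Z (t : R) := v0.2 + t * (z - v0.2).
pose Z' (t : R) := v0.2 + r + t * (z' - (v0.2 + r)).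
pose h (t : R) := o * (f (X t, Z' t) - f (X t, Z t)).
have bZ t : 0 <= t -> t <= 1 -> cbox v0 r (X t, Z t).
  by move=> t0 t1; split; apply: convex_norm => //; case: bz => //= _ _; case: b0.
have bZ' t : 0 <= t -> t <= 1 -> cbox v0 r (X t, Z' t).
  by move=> t0 t1; split; apply: convex_norm => //; (case: bz' => //; case: b1).
have ca (a b : R) t : {for t, continuous (fun t : R => a + t * b)}.
  by cont.
have ch : {within `[0, 1], continuous h}.
  apply: continuous_in_subspaceT => t; rewrite inE /= in_itv/= => /andP[t0 t1].
  apply: (@continuousM _ _ (fun=> o) (fun t => f (X t, Z' t) - f (X t, Z t))); first exact: cst_continuous.
  apply: contB.
    apply: (cont_comp (fun t => (X t, Z' t)) f); last exact: cf (bZ' _ t0 t1).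
    exact: cvg_pair (ca _ _ t) (ca _ _ t).
  apply: (cont_comp (fun t => (X t, Z t)) f); last exact: cf (bZ _ t0 t1).
  exact: cvg_pair (ca _ _ t) (ca _ _ t).
have h0 : 0 < h 0 by rewrite /h /X /Z /Z' !mul0r !addr0.
have h1 : h 1 = o * (f (x, z') - f (x, z)) by rewrite /h /X /Z /Z' !mul1r ![_ + (_ - _)]addrC !subrK.
rewrite -h1 ltNge; apply/negP => h10.
have [|t] := @IVT R h 0 1 0 ler01 ch.
  by have h10' := le_trans h10 (ltW h0); rewrite min_r// max_l// h10 ltW.
rewrite in_itv/= => /andP[t0 t1] /eqP; rewrite mulf_eq0 => /orP[/eqP o0|].
  by case: o1 => o1; move: o0; rewrite o1 => /eqP; rewrite ?oppr_eq0 oner_eq0.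
rewrite subr_eq0 => /eqP /(injf (bZ' _ t0 t1) (bZ _ t0 t1)) E.
suff : Z t < Z' t by rewrite E ltxx.
rewrite /Z /Z' -subr_gt0.
rewrite (_ : _ - _ = (1 - t) * r + t * (z' - z)); last by ring.
have [t1'|t1'] := ltP t 1.
  by rewrite ltr_pwDl// ?mulr_gt0 ?mulr_ge0 ?subr_gt0 ?subr_ge0 ?(ltW zz').
by rewrite (_ : t = 1) ?subrr ?mul0r ?add0r ?mul1r ?subr_gt0//; apply/eqP; rewrite eq_le t1.
Qed.

Lemma slice_derivative_sign (o : R) : (forall x z z',
    cbox v0 r (x, z) -> cbox v0 r (x, z') -> z < z' -> 0 < o * (f (x, z') - f (x, z))) ->
  (o = 1 \/ o = -1) -> forall v a, `|v.1 - v0.1| <= r -> `|v.2 - v0.2| < r ->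
  is_dz v f a -> 0 <= o * a.
Proof.
move=> Ho o1 v a v1 v2 /is_derive_dz/is_derive_leP D; rewrite leNgt; apply/negP => oa.
have e0 : 0 < - (o * a) / 2 by rewrite divr_gt0// oppr_gt0.
have [d d0 Hd] := D _ e0.
pose k := Num.min d (r - `|v.2 - v0.2|).
have k0 : 0 < k by rewrite lt_min d0 subr_gt0.
have kd : `|k| <= d by rewrite gtr0_norm// ge_min lexx.
have kr : k <= r - `|v.2 - v0.2| by rewrite ge_min lexx orbT.
have := Hd k kd; rewrite (gtr0_norm k0) => Hk.
have P : 0 < o * (f (v.1, v.2 + k) - f (v.1, v.2)).
  apply: Ho; [by split=> //=; exact: ltW| |by rewrite ltrDl].
  split=> //=; rewrite addrAC; apply: (le_trans (ler_normD _ _)).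
  by rewrite (gtr0_norm k0); move: kr; lra.
have on : `|o| = 1 by case: o1 => ->; rewrite ?normrN normr1.
have : o * (f (v.1, v.2 + k) - f (v.1, v.2) - a * k) <= - (o * a) / 2 * k.
  by apply: le_trans (ler_norm _) _; rewrite normrM on mul1r.
have : 0 < - (o * a) * k by rewrite mulr_gt0// oppr_gt0.
by move: P; move: (f (v.1, v.2 + k) - f (v.1, v.2)) => u; rewrite mulrBr mulrA; lra.
Qed.

Section slice_derivative_integrable.
Variables (I : set R) (ga dga : R -> R) (s : R) (fz : R * R -> R).
Hypotheses (oI : open I) (dga_ga : forall x, I x -> is_derive1 x ga (dga x))
  (cdga : cont_on I dga) (s1 : s = 1 \/ s = -1)
  (KI : forall v, cbox v0 r v -> I v.1).
Let Om : set (R * R) := [set v | I v.1 /\ 0 < s * (v.2 - ga v.1)].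
Hypotheses (dfz : forall v, cbox v0 r v -> Om v -> is_dz v f (fz v))
  (cfz : forall v, cbox v0 r v -> Om v -> {for v, continuous fz}).

Let K := cbox v0 r.
Let eta := box_plateau v0 (r / 2).
Let r2 : 0 < r / 2. Proof. by rewrite divr_gt0. Qed.
Let seta n : Cn_on n setT eta. Proof. exact: box_plateau_smooth. Qed.
Let ceta v : {for v, continuous eta}. Proof. exact: (Cn_cont (seta 0)). Qed.
Let deta v : is_dz v eta (d_z eta v). Proof. exact: (Cn_is_derive _ (seta 1)). Qed.
Let cdeta v : {for v, continuous (d_z eta)}. Proof. exact: (Cn_cont (Cn_D _ (seta 1))). Qed.
Let eta0 v : ~ K v -> eta v = 0.
Proof.
move=> nK; rewrite /eta box_plateau0// mulrC divfK//.
have [h1|h1] := leP `|v.1 - v0.1| r; last by left; exact: ltW.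
by right; rewrite leNgt; apply/negP => h2; apply: nK; split=> //; exact: ltW.
Qed.
Let eta_in v : eta v != 0 -> `|v.1 - v0.1| <= r /\ `|v.2 - v0.2| < r.
Proof.
move=> n0; have Kv : K v by apply: contrapT => /eta0 E; rewrite E eqxx in n0.
split; first by case: Kv.
rewrite ltNge; apply/negP => h; move: n0; rewrite /eta box_plateau0 ?eqxx//.
by right; rewrite mulrC divfK.
Qed.
Let deta0 v : ~ K v -> d_z eta v = 0.
Proof.
by move=> nK; have [] := is_derive_zero_out (@cbox_openC v0 r) (0, 1) eta0 nK.
Qed.
Let Q v := eta v * f v.
Let Qz v := d_z eta v * f v + eta v * fz v.
Let cK v (X : R * R -> R) : (K v -> {for v, continuous X}) -> (forall v, ~ K v -> X v = 0) -> {for v, continuous X}.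
Proof.
move=> cX X0; have [/cX//|nK] := pselect (K v).
exact: (continuous_zero_near (@cbox_openC v0 r) nK).
Qed.
Let oOm : open Om. Proof. exact: @collar_open R I ga dga s oI dga_ga. Qed.
Let mOm : measurable (mset Om). Proof. exact: meas_open2 oOm. Qed.
Let cdf v : {for v, continuous (fun v => d_z eta v * f v)}.
Proof.
apply: cK => [Kv|w /deta0 ->]; last by rewrite mul0r.
by apply: contM; [exact: cdeta|exact: cf].
Qed.
Let cQz v : Om v -> {for v, continuous Qz}.
Proof.
move=> Ov; apply: cK => [Kv|w nK]; last by rewrite /Qz eta0 ?deta0// !mul0r addr0.
apply: contD; first exact: cdf.
by apply: contM; [exact: ceta|exact: cfz].
Qed.
Let dQ v : Om v -> is_dz v Q (Qz v).
Proof.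
move=> Ov; have [Kv|nK] := pselect (K v).
  by apply: (derive_cast (is_deriveM (deta v) (dfz Kv Ov))) => //; rewrite /Qz /GRing.scale/=; ring.
rewrite /Qz eta0 ?deta0// !mul0r addr0; apply: (near_is_derive (fun=> 0)).
by apply: (open_near (@cbox_openC v0 r) nK) => w /eta0; rewrite /Q => ->; rewrite mul0r.
Qed.
Let chi (n : nat) (v : R * R) : R := step (s * (v.2 - ga v.1) / n.+1%:R^-1 - 1).

(** [o * d_z f] is nonnegative on the box, [o] being the direction of monotonicity of [f]. For the
    field [(0, eta * f)], [cutoff_limit] bounds the integrals of the cut-off divergence; without the
    bounded term [d_z eta * f] these are the integrals of [chi n * (eta * d_z f)], and Fatou's lemma
    concludes. *)
Lemma slice_derivative_integrable : mu2.-integrable (Om `&` cbox v0 (r / 2)) (EFin \o fz).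
Proof.
have [ o o1 Ho] := slice_sign; have on : `|o| = 1 by case: o1 => ->; rewrite ?normrN normr1.
have P0 v : ~ K v -> (fun=> 0 : R) v = 0 by [].
have Q0 v : ~ K v -> Q v = 0 by move=> nK; rewrite /Q eta0// mul0r.
have cP : continuous (fun _ : R * R => 0 : R) by move=> v; exact: cst_continuous.
have cQ : continuous Q.
  move=> v; apply: cK => // Kv.
  by apply: contM; [exact: ceta|exact: cf].
have dP v : Om v -> is_dx v (fun=> 0 : R) 0 by move=> _; exact: is_derive_cst0.
have cPx v : Om v -> {for v, continuous (fun _ : R * R => 0 : R)} by move=> _; exact: cst_continuous.
have [q q0 Kq] := bounded_Box (compact_bounded (@cbox_compact v0 r)).
have e_0 n : 0 < n.+1%:R^-1 :> R by rewrite invr_gt0.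
have lim := @cutoff_limit R I ga dga s K (fun=> 0) Q (fun=> 0) Qz oI dga_ga cdga s1 (@cbox_compact v0 r) KI P0 Q0 cP cQ dP dQ cPx cQz.
have int n := @cutoff_integrable R I ga dga s K (fun=> 0) Q (fun=> 0) Qz oI dga_ga cdga s1 (@cbox_compact v0 r) KI P0 Q0 cP cQ dP dQ cPx cQz _ (e_0 n) _ Kq.
have cchi n v : Om v -> {for v, continuous (chi n)}.
  move=> [Iv _]; apply: (cont_comp (fun v => s * (v.2 - ga v.1) / n.+1%:R^-1 - 1) step); last first.
    exact: is_derive_continuous (is_derive_step _).
  apply: contB; last exact: cst_continuous.
  apply: contM; last exact: cst_continuous.
  apply: contM; first exact: cst_continuous.
  apply: contB; first exact: cvg_snd.
  by apply: continuous_fst_comp; exact: is_derive_continuous (dga_ga Iv).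
have [C C0 HC] : exists2 C, 0 <= C & forall v, Om v -> `|d_z eta v * f v| <= C.
  have [C C0 HC] := @compact_bound _ K (fun v => d_z eta v * f v) (@cbox_compact v0 r) (fun v _ => cdf (v := v)).
  exists C => [|v _]; first exact: ltW.
  by have [/HC//|nK] := pselect (K v); rewrite deta0// mul0r normr0 ltW.
have chi_le n v X : `|chi n v * X| <= `|X|.
  by rewrite normrM ler_piMl// ger0_norm ?step_ge0// step_le1.
have nBox v (X : R * R -> R) : (forall v, ~ K v -> X v = 0) -> ~ Box q v -> X v = 0.
  by move=> X0 nB; apply: X0 => /Kq.
have intd n : integrable2 Om (fun v => chi n v * (d_z eta v * f v)).
  apply: (@bounded_integrable _ Om q C) => //.
  - apply: cont2_measurable => // v Ov.
    by apply: contM; [exact: cchi|exact: cdf].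
  - by move=> v Ov; exact: le_trans (chi_le _ _ _) (HC v Ov).
  - by move=> v Ov; apply: (nBox _ (fun v => chi n v * (d_z eta v * f v))) => w nK; rewrite deta0// mul0r mulr0.
pose F n v := o * (chi n v * (eta v * fz v)).
have FE n v : F n v = o * (chi n v * (0 + Qz v)) - o * (chi n v * (d_z eta v * f v)).
  by rewrite /F /Qz; ring.
have iZ (X : R * R -> R) : integrable2 Om X -> integrable2 Om (fun v => o * X v).
  move=> iX; rewrite (_ : _ \o _ = (fun v => o%:E * (EFin \o X) v)%E)//; exact: integrableZl.
have iF n : mu2.-integrable Om (EFin \o F n).
  have := integrableB mOm (iZ _ (int n)) (iZ _ (intd n)).
  by apply: (eq_integrable mOm) => v _; rewrite /= FE.
have [A HA] : exists A : R, forall n, `|\int[mu2]_(v in Om) (chi n v * (0 + Qz v))| <= A.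
  have : cvgn (fun n => \int[mu2]_(v in Om) (chi n v * (0 + Qz v))) by apply/cvg_ex; eexists; exact: lim.
  move=> /cvg_seq_bounded [A [_ HA]]; exists (A + 1) => n.
  by apply: (HA (A + 1)) => //; rewrite ltrDl.
have icst : integrable2 Om (fun v => `|d_z eta v * f v|).
  apply: integrable_norm; apply: (@bounded_integrable _ Om q C) => //.
    by apply: cont2_measurable => // v Ov; exact: cdf.
  by move=> v Ov; apply: (nBox _ (fun v => d_z eta v * f v)) => w nK; rewrite deta0// mul0r.
have F_le n : \int[mu2]_(v in Om) F n v <= A + \int[mu2]_(v in Om) `|d_z eta v * f v|.
  have -> : \int[mu2]_(v in Om) F n v = \int[mu2]_(v in Om) (o * (chi n v * (0 + Qz v)) - o * (chi n v * (d_z eta v * f v))).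
    by apply: eq_Rintegral => v _; rewrite FE.
  rewrite RintegralB//; [|exact: iZ (int n)|exact: iZ (intd n)].
  rewrite !RintegralZl//; last exact: int.
  apply: lerD; first by apply: le_trans (ler_norm _) _; rewrite normrM on mul1r.
  apply: le_trans (ler_norm _) _; rewrite normrN normrM on mul1r.
  apply: (le_trans (le_normr_Rintegral mOm (intd n))).
  by apply: le_Rintegral => //; exact: integrable_norm (intd n).
have iE : integrable2 Om (fun v => o * (eta v * fz v)).
  apply: (@Rfatou _ _ (mvplane R) mu2 Om F _ _ mOm iF _ _ _ F_le).
  - apply: cont2_measurable => // v Ov.
    apply: contM; first exact: cst_continuous.
    apply: cK => [Kv|w nK]; last by rewrite eta0// mul0r.
    by apply: contM; [exact: ceta|exact: cfz].
  - move=> v [Iv hv]; apply: cvgM; first exact: cvg_cst.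
    rewrite -[X in _ --> X]mul1r; apply: cvgM; last exact: cvg_cst.
    apply: cvg_near_cst.
    have h20 : 0 < s * (v.2 - ga v.1) / 2 by rewrite divr_gt0.
    have := near_infty_natSinv_lt (PosNum h20); apply: filterS => n /= nh.
    by apply: step1; rewrite lerBrDr ler_pdivlMr ?e_0//; move: nh; move: (n.+1%:R^-1 : R) => q'; lra.
  - move=> n v Ov; rewrite /F mulrCA mulr_ge0 ?step_ge0//.
    have [->|n0] := eqVneq (eta v) 0; first by rewrite mul0r mulr0.
    have [h1 h2] := eta_in n0.
    have e1 : 0 <= eta v by apply: mulr_ge0; exact: plateau_ge0.
    have e2 : 0 <= o * fz v.
      apply: (slice_derivative_sign Ho o1 h1 h2); apply: dfz => //.
      by split=> //; exact: ltW.
    by rewrite mulrCA; apply: mulr_ge0.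
have mB := @cbox_measurable v0 (r / 2).
have := integrableS mOm (measurableI _ _ mOm mB) (@subIsetl _ _ _) (iZ _ iE).
apply: eq_integrable; first exact: measurableI.
move=> v; rewrite inE => -[_ [h1 h2]] /=; rewrite /eta box_plateau1// mul1r mulrA.
by congr EFin; case: o1 => ->; ring.
Qed.

End slice_derivative_integrable.

End monotone_slices.

(** * The first variation on one side of the curve *)

Section compact_support.
Context {R : realType}.
Variable K : set (R * R).
Hypothesis oK : open (~` K).

Lemma derive_zero_out (u : R * R -> R) (d v : R * R) : (forall v, ~ K v -> u v = 0) -> ~ K v -> 'D_d u v = 0.
Proof. by move=> u0 nK; have [] := is_derive_zero_out oK d u0 nK. Qed.

Lemma continuous_zero_out (u : R * R -> R) v : (K v -> {for v, continuous u}) -> (forall v, ~ K v -> u v = 0) ->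
  {for v, continuous u}.
Proof.
move=> cu u0; have [/cu//|nK] := pselect (K v); exact: (continuous_zero_near oK nK).
Qed.

End compact_support.

Lemma nabla_smooth {R : realType} (A : set (R * R)) (f g : R * R -> R) : open A ->
  smooth_on A f -> smooth_on A g -> smooth_on A (nabla f g).
Proof.
move=> oA sf sg n; have sx : Cn_on n A (d_x g) by exact: Cn_D _ (sg n.+1).
have sz : Cn_on n A (d_z g) by exact: Cn_D _ (sg n.+1).
by apply: Cn_sub_fun => //; apply: Cn_mul.
Qed.

Section side_identity.
Context {R : realType}.
Variables (U : set (R * R)) (I : set R) (ga cy dcy : R -> R) (s M r : R) (v0 : R * R) (f m w : R * R -> R).
Hypotheses (oU : open U) (oI : open I) (UI : forall v, U v -> I v.1)
  (dga : forall x, I x -> is_derive1 x ga (- cy x))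
  (dcyP : forall x, I x -> is_derive1 x cy (dcy x))
  (cdcy : cont_on I dcy)
  (s1 : s = 1 \/ s = -1) (r0 : 0 < r) (KU : cbox v0 r `<=` U)
  (cf : cont_on U f) (fM : forall v, U v -> `|f v| <= M)
  (U_ga : forall x, I x -> U (x, ga x)) (f_ga : forall x, I x -> f (x, ga x) = cy x).
Let OmI : set (R * R) := [set v | I v.1 /\ 0 < s * (v.2 - ga v.1)].
Let Om : set (R * R) := [set v | U v /\ 0 < s * (v.2 - ga v.1)].
Hypotheses (sf : smooth_on Om f) (sm : csmooth m)
  (Gm : forall v, cbox v0 r v -> Om v -> nabla f f v = m (v.1, f v))
  (injf : forall x z z', cbox v0 r (x, z) -> cbox v0 r (x, z') -> f (x, z) = f (x, z') -> z = z').
Let K := cbox v0 (r / 2).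
Hypotheses (sw : smooth_on setT w) (wK : forall v, ~ K v -> w v = 0).

(** Minus the velocity of [f_t] at time 0: differentiating [f_t (x, g t v) = Y t v] at [t = 0] gives
    [d/dt f_t + w * d_z f = d_z w * f - d_x w]. *)
Definition kappa v : R := w v * d_z f v + nabla f w v.
Let n : R * R -> R := nabla f (nabla f f).

Let cK : compact K. Proof. exact: cbox_compact. Qed.
Let oKc : open (~` K). Proof. exact: cbox_openC. Qed.
Let Kr : K `<=` cbox v0 r. Proof. by apply: sub_cbox; move: r0; lra. Qed.
Let K_U v : K v -> U v. Proof. by move=> /Kr/KU. Qed.
Let K_I v : K v -> I v.1. Proof. by move=> /K_U/UI. Qed.
Let oOmI : open OmI. Proof. exact: @collar_open R I ga (fun x => - cy x) s oI dga. Qed.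
Let OmE : Om = U `&` OmI.
Proof. by apply/seteqP; split=> v; [move=> [Uv h]; split=> //; split=> //; exact: UI|move=> [Uv [_ h]]]. Qed.
Let oOm : open Om. Proof. by rewrite OmE; exact: openI. Qed.
Let Om_K v : K v -> OmI v -> Om v. Proof. by move=> /K_U Uv [_ h]. Qed.
Let ccy x : I x -> {for x, continuous cy}. Proof. by move=> Ix; exact: is_derive_continuous (dcyP Ix). Qed.
Let cycont x : I x -> {for x, continuous (fun x => - cy x)}. Proof. by move=> Ix; apply: continuousN; exact: ccy. Qed.
Let df v : Om v -> dif f v (d_x f v) (d_z f v). Proof. by move=> Ov; exact: Cn_dif oOm (sf 1) Ov. Qed.
Let cfx v : Om v -> {for v, continuous (d_x f)}. Proof. by move=> Ov; exact: Cn_cont (Cn_D _ (sf 1)) Ov. Qed.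
Let cfz v : Om v -> {for v, continuous (d_z f)}. Proof. by move=> Ov; exact: Cn_cont (Cn_D _ (sf 1)) Ov. Qed.
Let a v := m (v.1, f v).
Let b v := d_x m (v.1, f v).
Let d v := d_z m (v.1, f v).

Let dm q : dif m q (d_x m q) (d_z m q).
Proof. by apply: (@Cn_dif R 0 setT) => //; [exact: openT|case: sm => + _; exact]. Qed.
Let ccomp (h : R * R -> R) v : U v -> continuous h -> {for v, continuous (fun v => h (v.1, f v))}.
Proof.
move=> Uv ch; apply: (cont_comp (fun v => (v.1, f v)) h); last exact: ch.
have c1 : {for v, continuous (fun v => v.1)} by exact: cvg_fst.
exact: cvg_pair c1 (cf Uv).
Qed.
Let ca v : U v -> {for v, continuous a}. Proof. by move=> Uv; apply: ccomp => //; exact: csmooth_cont. Qed.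
Let cb v : U v -> {for v, continuous b}.
Proof. by move=> Uv; apply: ccomp => //; apply: csmooth_cont; exact: csmooth_dx. Qed.
Let cd v : U v -> {for v, continuous d}.
Proof. by move=> Uv; apply: ccomp => //; apply: csmooth_cont; exact: csmooth_dz. Qed.
Let d1 v : is_dx v (fun v : R * R => v.1) 1.
Proof. by apply/is_derive_dx; exact: is_derive_id. Qed.
Let d1z v : is_dz v (fun v : R * R => v.1) 0.
Proof. by apply/is_derive_dz; exact: is_derive_cst. Qed.
Let dax v : Om v -> is_dx v a (b v + d v * d_x f v).
Proof.
move=> Ov; have := @dif_is_derive R _ m (fun v => v.1) f v _ _ _ _ _ (dm (v.1, f v)) (d1 v) (dif_dx (df Ov)).
by rewrite mulr1.
Qed.
Let daz v : Om v -> is_dz v a (d v * d_z f v).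
Proof.
move=> Ov; have := @dif_is_derive R _ m (fun v => v.1) f v _ _ _ _ _ (dm (v.1, f v)) (d1z v) (dif_dz (df Ov)).
by rewrite mulr0 add0r.
Qed.
Let Bi : set (R * R) := interior (cbox v0 r).

Let K_B : K `<=` Bi.
Proof.
move=> v [h1 h2]; have r2 : 0 < r / 2 by rewrite divr_gt0.
apply/nbhs2_leP; exists (r / 2) => // h k hh kk; split => /=.
  by rewrite addrAC; apply: (le_trans (ler_normD _ _)); move: h1 hh; lra.
by rewrite addrAC; apply: (le_trans (ler_normD _ _)); move: h2 kk; lra.
Qed.
Let BGm v : Bi v -> Om v -> nabla f f v = a v.
Proof. by move=> /nbhs_singleton bv; exact: Gm. Qed.
Let Gnear v : Bi v -> Om v -> \forall u \near v, a u = nabla f f u.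
Proof.
move=> Bv Ov; near=> u; apply/esym/BGm; last by near: u; exact: open_nbhs_nbhs.
by near: u; apply: open_nbhs_nbhs; split=> //; exact: open_interior.
Unshelve. all: by end_near. Qed.
(** [n] is [nabla f] of [m (x, f)], and the derivatives of [f] recombine into [nabla f f = a]. So
    [n] has a formula in [(x, f)] that is continuous up to the curve, although [d_z f] is not. *)
Let nE v : Bi v -> Om v -> n v = b v + d v * a v.
Proof.
move=> Bv Ov; have nG := Gnear Bv Ov.
have Ex : d_x (nabla f f) v = b v + d v * d_x f v.
  have [_] // : is_dx v (nabla f f) (b v + d v * d_x f v).
  by apply: (near_eq_is_derive nG); exact: dax.
have Ez : d_z (nabla f f) v = d v * d_z f v.
  have [_] // : is_dz v (nabla f f) (d v * d_z f v).
  by apply: (near_eq_is_derive nG); exact: daz.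
have Ea : a v = d_x f v - f v * d_z f v by rewrite -(BGm Bv Ov).
by rewrite /n [LHS]/nabla Ex Ez Ea; ring.
Qed.
Let sx : smooth_on setT (d_x w). Proof. by move=> k; exact: Cn_D _ (sw k.+1). Qed.
Let sz : smooth_on setT (d_z w). Proof. by move=> k; exact: Cn_D _ (sw k.+1). Qed.
Let cts (u : R * R -> R) : smooth_on setT u -> forall v, {for v, continuous u}.
Proof. by move=> su v; exact: (Cn_cont (su 0)). Qed.
Let Dx (u : R * R -> R) : smooth_on setT u -> forall v, is_dx v u (d_x u v).
Proof. by move=> su v; exact: (Cn_is_derive _ (su 1)). Qed.
Let Dz (u : R * R -> R) : smooth_on setT u -> forall v, is_dz v u (d_z u v).
Proof. by move=> su v; exact: (Cn_is_derive _ (su 1)). Qed.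
Let sD (u : R * R -> R) (q : R * R) : smooth_on setT u -> smooth_on setT ('D_q u).
Proof. by move=> su k; exact: Cn_D _ (su k.+1). Qed.
Let wx0 v : ~ K v -> d_x w v = 0. Proof. exact: (derive_zero_out oKc _ wK). Qed.
Let wz0 v : ~ K v -> d_z w v = 0. Proof. exact: (derive_zero_out oKc _ wK). Qed.
Let wxx0 v : ~ K v -> d_x (d_x w) v = 0. Proof. exact: (derive_zero_out oKc _ wx0). Qed.
Let wxz0 v : ~ K v -> d_z (d_x w) v = 0. Proof. exact: (derive_zero_out oKc _ wx0). Qed.
Let wzx0 v : ~ K v -> d_x (d_z w) v = 0. Proof. exact: (derive_zero_out oKc _ wz0). Qed.
Let wzz0 v : ~ K v -> d_z (d_z w) v = 0. Proof. exact: (derive_zero_out oKc _ wz0). Qed.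
Let vd : R * R -> R := var_density w f (nabla f f).

Let vd0 v : ~ K v -> vd v = 0.
Proof.
move=> nK; rewrite /vd /var_density /second_nabla wxx0// wxz0// wzx0// wzz0// wz0//.
by rewrite !(addr0, mulr0, subrr, mul0r, oppr0).
Qed.
Let kappa0 v : ~ K v -> kappa v = 0.
Proof. by move=> nK; rewrite /kappa /nabla wK// wx0// wz0// mul0r mulr0 subrr addr0. Qed.

Section with_primitive.
Local Notation cD := contD.
Local Notation cM := contM.
Local Notation cN := contN.
Variables (E Ex : R * R -> R).
Hypotheses (HE : forall v, `|v.2| < `|M| + 1 -> dif E v (Ex v) (m v))
  (HEx : forall v, `|v.2| < `|M| + 1 -> {for v, continuous Ex} /\ is_dz v Ex (d_x m v)).

Let fL v : U v -> `|f v| < `|M| + 1.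
Proof. by move=> Uv; rewrite (le_lt_trans (fM Uv))// (le_lt_trans (ler_norm _))// ltrDl. Qed.
Let cyL x : I x -> `|cy x| < `|M| + 1.
Proof. by move=> Ix; rewrite -f_ga//; apply: fL; exact: U_ga. Qed.
(** Normalized to vanish on the curve, so that the flux there does not involve the primitive. Its
    derivatives are [d_z e = a * d_z f] and [d_x e = ex + a * d_x f]. *)
Let e v := E (v.1, f v) - E (v.1, cy v.1).
Let ex v := Ex (v.1, f v) - Ex (v.1, cy v.1) - m (v.1, cy v.1) * dcy v.1.
Let Dw v := d_x w v - f v * d_z w v.
Let Dwx v := d_x (d_x w) v - (f v * d_x (d_z w) v + d_z w v * d_x f v).
Let Dwz v := d_z (d_x w) v - (f v * d_z (d_z w) v + d_z w v * d_z f v).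
(** This is the field [(- kappa * a, f * kappa * a + w * a ^ 2 / 2)] that serves off the curve, plus
    the divergence-free field [(d_z (w * e), - d_x (w * e))]. By [d_z e = a * d_z f] and
    [a = d_x f - f * d_z f] all terms with derivatives of [f] combine into [a], and the result is
    continuous up to the curve. *)
Let P v := - (Dw v * a v) + d_z w v * e v.
Let Q v := f v * Dw v * a v - d_x w v * e v - w v * ex v - 2^-1 * (w v * (a v * a v)).
Let Px v := - (Dwx v * a v + Dw v * (b v + d v * d_x f v)) +
  (d_x (d_z w) v * e v + d_z w v * (ex v + a v * d_x f v)).
Let Qz v := d_z f v * Dw v * a v + f v * Dwz v * a v + f v * Dw v * (d v * d_z f v)
  - (d_z (d_x w) v * e v + d_x w v * (a v * d_z f v)) - (d_z w v * ex v + w v * (b v * d_z f v))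
  - 2^-1 * (d_z w v * (a v * a v) + w v * (2 * a v * (d v * d_z f v))).

Let cpair (h g : R * R -> R) v : {for v, continuous g} -> {for (v.1, g v), continuous h} -> {for v, continuous (fun v => h (v.1, g v))}.
Proof.
move=> cg ch; apply: (cont_comp (fun v => (v.1, g v)) h) => //.
have c1 : {for v, continuous (fun v => v.1)} by exact: cvg_fst.
exact: cvg_pair c1 cg.
Qed.
Let ccyv v : I v.1 -> {for v, continuous (fun v : R * R => cy v.1)}.
Proof. by move=> Iv; apply: continuous_fst_comp; exact: ccy. Qed.
Let ce v : U v -> {for v, continuous e}.
Proof.
move=> Uv; have Iv := UI Uv; apply: contD; first by apply: cpair; [exact: cf|apply: dif_continuous; exact: HE (v.1, f v) (fL Uv)].
by apply: contN; apply: cpair; [exact: ccyv|apply: dif_continuous; exact: HE (v.1, cy v.1) (cyL Iv)].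
Qed.
Let cex v : U v -> {for v, continuous ex}.
Proof.
move=> Uv; have Iv := UI Uv.
have e1 := proj1 (@HEx (v.1, f v) (fL Uv)); have e2 := proj1 (@HEx (v.1, cy v.1) (cyL Iv)).
have c1 := @cpair Ex f v (cf Uv) e1.
have c2 := @cpair Ex (fun v => cy v.1) v (ccyv Iv) e2.
have c3 := @cpair m (fun v => cy v.1) v (ccyv Iv) (csmooth_cont sm (x := (v.1, cy v.1))).
have c4 : {for v, continuous (fun v => dcy v.1)} by apply: continuous_fst_comp; exact: cdcy.
exact: cD (cD c1 (cN c2)) (cN (cM c3 c4)).
Qed.
Let cDw v : U v -> {for v, continuous Dw}.
Proof.
move=> Uv; apply: contD; first exact: cts.
by apply: contN; apply: contM; [exact: cf|exact: cts].
Qed.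
Let cP : continuous P.
Proof.
move=> v; apply: (continuous_zero_out oKc) => [/K_U Uv|{}v nK].
  have c1 := cDw Uv; have c2 := ca Uv; have c3 := ce Uv; have c4 := cts sz (v := v).
  exact: cD (cN (cM c1 c2)) (cM c4 c3).
by rewrite /P /Dw wx0// wz0// mulr0 subrr !mul0r oppr0 addr0.
Qed.
Let P0 v : ~ K v -> P v = 0.
Proof. by move=> nK; rewrite /P /Dw wx0// wz0// mulr0 subrr !mul0r oppr0 addr0. Qed.
Let Q0 v : ~ K v -> Q v = 0.
Proof. by move=> nK; rewrite /Q /Dw wx0// wz0// wK// mulr0 subrr !(mul0r, mulr0) !subr0. Qed.
Let cQ : continuous Q.
Proof.
move=> v; apply: (continuous_zero_out oKc) Q0 => /K_U Uv.
have c1 := cDw Uv; have c2 := ca Uv; have c3 := ce Uv; have c4 := cts sx (v := v).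
have c5 := cex Uv; have c6 := cf Uv; have c7 := cts sw (v := v).
have c0 : {for v, continuous (fun _ => 2^-1 : R)} by exact: cst_continuous.
exact: cD (cD (cD (cM (cM c6 c1) c2) (cN (cM c4 c3))) (cN (cM c7 c5))) (cN (cM c0 (cM c7 (cM c2 c2)))).
Qed.
Let cDwx v : Om v -> {for v, continuous Dwx}.
Proof.
move=> Ov; have c1 := cf (proj1 Ov); have c2 := cfx Ov; have c3 := cts sz (v := v).
have c4 : {for v, continuous (d_x (d_x w))} by apply: cts; exact: sD.
have c5 : {for v, continuous (d_x (d_z w))} by apply: cts; exact: sD.
exact: cD c4 (cN (cD (cM c1 c5) (cM c3 c2))).
Qed.
Let cDwz v : Om v -> {for v, continuous Dwz}.
Proof.
move=> Ov; have c1 := cf (proj1 Ov); have c2 := cfz Ov; have c3 := cts sz (v := v).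
have c4 : {for v, continuous (d_z (d_x w))} by apply: cts; exact: sD.
have c5 : {for v, continuous (d_z (d_z w))} by apply: cts; exact: sD.
exact: cD c4 (cN (cD (cM c1 c5) (cM c3 c2))).
Qed.
Let Px0 v : ~ K v -> Px v = 0.
Proof.
move=> nK; rewrite /Px /Dwx /Dw wx0// wz0// wxx0// wzx0//.
by rewrite !(mul0r, mulr0, addr0, subrr, oppr0).
Qed.
Let Qz0 v : ~ K v -> Qz v = 0.
Proof.
move=> nK; rewrite /Qz /Dwz /Dw wx0// wz0// wxz0// wzz0// wK//.
by rewrite !(mul0r, mulr0, addr0, subrr, oppr0).
Qed.
Let cPx v : OmI v -> {for v, continuous Px}.
Proof.
move=> Ov; apply: (continuous_zero_out oKc) Px0 => Kv; have Uv := K_U Kv; have {}Ov := Om_K Kv Ov.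
have c1 := cDw Uv; have c2 := ca Uv; have c3 := ce Uv; have c4 := cts sz (v := v).
have c5 := cex Uv; have c6 := cDwx Ov; have c7 := cb Uv; have c8 := cd Uv; have c9 := cfx Ov.
have c10 : {for v, continuous (d_x (d_z w))} by apply: cts; exact: sD.
exact: cD (cN (cD (cM c6 c2) (cM c1 (cD c7 (cM c8 c9))))) (cD (cM c10 c3) (cM c4 (cD c5 (cM c2 c9)))).
Qed.
Let cQz v : OmI v -> {for v, continuous Qz}.
Proof.
move=> Ov; apply: (continuous_zero_out oKc) Qz0 => Kv; have Uv := K_U Kv; have {}Ov := Om_K Kv Ov.
have c1 := cDw Uv; have c2 := ca Uv; have c3 := ce Uv; have c4 := cts sz (v := v).
have c5 := cex Uv; have c6 := cDwz Ov; have c7 := cb Uv; have c8 := cd Uv; have c9 := cfz Ov.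
have c10 : {for v, continuous (d_z (d_x w))} by apply: cts; exact: sD.
have c11 := cts sw (v := v); have c12 := cts sx (v := v); have c13 := cf Uv.
have c0 : {for v, continuous (fun _ => 2^-1 : R)} by exact: cst_continuous.
have c0' : {for v, continuous (fun _ => 2 : R)} by exact: cst_continuous.
exact: cD (cD (cD (cD (cD (cM (cM c9 c1) c2) (cM (cM c13 c6) c2)) (cM (cM c13 c1) (cM c8 c9)))
  (cN (cD (cM c10 c3) (cM c12 (cM c2 c9))))) (cN (cD (cM c4 c5) (cM c11 (cM c7 c9)))))
  (cN (cM c0 (cD (cM c4 (cM c2 c2)) (cM c11 (cM (cM c0' c2) (cM c8 c9)))))).
Qed.
Let dDwx v : Om v -> is_dx v Dw (Dwx v).
Proof.
by move=> Ov; exact: is_deriveB (Dx sx v) (is_deriveM (dif_dx (df Ov)) (Dx sz v)).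
Qed.
Let dDwz v : Om v -> is_dz v Dw (Dwz v).
Proof.
by move=> Ov; exact: is_deriveB (Dz sx v) (is_deriveM (dif_dz (df Ov)) (Dz sz v)).
Qed.
Let dex v : Om v -> is_dx v e (ex v + a v * d_x f v).
Proof.
move=> Ov; have Uv := proj1 Ov; have Iv := UI Uv.
have D1 := @dif_is_derive R _ E (fun v => v.1) f v _ _ _ _ _ (@HE (v.1, f v) (fL Uv)) (d1 v) (dif_dx (df Ov)).
have dcyv : is_dx v (fun v => cy v.1) (dcy v.1).
  by apply/is_derive_dx; exact: dcyP.
have D2 := @dif_is_derive R _ E (fun v => v.1) (fun v => cy v.1) v _ _ _ _ _ (@HE (v.1, cy v.1) (cyL Iv)) (d1 v) dcyv.
have := is_deriveB D1 D2; move=> D; apply: (derive_cast D) => //.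
by rewrite /ex /a; ring.
Qed.
Let dez v : Om v -> is_dz v e (a v * d_z f v).
Proof.
move=> Ov; have Uv := proj1 Ov; have Iv := UI Uv.
have D1 := @dif_is_derive R _ E (fun v => v.1) f v _ _ _ _ _ (@HE (v.1, f v) (fL Uv)) (d1z v) (dif_dz (df Ov)).
have D2 : is_dz v (fun v => E (v.1, cy v.1)) 0.
  by apply/is_derive_dz; exact: is_derive_cst (E (v.1, cy v.1)) v.2 (1:R).
have := is_deriveB D1 D2; move=> D; apply: (derive_cast D) => //.
by rewrite /a; ring.
Qed.
Let dexz v : Om v -> is_dz v ex (b v * d_z f v).
Proof.
move=> Ov; have Uv := proj1 Ov; have Iv := UI Uv.
have D1 : is_dz v (fun v => Ex (v.1, f v)) (b v * d_z f v).
  have /is_derive_dz Df := dif_dz (df Ov).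
  have De : is_derive (f (v.1, v.2)) (1:R) (fun y => Ex (v.1, y)) (d_x m (v.1, f v)).
    by rewrite -surjective_pairing; have /is_derive_dz := proj2 (@HEx (v.1, f v) (fL Uv)).
  apply/is_derive_dz; have D := @is_derive1_comp R (fun y => Ex (v.1, y)) (fun z => f (v.1, z)) v.2 _ _ De Df.
  by apply: (derive_cast D) => //; rewrite mulrC.
have D2 : is_dz v (fun v => Ex (v.1, cy v.1)) 0.
  by apply/is_derive_dz; exact: is_derive_cst (Ex (v.1, cy v.1)) v.2 (1:R).
have D3 : is_dz v (fun v => m (v.1, cy v.1) * dcy v.1) 0.
  by apply/is_derive_dz; exact: is_derive_cst (m (v.1, cy v.1) * dcy v.1) v.2 (1:R).
have := is_deriveB (is_deriveB D1 D2) D3; move=> D; apply: (derive_cast D) => //.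
by rewrite !subr0.
Qed.
Let dP v : OmI v -> is_dx v P (Px v).
Proof.
move=> Ov; have [Kv|nK] := pselect (K v); last by rewrite Px0//; exact: (is_derive_zero_out oKc _ P0 nK).
have {}Ov := Om_K Kv Ov.
by apply: (derive_cast (is_deriveD (is_deriveN (is_deriveM (dDwx Ov) (dax Ov))) (is_deriveM (Dx sz v) (dex Ov)))) => //; rewrite /Px /GRing.scale/=; ring.
Qed.
Let dQ v : OmI v -> is_dz v Q (Qz v).
Proof.
move=> Ov; have [Kv|nK] := pselect (K v); last by rewrite Qz0//; exact: (is_derive_zero_out oKc _ Q0 nK).
have {}Ov := Om_K Kv Ov; have da := daz Ov.
have := is_deriveB (is_deriveB (is_deriveB (is_deriveM (is_deriveM (dif_dz (df Ov)) (dDwz Ov)) da)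
   (is_deriveM (Dz sx v) (dez Ov))) (is_deriveM (Dz sw v) (dexz Ov)))
   (is_deriveM (is_derive_cst (2^-1 : R) v ((0, 1) : R * R)) (is_deriveM (Dz sw v) (is_deriveM da da))).
move=> D; apply: (derive_cast D) => //; rewrite /Qz /GRing.scale/= !fctE.
by move: (d_z (d_x w) v) (Dwz v) (d_z w v) (d_x w v) (Dw v) (d_z f v) => *; ring.
Qed.
Let schwarz_w v : d_z (d_x w) v = d_x (d_z w) v.
Proof. by apply: (@Cn_dxdz R 0 setT) => //; exact: openT. Qed.

Lemma divergence_density v : OmI v -> Px v + Qz v = vd v - kappa v * n v.
Proof.
move=> Ov; have [Kv|nK] := pselect (K v); last by rewrite Px0// Qz0// vd0// kappa0// mul0r subrr addr0.
have {}Ov := Om_K Kv Ov; rewrite (nE (K_B Kv) Ov) /vd /var_density /second_nabla (Gm (Kr Kv) Ov) -/(a v).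
have Ea : a v = d_x f v - f v * d_z f v by rewrite /a -(Gm (Kr Kv) Ov).
rewrite /Px /Qz /Dwx /Dwz /Dw /kappa /nabla schwarz_w.
move: Ea; move: (a v) (b v) (d v) (e v) (ex v) (f v) (d_x f v) (d_z f v) (w v) (d_x w v) (d_z w v)
  (d_x (d_x w) v) (d_x (d_z w) v) (d_z (d_z w) v) => a' b' d' e' ex' f' fx' fz' w' wx' wz' wxx' wxz' wzz' Ea.
have -> : fx' = a' + f' * fz' by rewrite Ea subrK.
by field.
Qed.

(** On the curve [f = cy], [e = 0] and [ex = - m * dcy]. Since [ga' = - cy], the flux density is
    [Q + cy * P], in which the derivatives of [w] cancel. *)
Lemma side_flux : integrable2 OmI (fun v => vd v - kappa v * n v) ->
  \int[mu2]_(v in OmI) (vd v - kappa v * n v) =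
  - s * \int[mu]_(x in I) (w (x, ga x) * (m (x, cy x) * dcy x - 2^-1 * m (x, cy x) ^+ 2)).
Proof.
move=> iT; have iS : integrable2 OmI (fun v => Px v + Qz v).
  apply: (eq_integrable (meas_open2 oOmI)) iT => v; rewrite inE => Ov.
  by rewrite /= divergence_density.
have := @collar_divergence R I ga (fun x => - cy x) s K P Q Px Qz oI dga cycont s1 cK K_I P0 Q0 cP cQ dP dQ cPx cQz iS.
have -> : \int[mu2]_(v in OmI) (Px v + Qz v) = \int[mu2]_(v in OmI) (vd v - kappa v * n v).
  by apply: eq_Rintegral => v; rewrite inE => Ov; rewrite divergence_density.
move=> ->; congr (_ * _); apply: eq_Rintegral => x; rewrite inE => Ix.
rewrite /P /Q /e /ex /a /= f_ga// /Dw f_ga//; ring.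
Qed.

End with_primitive.

Hypothesis ivd : integrable2 Om vd.

Let mOm : measurable (mset Om). Proof. exact: meas_open2 oOm. Qed.
Let mOmI : measurable (mset OmI). Proof. exact: meas_open2 oOmI. Qed.
Let patch_side (X : R * R -> R) : (forall v, ~ K v -> X v = 0) -> X \_ OmI = X \_ Om.
Proof.
move=> X0; apply/funext => v; rewrite !patchE OmE.
have [Kv|nK] := pselect (K v); last by rewrite X0//; case: ifP; case: ifP.
by rewrite in_setI [v \in U]mem_set//; exact: K_U.
Qed.
Let integrable_patch (A B : set (R * R)) (X : R * R -> R) : measurable (mset A) ->
  measurable (mset B) -> X \_ A = X \_ B ->
  integrable2 A X -> integrable2 B X.
Proof.
move=> mA mB E iA; have -> : B = [set: R * R] `&` B by rewrite setTI.
apply/integrable_restrict => //; rewrite restrict_EFin -E -restrict_EFin.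
by apply/integrable_restrict => //; rewrite setTI.
Qed.
Let A : set (R * R) := OmI `&` K.

(** [n] is bounded on [K] by its formula in [(x, f)], and [kappa] is [w * d_z f] plus a bounded
    term, so the question reduces to the integrability of [d_z f]. *)
Lemma kappa_second_integrable : integrable2 Om (fun v => kappa v * n v).
Proof.
have mA : measurable (mset A) by apply: measurableI => //; exact: cbox_measurable.
have X0 v : ~ K v -> kappa v * n v = 0 by move=> nK; rewrite kappa0// mul0r.
apply: (integrable_patch mA mOm).
  apply/funext => v; rewrite !patchE.
  have [Kv|nK] := pselect (K v); last by rewrite X0//; case: ifP; case: ifP.
  have -> // : (v \in A) = (v \in Om).
  by apply/idP/idP; rewrite !inE; [move=> [Ov _]; exact: Om_K|rewrite OmE => -[_ Ov]; split].
have iz : mu2.-integrable A (EFin \o d_z f).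
  apply: (@slice_derivative_integrable R f v0 r r0 _ injf I ga (fun x => - cy x) s (d_z f) oI dga cycont s1).
  - by move=> v /KU/cf.
  - by move=> v /KU/UI.
  - by move=> v /KU Uv [_ h]; apply: dif_dz; apply: df.
  - by move=> v /KU Uv [_ h]; apply: cfz.
have cA : forall v, A v -> Om v by move=> v [Ov Kv]; exact: Om_K.
have [C1 C10 H1] := @compact_bound R K a cK (fun v Kv => ca (K_U Kv)).
have [C2 C20 H2] := @compact_bound R K b cK (fun v Kv => cb (K_U Kv)).
have [C3 C30 H3] := @compact_bound R K d cK (fun v Kv => cd (K_U Kv)).
have [C4 C40 H4] := @compact_bound R K w cK (fun v Kv => cts sw (v := v)).
have cn : cont_on U (fun v => d_x w v - f v * d_z w v).
  move=> v Uv; apply: contD; first exact: cts.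
  by apply: contN; apply: contM; [exact: cf|exact: cts].
have [C5 C50 H5] := @compact_bound R K _ cK (fun v Kv => cn v (K_U Kv)).
pose C := C2 + C3 * C1.
have Cn v : A v -> `|n v| <= C.
  move=> Av; have [_ Kv] := Av; rewrite (nE (K_B Kv) (cA v Av)).
  apply: (le_trans (ler_normD _ _)); apply: lerD; first exact: H2.
  by rewrite normrM; apply: ler_pM => //; [exact: H3|exact: H1].
have C0 : 0 <= C by rewrite addr_ge0 ?mulr_ge0 ?ltW.
have lA : (mu2 A < +oo)%E.
  have [q q0 Kq] := bounded_Box (compact_bounded cK).
  apply: le_lt_trans (area_Box q); apply: le_measure; rewrite ?inE//; first exact: Box_measurable.
  by move=> v [_ /Kq].
have ig : integrable2 A (fun v => C4 * C * `|d_z f v| + C5 * C).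
  have i1 : integrable2 A (fun v => C4 * C * `|d_z f v|).
    by have := integrableZl mA (C4 * C) (integrable_norm iz).
  have i2 : integrable2 A (fun=> C5 * C).
    have [q q0 Kq] := bounded_Box (compact_bounded cK).
    apply: (@bounded_integrable R A q (C5 * C)) => // [v _|v [_ /Kq]//].
    by rewrite ger0_norm// mulr_ge0// ltW.
  by have := integrableD mA i1 i2.
apply: le_integrable ig => //.
  apply/measurable_EFinP; apply: (@measurable_funS _ _ _ _ Om) => //.
  apply: cont2_measurable => // v Ov.
  have c1 := cts sw (v := v); have c2 := cfz Ov; have c3 := cn v (proj1 Ov).
  have c4 : {for v, continuous n} by exact: Cn_cont (nabla_smooth oOm sf (nabla_smooth oOm sf sf) 0) Ov.
  by apply: contM => //; apply: contD => //; apply: contM.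
move=> v Av; have [_ Kv] := Av; rewrite /= lee_fin [leRHS]ger0_norm; last first.
  by rewrite addr_ge0 ?mulr_ge0 ?(ltW C40) ?(ltW C50).
rewrite normrM [leRHS](_ : _ = (C4 * `|d_z f v| + C5) * C); last by ring.
apply: ler_pM => //; last exact: Cn.
apply: (le_trans (ler_normD _ _)); apply: lerD; last exact: H5.
by rewrite normrM ler_wpM2r// H4.
Qed.

Theorem side_identity :
  \int[mu2]_(v in Om) vd v - \int[mu2]_(v in Om) (kappa v * n v) =
  - s * \int[mu]_(x in I) (w (x, ga x) * (m (x, cy x) * dcy x - 2^-1 * m (x, cy x) ^+ 2)).
Proof.
have iT := integrableB mOm ivd kappa_second_integrable.
have T0 v : ~ K v -> vd v - kappa v * n v = 0 by move=> nK; rewrite vd0// kappa0// mul0r subrr.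
(* The primitive is evaluated at the heights [f v] and [cy x], all smaller than [|M| + 1] in
   absolute value. *)
have L0 : 0 < `|M| + 1 by rewrite ltr_wpDl.
have [E [Ex [HE HEx]]] := @primitive_exists R m _ sm L0.
rewrite -RintegralB//; last exact: kappa_second_integrable.
rewrite -(side_flux HE HEx); last first.
  apply: (integrable_patch mOm mOmI); first by rewrite patch_side.
  by have := iT.
by rewrite Rintegral_mkcond [RHS]Rintegral_mkcond patch_side.
Qed.

Section critical.
Hypothesis n2 : forall v, Om v -> nabla f n v = 2 * d_z f v * n v.

(** The formula of [nE]. It extends [n] continuously to the curve, so that the field [(P, Q)] is
    continuous on the plane, as the divergence theorem requires. *)
Let nn v := b v + d v * a v.
Let P v := w v * nn v.
Let Q v := - (f v * P v).
Let sG : smooth_on Om n := nabla_smooth oOm sf (nabla_smooth oOm sf sf).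
Let Px v := w v * d_x n v + n v * d_x w v.
Let Qz v := - (f v * (w v * d_z n v + n v * d_z w v) + (w v * n v) * d_z f v).

Let nn_near v : K v -> Om v -> \forall u \near v, n u = nn u.
Proof.
move=> Kv Ov; near=> u; apply: nE; last by near: u; exact: open_nbhs_nbhs.
by near: u; apply: open_nbhs_nbhs; split; [exact: open_interior|exact: K_B].
Unshelve. all: by end_near. Qed.
Let Pz0 v : ~ K v -> P v = 0. Proof. by move=> nK; rewrite /P wK// mul0r. Qed.
Let Qz0' v : ~ K v -> Q v = 0. Proof. by move=> nK; rewrite /Q Pz0// mulr0 oppr0. Qed.
Let cPn : continuous P.
Proof.
move=> v; apply: (continuous_zero_out oKc) Pz0 => /K_U Uv.
exact: contM (cts sw (v := v)) (contD (cb Uv) (contM (cd Uv) (ca Uv))).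
Qed.
Let cQn : continuous Q.
Proof.
move=> v; apply: (continuous_zero_out oKc) Qz0' => /K_U Uv.
exact: contN (contM (cf Uv) (cPn (x := v))).
Qed.
Let Px0 v : ~ K v -> Px v = 0.
Proof. by move=> nK; rewrite /Px wK// wx0// mul0r mulr0 addr0. Qed.
Let Qz0 v : ~ K v -> Qz v = 0.
Proof. by move=> nK; rewrite /Qz wK// wz0// !(mul0r, mulr0, addr0, oppr0). Qed.
Let cDn (q : R * R) v : Om v -> {for v, continuous ('D_q n)}.
Proof. by move=> Ov; exact: Cn_cont (Cn_D _ (sG 1)) Ov. Qed.
Let cn v : Om v -> {for v, continuous n}. Proof. by move=> Ov; exact: Cn_cont (sG 0) Ov. Qed.
Let cPx v : OmI v -> {for v, continuous Px}.
Proof.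
move=> Ov; apply: (continuous_zero_out oKc) Px0 => Kv; have {}Ov := Om_K Kv Ov.
have cnx : {for v, continuous (d_x n)} by exact: cDn.
have cw := cts sw (v := v); have cwx := cts sx (v := v).
exact: contD (contM cw cnx) (contM (cn Ov) cwx).
Qed.
Let cQz v : OmI v -> {for v, continuous Qz}.
Proof.
move=> Ov; apply: (continuous_zero_out oKc) Qz0 => Kv; have {}Ov := Om_K Kv Ov.
have cnz : {for v, continuous (d_z n)} by exact: cDn.
have cw := cts sw (v := v); have cwz := cts sz (v := v).
have c1 := contD (contM cw cnz) (contM (cn Ov) cwz).
have c2 := contM (contM cw (cn Ov)) (cfz Ov).
exact: contN (contD (contM (cf (K_U Kv)) c1) c2).
Qed.
Let Dn (q v : R * R) : Om v -> is_derive v q n ('D_q n v).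
Proof. by move=> Ov; exact: Cn_is_derive _ (sG 1) Ov. Qed.
Let dP v : OmI v -> is_dx v P (Px v).
Proof.
move=> Ov; have [Kv|nK] := pselect (K v); last by rewrite Px0//; exact: (is_derive_zero_out oKc _ Pz0 nK).
have {}Ov := Om_K Kv Ov; apply: (near_is_derive (fun v => w v * n v)).
  by apply: filterS (nn_near Kv Ov) => u E; rewrite /P E.
exact: (is_deriveM (Dx sw v) (Dn (1, 0) Ov)).
Qed.
Let dQ v : OmI v -> is_dz v Q (Qz v).
Proof.
move=> Ov; have [Kv|nK] := pselect (K v); last by rewrite Qz0//; exact: (is_derive_zero_out oKc _ Qz0' nK).
have {}Ov := Om_K Kv Ov; apply: (near_is_derive (fun v => - (f v * (w v * n v)))).
  by apply: filterS (nn_near Kv Ov) => u E; rewrite /Q /P E.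
exact: (is_deriveN (is_deriveM (dif_dz (df Ov)) (is_deriveM (Dz sw v) (Dn (0, 1) Ov)))).
Qed.
Let PQ v : OmI v -> Px v + Qz v = kappa v * n v.
Proof.
move=> Ov; have [Kv|nK] := pselect (K v); last by rewrite Px0// Qz0// kappa0// mul0r addr0.
have := n2 (Om_K Kv Ov); rewrite /Px /Qz /kappa /nabla.
move: (d_x n v) (d_z n v) (d_z f v) (d_x w v) (d_z w v) => x1 x2 x3 x4 x5 E.
rewrite (_ : x1 = 2 * x3 * n v + f v * x2); last by rewrite -E subrK.
by ring.
Qed.

(* The flux of (P, Q) through the curve is zero because f = - gamma_z'. *)
Lemma side_kappa_eq0 : \int[mu2]_(v in Om) (kappa v * n v) = 0.
Proof.
have X0 v : ~ K v -> kappa v * n v = 0 by move=> nK; rewrite kappa0// mul0r.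
have iI := integrable_patch mOm mOmI (esym (patch_side X0)) kappa_second_integrable.
have iS : integrable2 OmI (fun v => Px v + Qz v).
  by apply: (eq_integrable mOmI) iI => v; rewrite inE => Ov; rewrite /= PQ.
rewrite Rintegral_mkcond -(patch_side X0) -Rintegral_mkcond.
have -> : \int[mu2]_(v in OmI) (kappa v * n v) = \int[mu2]_(v in OmI) (Px v + Qz v).
  by apply: eq_Rintegral => v; rewrite inE => Ov; rewrite PQ.
rewrite (@collar_divergence R I ga (fun x => - cy x) s K P Q Px Qz oI dga cycont s1 cK K_I Pz0 Qz0' cPn cQn dP dQ cPx cQz iS).
rewrite [X in _ * X]Rint_eq0 ?mulr0// => x Ix; rewrite /Q f_ga//; ring.
Qed.

End critical.

End side_identity.

(** * From local to global, and variations supported off the curve *)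

Section local_to_global.
Context {R : realType}.
Variables (U : set (R * R)) (good : (R * R -> R) -> Prop).
Hypotheses (good0 : good (fun=> 0))
  (goodD : forall w1 w2, good w1 -> good w2 -> good (fun v => w1 v + w2 v))
  (local : forall p, U p -> exists2 r : R, 0 < r & forall w, test_function U w ->
     (forall v, ~ cbox p r v -> w v = 0) -> good w).

Lemma good_sum (T : Type) (s : seq T) (F : T -> R * R -> R) : (forall i, good (F i)) ->
  good (fun v => \sum_(i <- s) F i v).
Proof.
move=> gF; elim: s => [|i s IH].
  by rewrite (_ : (fun v => _) = fun=> 0)//; apply/funext => v; rewrite big_nil.
rewrite (_ : (fun v => _) = fun v => F i v + \sum_(j <- s) F j v); first exact: goodD.
by apply/funext => v; rewrite big_cons.
Qed.

Lemma local_radius (K : set (R * R)) : compact K -> K `<=` U -> exists2 d : R, 0 < d &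
  forall p, K p -> forall w, test_function U w -> (forall v, ~ cbox p d v -> w v = 0) -> good w.
Proof.
move=> cK KU; pose P (d : R) p := forall w, test_function U w ->
  (forall v, ~ cbox p d v -> w v = 0) -> good w.
have /compact_near_coveringP/(_ _ (at_right 0) P) H := cK.
have /H : forall v, K v -> \forall x' \near v & i \near at_right 0, P i x'.
  move=> v /KU/local[d d0 Hd].
  have d20 : 0 < d / 2 by rewrite divr_gt0.
  exists (cbox v (d / 2), [set x | x <= d / 2]).
    split=> /=; last exact: nbhs_right_le.
    apply/nbhs2_leP; exists (d / 2) => // h k hd kd; split=> /=.
      by rewrite addrAC subrr add0r.
    by rewrite addrAC subrr add0r.
  move=> [p x] /= [[p1 p2] xd] w tw w0; apply: Hd => // u nu; apply: w0 => -[u1 u2]; apply: nu.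
  split.
    rewrite -(subrK p.1 u.1) -addrA (le_trans (ler_normD _ _))//.
    by move: u1 p1 xd => /=; lra.
  rewrite -(subrK p.2 u.2) -addrA (le_trans (ler_normD _ _))//.
  by move: u2 p2 xd => /=; lra.
case=> /= d d0 Hd; exists (d / 2); first by rewrite divr_gt0.
have := Hd (d / 2); rewrite /ball /= sub0r normrN gtr0_norm ?divr_gt0// => Hd2.
move=> p Kp; apply: Hd2 => //.
by lra.
Qed.

(** [local_radius] provides one radius [d] for the whole support. With bumps of width [2 / N = d], a
    partition of unity cuts [w] into finitely many pieces, each supported within [d] of a point of
    the support. [good] is only asked to be additive, so it may include integrability. *)
Lemma local_to_global w : test_function U w -> good w.
Proof.
move=> tw; have cK := test_compact tw; pose K := closure [set v | w v != 0].
have w0 v : ~ K v -> w v = 0 by exact: test_function0 tw.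
have [d d0 Hd] := local_radius cK (test_sub tw).
have [r r0 Kr] := bounded_Box (compact_bounded cK).
pose N : R := 2 / d; have N0 : 0 < N by rewrite divr_gt0.
pose M : nat := Num.bound (N * r).
have MN : N * r <= M%:R.
  by apply: ltW; have := archi_boundP (x := N * r); apply; rewrite mulr_ge0// ltW.
pose chi (i : nat) (x : R) : R := pu (N * x - (i%:R - M%:R)).
have chi1 x : `|x| <= r -> \sum_(i < (M + M).+1) chi i x = 1.
  move=> xr; apply: pu_sum1; rewrite normrM (gtr0_norm N0); apply: le_trans MN.
  by rewrite ler_wpM2l// ltW.
have chi0 i x : chi i x != 0 -> `|N * x - (i%:R - M%:R)| <= 1.
  by move=> n0; rewrite leNgt; apply/negP => /pu0 E; rewrite /chi E eqxx in n0.
have chi_near i x y : chi i x != 0 -> chi i y != 0 -> `|x - y| <= d.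
  move=> /chi0 hx /chi0 hy.
  have : `|N * (x - y)| <= 2.
    rewrite (_ : N * _ = (N * x - (i%:R - M%:R)) - (N * y - (i%:R - M%:R))); last by ring.
    by apply: (le_trans (ler_normB _ _)); move: hx hy; lra.
  rewrite normrM (gtr0_norm N0) /N -ler_pdivlMl ?divr_gt0// invf_div.
  by rewrite divfK.
pose psi (q : 'I_(M + M).+1 * 'I_(M + M).+1) (v : R * R) : R := chi q.1 v.1 * chi q.2 v.2 * w v.
have oT : open [set: R * R] by exact: openT.
have schi n i : Cn_on n setT (chi i).
  apply: (@Cn_comp1 R _ n setT setT pu (fun x => N * x - (i%:R - M%:R))) => //; try exact: openT.
    exact: pu_smooth.
  by apply: Cn_sub_fun; [exact: openT| |apply: Cn_cst; exact: openT];
    apply: Cn_mul; [exact: openT|apply: Cn_cst; exact: openT|apply: Cn_id; exact: openT].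
have tpsi q : test_function U (psi q).
  apply: (@test_function_of _ U K) => //; last by move=> v /w0; rewrite /psi => ->; rewrite mulr0.
    move=> n; apply: Cn_mul => //; last exact: (test_smooth tw).
    apply: Cn_mul => //.
      by apply: (@Cn_comp_fst R (chi q.1) n setT) => //; exact: openT.
    exact: (@Cn_comp_snd R (chi q.2) n).
  exact: test_sub tw.
have gpsi q : good (psi q).
  have [[p [Kp p1 p2]]|nex] := pselect (exists p, [/\ K p, chi q.1 p.1 != 0 & chi q.2 p.2 != 0]).
    apply: (Hd p Kp _ (tpsi q)) => v nv; apply/eqP; apply: contrapT => /negP.
    rewrite /psi !mulf_eq0 !negb_or => /andP[/andP[h1 h2] h3]; apply: nv.
    by split; [exact: (chi_near q.1)|exact: (chi_near q.2)].
  rewrite (_ : psi q = fun=> 0)//; apply/funext => v; apply/eqP; apply: contrapT => /negP.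
  rewrite /psi !mulf_eq0 !negb_or => /andP[/andP[h1 h2] h3]; apply: nex; exists v; split=> //.
  by apply: contrapT => /w0 E; rewrite E eqxx in h3.
rewrite (_ : w = fun v => \sum_(q <- index_enum ('I_(M + M).+1 * 'I_(M + M).+1)%type) psi q v); first exact: good_sum.
apply/funext => v; have [Kv|nK] := pselect (K v); last first.
  by rewrite w0// big1// => q _; rewrite /psi w0// mulr0.
have [v1 v2] := Kr _ Kv.
rewrite -big_distrl /= -(pair_bigA _ (fun i j : 'I_(M + M).+1 => chi i v.1 * chi j v.2)) /=.
under eq_bigr => i _ do rewrite -big_distrr /= chi1// mulr1.
by rewrite chi1// mul1r.
Qed.

End local_to_global.

Section linearity.
Context {R : realType}.
Implicit Types (w f G : R * R -> R).

Lemma d_xD w1 w2 : smooth_on setT w1 -> smooth_on setT w2 ->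
  d_x (fun v => w1 v + w2 v) = fun v => d_x w1 v + d_x w2 v.
Proof.
move=> s1 s2; apply/funext => v.
have D (w : R * R -> R) : smooth_on setT w -> is_dx v w (d_x w v).
  by move=> sw; exact: (Cn_is_derive _ (sw 1)).
by have [_] := is_deriveD (D _ s1) (D _ s2).
Qed.

Lemma d_zD w1 w2 : smooth_on setT w1 -> smooth_on setT w2 ->
  d_z (fun v => w1 v + w2 v) = fun v => d_z w1 v + d_z w2 v.
Proof.
move=> s1 s2; apply/funext => v.
have D (w : R * R -> R) : smooth_on setT w -> is_dz v w (d_z w v).
  by move=> sw; exact: (Cn_is_derive _ (sw 1)).
by have [_] := is_deriveD (D _ s1) (D _ s2).
Qed.

Lemma d_x_cst0 : d_x (fun _ : R * R => 0 : R) = fun=> 0.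
Proof. by apply/funext => v; exact: derive_cst. Qed.

Lemma d_z_cst0 : d_z (fun _ : R * R => 0 : R) = fun=> 0.
Proof. by apply/funext => v; exact: derive_cst. Qed.

Lemma smooth_d_x w : smooth_on setT w -> smooth_on setT (d_x w).
Proof. by move=> sw n; exact: Cn_D _ (sw n.+1). Qed.

Lemma smooth_d_z w : smooth_on setT w -> smooth_on setT (d_z w).
Proof. by move=> sw n; exact: Cn_D _ (sw n.+1). Qed.

Lemma test_functionD (U : set (R * R)) w1 w2 : test_function U w1 -> test_function U w2 ->
  test_function U (fun v => w1 v + w2 v).
Proof.
move=> t1 t2; apply: (@test_function_of _ U (closure [set v | w1 v != 0] `|` closure [set v | w2 v != 0])).
- by move=> n; apply: Cn_add; [exact: openT|exact: (test_smooth t1)|exact: (test_smooth t2)].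
- by apply: compactU; [exact: test_compact t1|exact: test_compact t2].
- by move=> v [/(test_sub t1)|/(test_sub t2)].
- move=> v nK; rewrite (test_function0 t1) ?(test_function0 t2) ?addr0// => h; apply: nK; by [left|right].
Qed.

Lemma test_function_cst0 (U : set (R * R)) : test_function U (fun=> 0 : R).
Proof.
apply: (@test_function_of _ U set0) => //; last exact: compact0.
by move=> n; apply: Cn_cst; exact: openT.
Qed.

Lemma kappaD f w1 w2 : smooth_on setT w1 -> smooth_on setT w2 ->
  kappa f (fun v => w1 v + w2 v) = fun v => kappa f w1 v + kappa f w2 v.
Proof.
move=> s1 s2; apply/funext => v; rewrite /kappa /nabla (d_xD s1 s2) (d_zD s1 s2).
by move: (d_x w1 v) (d_x w2 v) (d_z w1 v) (d_z w2 v) (d_z f v) => *; ring.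
Qed.

Lemma kappa_cst0 f : kappa f (fun=> 0) = fun=> 0.
Proof.
by apply/funext => v; rewrite /kappa /nabla d_x_cst0 d_z_cst0 mul0r mulr0 subrr addr0.
Qed.

Lemma var_densityD f G w1 w2 : smooth_on setT w1 -> smooth_on setT w2 ->
  var_density (fun v => w1 v + w2 v) f G =
  fun v => var_density w1 f G v + var_density w2 f G v.
Proof.
move=> s1 s2; have x1 := smooth_d_x s1; have x2 := smooth_d_x s2; have z1 := smooth_d_z s1; have z2 := smooth_d_z s2.
apply/funext => v; rewrite /var_density /second_nabla (d_xD s1 s2) (d_zD s1 s2).
rewrite (d_xD x1 x2) (d_zD x1 x2) (d_xD z1 z2) (d_zD z1 z2).
move: (d_x (d_x w1) v) (d_x (d_x w2) v) (d_z (d_x w1) v) (d_z (d_x w2) v) (d_x (d_z w1) v) (d_x (d_z w2) v)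
  (d_z (d_z w1) v) (d_z (d_z w2) v) (d_z w1 v) (d_z w2 v) (f v) (G v) => *.
by ring.
Qed.

Lemma var_density_cst0 f G : var_density (fun=> 0) f G = fun=> 0.
Proof.
apply/funext => v; rewrite /var_density /second_nabla d_x_cst0 d_z_cst0 d_x_cst0 d_z_cst0.
by rewrite !(mulr0, addr0, subr0, mul0r, oppr0).
Qed.

Lemma smooth_extend (A K : set (R * R)) (u : R * R -> R) : open A -> smooth_on A u -> open (~` K) -> K `<=` A ->
  (forall v, ~ K v -> u v = 0) -> smooth_on setT u.
Proof.
move=> oA su oK KA u0 n; have -> : setT = A `|` ~` K.
  by apply/seteqP; split=> // v _; have [/KA|] := pselect (K v); [left|right].
apply: Cn_setU; first exact: su.
by apply: (Cn_eq oK) (Cn_cst n 0 oK) => v /u0.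
Qed.

End linearity.

Lemma int_divergence0 {R : realType} (Om K : set (R * R)) (P Q : R * R -> R) : open Om -> compact K -> K `<=` Om ->
  smooth_on setT P -> smooth_on setT Q -> (forall v, ~ K v -> P v = 0) -> (forall v, ~ K v -> Q v = 0) ->
  mu2.-integrable Om (EFin \o (fun v => d_x P v + d_z Q v)) /\ \int[mu2]_(v in Om) (d_x P v + d_z Q v) = 0.
Proof.
move=> oOm cK KO sP sQ P0 Q0; have mOm := meas_open2 oOm.
have oK : open (~` K) by rewrite openC; apply: compact_closed => //; exact: norm_hausdorff.
have [r r0 Kr] := bounded_Box (compact_bounded cK).
have DP v : is_dx v P (d_x P v) by exact: (Cn_is_derive _ (sP 1)).
have DQ v : is_dz v Q (d_z Q v) by exact: (Cn_is_derive _ (sQ 1)).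
have cP : continuous (d_x P) by move=> v; exact: (Cn_cont (Cn_D _ (sP 1))).
have cQ : continuous (d_z Q) by move=> v; exact: (Cn_cont (Cn_D _ (sQ 1))).
have zP : csupp r P by move=> v nB; apply: P0 => /Kr.
have zQ : csupp r Q by move=> v nB; apply: Q0 => /Kr.
have iP := csupp_integrable cP (csupp_dx DP zP); have iQ := csupp_integrable cQ (csupp_dz DQ zQ).
have iS := integrableD measurableT iP iQ.
split; first by have := integrableS measurableT mOm (@subsetT _ Om) iS.
have -> : \int[mu2]_(v in Om) (d_x P v + d_z Q v) = \int[mu2]_v (d_x P v + d_z Q v).
  rewrite Rintegral_mkcond; apply: eq_Rintegral => v _; rewrite patchE.
  have [Ov|nO] := pselect (Om v); first by rewrite mem_set.
  have nK : ~ K v by move/KO.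
  by rewrite memNset// /d_x /d_z (derive_zero_out oK _ P0 nK) (derive_zero_out oK _ Q0 nK) addr0.
by rewrite RintegralD// (int_dx0 DP cP zP) (int_dz0 DQ cQ zQ) addr0.
Qed.

Section off_curve.
Context {R : realType}.
Variables (Om : set (R * R)) (f w : R * R -> R).
Hypotheses (oOm : open Om) (sf : smooth_on Om f) (tw : test_function Om w).
Let G := nabla f f.
Let n := nabla f G.
Let K := closure [set v | w v != 0].
Let cK : compact K := test_compact tw.
Let KO : K `<=` Om := test_sub tw.
Let oK : open (~` K) := test_openC (psi := w).
Let sw : smooth_on setT w := test_smooth tw.
Let swO : smooth_on Om w. Proof. by move=> k; exact: Cn_sub (@subsetT _ Om) (sw k). Qed.
Let sG : smooth_on Om G := nabla_smooth oOm sf sf.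
Let sD (u : R * R -> R) (d : R * R) : smooth_on Om u -> smooth_on Om ('D_d u).
Proof. by move=> su k; exact: Cn_D _ (su k.+1). Qed.
Let sDw := nabla_smooth oOm sf swO.
Let sk : smooth_on Om (kappa f w).
Proof.
by move=> k; exact: Cn_add oOm (Cn_mul oOm (swO k) (sD (0, 1) sf k)) (sDw k).
Qed.
Let w0 v : ~ K v -> w v = 0. Proof. exact: test_zero. Qed.
Let k0 v : ~ K v -> kappa f w v = 0.
Proof.
move=> nK; rewrite /kappa /nabla (test_dx_zero nK) (test_dz_zero nK) w0//.
by rewrite mul0r mulr0 subrr addr0.
Qed.
(** The field has the form [(- u, f * u)] with [u = kappa * G], whose divergence is
    [- nabla f u + u * d_z f], plus a vertical term accounting for [G ^ 2 * d_z w / 2]. It may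
    contain [d_z f] because [f] is smooth on the support of [w]. *)
Let P v := - (kappa f w v * G v).
Let Q v := f v * (kappa f w v * G v) + 2^-1 * (G v * (G v * w v)).

Let sP : smooth_on setT P.
Proof.
apply: (smooth_extend oOm _ oK KO) => [k|v nK]; last by rewrite /P k0// mul0r oppr0.
exact: Cn_opp oOm (Cn_mul oOm (sk k) (sG k)).
Qed.
Let sQ : smooth_on setT Q.
Proof.
apply: (smooth_extend oOm _ oK KO) => [k|v nK]; last by rewrite /Q k0// w0// !(mul0r, mulr0) addr0.
have c0 : Cn_on k Om (fun _ => 2^-1 : R) by exact: Cn_cst.
exact: Cn_add oOm (Cn_mul oOm (sf k) (Cn_mul oOm (sk k) (sG k))) (Cn_mul oOm c0 (Cn_mul oOm (sG k) (Cn_mul oOm (sG k) (swO k)))).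
Qed.
Let Dx (u : R * R -> R) v : smooth_on Om u -> Om v -> is_dx v u (d_x u v).
Proof. by move=> su Ov; exact: Cn_is_derive _ (su 1) Ov. Qed.
Let Dz (u : R * R -> R) v : smooth_on Om u -> Om v -> is_dz v u (d_z u v).
Proof. by move=> su Ov; exact: Cn_is_derive _ (su 1) Ov. Qed.

Lemma off_curve_density v : Om v -> var_density w f G v - kappa f w v * n v = d_x P v + d_z Q v.
Proof.
move=> Ov; pose Dw := nabla f w.
have Dk (d : R * R) (D : forall u : R * R -> R, smooth_on Om u -> is_derive v d u ('D_d u v)) :
    'D_d (kappa f w) v = 'D_d w v * d_z f v + w v * 'D_d (d_z f) v + 'D_d Dw v.
  have [_ ->] := is_deriveD (is_deriveM (D _ swO) (D _ (sD (0, 1) sf))) (D _ sDw).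
  by rewrite /GRing.scale/= addrC [d_z f v * _]mulrC [_ + w v * _]addrC addrC.
have kx := Dk (1, 0) (fun u su => Dx su Ov); have kz := Dk (0, 1) (fun u su => Dz su Ov).
have Gz : d_z G v = d_z (d_x f) v - (f v * d_z (d_z f) v + d_z f v * d_z f v).
  by have [_] := is_deriveB (Dz (sD (1, 0) sf) Ov) (is_deriveM (Dz sf Ov) (Dz (sD (0, 1) sf) Ov)).
have Px : d_x P v = - (kappa f w v * d_x G v + G v * d_x (kappa f w) v).
  by have [_] := is_deriveN (is_deriveM (Dx sk Ov) (Dx sG Ov)).
have Qz : d_z Q v = f v * (kappa f w v * d_z G v + G v * d_z (kappa f w) v) + (kappa f w v * G v) * d_z f v +
    (2^-1 * (G v * (G v * d_z w v + w v * d_z G v) + (G v * w v) * d_z G v) + (G v * (G v * w v)) * 0).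
  by have [_] := is_deriveD (is_deriveM (Dz sf Ov) (is_deriveM (Dz sk Ov) (Dz sG Ov)))
    (is_deriveM (is_derive_cst (2^-1 : R) v (0, 1)) (is_deriveM (Dz sG Ov) (is_deriveM (Dz sG Ov) (Dz swO Ov)))).
have SN : d_x Dw v - f v * d_z Dw v = second_nabla w f G v.
  have Ex : d_x Dw v = d_x (d_x w) v - (f v * d_x (d_z w) v + d_z w v * d_x f v).
    by have [_] := is_deriveB (Dx (sD (1, 0) swO) Ov) (is_deriveM (Dx sf Ov) (Dx (sD (0, 1) swO) Ov)).
  have Ez : d_z Dw v = d_z (d_x w) v - (f v * d_z (d_z w) v + d_z w v * d_z f v).
    by have [_] := is_deriveB (Dz (sD (1, 0) swO) Ov) (is_deriveM (Dz sf Ov) (Dz (sD (0, 1) swO) Ov)).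
  rewrite Ex Ez /second_nabla /G /nabla.
  by move: (d_x (d_x w) v) (d_x (d_z w) v) (d_z (d_x w) v) (d_z (d_z w) v) (d_z w v) (d_x f v) (d_z f v) => *; ring.
have fzx : d_z (d_x f) v = d_x (d_z f) v by exact: Cn_dxdz oOm (sf 2) Ov.
rewrite Px Qz [d_x (kappa f w) v]kx [d_z (kappa f w) v]kz Gz fzx /var_density -SN /n /nabla [d_z G v]Gz fzx /kappa.
rewrite -/(d_x w v) -/(d_z w v) -/(d_x (d_z f) v) -/(d_z (d_z f) v) -/(d_x Dw v) -/(d_z Dw v) /nabla.
move: (d_x Dw v) (d_z Dw v) (d_x (d_z f) v) (d_z (d_z f) v) (d_x w v) (d_z w v) (w v) (f v) (d_z f v) (G v) (d_x G v) => *.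
by field.
Qed.

Lemma off_curve_kappa_integrable : integrable2 Om (fun v => kappa f w v * n v).
Proof.
have [r r0 Kr] := bounded_Box (compact_bounded cK).
have s : smooth_on setT (fun v => kappa f w v * n v).
  apply: (smooth_extend oOm _ oK KO) => [k|v nK]; last by rewrite k0// mul0r.
  exact: (Cn_mul oOm (sk k) (nabla_smooth oOm sf sG k)).
have i : integrable2 setT (fun v => kappa f w v * n v).
  apply: (@csupp_integrable R r); first by move=> v; exact: (Cn_cont (s 0%N)).
  by move=> v nB; rewrite k0 ?mul0r// => /Kr.
by apply: integrableS i => //; exact: meas_open2.
Qed.

Lemma off_curve_identity : mu2.-integrable Om (EFin \o var_density w f G) ->
  \int[mu2]_(v in Om) var_density w f G v = \int[mu2]_(v in Om) (kappa f w v * n v).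
Proof.
move=> ivd; have mOm := meas_open2 oOm.
apply/eqP; rewrite -subr_eq0 -RintegralB//; last exact: off_curve_kappa_integrable.
have P0 v : ~ K v -> P v = 0 by move=> nK; rewrite /P k0// mul0r oppr0.
have Q0 v : ~ K v -> Q v = 0 by move=> nK; rewrite /Q k0// w0// !(mul0r, mulr0) addr0.
have [_ E] := int_divergence0 oOm cK KO sP sQ P0 Q0; rewrite -[X in _ == X]E; apply/eqP.
by apply: eq_Rintegral => v; rewrite inE => Ov; rewrite off_curve_density.
Qed.
Let P' v := w v * n v.
Let Q' v := - (f v * (w v * n v)).
Let sn : smooth_on Om n := nabla_smooth oOm sf sG.

Let sP' : smooth_on setT P'.
Proof.
apply: (smooth_extend oOm _ oK KO) => [k|v nK]; last by rewrite /P' w0// mul0r.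
exact: Cn_mul oOm (swO k) (sn k).
Qed.
Let sQ' : smooth_on setT Q'.
Proof.
apply: (smooth_extend oOm _ oK KO) => [k|v nK]; last by rewrite /Q' w0// mul0r mulr0 oppr0.
exact: Cn_opp oOm (Cn_mul oOm (sf k) (Cn_mul oOm (swO k) (sn k))).
Qed.

(* Integration by parts; the right factor is the adjoint of w |-> kappa f w
   applied to n. *)
Lemma off_curve_adjoint :
  \int[mu2]_(v in Om) (w v * (2 * d_z f v * n v - nabla f n v)) = \int[mu2]_(v in Om) (kappa f w v * n v).
Proof.
have mOm := meas_open2 oOm.
have P0 v : ~ K v -> P' v = 0 by move=> nK; rewrite /P' w0// mul0r.
have Q0 v : ~ K v -> Q' v = 0 by move=> nK; rewrite /Q' w0// mul0r mulr0 oppr0.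
have [iD E] := int_divergence0 oOm cK KO sP' sQ' P0 Q0.
rewrite -[RHS]subr0 -E -RintegralB//; last exact: off_curve_kappa_integrable.
apply: eq_Rintegral => v; rewrite inE => Ov.
have -> : d_x P' v = w v * d_x n v + n v * d_x w v by have [_] := is_deriveM (Dx swO Ov) (Dx sn Ov).
have -> : d_z Q' v = - (f v * (w v * d_z n v + n v * d_z w v) + (w v * n v) * d_z f v).
  by have [_] := is_deriveN (is_deriveM (Dz sf Ov) (is_deriveM (Dz swO Ov) (Dz sn Ov))).
rewrite /kappa [nabla f n v]/nabla [nabla f w v]/nabla.
by move: (d_x n v) (d_z n v) (d_x w v) (d_z w v) (d_z f v) => *; ring.
Qed.

End off_curve.

(** * Order of the slopes on each side of the curve *)

Section plateau_derivative.
Context {R : realType}.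

(** In the quotient rule the numerator is a sum of products of nonnegative functions [expm]. *)
Lemma dstep_ge0 (x : R) : 0 <= dstep x.
Proof.
pose e (y : R) := expm 0 y; pose h (y : R) := expm 0 (1 - y).
have D0 : e x + h x != 0 by rewrite gt_eqF// step_den.
have De (y : R) : is_derive1 y (expm 0) (expm 2 y).
  by have D := is_derive_expm 0 y; apply: (derive_cast D) => //; rewrite mulr0n oppr0 mul0r add0r.
have D1 : is_derive1 x (fun y => 1 - y) (-1).
  have D := is_deriveB (is_derive_cst (1:R) x 1) (is_derive_id x 1).
  by apply: (derive_cast D) => //; rewrite sub0r.
have Dh : is_derive1 x h (- expm 2 (1 - x)).
  have D := @is_derive1_comp R (expm 0) (fun y => 1 - y) x _ _ (De (1 - x)) D1.
  by apply: (derive_cast D) => //; rewrite mulrN1.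
have Dd := is_deriveD (De x) Dh.
have Di := @is_derive1_comp R (fun y => y^-1) (fun y => e y + h y) x _ _ (is_derive_inv D0) Dd.
have Ds := is_deriveM (De x) Di.
have -> : dstep x = (e x + h x)^-1 * (e x + h x)^-1 * (expm 2 x * h x + e x * expm 2 (1 - x)).
  have [_ <-] : is_derive1 x step ((e x + h x)^-1 * (e x + h x)^-1 * (expm 2 x * h x + e x * expm 2 (1 - x))) by
    apply: (derive_cast Ds) => //; rewrite !fctE /GRing.scale/=; move: D0; rewrite /e /h;
    move: (expm 2 (1 - x)) (expm 2 x) (expm 0 x) (expm 0 (1 - x)) => a b c d D0; field.
  by [].
have i0 : 0 <= (e x + h x)^-1 by rewrite invr_ge0 ltW// step_den.
by apply: mulr_ge0; [exact: mulr_ge0|apply: addr_ge0; apply: mulr_ge0; exact: expm_ge0].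
Qed.

Definition dplateau (u : R) : R := step (2 - u) * dstep (2 + u) - step (2 + u) * dstep (2 - u).

Lemma is_derive_plateau (u : R) : is_derive1 u plateau (dplateau u).
Proof.
have D1 : is_derive1 u (fun y => 2 + y) 1.
  have D := is_deriveD (is_derive_cst (2:R) u 1) (is_derive_id u 1).
  by apply: (derive_cast D) => //; rewrite add0r.
have D2 : is_derive1 u (fun y => 2 - y) (-1).
  have D := is_deriveB (is_derive_cst (2:R) u 1) (is_derive_id u 1).
  by apply: (derive_cast D) => //; rewrite sub0r.
have E1 := @is_derive1_comp R step (fun y => 2 + y) u _ _ (is_derive_step _) D1.
have E2 := @is_derive1_comp R step (fun y => 2 - y) u _ _ (is_derive_step _) D2.
have D := is_deriveM E1 E2; apply: (derive_cast D) => //.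
by rewrite /dplateau /GRing.scale/=; ring.
Qed.

Lemma dplateau_continuous : continuous dplateau.
Proof.
move=> u; have c1 : {for u, continuous (fun y : R => 2 + y)}.
  by cont.
have c2 : {for u, continuous (fun y : R => 2 - y)}.
  by apply: contD; [exact: cst_continuous|apply: contN; exact: id].
have cs (y : R) : {for y, continuous step} by exact: is_derive_continuous (is_derive_step y).
have d1 := @continuous_comp _ _ _ _ dstep _ c1 (@dstep_continuous R (2 + u)).
have d2 := @continuous_comp _ _ _ _ dstep _ c2 (@dstep_continuous R (2 - u)).
have e1 := @continuous_comp _ _ _ _ step _ c1 (cs (2 + u)).
have e2 := @continuous_comp _ _ _ _ step _ c2 (cs (2 - u)).
exact: contD (contM e2 d1) (contN (contM e1 d2)).
Qed.

Lemma dplateau_sign (u : R) : u * dplateau u <= 0.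
Proof.
have s0 (y : R) := step_ge0 y; have d0 := dstep_ge0.
have [u0|u0|->] := ltgtP u 0; last by rewrite mul0r.
  rewrite nmulr_rle0// /dplateau (@dstep0 R (2 - u)); last by right; lra.
  by rewrite mulr0 subr0 mulr_ge0.
rewrite pmulr_rle0// /dplateau (@dstep0 R (2 + u)); last by right; lra.
by rewrite mulr0 sub0r oppr_le0 mulr_ge0.
Qed.

Lemma dplateau0 (u : R) : 2 < `|u| -> dplateau u = 0.
Proof.
rewrite /dplateau; have [u0|u0] := leP 0 u; first rewrite ger0_norm// => h.
  by rewrite (@step0 R (2 - u)) ?mul0r ?sub0r ?(@dstep0 R (2 - u)) ?mulr0 ?oppr0//; [left|]; lra.
rewrite ltr0_norm// => h; rewrite (@step0 R (2 + u)) ?mul0r ?subr0 ?(@dstep0 R (2 + u)) ?mulr0//; [left|]; lra.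
Qed.

Lemma dplateau_bound : exists2 C : R, 0 < C & forall u, `|dplateau u| <= C.
Proof.
have [C C0 HC] := @dstep_bound R; exists (2 * C); first by rewrite mulr_gt0.
move=> u; apply: (le_trans (ler_normB _ _)); rewrite mulr_natl mulr2n.
have P (x y : R) : `|step x * dstep y| <= C.
  by rewrite normrM (le_trans _ (HC y))// ler_piMl// ger0_norm ?step_ge0// step_le1.
by apply: lerD; exact: P.
Qed.

End plateau_derivative.

Section strips.
Context {R : realType}.
Variables (ga : R -> R) (s t0 a b : R).
Hypotheses (s1 : s = 1 \/ s = -1) (a0 : 0 < a) (b0 : 0 < b).

Definition strip : set (R * R) := [set v | `|v.1 - t0| <= a /\ 0 < s * (v.2 - ga v.1) <= b].

Lemma area_strip : measurable (mset strip) -> mu2 strip = (2 * a * b)%:E.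
Proof.
move=> mS; have mJ := mitv (t0 - a) (t0 + a).
transitivity (\int[mu]_x mu (xsection strip x))%E; first by [].
have E x : mu (xsection strip x) = (\1_(`[t0 - a, t0 + a]%classic) x * b)%:E.
  have [xJ|xJ] := pselect (`|x - t0| <= a); last first.
    rewrite indicE memNset ?mul0r; last by rewrite /= in_itv/= -ler_distl.
    rewrite (_ : xsection strip x = set0) ?measure0//.
    by apply/seteqP; split=> // z; rewrite /xsection /= inE => -[].
  rewrite indicE mem_set ?mul1r; last by rewrite /= in_itv/= -ler_distl.
  case: s1 => sE.
    have -> : xsection strip x = `]ga x, (ga x + b)]%classic.
      apply/seteqP; split=> z; rewrite /xsection /= inE /strip /= sE mul1r in_itv/=.
        by move=> [_ /andP[h1 h2]]; apply/andP; split; lra.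
      by move=> /andP[h1 h2]; split=> //; apply/andP; split; lra.
    by rewrite lebesgue_measure_itv/= lte_fin ltrDl b0 -EFinD addrAC subrr add0r.
  have -> : xsection strip x = `[(ga x - b), ga x[%classic.
    apply/seteqP; split=> z; rewrite /xsection /= inE /strip /= sE mulN1r in_itv/=.
      by move=> [_ /andP[h1 h2]]; apply/andP; split; lra.
    by move=> /andP[h1 h2]; split=> //; apply/andP; split; lra.
  by rewrite lebesgue_measure_itv/= lte_fin ltrBlDr ltrDl b0 -EFinD opprB addrCA subrr addr0.
under eq_integral => x _ do rewrite E EFinM.
rewrite ge0_integralZr//; try (by rewrite lee_fin ltW); try (by apply/measurable_EFinP; exact: measurable_indic).
have mJE : mu `[(t0 - a)%R, (t0 + a)%R]%classic = (2 * a)%:E.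
  by rewrite lebesgue_measure_itv/= lte_fin ltrD2l gtrN// -EFinD; congr EFin; ring.
by rewrite integral_indic// setIT EFinM -mJE.
Qed.

End strips.

Section slope_order.
Context {R : realType}.
Variables (U : set (R * R)) (I : set R) (ga cy dcy : R -> R) (s t0 r0 c : R) (f : R * R -> R).
Hypotheses (oU : open U) (oI : open I) (UI : forall v, U v -> I v.1)
  (dga : forall x, I x -> is_derive1 x ga (- cy x))
  (dcyP : forall x, I x -> is_derive1 x cy (dcy x))
  (cdcy : cont_on I dcy)
  (s1 : s = 1 \/ s = -1) (It0 : I t0) (r00 : 0 < r0) (KU : cbox (t0, ga t0) r0 `<=` U)
  (cf : cont_on U f) (f_ga : forall x, I x -> f (x, ga x) = cy x).
Let OmI : set (R * R) := [set v | I v.1 /\ 0 < s * (v.2 - ga v.1)].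
Let Om : set (R * R) := [set v | U v /\ 0 < s * (v.2 - ga v.1)].
Let K := cbox (t0, ga t0) r0.
Variable B : R.
Hypotheses (B0 : 0 <= B) (sf : smooth_on Om f) (GB : forall v, K v -> Om v -> `|nabla f f v| <= B)
  (c0 : 0 < c) (slope_gap : forall v, K v -> Om v -> c <= s * (nabla f f v - dcy v.1)).

Let cK : compact K. Proof. exact: cbox_compact. Qed.
Let oKc : open (~` K). Proof. exact: cbox_openC. Qed.
Let oOmI : open OmI. Proof. exact: @collar_open R I ga (fun x => - cy x) s oI dga. Qed.
Let oOm : open Om.
Proof.
have -> : Om = U `&` OmI by apply/seteqP; split=> v; [move=> [Uv h]; split=> //; split=> //; exact: UI|move=> [Uv [_ h]]].
exact: openI.
Qed.
Let Om_K v : K v -> OmI v -> Om v. Proof. by move=> /KU Uv [_ h]. Qed.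
Let cga x : I x -> {for x, continuous ga}. Proof. by move=> Ix; exact: is_derive_continuous (dga Ix). Qed.
Let ccy x : I x -> {for x, continuous cy}. Proof. by move=> Ix; exact: is_derive_continuous (dcyP Ix). Qed.
Let ss : s * s = 1. Proof. by case: s1 => ->; rewrite ?mulr1// mulrN1 opprK. Qed.
Let ns : `|s| = 1. Proof. by case: s1 => ->; rewrite ?normrN normr1. Qed.

Section test_strip.
Variables (r rho : R).
Hypotheses (r_gt0 : 0 < r) (rho_gt0 : 0 < rho) (rr0 : 2 * r <= r0) (rho_r0 : 2 * rho <= r0 / 2)
  (ga_r : forall x, `|x - t0| <= 2 * r -> `|ga x - ga t0| <= r0 / 2).

Let k v := f v - cy v.1.
Let al (v : R * R) := plateau ((v.1 - t0) / r).
Let dal (v : R * R) := dplateau ((v.1 - t0) / r) / r.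
Let be (v : R * R) := plateau ((v.2 - ga v.1) / rho).
Let dbe (v : R * R) := dplateau ((v.2 - ga v.1) / rho) / rho.
(** [k] is the deviation of [f] from its value on the curve. [(k, - (cy * k + k ^ 2 / 2))] is a
    field with divergence [nabla f f - dcy]; it is multiplied by a cutoff that follows the curve, so
    that the terms [cy * k * dbe] cancel in [T]. Nothing flows through the curve, where [k = 0]. *)
Let P v := k v * (al v * be v).
Let Q v := - ((cy v.1 * k v + 2^-1 * (k v * k v)) * (al v * be v)).
Let psix v := dal v * be v + al v * (cy v.1 * dbe v).
Let psiz v := al v * dbe v.
Let Px v := (d_x f v - dcy v.1) * (al v * be v) + k v * psix v.
Let Qz v := - (f v * d_z f v * (al v * be v) + (cy v.1 * k v + 2^-1 * (k v * k v)) * psiz v).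

Let offK v : ~ K v -> [/\ al v * be v = 0, dal v * be v = 0 & al v * dbe v = 0].
Proof.
move=> nK; have [h1|h1] := ltP (2 * r) `|v.1 - t0|.
  have h : 2 < `|(v.1 - t0) / r| by rewrite normrM normfV (gtr0_norm r_gt0) ltr_pdivlMr.
  by rewrite /al /dal plateau0 ?(ltW h)// dplateau0// !mul0r.
have h2 : 2 < `|(v.2 - ga v.1) / rho|.
  rewrite normrM normfV (gtr0_norm rho_gt0) ltr_pdivlMr//.
  rewrite ltNge; apply/negP => h2; apply: nK; split=> /=; first exact: le_trans rr0.
  rewrite -(subrK (ga v.1) v.2) -addrA (le_trans (ler_normD _ _))//.
  by have := ga_r h1; move: h2 rho_r0; lra.
by rewrite /be /dbe plateau0 ?(ltW h2)// dplateau0// !(mul0r, mulr0).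
Qed.
Let ca (h : R -> R) v : continuous h -> {for v, continuous (fun v : R * R => h ((v.1 - t0) / r))}.
Proof.
move=> ch; apply: (cont_comp (fun v => (v.1 - t0) / r) h); last exact: ch.
by cont.
Qed.
Let cb (h : R -> R) v : I v.1 -> continuous h -> {for v, continuous (fun v : R * R => h ((v.2 - ga v.1) / rho))}.
Proof.
move=> Iv ch; apply: (cont_comp (fun v => (v.2 - ga v.1) / rho) h); last exact: ch.
apply: contM; last exact: cst_continuous.
by apply: contD; [exact: cvg_snd|apply: contN; apply: continuous_fst_comp; exact: cga].
Qed.
Let cpl : continuous (@plateau R). Proof. by move=> u; exact: is_derive_continuous (is_derive_plateau u). Qed.
Let cal v : {for v, continuous al}. Proof. exact: ca cpl. Qed.
Let cdal v : {for v, continuous dal}.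
Proof. by apply: contM; [exact: ca (@dplateau_continuous R)|exact: cst_continuous]. Qed.
Let cbe v : I v.1 -> {for v, continuous be}. Proof. by move=> Iv; exact: cb cpl. Qed.
Let cdbe v : I v.1 -> {for v, continuous dbe}.
Proof. by move=> Iv; apply: contM; [exact: cb (@dplateau_continuous R)|exact: cst_continuous]. Qed.
Let ccyv v : I v.1 -> {for v, continuous (fun v : R * R => cy v.1)}.
Proof. by move=> Iv; apply: continuous_fst_comp; exact: ccy. Qed.
Let ck v : U v -> {for v, continuous k}.
Proof. by move=> Uv; exact: contD (cf Uv) (contN (ccyv (UI Uv))). Qed.
Let P0 v : ~ K v -> P v = 0. Proof. by move=> /offK[E _ _]; rewrite /P E mulr0. Qed.
Let Q0 v : ~ K v -> Q v = 0. Proof. by move=> /offK[E _ _]; rewrite /Q E mulr0 oppr0. Qed.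
Let psix0 v : ~ K v -> psix v = 0. Proof. by move=> /offK[_ E F]; rewrite /psix E mulrCA F mulr0 addr0. Qed.
Let psiz0 v : ~ K v -> psiz v = 0. Proof. by move=> /offK[]. Qed.
Let Px0 v : ~ K v -> Px v = 0.
Proof. by move=> nK; have [E _ _] := offK nK; rewrite /Px E psix0// !mulr0 addr0. Qed.
Let Qz0 v : ~ K v -> Qz v = 0.
Proof. by move=> nK; have [E _ _] := offK nK; rewrite /Qz E psiz0// !mulr0 addr0 oppr0. Qed.
Let c2 (v : R * R) : {for v, continuous (fun _ : R * R => 2^-1 : R)}. Proof. exact: cst_continuous. Qed.
Let cP : continuous P.
Proof.
move=> v; apply: (continuous_zero_out oKc) P0 => /KU Uv.
exact: contM (ck Uv) (contM (@cal v) (cbe (UI Uv))).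
Qed.
Let cq v : U v -> {for v, continuous (fun v => cy v.1 * k v + 2^-1 * (k v * k v))}.
Proof.
move=> Uv; exact: contD (contM (ccyv (UI Uv)) (ck Uv)) (contM (@c2 v) (contM (ck Uv) (ck Uv))).
Qed.
Let cQ : continuous Q.
Proof.
move=> v; apply: (continuous_zero_out oKc) Q0 => /KU Uv.
exact: contN (contM (cq Uv) (contM (@cal v) (cbe (UI Uv)))).
Qed.
Let df v : Om v -> dif f v (d_x f v) (d_z f v). Proof. by move=> Ov; exact: Cn_dif oOm (sf 1) Ov. Qed.
Let cfx v : Om v -> {for v, continuous (d_x f)}. Proof. by move=> Ov; exact: Cn_cont (Cn_D _ (sf 1)) Ov. Qed.
Let cfz v : Om v -> {for v, continuous (d_z f)}. Proof. by move=> Ov; exact: Cn_cont (Cn_D _ (sf 1)) Ov. Qed.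
Let cPx v : OmI v -> {for v, continuous Px}.
Proof.
move=> Ov; apply: (continuous_zero_out oKc) Px0 => Kv; have {}Ov := Om_K Kv Ov; have Iv := UI (proj1 Ov).
have e1 : {for v, continuous (fun v => dcy v.1)} by apply: continuous_fst_comp; exact: cdcy.
have e2 := contD (contM (@cdal v) (cbe Iv)) (contM (@cal v) (contM (ccyv Iv) (cdbe Iv))).
exact: contD (contM (contD (cfx Ov) (contN e1)) (contM (@cal v) (cbe Iv)))
  (contM (ck (proj1 Ov)) e2).
Qed.
Let cQz v : OmI v -> {for v, continuous Qz}.
Proof.
move=> Ov; apply: (continuous_zero_out oKc) Qz0 => Kv; have {}Ov := Om_K Kv Ov; have Iv := UI (proj1 Ov).
exact: contN (contD (contM (contM (cf (proj1 Ov)) (cfz Ov)) (contM (@cal v) (cbe Iv)))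
  (contM (cq (proj1 Ov)) (contM (@cal v) (cdbe Iv)))).
Qed.
Let dalx v : is_dx v al (dal v).
Proof.
apply/is_derive_dx; have D1 := is_deriveM (is_deriveB (is_derive_id v.1 1) (is_derive_cst t0 v.1 1)) (is_derive_cst (r^-1) v.1 1).
have D := @is_derive1_comp R plateau _ v.1 _ _ (is_derive_plateau _) D1.
by apply: (derive_cast D) => //; rewrite /dal !fctE /GRing.scale/=; ring.
Qed.
Let dbex v : I v.1 -> is_dx v be (cy v.1 * dbe v).
Proof.
move=> Iv; apply/is_derive_dx; have D1 := is_deriveM (is_deriveB (is_derive_cst v.2 v.1 1) (dga Iv)) (is_derive_cst (rho^-1) v.1 1).
have D := @is_derive1_comp R plateau _ v.1 _ _ (is_derive_plateau _) D1.
by apply: (derive_cast D) => //; rewrite /dbe !fctE /GRing.scale/=; ring.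
Qed.
Let dbez v : is_dz v be (dbe v).
Proof.
apply/is_derive_dz; have D1 := is_deriveM (is_deriveB (is_derive_id v.2 1) (is_derive_cst (ga v.1) v.2 1)) (is_derive_cst (rho^-1) v.2 1).
have D := @is_derive1_comp R plateau _ v.2 _ _ (is_derive_plateau _) D1.
by apply: (derive_cast D) => //; rewrite /dbe !fctE /GRing.scale/=; ring.
Qed.
Let dalz v : is_dz v al 0.
Proof. by apply/is_derive_dz; exact: is_derive_cst (al v) v.2 (1:R). Qed.
Let dP v : OmI v -> is_dx v P (Px v).
Proof.
move=> Ov; have [Kv|nK] := pselect (K v); last by rewrite Px0//; exact: (is_derive_zero_out oKc _ P0 nK).
have {}Ov := Om_K Kv Ov; have Iv := UI (proj1 Ov).
have dc : is_dx v (fun v => cy v.1) (dcy v.1) by apply/is_derive_dx; exact: dcyP.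
have D := is_deriveM (is_deriveB (dif_dx (df Ov)) dc) (is_deriveM (dalx v) (dbex Iv)).
by apply: (derive_cast D) => //; rewrite /Px /psix /k !fctE /GRing.scale/=; ring.
Qed.
Let dQ v : OmI v -> is_dz v Q (Qz v).
Proof.
move=> Ov; have [Kv|nK] := pselect (K v); last by rewrite Qz0//; exact: (is_derive_zero_out oKc _ Q0 nK).
have {}Ov := Om_K Kv Ov; have Iv := UI (proj1 Ov).
have dc : is_dz v (fun v => cy v.1) 0 by apply/is_derive_dz; exact: (is_derive_cst (cy v.1) v.2 (1:R)).
have dk := is_deriveB (dif_dz (df Ov)) dc.
have D := is_deriveN (is_deriveM (is_deriveD (is_deriveM dc dk) (is_deriveM (is_derive_cst (2^-1 : R) v ((0, 1) : R * R)) (is_deriveM dk dk)))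
  (is_deriveM (dalz v) (dbez v))).
by apply: (derive_cast D) => //; rewrite /Qz /psiz /k !fctE /GRing.scale/=; field.
Qed.
Let T v := (nabla f f v - dcy v.1) * (al v * be v) + k v * (dal v * be v) - 2^-1 * (k v * k v) * (al v * dbe v).

Let TE v : Px v + Qz v = T v.
Proof.
rewrite /Px /Qz /T /psix /psiz /nabla /k.
by move: (d_x f v) (d_z f v) (dal v) (dbe v) (al v) (be v) => *; field.
Qed.

Variables (eta C : R).
Hypotheses (k_eta : forall v, `|v.1 - t0| <= 2 * r -> `|v.2 - ga v.1| <= 2 * rho -> `|k v| <= eta)
  (HC : forall u : R, `|dplateau u| <= C).

Let inner := strip ga s t0 r rho.
Let outer := strip ga s t0 (2 * r) (2 * rho).

(* The term with dbe has the sign of s because the plateau decreases away from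
   the curve. *)
Lemma strip_lower_bound v : OmI v -> c * \1_inner v - eta * (C / r) * \1_outer v <= s * T v.
Proof.
move=> [Iv hv]; set u := v.2 - ga v.1.
have su : s * u = `|u| by rewrite -(gtr0_norm hv) normrM ns mul1r.
have al0 : 0 <= al v by exact: plateau_ge0.
have be0 : 0 <= be v by exact: plateau_ge0.
have t1 : 0 <= s * (- (2^-1 * (k v * k v) * (al v * dbe v))).
  have h : s * dbe v <= 0.
    have u0 : 0 < s * u / rho by rewrite divr_gt0.
    have := dplateau_sign (u / rho); rewrite /dbe -/u => h.
    rewrite mulrA pmulr_lle0 ?invr_gt0// -(pmulr_rle0 _ u0).
    rewrite (_ : s * u / rho * _ = s * s * (u / rho * dplateau (u / rho))); last by ring.
    by rewrite ss mul1r.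
  rewrite (_ : s * _ = 2^-1 * (k v * k v) * al v * - (s * dbe v)); last by ring.
  apply: mulr_ge0; last by rewrite oppr_ge0.
  by apply: mulr_ge0 => //; apply: mulr_ge0; [rewrite invr_ge0|rewrite -expr2 sqr_ge0].
have t2 : c * \1_inner v <= s * ((nabla f f v - dcy v.1) * (al v * be v)).
  have [ab0|ab0] := eqVneq (al v * be v) 0.
    rewrite ab0 mulr0 mulr0 indicE memNset ?mulr0// => -[/= h1 /andP[_ h2]]; move: ab0; apply/eqP.
    rewrite /al /be !plateau1 ?mulr1 ?oner_neq0//.
      by rewrite -/u normrM normfV (gtr0_norm rho_gt0) ler_pdivrMr// mul1r -su.
    by rewrite normrM normfV (gtr0_norm r_gt0) ler_pdivrMr// mul1r.
  have Kv : K v by apply: contrapT => /offK[E _ _]; rewrite E eqxx in ab0.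
  have Ov : Om v by split=> //; exact: KU.
  have g := slope_gap Kv Ov.
  have [iv|niv] := pselect (inner v); last first.
    rewrite indicE memNset// mulr0 mulrA; apply: mulr_ge0; first exact: le_trans (ltW c0) g.
    exact: mulr_ge0.
  rewrite indicE mem_set// mulr1; case: iv => /= h1 /andP[_ h2].
  have a1 : al v = 1 by rewrite /al plateau1// normrM normfV (gtr0_norm r_gt0) ler_pdivrMr// mul1r.
  have b1 : be v = 1 by rewrite /be -/u plateau1// normrM normfV (gtr0_norm rho_gt0) ler_pdivrMr// mul1r -su.
  by rewrite a1 b1 !mulr1.
have t3 : - (eta * (C / r) * \1_outer v) <= s * (k v * (dal v * be v)).
  have [ov|nov] := pselect (outer v).
    rewrite indicE mem_set// mulr1 lerNl; case: ov => /= h1 /andP[_ h2].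
    apply: (le_trans (ler_norm _)); rewrite normrN (normrM s) ns mul1r (normrM (k v)) (normrM (dal v)) (ger0_norm be0).
    have be1 : be v <= 1 by exact: plateau_le1.
    have dal1 : `|dal v| <= C / r.
      by rewrite /dal normrM normfV (gtr0_norm r_gt0); apply: ler_wpM2r => //; rewrite invr_ge0 ltW.
    apply: ler_pM => //; first exact: mulr_ge0.
      by apply: k_eta => //; rewrite -/u -su.
    by apply: le_trans dal1; rewrite ler_piMr.
  rewrite indicE memNset// mulr0 oppr0.
  suff -> : dal v * be v = 0 by rewrite !mulr0.
  have [h1|h1] := ltP (2 * r) `|v.1 - t0|.
    by rewrite /dal dplateau0 ?mul0r// normrM normfV (gtr0_norm r_gt0) ltr_pdivlMr.
  rewrite /be -/u plateau0 ?mulr0// normrM normfV (gtr0_norm rho_gt0) ler_pdivlMr//.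
  rewrite leNgt; apply/negP => h2; apply: nov; split=> //; apply/andP; split=> //.
  by rewrite -/u su ltW.
rewrite /T mulrDr [s * (_ + _)]mulrDr; apply: (le_trans (lerD t2 t3)).
by rewrite lerDl.
Qed.
Let mOmI : measurable (mset OmI). Proof. exact: meas_open2 oOmI. Qed.
Let integrable_T : integrable2 OmI (fun v => Px v + Qz v).
Proof.
have cdcyv v : K v -> {for v, continuous (fun v => dcy v.1)}.
  by move=> /KU/UI Iv; apply: continuous_fst_comp; exact: cdcy.
have Kb (h : R * R -> R) : (cont_on K h) -> exists2 C, 0 < C & forall v, K v -> `|h v| <= C.
  exact: compact_bound.
have [C1 C10 H1] := Kb _ cdcyv.
have [C2 C20 H2] := Kb (fun v => al v * be v) (fun v Kv => contM (@cal v) (cbe (UI (KU Kv)))).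
have [C3 C30 H3] := Kb (fun v => k v * (dal v * be v) - 2^-1 * (k v * k v) * (al v * dbe v))
  (fun v Kv => contD (contM (ck (KU Kv)) (contM (@cdal v) (cbe (UI (KU Kv)))))
    (contN (contM (contM (@c2 v) (contM (ck (KU Kv)) (ck (KU Kv))))
     (contM (@cal v) (cdbe (UI (KU Kv))))))).
have [q q0 Kq] := bounded_Box (compact_bounded cK).
apply: (@bounded_integrable R OmI q ((B + C1) * C2 + C3)) => //.
- apply: cont2_measurable => // v Ov; exact: contD (cPx Ov) (cQz Ov).
- move=> v Ov; have [Kv|nK] := pselect (K v); last first.
    have Kp : K (t0, ga t0) by split; rewrite /= subrr normr0 ltW.
    rewrite Px0// Qz0// addr0 normr0.
    apply: addr_ge0; last exact: ltW.
    apply: mulr_ge0; last exact: ltW.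
    by apply: addr_ge0; [exact: B0|exact: ltW].
  rewrite TE /T -addrA; apply: (le_trans (ler_normD _ _)); apply: lerD; last exact: H3.
  rewrite normrM; apply: ler_pM => //; last exact: H2.
  apply: (le_trans (ler_normB _ _)); apply: lerD; last exact: H1.
  by apply: GB => //; exact: Om_K.
- by move=> v Ov nB; rewrite Px0 ?Qz0 ?addr0// => /Kq.
Qed.
Let J_I x : `|x - t0| <= r0 -> I x.
Proof.
move=> h; have /KU/UI// : K (x, ga t0) by split=> //=; rewrite subrr normr0 ltW.
Qed.
(** The strip is closed on its far side; it is a difference of two open sets. *)
Let strip_measurable a b : a <= r0 -> measurable (strip ga s t0 a b : set (mvplane R)).
Proof.
move=> ar; have -> : strip ga s t0 a b =
    OmI `\` ([set v | a < `|v.1 - t0|] `|` [set v | I v.1 /\ 0 < s * (v.2 - (ga v.1 + s * b))]).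
  have E (v : R * R) : s * (v.2 - (ga v.1 + s * b)) = s * (v.2 - ga v.1) - b.
    by transitivity (s * (v.2 - ga v.1) - (s * s) * b); [ring|rewrite ss mul1r].
  apply/seteqP; split=> v.
    move=> [h1 /andP[h2 h3]]; split; first by split=> //; apply: J_I; exact: le_trans ar.
    move=> [/=|[_]]; first by rewrite ltNge h1.
    by rewrite E subr_gt0 ltNge h3.
  move=> [[Iv h] nO]; split.
    by rewrite leNgt; apply/negP => h1; apply: nO; left.
  by rewrite h /= leNgt; apply/negP => h1; apply: nO; right; split=> //; rewrite E subr_gt0.
apply: measurableD => //; apply: meas_open2; apply: openU.
  apply: (@open_comp _ _ (fun v => `|v.1 - t0|) [set y : R | a < y]); last exact: open_gt.
  move=> v _; apply: (cont_comp (fun v => v.1 - t0) (fun y => `|y|)); last exact: norm_continuous.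
  by cont.
apply: (@collar_open R I (fun x => ga x + s * b) (fun x => - cy x) s oI) => x Ix.
have D := is_deriveD (dga Ix) (is_derive_cst (s * b) x 1).
by apply: (derive_cast D) => //; rewrite addr0.
Qed.
Let strip_integrable a b : a <= 2 * r -> b <= 2 * rho -> 0 < a -> 0 < b ->
  mu2.-integrable OmI (EFin \o (\1_(strip ga s t0 a b) : R * R -> R)) /\
  \int[mu2]_(v in OmI) \1_(strip ga s t0 a b) v = 2 * a * b.
Proof.
move=> ar br a0 b0; have ar0 : a <= r0 by exact: le_trans rr0.
have mS := strip_measurable b ar0.
have SO : strip ga s t0 a b `<=` OmI.
  by move=> v [h1 /andP[h2 _]]; split=> //; apply: J_I; exact: le_trans ar0.
split; last first.
  rewrite /Rintegral integral_indic//; have -> : strip ga s t0 a b `&` OmI = strip ga s t0 a b by exact/setIidl.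
  by rewrite area_strip.
have [q q0 Kq] := bounded_Box (compact_bounded cK).
apply: (@bounded_integrable R OmI q 1) => //.
- by move=> v _; rewrite indicE; case: (_ \in _); rewrite ?normr1 ?normr0.
- move=> v _ nB; rewrite indicE memNset// => -[h1 /andP[h2 h3]]; apply: nB; apply: Kq.
  have h4 : `|v.1 - t0| <= 2 * r by exact: le_trans ar.
  split=> /=; first exact: le_trans rr0.
  rewrite -(subrK (ga v.1) v.2) -addrA (le_trans (ler_normD _ _))//.
  have h5 : `|v.2 - ga v.1| <= 2 * rho.
    have -> : `|v.2 - ga v.1| = s * (v.2 - ga v.1) by rewrite -(gtr0_norm h2) normrM ns mul1r.
    exact: le_trans br.
  by have := ga_r h4; move: h5 rho_r0; lra.
Qed.

(** The integral of [T] is 0, as the flux through the curve vanishes; the pointwise lower bound of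
    [s * T] therefore compares the areas of the inner and of the outer strip. *)
Lemma strip_measure_bound : c * (2 * r * rho) <= eta * (C / r) * (2 * (2 * r) * (2 * rho)).
Proof.
have iT := integrable_T; have r2 : 0 < 2 * r by rewrite mulr_gt0.
have rho2 : 0 < 2 * rho by rewrite mulr_gt0.
have rle : r <= 2 * r by have := r_gt0; lra.
have rhole : rho <= 2 * rho by have := rho_gt0; lra.
have D := @collar_divergence R I ga (fun x => - cy x) s K P Q Px Qz oI dga _ s1 cK _ P0 Q0 cP cQ dP dQ cPx cQz iT.
have ET : \int[mu2]_(v in OmI) (Px v + Qz v) = 0.
  rewrite D.
  - rewrite [X in _ * X]Rint_eq0 ?mulr0// => x Ix; rewrite /Q /P /k /= f_ga//; ring.
  - by move=> x Ix; apply: continuousN; exact: ccy.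
  - by move=> v /KU/UI.
have [i1 e1] := strip_integrable rle rhole r_gt0 rho_gt0.
have [i2 e2] := strip_integrable (lexx _) (lexx _) r2 rho2.
have j1 := integrableZl mOmI c i1; have j2 := integrableZl mOmI (eta * (C / r)) i2.
have jj := integrableB mOmI j1 j2.
have jT := integrableZl mOmI s iT.
have : \int[mu2]_(v in OmI) (c * \1_inner v - eta * (C / r) * \1_outer v) <= \int[mu2]_(v in OmI) (s * (Px v + Qz v)).
  apply: le_Rintegral => //.
  by move=> v Ov; rewrite TE; exact: strip_lower_bound.
rewrite RintegralB//; try by [have := j1|have := j2].
by rewrite !RintegralZl// ET mulr0 e1 e2 subr_le0.
Qed.

End test_strip.
(** The two strips have comparable areas, whereas [k] is uniformly small on thin strips because
    [f = cy] on the curve. With [r] fixed and [rho] small, the inequality between the strips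
    fails. *)
Lemma slope_gap_false : False.
Proof.
have [C C0 HC] := @dplateau_bound R.
have r02 : 0 < r0 / 2 by rewrite divr_gt0.
have /continuousR_leP/(_ _ r02)[d d0 Hd] : {for t0, continuous ga} by exact: cga.
pose r := Num.min (d / 2) (r0 / 2).
have r_gt0 : 0 < r by rewrite lt_min !divr_gt0.
have rd : 2 * r <= d by rewrite mulrC -ler_pdivlMr// ge_min lexx.
have rr0 : 2 * r <= r0 by rewrite mulrC -ler_pdivlMr// ge_min lexx orbT.
have ga_r x : `|x - t0| <= 2 * r -> `|ga x - ga t0| <= r0 / 2.
  by move=> h; have := Hd (x - t0) (le_trans h rd); rewrite [t0 + _]addrC subrK.
(* This value makes the right side of [strip_measure_bound] equal to [c * r * rho / 2], against
   [2 * c * r * rho] on the left. *)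
pose eta := c * r / (16 * C).
have eta0 : 0 < eta by rewrite divr_gt0 ?mulr_gt0.
have ck v : K v -> {for v, continuous (fun v => f v - cy v.1)}.
  move=> /KU Uv; apply: contD; first exact: cf.
  by apply: contN; apply: continuous_fst_comp; apply: ccy; exact: UI.
have [d' d'0 Hd'] := compact_unif cK ck eta0.
pose rho := Num.min (d' / 2) (r0 / 4).
have rho_gt0 : 0 < rho by rewrite lt_min !divr_gt0.
have rhod : 2 * rho <= d' by rewrite mulrC -ler_pdivlMr// ge_min lexx.
have rho4 : rho <= r0 / 4 by rewrite ge_min lexx orbT.
have rho_r0 : 2 * rho <= r0 / 2 by move: rho4; lra.
have k_eta v : `|v.1 - t0| <= 2 * r -> `|v.2 - ga v.1| <= 2 * rho -> `|f v - cy v.1| <= eta.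
  move=> h1 h2; have Kx : K (v.1, ga v.1).
    split=> /=; first exact: le_trans rr0.
    by apply: (le_trans (ga_r _ h1)); move: r00; lra.
  have := Hd' _ 0 (v.2 - ga v.1) Kx; rewrite normr0 (ltW d'0) => /(_ isT (le_trans h2 rhod)) /=.
  rewrite addr0 [ga v.1 + _]addrC subrK -surjective_pairing f_ga; last exact: UI (KU Kx).
  by rewrite subrr subr0.
have := strip_measure_bound r_gt0 rho_gt0 rr0 rho_r0 ga_r k_eta HC.
rewrite (_ : eta * (C / r) * _ = 2^-1 * (c * r * rho)); last first.
  by rewrite /eta; field; rewrite !gt_eqF.
have p : 0 < c * r * rho by rewrite !mulr_gt0.
by rewrite (_ : c * (2 * r * rho) = 2 * (c * r * rho)); [lra|ring].
Qed.

End slope_order.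

(** * The first variation of the energy and critical graphs *)

Section positivity.
Context {R : realType}.

Lemma Rintegral_gt0 d (T : measurableType d) (m : {measure set T -> \bar R}) (A B : set T) (X : T -> R) (c : R) :
  measurable A -> measurable B -> B `<=` A -> (0 < m B)%E -> m.-integrable A (EFin \o X) ->
  (forall x, A x -> 0 <= X x) -> 0 < c -> (forall x, B x -> c <= X x) -> 0 < \int[m]_(x in A) X x.
Proof.
move=> mA mB BA B0 iX X0 c0 Xc.
rewrite -lte_fin fineK; last exact: integrable_fin_num.
have iB := integrableS mA mB BA iX.
have mXA : measurable_fun A (EFin \o X) by have /integrableP[] := iX.
have mXB : measurable_fun B (EFin \o X) by have /integrableP[] := iB.
apply: (@lt_le_trans _ _ (\int[m]_(x in B) (c%:E))%E).
  by rewrite integral_cst//; exact: mule_gt0.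
apply: (@le_trans _ _ (\int[m]_(x in B) (X x)%:E)%E).
  by apply: ge0_le_integral => // x _; rewrite lee_fin ltW.
by apply: ge0_subset_integral => // x Ax; rewrite lee_fin X0.
Qed.

Lemma box_plateau_test (O : set (R * R)) (p : R * R) (r : R) : 0 < r -> cbox p (2 * r) `<=` O ->
  test_function O (box_plateau p r).
Proof.
move=> r0 HO; apply: (@test_function_of _ O (cbox p (2 * r))) => //.
- by move=> n; exact: box_plateau_smooth.
- exact: cbox_compact.
- move=> v nK; apply: box_plateau0 => //.
  have [h1|h1] := leP (2 * r) `|v.1 - p.1|; first by left.
  have [h2|h2] := leP (2 * r) `|v.2 - p.2|; first by right.
  by exfalso; apply: nK; split; exact: ltW.
Qed.

Lemma box_plateau_ge0 (p v : R * R) (r : R) : 0 <= box_plateau p r v.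
Proof. by apply: mulr_ge0; exact: plateau_ge0. Qed.

Lemma area_cbox_gt0 (p : R * R) (r : R) : 0 < r -> (0 < mu2 (cbox p r))%E.
Proof. by move=> r0; rewrite cboxE; exact: area_box_gt0. Qed.

Lemma exists_sign (x : R) : x != 0 -> exists2 s : R, s = 1 \/ s = -1 & 0 < s * x.
Proof.
rewrite neq_lt => /orP[h|h]; [exists (-1)|exists 1]; rewrite ?mul1r ?mulN1r ?oppr_gt0; tauto.
Qed.

Lemma half_near (h : R * R -> R) (p : R * R) : {for p, continuous h} -> 0 < h p ->
  exists2 r, 0 < r & forall v, cbox p r v -> h p / 2 <= h v.
Proof.
move=> ch hp; have h2 : 0 < h p / 2 by rewrite divr_gt0.
have [r r0 Hr] := continuous_cbox ch h2; exists r => // v /Hr.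
by rewrite ler_norml => /andP[+ _]; lra.
Qed.

(** Fundamental lemma of the calculus of variations: a plateau function near a point where [h] does
    not vanish has a nonzero integral against [h]. *)
Lemma test_integrals_eq0 (O : set (R * R)) (h : R * R -> R) : open O -> (cont_on O h) ->
  (forall w, test_function O w -> \int[mu2]_(v in O) (w v * h v) = 0) -> forall v, O v -> h v = 0.
Proof.
move=> oO ch H p Op; apply/eqP; apply: contrapT => /negP /exists_sign[s s1 hp].
have chs v : O v -> {for v, continuous (fun v => s * h v)}.
  by move=> Ov; apply: contM; [exact: cst_continuous|exact: ch].
have [r1 r10 H1] := half_near (chs p Op) hp.
have [r2 r20 H2] := nbhs_cbox (open_nbhs_nbhs (conj oO Op)).
pose r := Num.min r1 r2 / 2; have r0 : 0 < r by rewrite divr_gt0// lt_min r10.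
have rE : 2 * r = Num.min r1 r2 by rewrite mulrC divfK.
have B1 : cbox p (2 * r) `<=` cbox p r1 by apply: sub_cbox; rewrite rE ge_min lexx.
have B2 : cbox p (2 * r) `<=` O by move=> v bv; apply: H2; move: bv; apply: sub_cbox; rewrite rE ge_min lexx orbT.
have B3 : cbox p r `<=` cbox p (2 * r) by apply: sub_cbox; move: r0; lra.
have tw := box_plateau_test r0 B2; set w := box_plateau p r in tw.
have w0 v : ~ cbox p (2 * r) v -> w v = 0.
  move=> nK; apply: box_plateau0 => //.
  have [h1|h1] := leP (2 * r) `|v.1 - p.1|; first by left.
  have [h2|h2] := leP (2 * r) `|v.2 - p.2|; first by right.
  by exfalso; apply: nK; split; exact: ltW.
have mO := meas_open2 oO.
have [q q0 Kq] := bounded_Box (compact_bounded (@cbox_compact R p (2 * r))).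
have cw v : O v -> {for v, continuous (fun v => w v * h v)}.
  by move=> Ov; apply: contM; [exact: (test_cont tw)|exact: ch].
have [C C0 HC] := @compact_bound R _ (fun v => w v * h v) (@cbox_compact R p (2 * r)) (fun v bv => cw v (B2 v bv)).
have i : integrable2 O (fun v => w v * h v).
  apply: (@bounded_integrable R O q C) => //.
  - exact: cont2_measurable.
  - by move=> v Ov; have [/HC//|nK] := pselect (cbox p (2 * r) v); rewrite w0// mul0r normr0 ltW.
  - by move=> v Ov nB; rewrite w0 ?mul0r// => /Kq.
have is_ : integrable2 O (fun v => s * (w v * h v)) by have := integrableZl mO s i.
have : 0 < \int[mu2]_(v in O) (s * (w v * h v)).
  apply: (@Rintegral_gt0 _ (mvplane R) mu2 O (cbox p r) _ (s * h p / 2) mO _ _ _ is_).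
  - exact: cbox_measurable.
  - by move=> v /B3/B2.
  - exact: area_cbox_gt0.
  - move=> v Ov; have [bv|nK] := pselect (cbox p (2 * r) v); last by rewrite w0// mul0r mulr0.
    rewrite mulrCA; apply: mulr_ge0; first exact: box_plateau_ge0.
    by apply: le_trans (H1 v (B1 v bv)); rewrite divr_ge0// ltW.
  - by rewrite divr_gt0.
  - move=> v bv; have w1 : w v = 1 by apply: box_plateau1 => //; case: bv.
    by rewrite w1 mul1r; apply: H1; exact: B1 _ (B3 _ bv).
by rewrite RintegralZl// H// mulr0 ltxx.
Qed.

End positivity.

Section flow_energy.
Context {R : realType}.
Variables (U : set (R * R)) (M : R).
Hypotheses (oU : open U) (bU : bounded_set U) (M0 : 0 <= M).

(** Passage from a flow in the group to the plane: its projection is a [local_flow] of [w], and the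
    heights of the flowed points solve the linear equation of [energy_expansion]. *)
Lemma flow_energy (w : R * R -> R) : test_function U w -> exists2 D, 0 < D &
  forall I ga dga (f fx fz G : R * R -> R) B eps W V phi f1 T,
  graph_data U M I ga dga f fx fz G B ->
  (forall p : heis R, V p = - (lie fieldX (w \o Pi) p *: fieldY p) + (w \o Pi) p *: fieldZ p) ->
  igraph U f `<=` W -> is_flow V eps W phi ->
  igraph U f1 = phi T @` igraph U f -> `|T| <= 1 -> `|T| < eps ->
  energy_expansion_bound U ga w f G f1 T D.
Proof.
move=> tw; have [D D0 HD] := energy_expansion oU bU M0 tw; exists D => // I ga dga f fx fz G B eps W V phi f1 T gd VE UW fl gr T1 Te.
have sw := test_smooth tw.
have w0 v : ~ U v -> w v = 0 by move=> nU; apply: (test_function0 tw) => /(test_sub tw).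
apply: (HD I ga dga f fx fz G B eps (plane_flow U f phi) (flow_height f phi) f1 T gd) => //.
- exact: plane_flow_local sw w0 VE UW fl.
- move=> v Uv; split; first exact: flow_height0 UW fl _ Uv.
  by move=> s se; exact: flow_height_ode sw VE UW fl _ _ Uv se.
- by move=> v Uv; exact: flowed_graph sw VE UW fl _ _ _ gr Te Uv.
Qed.

End flow_energy.

Section first_variation.
Context {R : realType}.
Variables (U : set (R * R)) (f : R * R -> R) (I : set R) (c : R -> heis R) (Fp Fm : R * R -> set (R * R)) (M : R).
Hypotheses (oU : open U) (bU : bounded_set U) (Lf : intrinsic_lipschitz U f)
  (H : smooth_herringbone U f I c Fp Fm) (M0 : 0 <= M) (fM : forall v, U v -> `|f v| <= M).

Let ga := gamma_z c.
Let cy (x : R) : R := hy (c x).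
Let s0 : R -> R := 'D_1 cy.
Let sp (x : R) : R := slope (Fp (pi_xy (c x))).
Let sm (x : R) : R := slope (Fm (pi_xy (c x))).
Let delta (x : R) : R := (sp x - s0 x) ^+ 2 - (s0 x - sm x) ^+ 2.
Let Om : set (R * R) := off_graph U ga.
Let side (s : R) : set (R * R) := [set v | U v /\ 0 < s * (v.2 - ga v.1)].
Let G := nabla f f.
Let n := nabla f G.

Let oI : open I := I_open oU H.
Let oOm : open Om := off_curve_open oU H.
Let sf : smooth_on Om f := f_smooth H.
Let sG : smooth_on Om G := nabla_smooth oOm sf sf.
Let sn : smooth_on Om n := nabla_smooth oOm sf sG.
Let l1 : (1 : R) = 1 \/ (1 : R) = -1. Proof. by left. Qed.
Let l2 : (-1 : R) = 1 \/ (-1 : R) = -1. Proof. by right. Qed.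
Let mOm : measurable (mset Om). Proof. exact: meas_open2 oOm. Qed.
Let UI v : U v -> I v.1. Proof. exact: projection_I H _. Qed.
Let dga x : I x -> is_derive1 x ga (- cy x). Proof. exact: is_derive_ga oU H _. Qed.
Let dcy x : I x -> is_derive1 x cy (s0 x). Proof. exact: is_derive_cy oU H _. Qed.
Let cs0 x : I x -> {for x, continuous s0}. Proof. exact: dcy_continuous oU H _. Qed.
Let cga x : I x -> {for x, continuous ga}. Proof. by move=> Ix; exact: is_derive_continuous (dga Ix). Qed.
Let ccy x : I x -> {for x, continuous cy}. Proof. by move=> Ix; exact: is_derive_continuous (dcy Ix). Qed.
Let cf v : U v -> {for v, continuous f}. Proof. exact: f_continuous oU bU Lf _. Qed.
Let Uga x : I x -> U (x, ga x). Proof. by move=> Ix; have [] := nexus_point H Ix. Qed.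
Let fga x : I x -> f (x, ga x) = cy x. Proof. by move=> Ix; have [] := nexus_point H Ix. Qed.

Lemma side_plusE : U_plus U I c = side 1.
Proof.
apply/seteqP; split=> v; rewrite /U_plus /side /= mul1r subr_gt0; first by case.
by move=> [Uv h]; split=> //; exact: UI.
Qed.

Lemma side_minusE : U_minus U I c = side (-1).
Proof.
apply/seteqP; split=> v; rewrite /U_minus /side /= mulN1r opprB subr_gt0; first by case.
by move=> [Uv h]; split=> //; exact: UI.
Qed.
Let OmE : Om = side 1 `|` side (-1).
Proof. by rewrite -side_plusE -side_minusE; exact: off_curveE H. Qed.

Lemma side_smooth s : s = 1 \/ s = -1 -> smooth_on (side s) f.
Proof.
case=> ->; [rewrite -side_plusE; exact: herringbone_smooth_plus H|rewrite -side_minusE; exact: herringbone_smooth_minus H].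
Qed.

Lemma side_sub s : s = 1 \/ s = -1 -> side s `<=` Om.
Proof. by rewrite OmE; case=> -> v hv; [left|right]. Qed.

Lemma open_side s : open (side s).
Proof.
have -> : side s = U `&` [set v | I v.1 /\ 0 < s * (v.2 - ga v.1)].
  by apply/seteqP; split=> v; [move=> [Uv h]; split=> //; split=> //; exact: UI|move=> [Uv [_ h]]].
by apply: openI => //; exact: @collar_open R I ga (fun x => - cy x) s oI dga.
Qed.

(* The slopes of the two foliations along C are written m (x, cy x), with one
   function m for each side. *)
Lemma local_leaves t0 : I t0 -> exists2 r, 0 < r & exists mp mm, [/\ csmooth mp, csmooth mm,
    cbox (t0, ga t0) r `<=` U,
    (forall x z z', cbox (t0, ga t0) r (x, z) -> cbox (t0, ga t0) r (x, z') ->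
          f (x, z) = f (x, z') -> z = z') &
    [/\ forall v, cbox (t0, ga t0) r v -> side 1 v -> G v = mp (v.1, f v),
        forall v, cbox (t0, ga t0) r v -> side (-1) v -> G v = mm (v.1, f v),
        forall x, `|x - t0| <= r -> I x -> sp x = mp (x, cy x) /\ sp x <> s0 x &
        forall x, `|x - t0| <= r -> I x -> sm x = mm (x, cy x) /\ sm x <> s0 x]].
Proof.
move=> It0; have [N [oN cN emb]] := herringbone_foliations H; rewrite side_plusE side_minusE => hp hm.
have sU1 : side 1 `<=` U by move=> v [].
have sU2 : side (-1) `<=` U by move=> v [].
have o1 := @open_side 1; have o2 := @open_side (-1).
have [mp smp [r1 r10 [H1 H2 H3 H4 H5]]] := local_leaf oU bU Lf H o1 sU1 (side_smooth l1) oN cN emb hp It0.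
have [mm smm [r2 r20 [K1 K2 K3 K4 _]]] := local_leaf oU bU Lf H o2 sU2 (side_smooth l2) oN cN emb hm It0.
have m1 : Num.min r1 r2 <= r1 by rewrite ge_min lexx.
have m2 : Num.min r1 r2 <= r2 by rewrite ge_min lexx orbT.
have S1 := sub_cbox (v0 := (t0, ga t0)) m1; have S2 := sub_cbox (v0 := (t0, ga t0)) m2.
exists (Num.min r1 r2); first by rewrite lt_min r10.
exists mp, mm; split => //.
- by move=> v /S1/H1.
- by move=> x z z' /S1 b1 /S1 b2; exact: H5 b1 b2.
split.
- by move=> v /S1 bv; exact: H2.
- by move=> v /S2 bv; exact: K2.
- by move=> x xr Ix; split; [apply: H3|apply: H4] => //; exact: le_trans m1.
- by move=> x xr Ix; split; [apply: K3|apply: K4] => //; exact: le_trans m2.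
Qed.

(** Integrability of both terms is part of the property, which thereby passes to sums, as the
    partition of unity requires. *)
Definition has_first_variation (w : R * R -> R) := [/\ test_function U w,
  integrable2 Om (fun v => kappa f w v * n v),
  mu.-integrable I (EFin \o (fun x => w (x, ga x) * delta x)) &
  \int[mu2]_(v in Om) var_density w f G v =
  2^-1 * \int[mu]_(x in I) (w (x, ga x) * delta x) + \int[mu2]_(v in Om) (kappa f w v * n v)].

Lemma var_density_int w : test_function U w -> mu2.-integrable Om (EFin \o var_density w f G).
Proof.
move=> tw; have [B gd] := herringbone_graph_data oU bU Lf H fM.
exact: (var_density_integrable oU bU M0 gd tw).
Qed.
Let mI : measurable (I : set (measurableTypeR R)). Proof. exact: open_measurable oI. Qed.

Lemma has_first_variation0 : has_first_variation (fun=> 0).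
Proof.
have E0 (v : R * R) : kappa f (fun=> 0) v * n v = 0 by rewrite kappa_cst0 mul0r.
split; first exact: test_function_cst0.
- apply: (eq_integrable mOm) (integrable0 _ _) => v _ /=; by rewrite E0.
- apply: (eq_integrable mI) (integrable0 _ _) => x _ /=; by rewrite mul0r.
rewrite var_density_cst0 Rint_eq0// Rint_eq0; last by move=> x _; rewrite mul0r.
by rewrite Rint_eq0 ?mulr0 ?addr0// => v _; rewrite E0.
Qed.

Lemma has_first_variationD w1 w2 : has_first_variation w1 -> has_first_variation w2 ->
  has_first_variation (fun v => w1 v + w2 v).
Proof.
move=> [t1 i1 j1 e1] [t2 i2 j2 e2]; have s1 := test_smooth t1; have s2 := test_smooth t2.
have E (v : R * R) : kappa f (fun v => w1 v + w2 v) v * n v = kappa f w1 v * n v + kappa f w2 v * n v.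
  by rewrite (kappaD f s1 s2) mulrDl.
split; first exact: test_functionD.
- have := integrableD mOm i1 i2; apply: (eq_integrable mOm) => v _ /=.
  by rewrite E.
- have := integrableD mI j1 j2; apply: (eq_integrable mI) => x _ /=.
  by rewrite mulrDl EFinD.
have -> : \int[mu]_(x in I) ((w1 (x, ga x) + w2 (x, ga x)) * delta x) =
    \int[mu]_(x in I) (w1 (x, ga x) * delta x + w2 (x, ga x) * delta x).
  by apply: eq_Rintegral => x _; rewrite mulrDl.
have -> : \int[mu2]_(v in Om) (kappa f (fun v => w1 v + w2 v) v * n v) =
    \int[mu2]_(v in Om) (kappa f w1 v * n v + kappa f w2 v * n v).
  by apply: eq_Rintegral => v _; rewrite E.
rewrite (var_densityD f G s1 s2) (RintegralD mOm (var_density_int t1) (var_density_int t2)).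
by have r1 := RintegralD mI j1 j2; have r2 := RintegralD mOm i1 i2; rewrite e1 e2 r1 r2 mulrDr addrACA.
Qed.

(** [w] vanishes on the curve, so there is no boundary term. *)
Lemma off_curve_first_variation w : test_function Om w -> has_first_variation w.
Proof.
move=> tw; have tU : test_function U w by apply: test_function_sub tw => v [].
have w0 x : w (x, ga x) * delta x = 0.
  rewrite (test_function0 tw) ?mul0r// => /(test_sub tw) [_] /=; by rewrite eqxx.
split => //.
- exact: off_curve_kappa_integrable.
- apply: (eq_integrable mI) (integrable0 _ _) => x _ /=; by rewrite w0.
rewrite [X in _ * X]Rint_eq0 ?mulr0 ?add0r//.
by apply: off_curve_identity => //; exact: var_density_int.
Qed.

Section near_the_curve.
Variables (t0 r : R) (mp mm : R * R -> R).
Hypotheses (It0 : I t0) (r0 : 0 < r) (smp : csmooth mp) (smm : csmooth mm)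
  (KU : cbox (t0, ga t0) r `<=` U)
  (injf : forall x z z', cbox (t0, ga t0) r (x, z) -> cbox (t0, ga t0) r (x, z') ->
          f (x, z) = f (x, z') -> z = z')
  (Gp : forall v, cbox (t0, ga t0) r v -> side 1 v -> G v = mp (v.1, f v))
  (Gm : forall v, cbox (t0, ga t0) r v -> side (-1) v -> G v = mm (v.1, f v))
  (spE : forall x, `|x - t0| <= r -> I x -> sp x = mp (x, cy x))
  (smE : forall x, `|x - t0| <= r -> I x -> sm x = mm (x, cy x)).
Variable w : R * R -> R.
Hypotheses (tw : test_function U w) (wK : forall v, ~ cbox (t0, ga t0) (r / 2) v -> w v = 0).

Let sw : smooth_on setT w := test_smooth tw.
Let J : set R := `[t0 - r, t0 + r]%classic.
Let JP x : J x <-> `|x - t0| <= r. Proof. by rewrite /J /= in_itv/= ler_distl. Qed.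
Let JI : J `<=` I.
Proof.
move=> x /JP xr; have /KU/UI// : cbox (t0, ga t0) r (x, ga t0).
by split=> //=; rewrite subrr normr0 ltW.
Qed.
Let w0 x : ~ J x -> w (x, ga x) = 0.
Proof.
move=> nJ; apply: wK => -[/= h _]; apply: nJ; apply/JP; apply: (le_trans h).
by move: r0; lra.
Qed.
Let integrable_w (h : R -> R) : (cont_on J h) ->
  mu.-integrable I (EFin \o (fun x => w (x, ga x) * h x)).
Proof.
move=> ch; have mJ : measurable J by exact: measurable_itv.
have iJ : mu.-integrable J (EFin \o (fun x => w (x, ga x) * h x)).
  apply: continuous_compact_integrable; first exact: segment_compact.
  apply: continuous_in_subspaceT => x; rewrite inE => Jx.
  apply: contM; last exact: ch.
  apply: (cont_comp (fun x => (x, ga x)) w); last exact: (Cn_cont (sw 0)).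
  exact: (cvg_pair (@cvg_id _ _) (cga (JI Jx))).
have -> : I = [set: R] `&` I by rewrite setTI.
apply/integrable_restrict => //; rewrite restrict_EFin.
have -> : (fun x => w (x, ga x) * h x) \_ I = (fun x => w (x, ga x) * h x) \_ J.
  apply/funext => x; rewrite !patchE; have [Jx|nJ] := pselect (J x).
    by rewrite !mem_set//; exact: JI.
  by rewrite (memNset nJ) w0// mul0r; case: ifP.
by rewrite -restrict_EFin; apply/integrable_restrict => //; rewrite setTI.
Qed.
(** Flux density of one side; it equals [(s0 ^ 2 - (m - s0) ^ 2) / 2]. In the difference of the two
    sides [s0 ^ 2] cancels and the squares leave [delta / 2]. *)
Let quad (m : R * R -> R) (x : R) : R := m (x, cy x) * s0 x - 2^-1 * m (x, cy x) ^+ 2.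

Let cquad (m : R * R -> R) x : csmooth m -> I x -> {for x, continuous (quad m)}.
Proof.
move=> smo Ix; have c1 : {for x, continuous (fun x => m (x, cy x))}.
  apply: (cont_comp (fun x => (x, cy x)) m); last exact: csmooth_cont.
  exact: cvg_pair (@cvg_id _ _) (ccy Ix).
have c2 : {for x, continuous (fun _ => 2^-1 : R)} by exact: cst_continuous.
exact: contD (contM c1 (cs0 Ix)) (contN (contM c2 (contM c1 c1))).
Qed.

Lemma near_curve_first_variation : has_first_variation w.
Proof.
have ivd := var_density_int tw.
have ms s : measurable (mset (side s)) by apply: meas_open2; exact: open_side.
have iv s : s = 1 \/ s = -1 -> mu2.-integrable (side s) (EFin \o var_density w f G).
  by move=> s1; apply: (integrableS mOm (ms s) (side_sub s1)).
have k1 := kappa_second_integrable oU oI UI dga dcy l1 r0 KU cf (side_smooth l1) smp Gp injf sw wK.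
have k2 := kappa_second_integrable oU oI UI dga dcy l2 r0 KU cf (side_smooth l2) smm Gm injf sw wK.
have e1 := side_identity oU oI UI dga dcy cs0 l1 r0 KU cf fM Uga fga (side_smooth l1) smp Gp injf sw wK (iv 1 l1).
have e2 := side_identity oU oI UI dga dcy cs0 l2 r0 KU cf fM Uga fga (side_smooth l2) smm Gm injf sw wK (iv (-1) l2).
have dS v : side 1 v -> ~ side (-1) v.
  move=> [_ a] [_ b]; move: a b; rewrite mul1r mulN1r oppr_gt0 => a b.
  by move: (lt_trans a b); rewrite ltxx.
have disj : [disjoint side 1 & side (-1)].
  by apply/eqP; apply/seteqP; split=> // v [/dS].
have ik : integrable2 Om (fun v => kappa f w v * n v).
  by rewrite OmE; apply: integrable_disjU.
have jp := integrable_w (fun x Jx => cquad smp (JI Jx)).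
have jm := integrable_w (fun x Jx => cquad smm (JI Jx)).
have dE x : I x -> w (x, ga x) * delta x = 2 * (w (x, ga x) * quad mm x - w (x, ga x) * quad mp x).
  move=> Ix; have [/JP Jx|nJ] := pselect (J x); last by rewrite w0// !mul0r subrr mulr0.
  by rewrite /delta /quad spE// smE//; field.
have idel : mu.-integrable I (EFin \o (fun x => w (x, ga x) * delta x)).
  have := integrableZl mI 2 (integrableB mI jm jp); apply: (eq_integrable mI) => x.
  by rewrite inE => Ix /=; rewrite dE.
split => //.
have -> : \int[mu]_(x in I) (w (x, ga x) * delta x) =
    2 * (\int[mu]_(x in I) (w (x, ga x) * quad mm x) - \int[mu]_(x in I) (w (x, ga x) * quad mp x)).
  rewrite -RintegralB// -RintegralZl//; last by have := integrableB mI jm jp.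
  by apply: eq_Rintegral => x; rewrite inE => Ix; exact: dE.
rewrite OmE !Rintegral_setU//; [|by rewrite -OmE|by rewrite -OmE].
move: e1 e2; rewrite -/(side 1) -/(side (-1)) -/(quad mp) -/(quad mm) -/G -/n.
set a1 := \int[mu2]_(v in side 1) _; set b1 := \int[mu2]_(v in side 1) _.
set a2 := \int[mu2]_(v in side (-1)) _; set b2 := \int[mu2]_(v in side (-1)) _.
set q1 := \int[mu]_(x in I) _; set q2 := \int[mu]_(x in I) _.
move=> e1 e2; rewrite (_ : a1 = b1 + - 1 * q1); last by rewrite -e1 addrC subrK.
rewrite (_ : a2 = b2 + - -1 * q2); last by rewrite -e2 addrC subrK.
by field.
Qed.

End near_the_curve.

Theorem first_variation u : test_function U u -> has_first_variation u.
Proof.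
apply: local_to_global; [exact: has_first_variation0|exact: has_first_variationD|].
move=> p Up; have [Op|nO] := pselect (Om p).
  have [r r0 Hr] := nbhs_cbox (open_nbhs_nbhs (conj oOm Op)).
  exists r => // w tw w0; apply: off_curve_first_variation.
  by apply: test_function_of w0 => //; [exact: test_smooth tw|exact: cbox_compact].
have pE : p.2 = ga p.1 by apply/eqP; apply: contrapT => /negP h; apply: nO.
have [r r0 [mp [mm [smp smm KU inj [Gp Gm spE smE]]]]] := local_leaves (UI Up).
(* The identities on each side want [w] supported in the half box, where the cutoff [eta] equals
   1. *)
exists (r / 2) => [|w tw w0]; first by rewrite divr_gt0.
apply: (near_curve_first_variation r0 smp smm KU inj Gp Gm _ _ tw).
- by move=> x xr Ix; have [] := spE x xr Ix.
- by move=> x xr Ix; have [] := smE x xr Ix.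
- by rewrite -pE -surjective_pairing.
Qed.

(** [w \o Pi] is an admissible [psi] because its Y-derivative vanishes. By the quadratic expansion
    the energy of [f_ t] has derivative [A] at 0, and harmonicity says that this derivative is 0. *)
Lemma harmonic_first_variation w : contact_harmonic U f -> test_function U w ->
  \int[mu2]_(v in Om) var_density w f G v = 0.
Proof.
move=> ch tw; have sw := test_smooth tw.
have yy p : lie fieldY (lie fieldY (w \o Pi)) p = 0.
  have -> : lie fieldY (w \o Pi) = fun=> 0 by apply/funext => q; exact: lieY_comp_Pi.
  by rewrite /lie derive_cst.
have [eps [W [phi [f_ [e0 [_ UW] fl gr der]]]]] := ch _ (smooth_comp_Pi sw) yy (support_comp_Pi tw).
have [D D0 HD] := flow_energy oU bU M0 tw; have [B gd] := herringbone_graph_data oU bU Lf H fM.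
have VE p : contact_field (w \o Pi) p = - (lie fieldX (w \o Pi) p *: fieldY p) + (w \o Pi) p *: fieldZ p.
  exact: contact_field_comp_Pi.
set E0 := 2^-1 * \int[mu2]_(v in Om) (G v ^+ 2).
set A := \int[mu2]_(v in Om) _.
pose S := D * (E0 + fine (mu2 U)).
pose F (t : R) := fine (energy U (f_ t)).
have HF t : `|t| <= 1 -> `|t| < eps -> `|F t - E0 - A * t| <= S * t ^+ 2.
  move=> t1 te; have [E1 EE HE] := HD I ga (fun x => - cy x) f (d_x f) (d_z f) G B eps W _ phi (f_ t) t gd VE UW fl (gr t te) t1 te.
  by rewrite /F EE; exact: HE.
(* At [t = 0] the error term of the expansion is zero, which gives the value. *)
have F0 : F 0 = E0.
  have := HF 0; rewrite normr0 ler01 => /(_ isT e0).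
  by rewrite mulr0 subr0 expr0n /= mulr0 normr_le0 subr_eq0 => /eqP.
have DA : is_derive1 (0:R) F A.
  apply/is_derive_leP => e e_gt0.
  have S0 : 0 < `|S| + 1 by rewrite ltr_wpDl.
  exists (Num.min (Num.min 1 (eps / 2)) (e / (`|S| + 1))); first by rewrite !lt_min ltr01 !divr_gt0.
  move=> t; rewrite !le_min => /andP[/andP[t1 te] tS]; rewrite add0r F0.
  have te' : `|t| < eps by apply: (le_lt_trans te); rewrite ltr_pdivrMr// mulr_natr mulr2n ltrDl.
  apply: (le_trans (HF t t1 te')); apply: (@le_trans _ _ ((`|S| + 1) * t ^+ 2)).
    by apply: ler_wpM2r; [exact: sqr_ge0|rewrite (le_trans (ler_norm _))// lerDl].
  rewrite -real_normK ?num_real// expr2 mulrA; apply: ler_wpM2r => //.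
  by rewrite mulrC -ler_pdivlMr.
exact: is_derive_unique DA der.
Qed.

Hypothesis crit : forall w, test_function U w -> \int[mu2]_(v in Om) var_density w f G v = 0.

(** For [w] supported off the curve, criticality and [off_curve_adjoint] say that
    [2 * d_z f * n - nabla f n] is orthogonal to every test function. *)
Lemma critical_second v : Om v -> nabla f n v = 2 * d_z f v * n v.
Proof.
move=> Ov; apply/esym/eqP; rewrite -subr_eq0; apply/eqP; move: v Ov.
apply: (test_integrals_eq0 oOm).
  move=> v Ov; have c0 : {for v, continuous (fun _ => 2 : R)} by exact: cst_continuous.
  have c1 : {for v, continuous (d_z f)} by exact: Cn_cont (Cn_D _ (sf 1)) Ov.
  have c2 := Cn_cont (sn 0) Ov; have c3 := Cn_cont (nabla_smooth oOm sf sn 0) Ov.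
  exact: contD (contM (contM c0 c1) c2) (contN c3).
move=> w tw; have tU : test_function U w by apply: test_function_sub tw => v [].
rewrite (off_curve_adjoint oOm sf tw) -(off_curve_identity oOm sf tw) ?crit//.
exact: var_density_int tU.
Qed.

(** For [w] meeting the curve, criticality controls only the sum of interior and boundary terms. The
    equation of [critical_second], obtained off the curve, makes [kappa * n] a divergence without
    flux through the curve, so the interior term vanishes by itself. *)
Lemma critical_kappa w : test_function U w -> \int[mu2]_(v in Om) (kappa f w v * n v) = 0.
Proof.
pose good (w : R * R -> R) := test_function U w /\ \int[mu2]_(v in Om) (kappa f w v * n v) = 0.
suff : test_function U w -> good w by move=> h /h[].
apply: local_to_global.
- split; first exact: test_function_cst0.
  by apply: Rint_eq0 => v _; rewrite kappa_cst0 mul0r.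
- move=> w1 w2 [t1 e1] [t2 e2]; split; first exact: test_functionD.
  have [_ i1 _ _] := first_variation t1; have [_ i2 _ _] := first_variation t2.
  have -> : \int[mu2]_(v in Om) (kappa f (fun v => w1 v + w2 v) v * n v) =
      \int[mu2]_(v in Om) (kappa f w1 v * n v + kappa f w2 v * n v).
    by apply: eq_Rintegral => v _; rewrite (kappaD f (test_smooth t1) (test_smooth t2)) mulrDl.
  by rewrite (RintegralD mOm i1 i2) e1 e2 addr0.
move=> p Up; have [Op|nO] := pselect (Om p).
  have [r r0 Hr] := nbhs_cbox (open_nbhs_nbhs (conj oOm Op)).
  exists r => // u tu u0; split=> //; have tw : test_function Om u.
    by apply: test_function_of u0 => //; [exact: test_smooth tu|exact: cbox_compact].
  rewrite -(off_curve_identity oOm sf tw) ?crit//.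
  exact: var_density_int tu.
have pE : p.2 = ga p.1 by apply/eqP; apply: contrapT => /negP h; apply: nO.
have [r r0 [mp [mm [smp smm KU inj [Gp Gm _ _]]]]] := local_leaves (UI Up).
exists (r / 2) => [|u tu u0]; first by rewrite divr_gt0.
split=> //; have su := test_smooth tu.
have u0' v : ~ cbox (p.1, ga p.1) (r / 2) v -> u v = 0 by rewrite -pE -surjective_pairing; exact: u0.
have S1 := side_sub l1; have S2 := side_sub l2.
have e1 := side_kappa_eq0 oU oI UI dga dcy l1 r0 KU cf fga (side_smooth l1) smp Gp inj su u0' (fun v h => critical_second (S1 v h)).
have e2 := side_kappa_eq0 oU oI UI dga dcy l2 r0 KU cf fga (side_smooth l2) smm Gm inj su u0' (fun v h => critical_second (S2 v h)).
have [_ iu _ _] := first_variation tu.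
rewrite OmE Rintegral_setU ?e1 ?e2 ?addr0//.
- by apply: meas_open2; exact: @open_side 1.
- by apply: meas_open2; exact: @open_side (-1).
- by rewrite -OmE.
apply/eqP; apply/seteqP; split=> // v [[_ a] [_ b]]; move: a b; rewrite mul1r mulN1r oppr_gt0 => a b.
by move: (lt_trans a b); rewrite ltxx.
Qed.

Lemma critical_delta w : test_function U w -> \int[mu]_(x in I) (w (x, ga x) * delta x) = 0.
Proof.
move=> tw; have [_ _ _] := first_variation tw.
rewrite crit// critical_kappa// addr0 => /esym/eqP; rewrite mulf_eq0 invr_eq0 pnatr_eq0 /= => /eqP.
exact.
Qed.

(** Near [t0], [delta] coincides with the continuous function [h]; if it were not 0 at [t0], a
    plateau around the point of the curve would contradict [critical_delta]. *)
Lemma critical_delta0 t0 : I t0 -> delta t0 = 0.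
Proof.
move=> It0; apply/eqP; apply: contrapT => /negP /exists_sign[s s1 hd].
have [r r0 [mp [mm [smp smm KU inj [_ _ spE smE]]]]] := local_leaves It0.
pose h (x : R) : R := (mp (x, cy x) - s0 x) ^+ 2 - (s0 x - mm (x, cy x)) ^+ 2.
have hE x : `|x - t0| <= r -> I x -> delta x = h x.
  by move=> xr Ix; have [e1 _] := spE x xr Ix; have [e2 _] := smE x xr Ix; rewrite /delta /h e1 e2.
have cm (m : R * R -> R) x : csmooth m -> I x -> {for x, continuous (fun x => m (x, cy x))}.
  move=> smo Ix; apply: (cont_comp (fun x => (x, cy x)) m); last exact: csmooth_cont.
  exact: cvg_pair (@cvg_id _ _) (ccy Ix).
have chs : {for t0, continuous (fun x => s * h x)}.
  have c1 := contD (cm mp t0 smp It0) (contN (cs0 It0)).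
  have c2 := contD (cs0 It0) (contN (cm mm t0 smm It0)).
  apply: contM; first exact: cst_continuous.
  exact: contD (contM c1 c1) (contN (contM c2 c2)).
have e0 : 0 < s * h t0 / 2 by rewrite divr_gt0// -hE// subrr normr0 ltW.
have /continuousR_leP/(_ _ e0)[d d0 Hd] := chs.
pose q := Num.min r d / 2; have q0 : 0 < q by rewrite divr_gt0// lt_min r0.
have qE : 2 * q = Num.min r d by rewrite mulrC divfK.
have qr : 2 * q <= r by rewrite qE ge_min lexx.
have qd : 2 * q <= d by rewrite qE ge_min lexx orbT.
have hpos x : `|x - t0| <= 2 * q -> s * h t0 / 2 <= s * h x.
  move=> xq; have := Hd (x - t0) (le_trans xq qd); rewrite [t0 + _]addrC subrK ler_norml => /andP[+ _].
  by lra.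
have tw : test_function U (box_plateau (t0, ga t0) q).
  by apply: box_plateau_test => // v; move=> bv; apply: KU; apply: (sub_cbox qr).
set w := box_plateau (t0, ga t0) q in tw.
have [_ _ iw _] := first_variation tw.
have is_ : mu.-integrable I (EFin \o (fun x => s * (w (x, ga x) * delta x))) by have := integrableZl mI s iw.
have /continuousR_leP/(_ _ q0)[d' d'0 Hd'] := cga It0.
(* On this interval the curve stays in the box where the plateau is 1. *)
pose a := Num.min q d'; have a0 : 0 < a by rewrite lt_min q0.
have aq : a <= q by rewrite ge_min lexx.
have ad : a <= d' by rewrite ge_min lexx orbT.
have JI x : `|x - t0| <= r -> I x.
  by move=> xr; have /KU/UI : cbox (t0, ga t0) r (x, ga t0) by split=> //=; rewrite subrr normr0 ltW.
have J0 : (0 < mu `[(t0 - a)%R, (t0 + a)%R]%classic)%E.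
  by rewrite lebesgue_measure_itv/= lte_fin ltrD2l gtrN// -EFinD lte_fin; move: a0; lra.
have : 0 < \int[mu]_(x in I) (s * (w (x, ga x) * delta x)).
  apply: (@Rintegral_gt0 R _ (measurableTypeR R) mu I `[t0 - a, t0 + a]%classic _ (s * h t0 / 2) mI (mitv _ _) _ J0 is_) => //.
  - by move=> x; rewrite /= in_itv/= -ler_distl => xa; apply: JI; move: xa aq qr q0; lra.
  - move=> x Ix; have [xq|xq] := leP `|x - t0| (2 * q).
      rewrite hE//; last exact: le_trans qr.
      rewrite mulrCA; apply: mulr_ge0; first exact: box_plateau_ge0.
      by apply: le_trans (hpos x xq); exact: ltW.
    by rewrite /w box_plateau0 ?mul0r ?mulr0//; left; exact: ltW.
  - move=> x; rewrite /= in_itv/= -ler_distl => xa.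
    have xq : `|x - t0| <= 2 * q by move: xa aq q0; lra.
    rewrite hE; [|exact: le_trans qr|by apply: JI; exact: le_trans qr].
    rewrite /w box_plateau1//; last 2 first.
    + exact: le_trans aq.
    + by have := Hd' (x - t0) (le_trans xa ad); rewrite [t0 + _]addrC subrK.
    by rewrite mul1r; exact: hpos.
by rewrite RintegralZl// critical_delta// mulr0 ltxx.
Qed.

(** Otherwise, by continuity of [m (x, f)] and [s0], half of the gap would persist in a box around
    the point, which [slope_gap_false] excludes. *)
Lemma slope_side_order s (m : R * R -> R) t0 r : s = 1 \/ s = -1 -> I t0 -> 0 < r -> csmooth m ->
  cbox (t0, ga t0) r `<=` U ->
  (forall v, cbox (t0, ga t0) r v -> side s v -> G v = m (v.1, f v)) ->
  s * (m (t0, cy t0) - s0 t0) <= 0.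
Proof.
move=> s1 It0 r0 smo KU Gm; rewrite leNgt; apply/negP => gap.
pose h v := s * (m (v.1, f v) - s0 v.1).
have ch v : U v -> {for v, continuous h}.
  move=> Uv; apply: contM; first exact: cst_continuous.
  apply: contD.
    apply: (cont_comp (fun v => (v.1, f v)) m); last exact: csmooth_cont.
    have c1 : {for v, continuous (fun v => v.1)} by exact: cvg_fst.
    exact: cvg_pair c1 (cf Uv).
  by apply: contN; apply: continuous_fst_comp; apply: cs0; exact: UI.
have h0 : 0 < h (t0, ga t0) by rewrite /h /= fga.
have [d d0 Hd] := half_near (ch _ (Uga It0)) h0.
pose q := Num.min r d; have q0 : 0 < q by rewrite lt_min r0.
have B1 : cbox (t0, ga t0) q `<=` cbox (t0, ga t0) r by apply: sub_cbox; rewrite ge_min lexx.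
have B2 : cbox (t0, ga t0) q `<=` cbox (t0, ga t0) d by apply: sub_cbox; rewrite ge_min lexx orbT.
have [C C0 HC] := csmooth_bound smo.
apply: (@slope_gap_false R U I ga cy s0 s t0 q (h (t0, ga t0) / 2) f oU oI UI dga dcy cs0 s1 It0 q0 _ cf fga C _ (side_smooth s1)).
- by move=> v /B1/KU.
- by [].
- by move=> v /B1 bv sv; rewrite -/G (Gm v bv sv); exact: HC.
- by rewrite divr_gt0.
- by move=> v bv sv; rewrite -/G (Gm v (B1 v bv) sv); exact: Hd (B2 v bv).
Qed.

Theorem critical_slopes t0 : I t0 -> delta t0 = 0 /\ s0 t0 = (sp t0 + sm t0) / 2.
Proof.
move=> It0; have d0 := critical_delta0 It0; split=> //.
have [r r0 [mp [mm [smp smm KU inj [Gp Gm spE smE]]]]] := local_leaves It0.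
have t00 : `|t0 - t0| <= r by rewrite subrr normr0 ltW.
have o1 := slope_side_order l1 It0 r0 smp KU Gp.
have o2 := slope_side_order l2 It0 r0 smm KU Gm.
move: o1 o2; have [<- _] := spE t0 t00 It0; have [<- _] := smE t0 t00 It0; rewrite mul1r mulN1r => o1 o2.
(* [delta = (sp + sm - 2 * s0) * (sp - sm)]. The first factor gives the mean. If the second one
   vanishes, [sp <= s0 <= sm] forces the three slopes to be equal, and [s0] is again the mean. *)
move/eqP: d0; rewrite /delta subr_sqr mulf_eq0 => /orP[/eqP e|/eqP e]; move: o1 o2 e; rewrite /sp /sm /s0; lra.
Qed.

End first_variation.

(** * Translation into extended reals and conclusion *)

Lemma area_fineK (R : realType) (U : set (R * R)) :
  open U -> bounded_set U -> (fine (area U))%:E = area U.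
Proof. by move=> oU bU; rewrite fineK// ge0_fin_numE// area_open_lty. Qed.

Lemma quadratic_bound_EFin (R : realType) (e1 e0 a A D t : R) :
  `|e1 - e0 - A * t| <= D * (e0 + a) * t ^+ 2 ->
  (`|e1%:E - e0%:E - (A * t)%:E| <= D%:E * (e0%:E + a%:E) * (t ^+ 2)%:E)%E.
Proof. by move=> h; rewrite -!EFinB -EFinD -!EFinM lee_fin. Qed.

Lemma herringbone_Pi (R : realType) (U : set (vplane R)) f I c Fp Fm (s : R) :
  smooth_herringbone U f I c Fp Fm -> I s -> (s, gamma_z c s) = Pi (c s).
Proof. by move=> H Is; rewrite /gamma_z/= -{1}(herringbone_param H Is). Qed.

Theorem theorem4p11 (R : realType) (U : set (vplane R))
    (openU : open U) (boundedU : bounded_set U)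
    (w2 : vplane R -> R) (hw2 : test_function U w2) (M : \bar R) :
  let psi := w2 \o Pi in
  let Vpsi := fun p : heis R =>
    - (lie fieldX psi p *: fieldY p) + psi p *: fieldZ p in
  exists eps0 D : R, [/\ 0 < eps0, 0 < D &
    forall (f : vplane R -> R) (I : set R) (c : R -> heis R)
      (Fplus Fminus : R * R -> set (R * R)),
    Linfty_norm U f = M ->
    intrinsic_lipschitz U f ->
    smooth_herringbone U f I c Fplus Fminus ->
    let gamma := Pi \o c in
    let sigma0 := 'D_1 (hy \o c) in
    let sigmap := fun s => slope (Fplus (pi_xy (c s))) in
    let sigmam := fun s => slope (Fminus (pi_xy (c s))) in
    let delta := fun s =>
      (sigmap s - sigma0 s) ^+ 2 - (sigma0 s - sigmam s) ^+ 2 in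
    let Upm := U_plus U I c `|` U_minus U I c in
    let A2 := \int[area]_(v in Upm)
      (- (nabla f (nabla f w2) v * nabla f f v)
       + 2^-1 * (nabla f f v ^+ 2 * d_z w2 v)) in
    [/\ forall (eps : R) (phi : R -> heis R -> heis R)
          (f_ : R -> vplane R -> R),
          0 < eps ->
          is_flow Vpsi eps setT phi ->
          (forall t, `|t| < eps -> igraph U (f_ t) = phi t @` igraph U f) ->
          forall t, `|t| < eps -> `|t| <= eps0 ->
            (`|energy U (f_ t) - energy U f - (A2 * t)%:E|
             <= D%:E * (energy U f + area U) * (t ^+ 2)%:E)%E,
        A2 = 2^-1 * \int[lebesgue_measure]_(s in I) (w2 (gamma s) * delta s)
             + \int[area]_(v in Upm)
                 ((w2 v * d_z f v + nabla f w2 v) * nabla f (nabla f f) v) &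
        contact_harmonic U f ->
          forall s, I s ->
            delta s = 0 /\ sigma0 s = (sigmap s + sigmam s) / 2]].
Proof.
move=> psi Vpsi; have M0 : 0 <= `|fine M| by [].
have [D D0 HD] := flow_energy openU boundedU M0 hw2.
(* The expansion holds whenever [|t| <= 1], and [D] was obtained from [U], [w2] and [|fine M|]
   before the graph is introduced. *)
exists 1, D; split=> // f I c Fp Fm LM Lf H gamma sigma0 sigmap sigmam delta Upm A2.
have [fB fB0 HfB] := intrinsic_lipschitz_bounded boundedU Lf.
have cf v : U v -> {for v, continuous f} by move=> Uv; exact: (f_continuous openU boundedU Lf Uv).
have fM := Linfty_norm_bound openU cf HfB fB0 LM.
have [B gd] := herringbone_graph_data openU boundedU Lf H fM.
pose Om : set (R * R) := [set v | U v /\ v.2 != gamma_z c v.1].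
have UpmE : Upm = Om by rewrite /Upm -(off_curveE H).
have A2E : A2 = \int[area]_(v in Om) var_density w2 f (nabla f f) v.
  rewrite /A2 UpmE; apply: eq_Rintegral => v; rewrite inE => Ov.
  by rewrite (second_nablaE openU H (test_smooth hw2) Ov).
split.
- move=> eps phi f_ eps0 fl gr t te t1.
  have UW : igraph U f `<=` setT by exact: subsetT.
  have [E1 E1E HE] := HD _ _ _ _ _ _ _ _ _ _ _ _ (f_ t) t gd (fun p => erefl) UW fl (gr t te) t1 te.
  rewrite -(area_fineK openU boundedU) E1E (graph_data_energy openU boundedU gd) A2E.
  apply: quadratic_bound_EFin; exact: HE.
- have [_ _ _] := first_variation openU boundedU Lf H M0 fM hw2.
  rewrite -A2E => ->; rewrite UpmE; congr (_ * _ + _).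
  apply: eq_Rintegral => s; rewrite inE => Is.
  congr (w2 _ * _); exact: herringbone_Pi H Is.
- move=> ch s Is.
  have crit w : test_function U w -> \int[area]_(v in Om) var_density w f (nabla f f) v = 0.
    by move=> tw; exact: (harmonic_first_variation openU boundedU Lf H M0 fM ch tw).
  exact: (critical_slopes openU boundedU Lf H M0 fM crit Is).
Qed.
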